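(* Let $\{\overline H_\lambda:\lambda>0\}$ be a family of measurable subsets of $\mathbb R^d$ with $\overline H_\lambda=-\overline H_\lambda$, $0\notin\overline H_\lambda$ and $\ell(\overline H_\lambda\cap Q_1)>0$ for every $\lambda>0$. Let $\psi,\check\psi,\hat\psi$, $F_\lambda,F_{1,\lambda},F_{2,\lambda},\widetilde F_\lambda$, $V_{1,\lambda},V_{2,\lambda},A_\lambda,\dots,E_\lambda$ be defined as in the context. Assume that $\check\psi(\lambda)\asymp\hat\psi(\lambda)$, and let $N\sim\mathscr N(0,1)$. Then $$\frac{V_{1,\lambda}^2}{V_{2,\lambda}^2}\asymp\lambda\psi(\lambda),\qquad \frac{1}{V_{1,\lambda}^2}A_\lambda\asymp\lambda^{-1/2},$$ and there exist constants $0<k<K<\infty$, independent of $\lambda$, such that, for all sufficiently large $\lambda$, $$k\max\big(\lambda^{-1/2},(\lambda^2\psi(\lambda))^{-1/2},\lambda^{1/2}\psi(\lambda)\big)\le\frac1{V_{2,\lambda}^2}\max(B_\lambda,C_\lambda,D_\lambda,E_\lambda)\le K\max\big(\sqrt{\psi(\lambda)},\lambda^{-1/2},(\lambda^2\psi(\lambda))^{-1/2},\lambda^{1/2}\psi(\lambda)\big).$$ Furthermore, one can choose $K$ in such a way that the following properties hold (the bounds on $d_W$ being for all sufficiently large $\lambda$). (i) If $\lambda\psi(\lambda)\to\infty$ as $\lambda\to\infty$, the first chaos projection $F_{1,\lambda}$ dominates: $\mathrm{Var}(F_{1,\lambda})\sim\mathrm{Var}(F_\lambda)\asymp\lambda^3\psi(\lambda)^2\to\infty$,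 and $d_W(\widetilde F_\lambda,N)\le K\lambda^{-1/2}$. (ii) If $\lambda\psi(\lambda)\asymp1$, then $\mathrm{Var}(F_\lambda)\asymp\mathrm{Var}(F_{1,\lambda})\asymp\mathrm{Var}(F_{2,\lambda})\asymp\lambda$ and $d_W(\widetilde F_\lambda,N)\le K\lambda^{-1/2}$. In this case, moreover, as $\lambda\to\infty$ the pair $$\Big(\frac{F_{1,\lambda}}{\mathrm{Var}(F_{1,\lambda})^{1/2}},\frac{F_{2,\lambda}}{\mathrm{Var}(F_{2,\lambda})^{1/2}}\Big)$$ converges in distribution to a two-dimensional Gaussian vector $(N_1,N_2)$ with $N_i\sim\mathscr N(0,1)$ and $N_1,N_2$ independent. (iii) If $\lambda\psi(\lambda)\to0$ as $\lambda\to\infty$, then the second chaos projection $F_{2,\lambda}$ dominates: $\mathrm{Var}(F_\lambda)\sim\mathrm{Var}(F_{2,\lambda})\asymp\lambda^2\psi(\lambda)$, and $$d_W(\widetilde F_\lambda,N)\le\frac{K}{\lambda\sqrt{\psi(\lambda)}}.$$ Moreover, $\widetilde F_\lambda$ converges in distribution to $N$ if and only if $\lambda^2\psi(\lambda)\to\infty$ (or, equivalently, $\mathrm{Var}(F_\lambda)\to\infty$).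
   Context: $d\ge1$ is a fixed integer, $\ell$ is Lebesgue measure on $\mathbb R^d$ (and $\ell$ also denotes Lebesgue measure on powers of $\mathbb R^d$), $Q_\lambda=[-\frac12\lambda^{1/d},\frac12\lambda^{1/d}]^d$, and $W=Q_1$. For $\lambda>0$, $\eta_\lambda$ is a Poisson measure on $\mathbb R^d$ with control (intensity) measure $\lambda\ell$, and $H_\lambda=\{(x,y)\in(\mathbb R^d)^2:x-y\in\overline H_\lambda\}$. $F_\lambda=\sum_{x,y\in\eta_\lambda\cap W,\,x\ne y}\mathbf 1_{x-y\in\overline H_\lambda}$ (sum over ordered pairs, so $\frac12F_\lambda$ is the number of edges of the graph with vertex set $\eta_\lambda\cap W$ in which $x,y$ are joined iff $x-y\in\overline H_\lambda$), and $\widetilde F_\lambda=(F_\lambda-E[F_\lambda])/\sqrt{\mathrm{Var}(F_\lambda)}$. Its chaotic decomposition is $F_\lambda=E[F_\lambda]+F_{1,\lambda}+F_{2,\lambda}$, $F_{i,\lambda}=I_i(f_{i,\lambda})$, where $I_i$ is the multiple Wiener–Itô integral of order $i$ with respect to $\eta_\lambda-\lambda\ell$, $f_{2,\lambda}(x,y)=\mathbf 1_{H_\lambda\cap(W\times W)}(x,y)$ and $f_{1,\lambda}(x)=2\lambda\int_{\mathbb R^d}\mathbf 1_{H_\lambda\cap(W\times W)}(x,y)\,dy$. Occupation coefficients: $\psi(\lambda)=\ell(\overline H_\lambda\cap Q_1)$, $\check\psi(\lambda)=\ell(\overline H_\lambda\cap Q_{1/2^d})$, $\hat\psi(\lambda)=\ell(\overline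 H_\lambda\cap Q_{2^d})$. Sets: $H^{(1)}_\lambda=\{(x_1,x_2,x_3):(x_1,x_2),(x_1,x_3)\in H_\lambda\}$; $H^{(2)}_\lambda=\{(x_1,\dots,x_5):(x_1,x_i)\in H_\lambda,\ i=2,\dots,5\}$; $H^{(3)}_\lambda=\{(x_1,\dots,x_4):(x_1,x_2),(x_2,x_3),(x_3,x_4),(x_4,x_1)\in H_\lambda\}$; $H^{(4)}_\lambda=\{(x_1,\dots,x_5):(x_1,x_2),(x_2,x_3),(x_3,x_4),(x_4,x_5)\in H_\lambda\}$. Quantities: $V_{1,\lambda}^2=4\lambda^3\ell(W^3\cap H^{(1)}_\lambda)$, $V_{2,\lambda}^2=2\lambda^2\ell(W^2\cap H_\lambda)$, $A_\lambda=\lambda^{5/2}\sqrt{\ell(W^5\cap H^{(2)}_\lambda)}$, $B_\lambda=\lambda^2\sqrt{\ell(W^4\cap H^{(3)}_\lambda)}$, $C_\lambda=\lambda^{3/2}\sqrt{\ell(W^3\cap H^{(1)}_\lambda)}$, $D_\lambda=\lambda\sqrt{\ell(W^2\cap H_\lambda)}$, $E_\lambda=\lambda^{5/2}\sqrt{\ell(W^5\cap H^{(4)}_\lambda)}$. Notation: $\gamma_\lambda\asymp\delta_\lambda$ means that there are constants $C,C'>0$ with $C\gamma_\lambda\le\delta_\lambda\le C'\gamma_\lambda$ for $\lambda$ sufficiently large; $\gamma_\lambda\sim\delta_\lambda$ means $\delta_\lambda>0$ for $\lambda$ large and $\gamma_\lambda/\delta_\lambda\to1$ as $\lambda\to\infty$.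 $d_W(U,Y)=\sup|E[h(U)]-E[h(Y)]|$ over $1$-Lipschitz $h:\mathbb R\to\mathbb R$. *)

(* Defs.v *)
From HB Require Import structures.
From mathcomp Require Import all_boot all_order all_algebra.
From mathcomp Require Import all_classical all_reals all_analysis.
From mathcomp Require Import measurable_realfun.
Set Implicit Arguments. Unset Strict Implicit. Unset Printing Implicit Defensive.
Import Order.TTheory GRing.Theory Num.Theory.
Import numFieldNormedType.Exports.
Local Open Scope classical_set_scope.
Local Open Scope ring_scope.
Section tuple_measure.
Context d (T : measurableType d) (R : realType).
Local Open Scope ereal_scope.

(* \x has no usable sigma-finite structure in the library outside of
   subprobabilities, hence the explicit proof for its image under tcons. *)
Definition tcons n (p : T * n.-tuple T) : n.+1.-tuple T :=
  [the n.+1.-tuple T of p.1 :: p.2].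

Lemma measurable_tcons n : measurable_fun [set: T * n.-tuple T] (@tcons n).
Proof. exact: measurable_cons. Qed.

Definition cons_measure n (m : {sigma_finite_measure set T -> \bar R})
    (mn : {sigma_finite_measure set (n.-tuple T) -> \bar R}) :
    set (n.+1.-tuple T) -> \bar R :=
  pushforward (m \x mn) (@tcons n).

Variables (m : {sigma_finite_measure set T -> \bar R}) (n : nat)
  (mn : {sigma_finite_measure set (n.-tuple T) -> \bar R}).
Let cm0 : cons_measure m mn set0 = 0.
Proof. by rewrite /cons_measure /pushforward preimage_set0 measure0. Qed.
Let cm_ge0 A : 0 <= cons_measure m mn A.
Proof. by rewrite /cons_measure /pushforward measure_ge0. Qed.
Let cm_sa : semi_sigma_additive (cons_measure m mn).
Proof.
move=> F mF tF _; rewrite /cons_measure /pushforward preimage_bigcup.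
have mpre A : measurable A -> measurable (@tcons n @^-1` A).
  by move=> mA; rewrite -[X in measurable X]setTI; exact: measurable_tcons.
apply: measure_semi_sigma_additive => [k||]; first exact: mpre.
  apply/trivIsetP => i j _ _ ij; rewrite -preimage_setI.
  by move/trivIsetP : tF => /(_ _ _ _ _ ij) ->//; rewrite preimage_set0.
by rewrite -preimage_bigcup; apply: mpre; exact: bigcup_measurable.
Qed.
HB.instance Definition _ := isMeasure.Build _ _ _ (cons_measure m mn) cm0 cm_ge0 cm_sa.

Let cm_sf : sigma_finite setT (cons_measure m mn).
Proof.
have /sigma_finiteP[F [TF ndF Foo]] := sigma_finiteT m.
have /sigma_finiteP[G [TG ndG Goo]] := sigma_finiteT mn.
exists (fun k => [set t : n.+1.-tuple T | F k (thead t) /\ G k [tuple of behead t]]).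
  apply/seteqP; split => // t _.
  have [i _ Fi] : (\bigcup_i F i) (thead t) by rewrite -TF; exact: I.
  have [j _ Gj] : (\bigcup_i G i) [tuple of behead t] by rewrite -TG; exact: I.
  exists (maxn i j) => //; split.
    by move: Fi; exact/subsetPset/ndF/leq_maxl.
  by move: Gj; exact/subsetPset/ndG/leq_maxr.
move=> k; have [mF Fk] := Foo k; have [mG Gk] := Goo k; split.
  rewrite (_ : [set _ | _] = (@thead n T @^-1` F k) `&`
    ((fun t : n.+1.-tuple T => [tuple of behead t]) @^-1` G k))//.
  apply: measurableI; rewrite -[X in measurable X]setTI.
    exact: measurable_tnth.
  exact: measurable_behead.
rewrite /cons_measure /pushforward (_ : _ @^-1` _ = F k `*` G k).
  by rewrite product_measure1E// lte_mul_pinfty// ge0_fin_numE.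
have tK (p : T * n.-tuple T) : [tuple of behead (tcons p)] = p.2.
  exact/val_inj.
by apply/seteqP; split=> p /=; rewrite theadE tK.
Qed.
HB.instance Definition _ := Measure_isSigmaFinite.Build _ _ _ (cons_measure m mn) cm_sf.
End tuple_measure.

Fixpoint tuple_measure d (T : measurableType d) (R : realType)
    (m : {sigma_finite_measure set T -> \bar R}) n :
    {sigma_finite_measure set (n.-tuple T) -> \bar R} :=
  if n is n'.+1 then cons_measure m (tuple_measure m n') else \d_[tuple].

(* tuple_measure m n is the product measure m x ... x m (n factors). *)
Lemma tuple_measure_box d (T : measurableType d) (R : realType)
    (m : {sigma_finite_measure set T -> \bar R}) n (A : 'I_n -> set T) :
  (forall i, measurable (A i)) ->
  tuple_measure m n [set t | forall i, A i (tnth t i)] = (\prod_i m (A i))%E.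
Proof.
elim: n A => [|n IHn] A mA.
  by rewrite big_ord0 /= diracE mem_set// => -[].
rewrite big_ord_recl /= /cons_measure /pushforward -(IHn (A \o lift ord0) (fun i => mA _)).
have tcE : @tcons _ T n @^-1` [set t | forall i, A i (tnth t i)] =
    A ord0 `*` [set t | forall i, A (lift ord0 i) (tnth t i)].
  apply/seteqP; split=> [p Ap|p [A0 Ap] i].
    split; first by have := Ap ord0.
    by move=> i; have := Ap (lift ord0 i); rewrite /tcons tnthS.
  by have [j ->|->//] := unliftP ord0 i; rewrite /tcons tnthS; exact: Ap.
have mbox : measurable [set t : n.-tuple T |
    forall i, A (lift ord0 i) (tnth t i)].
  rewrite (_ : [set t | _] = \bigcap_(i in [set: 'I_n])
    ((@tnth n T ^~ i) @^-1` A (lift ord0 i))); last first.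
    by apply/seteqP; split=> [t At i _|t At i]; exact: At.
  apply: fin_bigcap_measurable => // i _.
  by rewrite -[X in measurable X]setTI; exact: measurable_tnth.
by rewrite tcE; apply: product_measure1E.
Qed.

(* R^d with its Borel sigma-algebra. *)
Notation Rvec R d := (d.-tuple (measurableTypeR R)).

Section euclidean.
Context (R : realType) (d : nat).

(* Lebesgue measure on R^d. *)
Definition leb : {sigma_finite_measure set (Rvec R d) -> \bar R} :=
  tuple_measure lebesgue_measure d.

Definition vzero : Rvec R d := [tuple (0 : R) | _ < d].

Definition vopp (x : Rvec R d) : Rvec R d := [tuple - (tnth x i : R) | i < d].

Definition vsub (x y : Rvec R d) : Rvec R d :=
  [tuple (tnth x i : R) - (tnth y i : R) | i < d].

(* Q_l, the closed cube of volume l centred at the origin. *)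
Definition cube (l : R) : set (Rvec R d) :=
  [set x | forall i, - (2^-1 * l `^ (d%:R^-1)) <= (tnth x i : R)
                     <= 2^-1 * l `^ (d%:R^-1)].

(* The measure l * leb; the absolute value only makes the definition total, it
   is used for l > 0. *)
Definition intensity (l : R) : set (Rvec R d) -> \bar R :=
  mscale (NngNum (normr_ge0 l)) leb.

HB.instance Definition _ l := Measure.on (intensity l).

Let intensity_sigma_finite l : sigma_finite setT (intensity l).
Proof.
have [F TF Foo] := sigma_finiteT leb; exists F => // k.
have [mF Fk] := Foo k; split=> //.
by rewrite /intensity /mscale/= lte_mul_pinfty// lee_fin.
Qed.

HB.instance Definition _ l :=
  Measure_isSigmaFinite.Build _ _ _ (intensity l) (@intensity_sigma_finite l).

End euclidean.
Arguments intensity {R} d l A.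

Section probability_notions.
Context (R : realType) d (Omega : measurableType d) (P : probability Omega R).

Definition mutually_independent d' (E : measurableType d') (I : finType)
    (X : I -> Omega -> E) : Prop :=
  forall C : I -> set E, (forall i, measurable (C i)) ->
    P [set w | forall i, C i (X i w)] = (\prod_i P (X i @^-1` C i))%E.

Definition std_normal (X : {RV P >-> R}) : Prop :=
  forall A : set R, measurable A -> distribution P X A = normal_prob 0 1 A.

Definition Var (X : Omega -> R) : R := fine ('V_P[X])%E.

Definition normalized (X : Omega -> R) (w : Omega) : R :=
  (X w - fine ('E_P[X])%E) / Num.sqrt (Var X).

Definition wasserstein d' (Omega' : measurableType d')
    (P' : probability Omega' R) (U : Omega -> R) (Y : Omega' -> R) : \bar R :=
  ereal_sup [set `|'E_P[h \o U] - 'E_P'[h \o Y]|%E |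
    h in [set h : R -> R | forall x y, `|h x - h y| <= `|x - y|]].

Definition cvg_in_distribution d' (Omega' : measurableType d')
    (P' : probability Omega' R) (E : topologicalType)
    (X : R -> Omega -> E) (Y : Omega' -> E) : Prop :=
  forall g : E -> R, continuous g -> (exists M, forall x, `|g x| <= M) ->
    ('E_P[g \o X l] @[l --> +oo%R] --> 'E_P'[g \o Y])%E.

End probability_notions.

Section poisson_measure.
Context (R : realType) (d : nat) d' (Omega : measurableType d')
  (P : probability Omega R).
Local Open Scope ereal_scope.

(* eta is a locally finite, integer-valued random measure. [poisson_prob] takes
   a dummy natural number as its second argument. *)
Record is_poisson_measure (mu : {measure set (Rvec R d) -> \bar R})
    (eta : Omega -> {measure set (Rvec R d) -> \bar R}) : Prop := {
  poisson_measurable : forall B, measurable B ->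
    measurable_fun [set: Omega] (eta ^~ B);
  poisson_integer : forall w B, measurable B ->
    eta w B = +oo \/ exists n : nat, eta w B = n%:R%:E;
  poisson_locally_finite : forall w r, eta w (cube r) < +oo;
  poisson_law : forall B, measurable B -> mu B < +oo -> forall k : nat,
    P [set w | eta w B = k%:R%:E] = poisson_prob (fine (mu B)) 0%N [set k];
  poisson_independent : forall n (B : 'I_n -> set (Rvec R d)),
    (forall i, measurable (B i)) -> trivIset setT B ->
    mutually_independent P (fun i w => eta w (B i)) }.

End poisson_measure.

Section multiple_integral.
Context (R : realType) d (T : measurableType d).
Variable mu : {sigma_finite_measure set T -> \bar R}.

(* Elementary kernels of order q: step functions on rectangles built from
   finitely many disjoint sets of finite measure, vanishing on diagonals. *)
Record elementary (q : nat) := Elementary {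
  el_size : nat;
  el_set : 'I_el_size -> set T;
  el_coef : q.-tuple 'I_el_size -> R;
  el_measurable : forall i, measurable (el_set i);
  el_finite : forall i, (mu (el_set i) < +oo)%E;
  el_disjoint : trivIset setT el_set;
  el_diagonal : forall s : q.-tuple 'I_el_size, ~~ uniq s -> el_coef s = 0 }.

Definition elementary_fun q (k : elementary q) (x : q.-tuple T) : R :=
  \sum_(s : q.-tuple 'I_(el_size k))
    el_coef s * \prod_(j < q) \1_(el_set (tnth s j)) (tnth x j).

Context d' (Omega : measurableType d') (P : probability Omega R).
Variable eta : Omega -> {measure set T -> \bar R}.

Definition elementary_int q (k : elementary q) (w : Omega) : R :=
  \sum_(s : q.-tuple 'I_(el_size k))
    el_coef s * \prod_(j < q)
      (fine (eta w (el_set (tnth s j))) - fine (mu (el_set (tnth s j)))).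

(* X is the multiple Wiener-Ito integral I_q(f) of f with respect to the
   compensated measure eta - mu, i.e. the L^2(P)-limit of the integrals of
   elementary kernels which converge to f in L^2(mu^q). This determines X up to
   a P-null set. *)
Definition is_multiple_integral (q : nat) (f : q.-tuple T -> R)
    (X : Omega -> R) : Prop :=
  exists k : nat -> elementary q,
    (\int[tuple_measure mu q]_x ((f x - elementary_fun (k n) x) ^+ 2)%:E
       @[n --> \oo] --> 0)%E /\
    ('E_P[(fun w => (X w - elementary_int (k n) w) ^+ 2)%R]
       @[n --> \oo] --> 0)%E.

End multiple_integral.

Section asymptotics.
Context (R : realType).
Implicit Types f g : R -> R.

Definition asymp f g : Prop := exists C C' : R, [/\ 0 < C, 0 < C' &
  \forall l \near +oo, C * f l <= g l /\ g l <= C' * f l].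

Definition equivalent f g : Prop :=
  (\forall l \near +oo, 0 < g l) /\ (f l / g l @[l --> +oo] --> (1 : R)).

End asymptotics.

Section random_graph.
Context (R : realType) (d : nat) (Hbar : R -> set (Rvec R d)).
Implicit Types l : R.

Definition W : set (Rvec R d) := cube 1.
Definition Wpow k : set (k.-tuple (Rvec R d)) :=
  [set t | forall i, W (tnth t i)].
Arguments Wpow : clear implicits.

(* Lebesgue measure on (R^d)^k. *)
Definition ell k (A : set (k.-tuple (Rvec R d))) : R :=
  fine (tuple_measure (leb R d) k A).

Definition psi l : R := fine (leb R d (Hbar l `&` cube 1)).
Definition psi_check l : R := fine (leb R d (Hbar l `&` cube (2 ^+ d)^-1)).
Definition psi_hat l : R := fine (leb R d (Hbar l `&` cube (2 ^+ d))).

Definition adj l (x y : Rvec R d) : Prop := Hbar l (vsub x y).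

Definition H0 l : set (2.-tuple (Rvec R d)) :=
  [set t | adj l (tnth t 0) (tnth t 1)].
Definition H1 l : set (3.-tuple (Rvec R d)) :=
  [set t | adj l (tnth t 0) (tnth t 1) /\ adj l (tnth t 0) (tnth t 2)].
Definition H2 l : set (5.-tuple (Rvec R d)) :=
  [set t | [/\ adj l (tnth t 0) (tnth t 1), adj l (tnth t 0) (tnth t 2),
    adj l (tnth t 0) (tnth t 3) & adj l (tnth t 0) (tnth t 4)]].
Definition H3 l : set (4.-tuple (Rvec R d)) :=
  [set t | [/\ adj l (tnth t 0) (tnth t 1), adj l (tnth t 1) (tnth t 2),
    adj l (tnth t 2) (tnth t 3) & adj l (tnth t 3) (tnth t 0)]].
Definition H4 l : set (5.-tuple (Rvec R d)) :=
  [set t | [/\ adj l (tnth t 0) (tnth t 1), adj l (tnth t 1) (tnth t 2),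
    adj l (tnth t 2) (tnth t 3) & adj l (tnth t 3) (tnth t 4)]].

Definition V1sq l : R := 4 * l ^+ 3 * ell (Wpow 3 `&` H1 l).
Definition V2sq l : R := 2 * l ^+ 2 * ell (Wpow 2 `&` H0 l).
Definition Aq l : R := l `^ (5 / 2) * Num.sqrt (ell (Wpow 5 `&` H2 l)).
Definition Bq l : R := l ^+ 2 * Num.sqrt (ell (Wpow 4 `&` H3 l)).
Definition Cq l : R := l `^ (3 / 2) * Num.sqrt (ell (Wpow 3 `&` H1 l)).
Definition Dq l : R := l * Num.sqrt (ell (Wpow 2 `&` H0 l)).
Definition Eq l : R := l `^ (5 / 2) * Num.sqrt (ell (Wpow 5 `&` H4 l)).

Definition f2 l (t : 2.-tuple (Rvec R d)) : R := \1_(H0 l `&` Wpow 2) t.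
Definition f1 l (t : 1.-tuple (Rvec R d)) : R :=
  2 * l * \int[leb R d]_y f2 l [tuple tnth t 0; y].

Definition points (m : set (Rvec R d) -> \bar R) : set (Rvec R d) :=
  [set x | (0 < m [set x])%E].

(* The sum over ordered pairs of distinct points of eta in W; eta being locally
   finite, the index set is finite. *)
Definition Fsum d' (Omega : measurableType d')
    (eta : R -> Omega -> {measure set (Rvec R d) -> \bar R})
    l (w : Omega) : R :=
  \sum_(p \in [set p : Rvec R d * Rvec R d |
      [/\ (points (eta l w) `&` W) p.1, (points (eta l w) `&` W) p.2 &
          p.1 <> p.2]]) (\1_(Hbar l) (vsub p.1 p.2) : R).

End random_graph.

(* Main.v *)
(* Write [deg x] for the Lebesgue measure of the neighbours of [x] in the window
   and [m_r] for [l ^ (r + 1)] times the integral of [deg ^ r]. The two chaoses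
   have variances [4 m_2] and [2 m_1] and are uncorrelated. To avoid multiple
   integrals of arbitrary kernels, the adjacency indicator is approximated in L2
   by the indicator of a finite graph on small cells; the edge count and its
   chaoses are then L2-limits of quadratic functionals of independent Poisson
   counts. For those, the Mecke formula and Stein's method bound the distance to
   the normal law, in dimension one and two, by [C s^(-3) (m_1 + m_2 + m_3)],
   where [s] is the normalization; the bound passes to the limit.

   On the cube [Q_(1/2^d)] the whole set [Hbar l] cut by [Q_(1/2^d)] fits in the
   window, so that [deg >= psi_check] there, while [deg <= psi_hat] everywhere.
   Since [psi_check] and [psi_hat] are comparable, [m_r] has order
   [l (l psi)^r], which gives all the rates. Conversely, if [l^2 psi] stays
   bounded along a sequence, the normalized count lives on a lattice whose mesh
   does not vanish, and it cannot be asymptotically normal. *)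
Require Import Defs.
From HB Require Import structures.
From mathcomp Require Import all_boot all_order all_algebra.
From mathcomp Require Import all_classical all_reals all_analysis.
From mathcomp Require Import measurable_realfun.
From mathcomp Require Import zify ring lra.
Set Implicit Arguments.
Unset Strict Implicit.
Unset Printing Implicit Defensive.
Import Order.TTheory GRing.Theory Num.Theory.
Import numFieldNormedType.Exports.
Local Open Scope classical_set_scope.
Local Open Scope ring_scope.

(** * Expectations *)

Section expectation.
Context d (T : measurableType d) (R : realType) (P : probability T R).
Implicit Types f g : T -> R.

(** The cells must carry a genuine loop-free graph and not merely a step kernel: with weights 0 or
    1, the centred number of neighbours of a cell has variance equal to the degree, so that every
    error term of Stein's method is bounded by moments of degrees, and these pass to the limit. The
    identity between the edge count and the two multiple integrals is not assumed; it is recovered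
    almost surely in the limit. As [Fsum] counts locations while a product of random measures counts
    multiplicities, this requires that a Poisson measure has no multiple points. The two-dimensional
    limit needs only the univariate Stein equation: it is solved in the first coordinate while a
    function of the second acts as a weight, and the mixed term is small because the number of
    neighbours is centred. With [x = l * psi l] the moment [m_r] has order [l x^r]. If [x] is
    bounded below, [s^2] dominates [l x^2] and the numerator is at most of order [l x^3]; if
    [x <= 1], both [s^2] and the numerator compare with [l x]. Division gives the rates [l^(-1/2)]
    and [(l x)^(-1/2)]. *)

Definition L1 f := P.-integrable [set: T] (EFin \o f).

(** Real-valued expectation; [fine] sends an infinite integral to 0, which is why most rules below
    carry integrability hypotheses. *)
Definition EX f : R := fine (\int[P]_x (f x)%:E).

Definition L2 f := measurable_fun setT f /\ L1 (fun x => f x ^+ 2).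

Lemma L1_meas f : L1 f -> measurable_fun setT f.
Proof. by move=> /integrableP[/measurable_EFinP]. Qed.

Lemma L1_E f : L1 f -> (\int[P]_x (f x)%:E)%E = (EX f)%:E.
Proof. by move=> /integrable_fin_num h; rewrite /EX fineK//; apply: h. Qed.

Lemma eq_EX f g : f =1 g -> EX f = EX g.
Proof. by move=> /funext ->. Qed.

Lemma eq_L1 f g : f =1 g -> L1 f -> L1 g.
Proof. by move=> /funext ->. Qed.

Lemma L1_le f g : measurable_fun setT f -> (forall x, `|f x| <= g x) ->
  L1 g -> L1 f.
Proof.
move=> mf fg; apply: le_integrable => //; first exact/measurable_EFinP.
by move=> x _ /=; rewrite lee_fin (le_trans (fg x))// ler_norm.
Qed.

Lemma L1_cst (c : R) : L1 (fun=> c).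
Proof. by apply: finite_measure_integrable_cst. Qed.

Lemma L1_D f g : L1 f -> L1 g -> L1 (fun x => f x + g x).
Proof. by move=> h1 h2; exact: (integrableD measurableT h1 h2). Qed.

Lemma L1_N f : L1 f -> L1 (fun x => - f x).
Proof. by move=> h1; exact: (integrableN h1). Qed.

Lemma L1_B f g : L1 f -> L1 g -> L1 (fun x => f x - g x).
Proof. by move=> h1 h2; exact: (L1_D h1 (L1_N h2)). Qed.

Lemma L1_Z (k : R) f : L1 f -> L1 (fun x => k * f x).
Proof. by move=> h1; exact: (integrableZl measurableT k h1). Qed.

Lemma L1_abs f : L1 f -> L1 (fun x => `|f x|).
Proof. by move=> h; exact: (integrable_norm h). Qed.

Lemma L1_sum (I : Type) (s : seq I) (Q : pred I) (F : I -> T -> R) :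
  (forall i, Q i -> L1 (F i)) -> L1 (fun x => \sum_(i <- s | Q i) F i x).
Proof.
move=> h; elim: s => [|i s IH].
  by apply: (@eq_L1 (fun=> 0)); [move=> x; rewrite big_nil|exact: L1_cst].
case Qi: (Q i); last by apply: (eq_L1 _ IH) => x; rewrite big_cons Qi.
by apply: (eq_L1 _ (L1_D (h i Qi) IH)) => x; rewrite big_cons Qi.
Qed.

Lemma L1_bounded f (M : R) : measurable_fun setT f -> (forall x, `|f x| <= M) -> L1 f.
Proof. by move=> mf fM; apply: (L1_le mf fM); exact: L1_cst. Qed.

Lemma EX_cst (c : R) : EX (fun=> c) = c.
Proof. by rewrite /EX integral_cst//= probability_setT mule1. Qed.

Lemma EX_D f g : L1 f -> L1 g -> EX (fun x => f x + g x) = EX f + EX g.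
Proof.
move=> hf hg; apply: EFin_inj; rewrite -L1_E; last exact: L1_D.
by rewrite EFinD -!L1_E//; exact: (integralD_EFin measurableT hf hg).
Qed.

Lemma EX_Z (k : R) f : L1 f -> EX (fun x => k * f x) = k * EX f.
Proof.
move=> hf; apply: EFin_inj; rewrite -L1_E; last exact: L1_Z.
rewrite EFinM -L1_E//; under eq_integral do rewrite EFinM.
by rewrite integralZl.
Qed.

Lemma EX_N f : L1 f -> EX (fun x => - f x) = - EX f.
Proof.
by move=> hf; rewrite -mulN1r -EX_Z//; apply: eq_EX => x; rewrite mulN1r.
Qed.

Lemma EX_B f g : L1 f -> L1 g -> EX (fun x => f x - g x) = EX f - EX g.
Proof. by move=> hf hg; rewrite (EX_D hf (L1_N hg)) EX_N. Qed.

Lemma EX_sum (I : Type) (s : seq I) (Q : pred I) (F : I -> T -> R) :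
  (forall i, Q i -> L1 (F i)) ->
  EX (fun x => \sum_(i <- s | Q i) F i x) = \sum_(i <- s | Q i) EX (F i).
Proof.
move=> h; elim: s => [|i s IH].
  by rewrite big_nil -[RHS](EX_cst 0); apply: eq_EX => x; rewrite big_nil.
rewrite big_cons; case Qi: (Q i).
  rewrite -IH -EX_D ?h//; last exact: L1_sum.
  by apply: eq_EX => x; rewrite big_cons Qi.
by rewrite -IH; apply: eq_EX => x; rewrite big_cons Qi.
Qed.

Lemma EX_ge0 f : (forall x, 0 <= f x) -> 0 <= EX f.
Proof. by move=> f0; apply/fine_ge0/integral_ge0 => x _; rewrite lee_fin. Qed.

Lemma EX_le f g : L1 f -> L1 g -> (forall x, f x <= g x) -> EX f <= EX g.
Proof.
move=> hf hg fg; rewrite -subr_ge0 -EX_B//; apply: EX_ge0 => x.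
by rewrite subr_ge0.
Qed.

Lemma EX_abs f : L1 f -> `|EX f| <= EX (fun x => `|f x|).
Proof.
move=> hf; rewrite ler_norml -EX_N; last exact: L1_abs.
have habs := L1_abs hf.
apply/andP; split; apply: EX_le => //; first exact: L1_N.
  by move=> x; rewrite lerNl -normrN ler_norm.
by move=> x; rewrite ler_norm.
Qed.

Lemma EX_abs_le f g : L1 f -> L1 g -> (forall x, `|f x| <= g x) -> `|EX f| <= EX g.
Proof.
by move=> hf hg fg; rewrite (le_trans (EX_abs hf))//; apply: EX_le => //; exact: L1_abs.
Qed.

Lemma EX_le_cst f (c : R) : L1 f -> (forall x, f x <= c) -> EX f <= c.
Proof. by move=> hf h; rewrite -[leRHS]EX_cst; apply: EX_le => //; exact: L1_cst. Qed.

Lemma L2_L1_mul f g : L2 f -> L2 g -> L1 (fun x => f x * g x).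
Proof.
move=> [mf hf] [mg hg]; apply: (@L1_le _ (fun x => f x ^+ 2 + g x ^+ 2)).
- exact: measurable_funM.
- move=> x; rewrite normrM -(real_normK (num_real (f x))) -(real_normK (num_real (g x))).
  have := normr_ge0 (f x); have := normr_ge0 (g x); nra.
- exact: L1_D.
Qed.

Lemma L2_L1 f : L2 f -> L1 f.
Proof.
move=> hf; apply: (@eq_L1 (fun x => f x * 1)); first by move=> x; rewrite mulr1.
apply: (L2_L1_mul hf); split; first exact: measurable_cst.
by apply: eq_L1 (L1_cst (1 ^+ 2)).
Qed.

Lemma L2_sq f : L2 f -> L1 (fun x => f x ^+ 2). Proof. by case. Qed.

Lemma L2_meas f : L2 f -> measurable_fun setT f. Proof. by case. Qed.

Lemma L2_cst (c : R) : L2 (fun=> c).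
Proof. by split; [exact: measurable_cst|exact: L1_cst]. Qed.

Lemma L2_Z (k : R) f : L2 f -> L2 (fun x => k * f x).
Proof.
move=> [mf hf]; split; first exact: (measurable_funM (@measurable_cst _ _ _ _ _ k) mf).
by apply: (eq_L1 _ (L1_Z (k ^+ 2) hf)) => x; rewrite exprMn.
Qed.

Lemma L2_D f g : L2 f -> L2 g -> L2 (fun x => f x + g x).
Proof.
move=> hf hg; split; first exact: (measurable_funD hf.1 hg.1).
apply: (@eq_L1 (fun x => f x ^+ 2 + 2 * (f x * g x) + g x ^+ 2)); first by move=> x; ring.
apply: L1_D; last exact: hg.2.
by apply: L1_D; [exact: hf.2|apply: L1_Z; exact: L2_L1_mul].
Qed.

Lemma L2_N f : L2 f -> L2 (fun x => - f x).
Proof.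
move=> hf; have := L2_Z (-1) hf.
by rewrite (_ : (fun x => -1 * f x) = (fun x => - f x))//; apply/funext => x; rewrite mulN1r.
Qed.

Lemma L2_B f g : L2 f -> L2 g -> L2 (fun x => f x - g x).
Proof. by move=> hf hg; exact: (L2_D hf (L2_N hg)). Qed.

Lemma L2_bounded f (M : R) : measurable_fun setT f -> (forall x, `|f x| <= M) -> L2 f.
Proof.
move=> mf fM; split => //; apply: (@L1_bounded _ (M ^+ 2)).
  exact: measurable_funX.
by move=> x; rewrite normrX lerXn2r ?nnegrE// (le_trans _ (fM x)).
Qed.

(* Positivity of the quadratic form [a |-> EX ((a f - g)^2)]. *)
Lemma EX_CS f g : L2 f -> L2 g ->
  EX (fun x => f x * g x) ^+ 2 <= EX (fun x => f x ^+ 2) * EX (fun x => g x ^+ 2).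
Proof.
move=> hf hg; have hfg := L2_L1_mul hf hg.
set A := EX (fun x => f x ^+ 2); set B := EX (fun x => _ * _); set C := EX _.
have A0 : 0 <= A by apply: EX_ge0 => x; exact: sqr_ge0.
have C0 : 0 <= C by apply: EX_ge0 => x; exact: sqr_ge0.
have key (a b : R) : 0 <= a ^+ 2 * A - 2 * a * b * B + b ^+ 2 * C.
  rewrite /A /B /C -!EX_Z//; [|exact: hg.2|exact: hf.2].
  have h1 := L1_Z (a ^+ 2) hf.2; have h2 := L1_Z (2 * a * b) hfg.
  have h3 := L1_Z (b ^+ 2) hg.2.
  rewrite -EX_B// -EX_D//; last exact: L1_B.
  apply: EX_ge0 => x.
  by rewrite (_ : _ + _ = (a * f x - b * g x) ^+ 2) ?sqr_ge0//; ring.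
(* The choice [(C, B)] gives [C (A C - B^2) >= 0], which settles the case [C > 0]; if [C = 0], the
   choice [(B, A)] leaves [- A B^2 >= 0]. *)
have := key C B; have := key B A.
have [C0'|Cn] := eqVneq C 0.
  move=> h _; rewrite C0' mulr0.
  have [A0'|An] := eqVneq A 0.
    have := key B 1; have := key (- B) 1; rewrite A0' C0'; nra.
  have Ap : 0 < A by rewrite lt_def An.
  rewrite C0' in h; rewrite leNgt; apply/negP => Bp; nra.
have Cp : 0 < C by rewrite lt_def Cn.
move=> _ h; rewrite leNgt; apply/negP => h'; nra.
Qed.

Lemma EX_abs_sq f : L2 f -> EX (fun x => `|f x|) ^+ 2 <= EX (fun x => f x ^+ 2).
Proof.
move=> hf; have h' : L2 (fun x => `|f x|).
  split; first exact: measurableT_comp hf.1.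
  by apply: (eq_L1 _ hf.2) => x; rewrite real_normK// num_real.
have := EX_CS h' (L2_cst 1).
rewrite expr1n EX_cst mulr1 (_ : (fun x => `|f x| * 1) = (fun x => `|f x|)); last first.
  by apply/funext => x; rewrite mulr1.
move=> /le_trans; apply; rewrite le_eqVlt; apply/orP; left; apply/eqP.
by apply: eq_EX => x; rewrite real_normK// num_real.
Qed.

Lemma EX_abs_sqrt f : L2 f -> EX (fun x => `|f x|) <= Num.sqrt (EX (fun x => f x ^+ 2)).
Proof.
move=> hf; rewrite -[leLHS]ger0_norm; last exact: EX_ge0.
by rewrite -sqrtr_sqr ler_wsqrtr// EX_abs_sq.
Qed.

End expectation.

(** * Finite families of independent Poisson counts *)

Section discrete_variable.
Context d (T : measurableType d) (R : realType) (P : probability T R).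
Context (V : countType) (K : T -> V).
Hypothesis mK : forall v, measurable [set w | K w = v].

Lemma measurable_discrete d' (T' : measurableType d') (g : V -> T') :
  measurable_fun setT (g \o K).
Proof.
move=> _ Y mY; rewrite setTI.
rewrite (_ : _ @^-1` Y = \bigcup_n [set w | g (K w) \in Y /\ pickle (K w) = n]); last first.
  apply/seteqP; split=> [w Yw|w [n _ [/set_mem//]]].
  by exists (pickle (K w)) => //; split => //; exact: mem_set.
apply: bigcup_measurable => n _.
case E : (@pickle_inv V n) => [v|].
  have [gY|gY] := pselect (g v \in Y).
    rewrite (_ : [set w | _] = [set w | K w = v])//.
    apply/seteqP; split=> [w [_ h]|w /= ->].
      by move: E; rewrite -h pickleK_inv; case.
    by split=> //; have := @pickle_invK V n; rewrite E.
  rewrite (_ : [set w | _] = set0)//; apply/seteqP; split=> // w [h1 h2].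
  by apply: gY; move: E; rewrite -h2 pickleK_inv; case=> <-.
rewrite (_ : [set w | _] = set0)//; apply/seteqP; split=> // w [h1 h2].
by move: E; rewrite -h2 pickleK_inv.
Qed.

(** Countable additivity over the level sets of [K], enumerated through [pickle]; codes outside the
    range of [pickle] contribute empty sets. *)
Lemma ge0_integral_discrete (G : V -> \bar R) : (forall v, 0 <= G v)%E ->
  (\int[P]_w G (K w) = \esum_(v in setT) (G v * P [set w | K w = v]))%E.
Proof.
move=> G0; pose F n := [set w | pickle (K w) = n].
have FE v : F (pickle v) = [set w | K w = v].
  by apply/seteqP; split=> w; rewrite /F/=; [exact: (pcan_inj pickleK)|move=> ->].
have F0 n : ~ range (@pickle V) n -> F n = set0.
  by move=> h; apply/seteqP; split=> // w hw; apply: h; exists (K w).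
have mF n : measurable (F n).
  have [[v _ <-]|/F0 -> //] := pselect (range (@pickle V) n).
  by rewrite FE.
have UF : \bigcup_n F n = setT.
  by apply/seteqP; split=> // w _; exists (pickle (K w)).
rewrite -UF ge0_integral_bigcup//; last 2 first.
- by rewrite UF; exact: measurable_discrete.
- by apply/trivIsetP => i j _ _ ij; apply/seteqP; split=> // w []; rewrite /F/= => h1 h2; rewrite -h1 -h2 eqxx in ij.
rewrite nneseries_esumT; last by move=> n; apply: integral_ge0 => w _; exact: G0.
rewrite (esumID (range (@pickle V))); last by move=> n _; apply: integral_ge0 => w _; exact: G0.
rewrite [X in (_ + X)%E]esum1 ?adde0; last first.
  by move=> n [_ /= /F0 ->]; rewrite integral_set0.
rewrite setTI (@reindex_esum R V nat setT (range (@pickle V)) (@pickle V)); first last.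
- split; first by move=> v _ /=; exists v.
    by move=> v w _ _; exact: (pcan_inj pickleK).
  by move=> n [v _ <-]; exists v.
apply: eq_esum => v _; rewrite FE.
rewrite (eq_integral (fun=> G v)); last by move=> w /set_mem /= ->.
by rewrite integral_cst.
Qed.

End discrete_variable.

Definition pois {R : realType} (m : R) (n : nat) : R :=
  fine (poisson_prob m 0%N [set n]).

Lemma pois_ge0 (R : realType) (m : R) n : 0 <= pois m n.
Proof. by rewrite fine_ge0. Qed.

(** This recursion is what the Mecke formula consumes. At rate 0 the law is the Dirac mass at 0 and
    both sides vanish. *)
Lemma pois_rec (R : realType) (m : R) n : 0 <= m ->
  n.+1%:R * pois m n.+1 = m * pois m n.
Proof.
rewrite le_eqVlt => /orP[/eqP <-|m0].
  by rewrite /pois /poisson_prob ltxx mul0r diracE memNset//= mulr0.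
rewrite /pois /poisson_prob m0 !esum_set1 ?lee_fin ?poisson_pmf_ge0//=.
rewrite /poisson_pmf m0 factS natrM exprS.
have h1 : n.+1%:R != 0 :> R by rewrite pnatr_eq0.
rewrite invfM; set a := n.+1%:R in h1 *; set b := (n`!%:R)^-1.
by field.
Qed.

Definition incr (I : finType) (i : I) (v : {ffun I -> nat}) : {ffun I -> nat} :=
  [ffun j => (v j + (j == i))%N].

Section poisson_family.
Context d (T : measurableType d) (R : realType) (P : probability T R).
Context (I : finType).
Implicit Types (m : I -> R) (K : T -> {ffun I -> nat}) (v : {ffun I -> nat}).

(** The counts take countably many joint values, so the product form of the point masses expresses
    the Poisson marginals and their independence at once, and turns every expectation into a sum. *)
Record poisson_family m K : Prop := PoissonFamily {
  pfam_ge0 : forall i, 0 <= m i;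
  pfam_meas : forall v, measurable [set w | K w = v];
  pfam_law : forall v, P [set w | K w = v] = (\prod_i pois (m i) (v i))%:E }.

Lemma prod_pois_incr m i v : (forall i, 0 <= m i) ->
  (v i).+1%:R * \prod_j pois (m j) (incr i v j) = m i * \prod_j pois (m j) (v j).
Proof.
move=> m0; rewrite (bigD1 i)//= [in RHS](bigD1 i)//= !mulrA -pois_rec//.
rewrite ffunE eqxx addn1; congr (_ * _ * _); apply: eq_bigr => j ji.
by rewrite ffunE (negbTE ji) addn0.
Qed.

Variables (m : I -> R) (K : T -> {ffun I -> nat}).
Hypothesis pK : poisson_family m K.

Lemma measurable_pfam (g : {ffun I -> nat} -> R) : measurable_fun setT (g \o K).
Proof. move=> mT Y mY; exact: (@measurable_discrete _ _ _ K (pfam_meas pK) _ _ g). Qed.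

(** Reindexing the sum over values by [incr i]: values with [v i = 0] contribute nothing on the
    left, and the other ones are matched by the recursion of the Poisson weights. *)
Lemma mecke_ereal i (G : {ffun I -> nat} -> R) : (forall v, 0 <= G v) ->
  (\int[P]_w ((K w i)%:R * G (K w))%:E
   = (m i)%:E * \int[P]_w (G (incr i (K w)))%:E)%E.
Proof.
move=> G0; rewrite -ge0_integralZl_EFin//; last 3 first.
- by move=> w _; rewrite lee_fin.
- by apply/measurable_EFinP; exact: (measurable_pfam (G \o incr i)).
- exact: pfam_ge0 pK i.
have disc := ge0_integral_discrete P (pfam_meas pK).
have := disc (fun v => ((v i)%:R * G v)%:E) => ->; last first.
  by move=> v; rewrite lee_fin mulr_ge0.
have := disc (fun v => ((m i)%:E * (G (incr i v))%:E)%E) => ->; last first.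
  by move=> v; rewrite -EFinM lee_fin mulr_ge0//; exact: pfam_ge0 pK i.
have p0 v : 0 <= \prod_j pois (m j) (v j) by apply: prodr_ge0 => j _; exact: pois_ge0.
rewrite (esumID (range (incr i))); last first.
  by move=> v _; rewrite (pfam_law pK) -EFinM lee_fin !mulr_ge0.
rewrite [X in (_ + X)%E]esum1 ?adde0; last first.
  move=> v [_ /= hv]; have -> : v i = 0%N; last by rewrite mul0r mul0e.
  apply/eqP; apply: contra_notT hv; rewrite -lt0n => vi.
  exists [ffun j => (v j - (j == i))%N] => //.
  apply/ffunP => j; rewrite !ffunE; have [->|] := eqVneq j i; last by rewrite subn0 addn0.
  by rewrite subnK.
rewrite setTI (@reindex_esum R {ffun I -> nat} {ffun I -> nat} setT (range (incr i)) (incr i)); first last.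
- split; first by move=> v _ /=; exists v.
    move=> v w _ _ /ffunP h; apply/ffunP => j; have := h j; rewrite !ffunE.
    exact: addIn.
  by move=> n [v _ <-]; exists v.
apply: eq_esum => v _; rewrite !(pfam_law pK) -!EFinM; congr EFin.
rewrite [in LHS]ffunE eqxx addn1 mulrAC (prod_pois_incr _ _ (pfam_ge0 pK)).
by ring.
Qed.

Definition total (v : {ffun I -> nat}) : nat := (\sum_i v i)%N.

Lemma total_incr i v : total (incr i v) = (total v).+1.
Proof.
rewrite /total; under eq_bigr do rewrite ffunE.
rewrite big_split/= -[RHS]addn1; congr (_ + _)%N.
by rewrite (bigD1 i)//= eqxx big1// => j /negbTE ->.
Qed.

(** Induction on the degree: one factor is expanded into the single counts, the Mecke formula trades
    each count for a shift of the total by one, and [2 + t <= 2 (1 + t)] returns to degree [n]. *)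
Lemma L1_total n : L1 P (fun w => (1 + (total (K w))%:R) ^+ n).
Proof.
have meas q : measurable_fun setT (fun w => (1 + (total (K w))%:R) ^+ q : R).
  exact: (measurable_pfam (fun v => (1 + (total v)%:R) ^+ q)).
have pos (x : nat) q : 0 <= (1 + x%:R) ^+ q :> R by rewrite exprn_ge0// addr_ge0.
elim: n => [|n IHn]; first by apply: L1_cst.
have split : (fun w => (1 + (total (K w))%:R) ^+ n.+1 : R) =
   (fun w => (1 + (total (K w))%:R) ^+ n +
     \sum_i (K w i)%:R * (1 + (total (K w))%:R) ^+ n).
  by apply/funext => w; rewrite exprS mulrDl mul1r /total natr_sum mulr_suml.
rewrite split; apply: L1_D => //; apply: L1_sum => i _.
apply/integrableP; split.
  apply/measurable_EFinP.
  exact: (measurable_pfam (fun v => (v i)%:R * (1 + (total v)%:R) ^+ n)).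
under eq_integral do rewrite /= ger0_norm ?mulr_ge0//.
rewrite (mecke_ereal i (G := fun v => (1 + (total v)%:R) ^+ n))//.
have : L1 P (fun w => (2 ^+ n) * (1 + (total (K w))%:R) ^+ n) by apply: L1_Z.
move=> /integrableP[_ /le_lt_trans h].
rewrite lte_mul_pinfty ?lee_fin ?(pfam_ge0 pK)//.
apply: h; apply: ge0_le_integral => //.
- apply/measurable_EFinP.
  exact: (measurable_pfam (fun v => (1 + (total (incr i v))%:R) ^+ n)).
- apply: measurableT_comp => //; apply/measurable_EFinP/measurable_funM => //.
- move=> w _; rewrite /= lee_fin ger0_norm ?mulr_ge0// ?exprn_ge0//.
  rewrite -exprMn lerXn2r ?nnegrE ?addr_ge0 ?mulr_ge0 ?addr_ge0//.
  by rewrite total_incr -natr1; have := ler0n R (total (K w)); lra.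
Qed.

(* Polynomial growth: a class of functionals of the counts that is stable under
   all operations used below and on which expectations are finite. *)
Definition pg (G : {ffun I -> nat} -> R) : Prop :=
  exists (C : R) n, forall v, `|G v| <= C * (1 + (total v)%:R) ^+ n.

Lemma pg_L1 G : pg G -> L1 P (G \o K).
Proof.
move=> [C [n h]]; apply: (L1_le (measurable_pfam G)) => [w|]; first exact: h.
exact/L1_Z/L1_total.
Qed.

End poisson_family.

Section polynomial_growth.
Context (R : realType) (I : finType).
Implicit Types (v : {ffun I -> nat}) (G : {ffun I -> nat} -> R).

Let tot_ge1 v n : 1 <= (1 + (total v)%:R) ^+ n :> R.
Proof. by rewrite exprn_ege1// lerDl. Qed.

Let tot_mono v n n' : (n <= n')%N ->
  (1 + (total v)%:R) ^+ n <= (1 + (total v)%:R) ^+ n' :> R.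
Proof. by move=> nn'; rewrite ler_weXn2l// lerDl. Qed.

Lemma pg_le G G' : (forall v, `|G v| <= `|G' v|) -> pg G' -> pg G.
Proof. by move=> h [C [n hn]]; exists C, n => v; exact: le_trans (h v) (hn v). Qed.

Lemma pg_eq G G' : G =1 G' -> pg G -> pg G'.
Proof. by move=> /funext ->. Qed.

Lemma pg_cst (c : R) : pg (fun _ : {ffun I -> nat} => c).
Proof. by exists `|c|, 0%N => v; rewrite expr0 mulr1. Qed.

Lemma pg_D G G' : pg G -> pg G' -> pg (fun v => G v + G' v).
Proof.
move=> [C [n h]] [C' [n' h']]; exists (`|C| + `|C'|), (n + n')%N => v.
rewrite (le_trans (ler_normD _ _))// mulrDl lerD//.
  apply: (le_trans (h v)); apply: le_trans (ler_wpM2r _ (ler_norm C)) _.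
    by rewrite (le_trans _ (tot_ge1 v n)).
  by rewrite ler_wpM2l// tot_mono// leq_addr.
apply: (le_trans (h' v)); apply: le_trans (ler_wpM2r _ (ler_norm C')) _.
  by rewrite (le_trans _ (tot_ge1 v n')).
by rewrite ler_wpM2l// tot_mono// leq_addl.
Qed.

Lemma pg_M G G' : pg G -> pg G' -> pg (fun v => G v * G' v).
Proof.
move=> [C [n h]] [C' [n' h']]; exists (C * C'), (n + n')%N => v.
by rewrite normrM exprD mulrACA ler_pM.
Qed.

Lemma pg_Z (c : R) G : pg G -> pg (fun v => c * G v).
Proof. by move=> h; apply: pg_M => //; exact: pg_cst. Qed.

Lemma pg_N G : pg G -> pg (fun v => - G v).
Proof. by apply: pg_le => v; rewrite normrN. Qed.

Lemma pg_B G G' : pg G -> pg G' -> pg (fun v => G v - G' v).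
Proof. by move=> h h'; apply: pg_D => //; exact: pg_N. Qed.

Lemma pg_X G n : pg G -> pg (fun v => G v ^+ n).
Proof.
move=> h; elim: n => [|n IH]; first by apply: pg_eq (pg_cst 1) => v; rewrite expr0.
by apply: (pg_eq _ (pg_M h IH)) => v; rewrite exprS.
Qed.

Lemma pg_abs G : pg G -> pg (fun v => `|G v|).
Proof. by apply: pg_le => v; rewrite normr_id. Qed.

Lemma pg_sum (J : Type) (s : seq J) (Q : pred J) (F : J -> {ffun I -> nat} -> R) :
  (forall j, Q j -> pg (F j)) -> pg (fun v => \sum_(j <- s | Q j) F j v).
Proof.
move=> h; elim: s => [|i s IH].
  by apply: pg_eq (pg_cst 0) => v; rewrite big_nil.
case Qi: (Q i); last by apply: (pg_eq _ IH) => v; rewrite big_cons Qi.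
by apply: (pg_eq _ (pg_D (h i Qi) IH)) => v; rewrite big_cons Qi.
Qed.

Lemma pg_coord i : pg (fun v => (v i)%:R : R).
Proof.
exists 1, 1%N => v; rewrite expr1 mul1r ger0_norm// addrC ler_wpDr//.
by rewrite ler_nat /total (bigD1 i)//= leq_addr.
Qed.

Lemma pg_incr i G : pg G -> pg (fun v => G (incr i v)).
Proof.
move=> [C [n h]]; exists (`|C| * 2 ^+ n), n => v.
apply: (le_trans (h _)); apply: le_trans (ler_wpM2r _ (ler_norm C)) _.
  by rewrite (le_trans _ (tot_ge1 _ n)).
rewrite -mulrA ler_wpM2l// -exprMn lerXn2r ?nnegrE ?addr_ge0 ?mulr_ge0 ?addr_ge0//.
by rewrite total_incr -natr1; have := ler0n R (total v); lra.
Qed.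

Lemma pg_bounded (M : R) (f : R -> R) G : (forall x, `|f x| <= M) -> pg (fun v => f (G v)).
Proof. by move=> h; exists M, 0%N => v; rewrite expr0 mulr1. Qed.

End polynomial_growth.

Section C11_functions.
Context (R : realType).

(* Bounded functions with bounded Lipschitz derivative, with all the constants
   equal to [M]. *)
Record C11 (M : R) (f f' : R -> R) : Prop := MkC11 {
  C11_bound : forall x, `|f x| <= M;
  C11_dbound : forall x, `|f' x| <= M;
  C11_lip : forall x y, `|f x - f y| <= M * `|x - y|;
  C11_dlip : forall x y, `|f' x - f' y| <= M * `|x - y|;
  C11_taylor : forall x y, `|f y - f x - (y - x) * f' x| <= M * (y - x) ^+ 2 }.

Lemma C11_ge0 M f f' : C11 M f f' -> 0 <= M.
Proof. by move=> h; apply: le_trans (C11_bound h 0). Qed.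

End C11_functions.

(** * Mecke formula and discrete chaoses of Poisson counts *)

Section poisson_functionals.
Context d (T : measurableType d) (R : realType) (P : probability T R).
Context (I : finType) (m : I -> R) (K : T -> {ffun I -> nat}).
Hypothesis pK : poisson_family P m K.
Implicit Types (G : {ffun I -> nat} -> R) (v : {ffun I -> nat}).

Definition EK G : R := EX P (G \o K).

Lemma eq_EK G G' : G =1 G' -> EK G = EK G'.
Proof. by move=> /funext ->. Qed.

Lemma EK_cst (c : R) : EK (fun=> c) = c.
Proof. exact: EX_cst. Qed.

Lemma EK_D G G' : pg G -> pg G' -> EK (fun v => G v + G' v) = EK G + EK G'.
Proof. by move=> h h'; exact: (EX_D (pg_L1 pK h) (pg_L1 pK h')). Qed.

Lemma EK_B G G' : pg G -> pg G' -> EK (fun v => G v - G' v) = EK G - EK G'.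
Proof. by move=> h h'; exact: (EX_B (pg_L1 pK h) (pg_L1 pK h')). Qed.

Lemma EK_Z (c : R) G : pg G -> EK (fun v => c * G v) = c * EK G.
Proof. by move=> h; exact: (EX_Z c (pg_L1 pK h)). Qed.

Lemma EK_sum (J : Type) (s : seq J) (Q : pred J) (F : J -> {ffun I -> nat} -> R) :
  (forall j, Q j -> pg (F j)) ->
  EK (fun v => \sum_(j <- s | Q j) F j v) = \sum_(j <- s | Q j) EK (F j).
Proof.
by move=> h; apply: (EX_sum s (Q := Q) (F := fun j w => F j (K w))) => j /h /(pg_L1 pK).
Qed.

Lemma EK_abs_le G G' : pg G -> pg G' -> (forall v, `|G v| <= G' v) -> `|EK G| <= EK G'.
Proof.
by move=> h h' hle; apply: (EX_abs_le (pg_L1 pK h) (pg_L1 pK h')) => w; exact: hle.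
Qed.

Definition Nt i v : R := (v i)%:R - m i.

Lemma pg_Nt i : pg (Nt i).
Proof. by apply: pg_B; [exact: pg_coord|exact: pg_cst]. Qed.

Lemma Nt_incr i j v : Nt j (incr i v) = Nt j v + (j == i)%:R.
Proof. by rewrite /Nt ffunE natrD; ring. Qed.

Let mecke_ge0 i G : pg G -> (forall v, 0 <= G v) ->
  EK (fun v => (v i)%:R * G v) = m i * EK (fun v => G (incr i v)).
Proof.
move=> hG G0; apply: EFin_inj; rewrite /EK -L1_E; last first.
  apply: (pg_L1 pK (G := fun v => (v i)%:R * G v)).
  by apply: pg_M => //; exact: pg_coord.
rewrite (mecke_ereal pK)// L1_E//.
exact: (pg_L1 pK (pg_incr i hG)).
Qed.

(** Integration by parts for the centred count. A signed [G] is the difference of [|G| + G] and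
    [|G|], to which the non-negative formula applies. *)
Lemma mecke i G : pg G ->
  EK (fun v => Nt i v * G v) = m i * EK (fun v => G (incr i v) - G v).
Proof.
move=> hG.
have hA := pg_abs hG; have hAG := pg_D hA hG.
have hAi := pg_incr i hA; have hAGi := pg_incr i hAG.
have hc := @pg_coord R I i.
have e1 := mecke_ge0 i hA (fun v => normr_ge0 _).
have e2 : EK (fun v => (v i)%:R * (`|G v| + G v)) =
    m i * EK (fun v => `|G (incr i v)| + G (incr i v)).
  by apply: (mecke_ge0 i hAG) => v; rewrite -lerBlDl sub0r lerNnormlW.
rewrite (_ : EK _ = EK (fun v => (v i)%:R * (`|G v| + G v) - (v i)%:R * `|G v| - m i * G v)).
  have h1 := pg_M hc hAG; have h2 := pg_M hc hA.
  rewrite (EK_B (pg_B h1 h2) (pg_Z (m i) hG)) (EK_B h1 h2).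
  rewrite e1 e2 EK_Z// EK_B//; last exact: pg_incr.
  rewrite EK_D//; last exact: pg_incr.
  by ring.
by apply: eq_EK => v; rewrite /Nt; ring.
Qed.

Lemma EK_Nt i : EK (Nt i) = 0.
Proof.
rewrite (_ : EK (Nt i) = EK (fun v => Nt i v * 1)); last by apply: eq_EK => v; rewrite mulr1.
rewrite mecke; last exact: pg_cst.
by rewrite subrr EK_cst mulr0.
Qed.

Lemma EK_Nt2 i j : EK (fun v => Nt i v * Nt j v) = (i == j)%:R * m i.
Proof.
rewrite mecke; last exact: pg_Nt.
rewrite (_ : EK _ = EK (fun=> (i == j)%:R)); last first.
  by apply: eq_EK => v; rewrite Nt_incr addrC addKr eq_sym.
by rewrite EK_cst mulrC.
Qed.

(** Only the two pairings survive: [i != j] and [k != l] exclude the coincidences from which higher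
    cumulants of a single count would arise. *)
Lemma EK_Nt4 i j k l : i != j -> k != l ->
  EK (fun v => Nt i v * Nt j v * (Nt k v * Nt l v)) =
  ((i == k) && (j == l))%:R * (m i * m j) + ((i == l) && (j == k))%:R * (m i * m j).
Proof.
move=> ij kl; have p2 a b : pg (fun v => Nt a v * Nt b v) by apply: pg_M; exact: pg_Nt.
rewrite (_ : EK _ = EK (fun v => Nt i v * (Nt j v * (Nt k v * Nt l v)))); last first.
  by apply: eq_EK => v; rewrite !mulrA.
rewrite mecke; last by apply: pg_M => //; exact: pg_Nt.
rewrite (_ : EK _ = EK (fun v => (i == k)%:R * (Nt j v * Nt l v) + (i == l)%:R * (Nt j v * Nt k v))).
  rewrite EK_D; [|exact: pg_Z|exact: pg_Z].
  rewrite !EK_Z// !EK_Nt2.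
  by case: (i == k); case: (i == l); case: (j == l); case: (j == k) => /=; ring.
apply: eq_EK => v; rewrite !Nt_incr (negbTE _ : (j == i) = false); last by rewrite eq_sym.
rewrite ![_ == i]eq_sym.
have [ik|_] := eqVneq i k; have [il|_] := eqVneq i l => /=; try ring.
by rewrite -ik -il eqxx in kl.
Qed.

(** When [g] vanishes on the diagonal this is the double Wiener-Ito integral of the corresponding
    step kernel; [g] need not be symmetric. *)
Definition chaos2 (g : I -> I -> R) v : R := \sum_i \sum_j g i j * (Nt i v * Nt j v).

Definition chaos1 (g : I -> R) v : R := \sum_i g i * Nt i v.

Lemma pg_chaos1 g : pg (chaos1 g).
Proof. by apply: pg_sum => i _; apply: pg_Z; exact: pg_Nt. Qed.

Lemma pg_chaos2 g : pg (chaos2 g).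
Proof.
by apply: pg_sum => i _; apply: pg_sum => j _; apply: pg_Z; apply: pg_M; exact: pg_Nt.
Qed.

Lemma EK_chaos1 g : EK (chaos1 g) = 0.
Proof.
rewrite EK_sum => [|i _]; last by apply: pg_Z; exact: pg_Nt.
by rewrite big1// => i _; rewrite EK_Z ?EK_Nt ?mulr0//; exact: pg_Nt.
Qed.

Lemma EK_chaos2 g : (forall i, g i i = 0) -> EK (chaos2 g) = 0.
Proof.
move=> g0; have p2 a b : pg (fun v => Nt a v * Nt b v) by apply: pg_M; exact: pg_Nt.
rewrite EK_sum => [|i _]; last by apply: pg_sum => j _; exact: pg_Z.
rewrite big1// => i _; rewrite EK_sum => [|j _]; last exact: pg_Z.
rewrite big1// => j _; rewrite EK_Z// EK_Nt2.
by have [<-|] := eqVneq i j; rewrite ?g0 !(mul0r, mulr0).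
Qed.

Lemma EK_chaos1_sq g : EK (fun v => chaos1 g v ^+ 2) = \sum_i g i ^+ 2 * m i.
Proof.
have p2 a b : pg (fun v => Nt a v * Nt b v) by apply: pg_M; exact: pg_Nt.
rewrite (_ : EK _ = EK (fun v => \sum_i \sum_j (g i * g j) * (Nt i v * Nt j v))).
  rewrite EK_sum => [|i _]; last by apply: pg_sum => j _; exact: pg_Z.
  apply: eq_bigr => i _; rewrite EK_sum => [|j _]; last exact: pg_Z.
  rewrite (bigD1 i)//= big1 => [|j ji]; last first.
    by rewrite EK_Z// EK_Nt2 eq_sym (negbTE ji) mul0r mulr0.
  by rewrite EK_Z// EK_Nt2 eqxx/=; ring.
apply: eq_EK => v; rewrite expr2 mulr_suml; apply: eq_bigr => i _.
by rewrite mulr_sumr; apply: eq_bigr => j _; ring.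
Qed.

Lemma EK_chaos2_sq g : (forall i, g i i = 0) ->
  EK (fun v => chaos2 g v ^+ 2) =
  \sum_i \sum_j (g i j ^+ 2 + g i j * g j i) * (m i * m j).
Proof.
move=> g0.
have p4 a b c e : pg (fun v => Nt a v * Nt b v * (Nt c v * Nt e v)).
  by do 2?apply: pg_M; exact: pg_Nt.
have t4 i j k l : g i j * g k l * EK (fun v => Nt i v * Nt j v * (Nt k v * Nt l v)) =
   g i j * g k l * (((i == k) && (j == l))%:R * (m i * m j) + ((i == l) && (j == k))%:R * (m i * m j)).
  have [<-|ij] := eqVneq i j; first by rewrite g0 !mul0r.
  have [<-|kl] := eqVneq k l; first by rewrite g0 !(mulr0, mul0r).
  by rewrite EK_Nt4.
rewrite (_ : EK _ = EK (fun v => \sum_i \sum_j \sum_k \sum_l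
   (g i j * g k l) * (Nt i v * Nt j v * (Nt k v * Nt l v)))); last first.
  apply: eq_EK => v; rewrite expr2 mulr_suml; apply: eq_bigr => i _.
  rewrite mulr_suml; apply: eq_bigr => j _.
  rewrite mulr_sumr; apply: eq_bigr => k _.
  by rewrite mulr_sumr; apply: eq_bigr => l _; ring.
rewrite EK_sum => [|i _]; last first.
  by apply: pg_sum => j _; apply: pg_sum => k _; apply: pg_sum => l _; exact: pg_Z.
apply: eq_bigr => i _; rewrite EK_sum => [|j _]; last first.
  by apply: pg_sum => k _; apply: pg_sum => l _; exact: pg_Z.
apply: eq_bigr => j _; rewrite EK_sum => [|k _]; last by apply: pg_sum => l _; exact: pg_Z.
rewrite (eq_bigr (fun k => \sum_l g i j * g k l * (((i == k) && (j == l))%:R * (m i * m j) +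
   ((i == l) && (j == k))%:R * (m i * m j)))); last first.
  move=> k _; rewrite EK_sum => [|l _]; last exact: pg_Z.
  by apply: eq_bigr => l _; rewrite EK_Z// t4.
under eq_bigr do (under eq_bigr do rewrite mulrDr; rewrite big_split /=).
rewrite big_split /= mulrDl; congr (_ + _).
  rewrite (bigD1 i)//= [X in _ + X]big1 ?addr0 => [|k ki]; last first.
    by rewrite big1// => l _; rewrite eq_sym (negbTE ki)/= mul0r mulr0.
  rewrite (bigD1 j)//= big1 ?addr0 => [|l lj]; last by rewrite [j == l]eq_sym (negbTE lj) andbF mul0r mulr0.
  by rewrite !eqxx/=; ring.
rewrite (bigD1 j)//= [X in _ + X]big1 ?addr0 => [|k kj]; last first.
  by rewrite big1// => l _; rewrite [j == k]eq_sym (negbTE kj) andbF mul0r mulr0.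
rewrite (bigD1 i)//= big1 ?addr0 => [|l li]; last by rewrite [i == l]eq_sym (negbTE li) mul0r mulr0.
by rewrite !eqxx/=; ring.
Qed.

Lemma EK_chaos2_sq_le g : (forall i, g i i = 0) ->
  EK (fun v => chaos2 g v ^+ 2) <= 2 * \sum_i \sum_j g i j ^+ 2 * (m i * m j).
Proof.
move=> g0; rewrite EK_chaos2_sq//.
have mm i j : 0 <= m i * m j by rewrite mulr_ge0// (pfam_ge0 pK).
rewrite (_ : 2 * _ = \sum_i \sum_j g i j ^+ 2 * (m i * m j) + \sum_i \sum_j g j i ^+ 2 * (m i * m j)); last first.
  rewrite [X in _ = _ + X]exchange_big/= mulr2n mulrDl !mul1r; congr (_ + _).
  by apply: eq_bigr => i _; apply: eq_bigr => j _; rewrite [m j * _]mulrC.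
rewrite (_ : \sum_i \sum_j _ = \sum_i \sum_j g i j ^+ 2 * (m i * m j) + \sum_i \sum_j g i j * g j i * (m i * m j)); last first.
  rewrite -big_split; apply: eq_bigr => i _; rewrite -big_split/=.
  by apply: eq_bigr => j _; rewrite mulrDl.
have key : \sum_i \sum_j g i j * g j i * (m i * m j) <=
  2^-1 * (\sum_i \sum_j g i j ^+ 2 * (m i * m j) + \sum_i \sum_j g j i ^+ 2 * (m i * m j)).
  rewrite -big_split mulr_sumr; apply: ler_sum => i _; rewrite -big_split mulr_sumr/=.
  apply: ler_sum => j _; have := mm i j; have := sqr_ge0 (g i j - g j i); nra.
have sw : \sum_i \sum_j g j i ^+ 2 * (m i * m j) = \sum_i \sum_j g i j ^+ 2 * (m i * m j).
  by rewrite exchange_big; apply: eq_bigr => i _; apply: eq_bigr => j _; rewrite [m j * _]mulrC.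
by move: key; rewrite sw; lra.
Qed.

(** By the Mecke formula each factor [Nt i] replaces the second chaos by its increment in direction
    [i], which is a first chaos and hence centred. *)
Lemma EK_chaos12 g h : (forall i, h i i = 0) -> EK (fun v => chaos1 g v * chaos2 h v) = 0.
Proof.
move=> h0; have p2 a b : pg (fun v => Nt a v * Nt b v) by apply: pg_M; exact: pg_Nt.
rewrite (_ : EK _ = EK (fun v => \sum_i g i * (Nt i v * chaos2 h v))); last first.
  by apply: eq_EK => v; rewrite mulr_suml; apply: eq_bigr => i _; rewrite mulrA.
have pc i : pg (fun v => Nt i v * chaos2 h v).
  by apply: pg_M; [exact: pg_Nt|exact: pg_chaos2].
rewrite EK_sum => [|i _]; last exact: pg_Z.
rewrite big1// => i _; rewrite EK_Z// mecke; last exact: pg_chaos2.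
rewrite (_ : EK _ = EK (chaos1 (fun j => h i j + h j i))); last first.
  apply: eq_EK => v; apply/eqP; rewrite subr_eq; apply/eqP.
  rewrite /chaos2 /chaos1.
  under eq_bigr do under eq_bigr do rewrite !Nt_incr.
  rewrite (eq_bigr (fun a => \sum_b h a b * (Nt a v * Nt b v) +
      (\sum_b (a == i)%:R * (h a b * Nt b v) + \sum_b (b == i)%:R * (h a b * Nt a v)))); last first.
    move=> a _; rewrite -!big_split/=; apply: eq_bigr => b _.
    have [->|_] := eqVneq a i; have [->|_] := eqVneq b i => /=; rewrite ?h0; ring.
  rewrite big_split/= addrC; congr (_ + _); rewrite big_split/=.
  under [RHS]eq_bigr do rewrite mulrDl.
  rewrite big_split/=; congr (_ + _).
    rewrite (bigD1 i)//= [X in _ + X]big1 ?addr0 => [|a ai]; last first.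
      by rewrite big1// => b _; rewrite (negbTE ai) mul0r.
    by rewrite eqxx; apply: eq_bigr => b _; rewrite mul1r.
  apply: eq_bigr => a _.
  rewrite (bigD1 i)//= [X in _ + X]big1 ?addr0 => [|b bi]; last by rewrite (negbTE bi) mul0r.
  by rewrite eqxx mul1r.
by rewrite EK_chaos1 !mulr0.
Qed.

End poisson_functionals.

(** * Normal approximation on Poisson-weighted graphs *)

Section stein_poisson_graph.
Context d (T : measurableType d) (R : realType) (P : probability T R).
Context (I : finType) (m : I -> R) (K : T -> {ffun I -> nat}).
Hypothesis pK : poisson_family P m K.
Variable c : rel I.
Hypothesis csym : forall i j, c i j = c j i.
Hypothesis cirr : forall i, c i i = false.
Implicit Types (G : {ffun I -> nat} -> R) (v : {ffun I -> nat}) (i j : I).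

Local Notation EK := (EK P K).
Local Notation Nt := (Nt m).

Let C i j : R := (c i j)%:R.

Let CS i j : C i j = C j i. Proof. by rewrite /C csym. Qed.
Let C0 i : C i i = 0. Proof. by rewrite /C cirr. Qed.
Let Cge0 i j : 0 <= C i j. Proof. by rewrite /C. Qed.
Let Cid i j : C i j * C i j = C i j. Proof. by rewrite /C; case: (c i j); rewrite ?mulr1 ?mulr0. Qed.
Let m0 i : 0 <= m i. Proof. exact: (pfam_ge0 pK). Qed.

Definition wdeg i : R := \sum_j (c i j)%:R * m j.

Definition wmom (r : nat) : R := \sum_i m i * wdeg i ^+ r.

(** The factor 2 collects the two positions of the free vertex in an ordered pair; see
    [edge_count_decomposition]. *)
Definition U1 : {ffun I -> nat} -> R := chaos1 m (fun i => 2 * wdeg i).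

Definition U2 : {ffun I -> nat} -> R := chaos2 m (fun i j => (c i j)%:R).

Let a := wdeg.
(** [Y i] is the centred number of points adjacent to cell [i], that is, half of the change of [U2]
    when a point is added there. Below, [b i] weights the two-step walks from [i]. *)
Let Y i v : R := \sum_j C i j * Nt j v.
Let b i : R := \sum_j C i j * m j * a j.

Let a0 i : 0 <= a i. Proof. by apply: sumr_ge0 => j _; rewrite mulr_ge0. Qed.
Let b0 i : 0 <= b i. Proof. by apply: sumr_ge0 => j _; rewrite !mulr_ge0. Qed.

Lemma wmom_ge0 r : 0 <= wmom r.
Proof. by apply: sumr_ge0 => i _; rewrite mulr_ge0// exprn_ge0. Qed.

Let sum_mb : \sum_i m i * b i = wmom 2.
Proof.
under eq_bigr do rewrite mulr_sumr.
rewrite exchange_big; apply: eq_bigr => j _ /=.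
rewrite expr2 -/(a j) [X in _ = _ * (X * _)]/a /wdeg mulr_suml mulr_sumr.
by apply: eq_bigr => i _; rewrite -/(C _ _) (CS j i); ring.
Qed.

(** The left side weights walks [i - j] by [a i * a j]. As the edge weights [m i * C i j * m j] are
    symmetric, [a i * a j <= (a i ^ 2 + a j ^ 2) / 2] bounds it by the third moment. *)
Let sum_mab : \sum_i m i * (a i * b i) <= wmom 3.
Proof.
have e1 : \sum_i \sum_j (m i * C i j * m j) * a i ^+ 2 = wmom 3.
  apply: eq_bigr => i _; rewrite exprS -/(a i) [X in _ = _ * (X * _)]/a /wdeg mulr_suml mulr_sumr.
  by apply: eq_bigr => j _; rewrite -/(C _ _); ring.
have e2 : \sum_i \sum_j (m i * C i j * m j) * a j ^+ 2 = wmom 3.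
  by rewrite -e1 exchange_big; apply: eq_bigr => i _; apply: eq_bigr => j _; rewrite CS; ring.
suff : \sum_i m i * (a i * b i) <= 2^-1 * (wmom 3 + wmom 3) by lra.
rewrite -{1}e1 -e2 -big_split/= mulr_sumr; apply: ler_sum => i _.
rewrite (_ : m i * (a i * b i) = \sum_j (m i * C i j * m j) * (a i * a j)); last first.
  by rewrite mulrA /b mulr_sumr; apply: eq_bigr => j _; ring.
rewrite -big_split/= mulr_sumr.
apply: ler_sum => j _.
have w0 : 0 <= m i * C i j * m j by rewrite !mulr_ge0.
have := sqr_ge0 (a i - a j); set w := _ * m j in w0 *; nra.
Qed.

Let pgNt i : pg (Nt i). Proof. exact: pg_Nt. Qed.

Let pgY i : pg (Y i). Proof. by apply: pg_sum => j _; exact: pg_Z. Qed.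

Let pgU1 : pg U1. Proof. exact: pg_chaos1. Qed.
Let pgU2 : pg U2. Proof. exact: pg_chaos2. Qed.

Let Y_incr i j v : Y j (incr i v) = Y j v + C j i.
Proof.
rewrite /Y; under eq_bigr do rewrite Nt_incr mulrDr.
rewrite big_split/=; congr (_ + _); rewrite (bigD1 i)//= eqxx mulr1 big1 ?addr0//.
by move=> k /negbTE ->; rewrite mulr0.
Qed.

Let U1_incr i v : U1 (incr i v) = U1 v + 2 * a i.
Proof.
rewrite /U1 /chaos1; under eq_bigr do rewrite Nt_incr mulrDr.
rewrite big_split/=; congr (_ + _); rewrite (bigD1 i)//= eqxx mulr1 big1 ?addr0//.
by move=> k /negbTE ->; rewrite mulr0.
Qed.

Let U2E v : U2 v = \sum_i Nt i v * Y i v.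
Proof.
apply: eq_bigr => i _; rewrite mulr_sumr; apply: eq_bigr => j _.
by rewrite -/(C i j); ring.
Qed.

Let U2_incr i v : U2 (incr i v) = U2 v + 2 * Y i v.
Proof.
rewrite !U2E (eq_bigr (fun j => Nt j v * Y j v + ((j == i)%:R * Y j v +
  (Nt j v * C j i + (j == i)%:R * C j i)))) => [|j _]; last first.
  by rewrite Nt_incr Y_incr; ring.
rewrite !big_split/=; congr (_ + _).
have h1 : \sum_j (j == i)%:R * Y j v = Y i v.
  rewrite (bigD1 i)//= eqxx mul1r big1 ?addr0//.
  by move=> k /negbTE ->; rewrite mul0r.
have h2 : \sum_j Nt j v * C j i = Y i v.
  by apply: eq_bigr => j _; rewrite CS mulrC.
have h3 : \sum_j (j == i)%:R * C j i = 0.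
  rewrite (bigD1 i)//= C0 mulr0 big1 ?addr0//.
  by move=> k /negbTE ->; rewrite mul0r.
by rewrite h1 h2 h3; ring.
Qed.

Let mecke_Y i G : pg G ->
  EK (fun v => Y i v * G v) = \sum_j C i j * m j * EK (fun v => G (incr j v) - G v).
Proof.
move=> hG; rewrite (_ : EK _ = EK (fun v => \sum_j C i j * (Nt j v * G v))); last first.
  by apply: eq_EK => v; rewrite mulr_suml; apply: eq_bigr => j _; rewrite mulrA.
have p1 j : pg (fun v => Nt j v * G v) by apply: pg_M.
rewrite (EK_sum pK) => [|j _]; last exact: pg_Z.
by apply: eq_bigr => j _; rewrite (EK_Z pK)// (mecke pK)// mulrA.
Qed.

Let EK_Y i : EK (Y i) = 0.
Proof.
rewrite (EK_sum pK) => [|j _]; last exact: pg_Z.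
by rewrite big1// => j _; rewrite (EK_Z pK)// (EK_Nt pK) mulr0.
Qed.

Let EK_Y2 i : EK (fun v => Y i v ^+ 2) = a i.
Proof.
rewrite (_ : EK _ = EK (fun v => Y i v * Y i v)); last by apply: eq_EK => v; rewrite expr2.
rewrite mecke_Y//; apply: eq_bigr => j _.
rewrite (_ : EK _ = EK (fun=> C i j)); last by apply: eq_EK => v; rewrite Y_incr; ring.
by rewrite EK_cst mulrAC Cid.
Qed.

(** Since [C] takes the values 0 and 1, [Y i] is a centred Poisson variable of parameter [a i], with
    fourth central moment [3 a^2 + a]. The recursion through the Mecke formula yields the same
    value. *)
Let EK_Y4 i : EK (fun v => Y i v ^+ 4) = 3 * a i ^+ 2 + a i.
Proof.
rewrite (_ : EK _ = EK (fun v => Y i v * Y i v ^+ 3)); last by apply: eq_EK => v; rewrite -exprS.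
rewrite mecke_Y; last exact: pg_X.
rewrite (_ : 3 * _ + _ = \sum_j C i j * m j * (3 * a i + 1)); last first.
  by rewrite -mulr_suml (_ : \sum_j C i j * m j = a i)//; ring.
apply: eq_bigr => j _.
rewrite (_ : EK _ = EK (fun v => C i j * (3 * Y i v ^+ 2 + (3 * C i j * Y i v + C i j ^+ 2)))); last first.
  by apply: eq_EK => v; rewrite Y_incr; ring.
have p2 : pg (fun v => 3 * Y i v ^+ 2) by apply: pg_Z; exact: pg_X.
have p1 : pg (fun v => 3 * C i j * Y i v) by apply: pg_Z.
have pc : pg (fun _ : {ffun I -> nat} => C i j ^+ 2) by exact: pg_cst.
rewrite (EK_Z pK (C i j) (pg_D p2 (pg_D p1 pc))) (EK_D pK p2 (pg_D p1 pc)) (EK_D pK p1 pc).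
rewrite (EK_Z pK 3 (pg_X 2 (pgY i))) (EK_Z pK _ (pgY i)) EK_Y EK_Y2 EK_cst mulr0 add0r.
by rewrite expr2 Cid; rewrite /C; case: (c i j) => /=; ring.
Qed.

Let EK_poly4 i (c0 c2 c4 : R) :
  EK (fun v => c0 + c2 * Y i v ^+ 2 + c4 * Y i v ^+ 4) =
  c0 + c2 * a i + c4 * (3 * a i ^+ 2 + a i).
Proof.
have p2 := pg_X 2 (pgY i); have p4 := pg_X 4 (pgY i); have pc := @pg_cst R I c0.
rewrite (EK_D pK (pg_D pc (pg_Z c2 p2)) (pg_Z c4 p4)) (EK_D pK pc (pg_Z c2 p2)).
by rewrite (EK_Z pK _ p2) (EK_Z pK _ p4) EK_cst EK_Y2 EK_Y4.
Qed.

Let EK_poly2 i j (c0 c1 c2 : R) :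
  EK (fun v => c0 + c1 * Y i v ^+ 2 + c2 * Y j v ^+ 2) = c0 + c1 * a i + c2 * a j.
Proof.
have p1 := pg_X 2 (pgY i); have p2 := pg_X 2 (pgY j); have pc := @pg_cst R I c0.
rewrite (EK_D pK (pg_D pc (pg_Z c1 p1)) (pg_Z c2 p2)) (EK_D pK pc (pg_Z c1 p1)).
by rewrite (EK_Z pK _ p1) (EK_Z pK _ p2) EK_cst !EK_Y2.
Qed.

Let pg_poly4 i (c0 c2 c4 : R) : pg (fun v => c0 + c2 * Y i v ^+ 2 + c4 * Y i v ^+ 4).
Proof.
have p2 := pg_X 2 (pgY i); have p4 := pg_X 4 (pgY i); have pc := @pg_cst R I c0.
exact: (pg_D (pg_D pc (pg_Z c2 p2)) (pg_Z c4 p4)).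
Qed.

Let pg_poly2 i j (c0 c1 c2 : R) : pg (fun v => c0 + c1 * Y i v ^+ 2 + c2 * Y j v ^+ 2).
Proof.
have p1 := pg_X 2 (pgY i); have p2 := pg_X 2 (pgY j); have pc := @pg_cst R I c0.
exact: (pg_D (pg_D pc (pg_Z c1 p1)) (pg_Z c2 p2)).
Qed.

Lemma EK_U1 : EK U1 = 0. Proof. exact: EK_chaos1 pK _. Qed.

Lemma EK_U2 : EK U2 = 0. Proof. exact: EK_chaos2 pK _ C0. Qed.

Lemma EK_U12 : EK (fun v => U1 v * U2 v) = 0.
Proof. exact: EK_chaos12 pK _ _ C0. Qed.

Lemma EK_U1_sq : EK (fun v => U1 v ^+ 2) = 4 * wmom 2.
Proof.
rewrite (EK_chaos1_sq pK) mulr_sumr; apply: eq_bigr => i _.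
by rewrite -/(a i); ring.
Qed.

Lemma EK_U2_sq : EK (fun v => U2 v ^+ 2) = 2 * wmom 1.
Proof.
rewrite (EK_chaos2_sq pK C0) mulr_sumr; apply: eq_bigr => i _.
rewrite expr1 /wdeg !mulr_sumr; apply: eq_bigr => j _.
by rewrite -/(C i j) -/(C j i) (CS j i) expr2 Cid; ring.
Qed.

Lemma edge_count_decomposition v :
  \sum_i \sum_j (c i j)%:R * ((v i)%:R * (v j)%:R) = wmom 1 + U1 v + U2 v.
Proof.
have e1 : U1 v = \sum_i \sum_j C i j * (m j * Nt i v) + \sum_i \sum_j C i j * (m i * Nt j v).
  rewrite [X in _ = _ + X]exchange_big/= -big_split/=; apply: eq_bigr => i _.
  rewrite -/(a i) /a /wdeg mulr_sumr mulr_suml -big_split/=; apply: eq_bigr => j _.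
  by rewrite -/(C i j) (CS j i); ring.
have e0 : wmom 1 = \sum_i \sum_j C i j * (m i * m j).
  apply: eq_bigr => i _; rewrite expr1 /wdeg mulr_sumr; apply: eq_bigr => j _.
  by rewrite -/(C i j); ring.
rewrite e0 e1 /U2 /chaos2 -!big_split/=; apply: eq_bigr => i _.
rewrite -!big_split/=; apply: eq_bigr => j _.
by rewrite -/(C i j) /Nt; ring.
Qed.

(* A first order chaos in which each summand is paired with a functional whose
   differences are small is itself small. *)
Let EK_Y_small i G (L : R) : 0 <= L -> pg G ->
  (forall j v, `|G (incr j v) - G v| <= L * (a j + `|Y j v|)) ->
  `|EK (fun v => Y i v * G v)| <= L * (2^-1 * a i + 3/2 * b i).
Proof.
move=> L0 hG hD; rewrite mecke_Y//.
apply: le_trans (ler_norm_sum _ _ _) _.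
rewrite [L * _](_ : _ = \sum_j C i j * m j * (L * (2^-1 + 3/2 * a j))); last first.
  rewrite /b mulrDr /a /wdeg !mulr_sumr -big_split/=; apply: eq_bigr => j _.
  by rewrite -/(C i j) -/(wdeg j) -/(a j); ring.
apply: ler_sum => j _; rewrite normrM (ger0_norm (mulr_ge0 (Cge0 i j) (m0 j))).
rewrite ler_wpM2l// ?mulr_ge0//.
have hDp : pg (fun v => G (incr j v) - G v) by apply: pg_B => //; exact: pg_incr.
apply: le_trans (EK_abs_le pK hDp (pg_poly2 j j (L * (2^-1 + a j)) (L * 2^-1) 0) _) _; last first.
  by rewrite EK_poly2; lra.
move=> v; apply: le_trans (hD j v) _.
have e : Y j v ^+ 2 = `|Y j v| ^+ 2 by rewrite real_normK// num_real.
rewrite e mul0r addr0; have := sqr_ge0 (`|Y j v| - 1); nra.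
Qed.

(** * Stein's method for a linear combination of the two chaoses *)

Section univariate.
Variables (al be ga M : R) (f f' : R -> R).
Hypotheses (al_le : `|al| <= ga) (be_le : `|be| <= ga) (hf : C11 M f f').

Let X v := al * U1 v + be * U2 v.
Let M0 : 0 <= M. Proof. exact: C11_ge0 hf. Qed.
Let ga0 : 0 <= ga. Proof. exact: le_trans al_le. Qed.
Let De i v := 2 * al * a i + 2 * be * Y i v.
(** While [De i] is the add-one cost of [X], [w i] is that of minus the inverse Ornstein-Uhlenbeck
    generator applied to [X]: the second chaos enters with half its weight. This makes
    [X = \sum_i Nt i * w i]. *)
Let w i v := 2 * al * a i + be * Y i v.

Let X_incr i v : X (incr i v) = X v + De i v.
Proof. by rewrite /X U1_incr U2_incr /De; ring. Qed.

Let pgw i : pg (w i). Proof. by apply: pg_D; [exact: pg_cst|exact: pg_Z]. Qed.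

Let pgf : pg (fun v => f (X v)). Proof. exact: pg_bounded (C11_bound hf). Qed.

Let pgf' : pg (fun v => f' (X v)). Proof. exact: pg_bounded (C11_dbound hf). Qed.

(** The Mecke formula applied to each [Nt i] in [X = \sum_i Nt i * w i]; without loops, [w i] does
    not see a point added in cell [i] and factors out of the increment. *)
Let ustep1 : EK (fun v => X v * f (X v)) =
  \sum_i m i * EK (fun v => w i v * (f (X (incr i v)) - f (X v))).
Proof.
rewrite (_ : EK _ = EK (fun v => \sum_i Nt i v * (w i v * f (X v)))); last first.
  apply: eq_EK => v; rewrite {1}/X U2E /U1 /chaos1 !mulr_sumr -big_split/= mulr_suml.
  by apply: eq_bigr => i _; rewrite /w -/(a i); ring.
have p1 i : pg (fun v => w i v * f (X v)) by exact: pg_M.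
rewrite (EK_sum pK) => [|i _]; last exact: pg_M.
apply: eq_bigr => i _; rewrite (mecke pK)//; congr (_ * _); apply: eq_EK => v.
by rewrite {1}/w Y_incr C0 addr0 -/(w i v) mulrBr.
Qed.

Let absDe i v : `|De i v| <= 2 * ga * (a i + `|Y i v|).
Proof.
rewrite /De (le_trans (ler_normD _ _))// mulrDr lerD//.
  by rewrite !normrM (ger0_norm (a0 i)) ger0_norm// ler_wpM2r// ler_wpM2l.
by rewrite !normrM (ger0_norm (ler0n _ 2)) ler_wpM2r// ler_wpM2l.
Qed.

Let absw i v : `|w i v| <= 2 * ga * (a i + `|Y i v|).
Proof.
rewrite /w (le_trans (ler_normD _ _))// mulrDr lerD//.
  by rewrite !normrM (ger0_norm (a0 i)) ger0_norm// ler_wpM2r// ler_wpM2l.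
by rewrite normrM ler_wpM2r//; move: be_le ga0; lra.
Qed.

(** First-order Taylor expansion of [f]: the three subtracted terms are the expansion of
    [w i * De i], and the remainder is at most [M |w i| (De i)^2], bounded in mean through the
    second and fourth moments of [Y i]. *)
Let ustep2 i :
  `|EK (fun v => w i v * (f (X (incr i v)) - f (X v))) -
    (4 * al ^+ 2 * a i ^+ 2 * EK (fun v => f' (X v)) +
     6 * al * be * a i * EK (fun v => Y i v * f' (X v)) +
     2 * be ^+ 2 * EK (fun v => Y i v ^+ 2 * f' (X v)))|
  <= M * ga ^+ 3 * (32 * a i ^+ 3 + 32 * a i + 48 * a i ^+ 2).
Proof.
have pYf := pg_M (pgY i) pgf'; have pYYf := pg_M (pg_X 2 (pgY i)) pgf'.
have pfi : pg (fun v => f (X (incr i v))) by exact: pg_bounded (C11_bound hf).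
have pL := pg_M (pgw i) (pg_B pfi pgf).
have p12 := pg_D (pg_Z (4 * al ^+ 2 * a i ^+ 2) pgf') (pg_Z (6 * al * be * a i) pYf).
have p123 := pg_D p12 (pg_Z (2 * be ^+ 2) pYYf).
rewrite -(EK_Z pK _ pgf') -(EK_Z pK _ pYf) -(EK_Z pK _ pYYf).
rewrite -(EK_D pK (pg_Z (4 * al ^+ 2 * a i ^+ 2) pgf') (pg_Z (6 * al * be * a i) pYf)).
rewrite -(EK_D pK p12 (pg_Z (2 * be ^+ 2) pYYf)) -(EK_B pK pL p123).
apply: le_trans (EK_abs_le pK (pg_B pL p123)
  (pg_poly4 i (M * ga ^+ 3 * (32 * a i ^+ 3)) (M * ga ^+ 3 * 16) (M * ga ^+ 3 * 16)) _) _; last first.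
  by rewrite EK_poly4; lra.
move=> v; rewrite X_incr.
rewrite (_ : _ - _ = w i v * (f (X v + De i v) - f (X v) - (X v + De i v - X v) * f' (X v))); last first.
  by rewrite /w /De; ring.
rewrite normrM.
have ht := C11_taylor hf (X v) (X v + De i v).
have e2 : Y i v ^+ 2 = `|Y i v| ^+ 2 by rewrite real_normK// num_real.
have e4 : Y i v ^+ 4 = `|Y i v| ^+ 4 by rewrite -[4%N]/(2 * 2)%N exprM e2 -exprM.
rewrite e2 e4; set y := `|Y i v|; have y0 : 0 <= y by exact: normr_ge0.
have hD : (X v + De i v - X v) ^+ 2 <= (2 * ga * (a i + y)) ^+ 2.
  rewrite addrAC subrr add0r -(real_normK (num_real (De i v))).
  by rewrite lerXn2r ?nnegrE// ?mulr_ge0 ?addr_ge0// absDe.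
apply: (@le_trans _ _ ((2 * ga * (a i + y)) * (M * (2 * ga * (a i + y)) ^+ 2))).
  by rewrite ler_pM ?absw//; apply: (le_trans ht); rewrite ler_wpM2l.
have Mg : 0 <= M * ga ^+ 3 by rewrite mulr_ge0 ?exprn_ge0.
rewrite (_ : _ * (M * _) = M * ga ^+ 3 * (8 * (a i + y) ^+ 3)); last by ring.
rewrite [leRHS](_ : _ = M * ga ^+ 3 * (32 * a i ^+ 3 + 16 * y ^+ 2 + 16 * y ^+ 4)); last by ring.
rewrite ler_wpM2l//.
(* These two squares say [(a + y)^3 <= 4 (a^3 + y^3)] and [2 y^3 <= y^2 + y^4], which avoids a third
   absolute moment. *)
have h1 : 0 <= (a i + y) * (a i - y) ^+ 2 by rewrite mulr_ge0 ?sqr_ge0 ?addr_ge0.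
have h2 : 0 <= (y * (y - 1)) ^+ 2 by rewrite sqr_ge0.
nra.
Qed.

Let Df' j v : `|f' (X (incr j v)) - f' (X v)| <= 2 * M * ga * (a j + `|Y j v|).
Proof.
apply: le_trans (C11_dlip hf _ _) _; rewrite X_incr addrAC subrr add0r.
rewrite (_ : 2 * M * ga * _ = M * (2 * ga * (a j + `|Y j v|))); last by ring.
by rewrite ler_wpM2l.
Qed.

Let ustep3 i : `|EK (fun v => Y i v * f' (X v))| <= M * ga * (a i + 3 * b i).
Proof.
have L0 : 0 <= 2 * M * ga by rewrite !mulr_ge0.
by apply: le_trans (EK_Y_small i L0 pgf' Df') _; lra.
Qed.

(** A second integration by parts on one factor [Y i]. Adding a point in an adjacent cell [j] raises
    [Y i] by 1, which produces [f'(X)] and sums up to [a i]; what is left is [(Y i + 1)] times an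
    increment of [f']. *)
Let ustep4 i : `|EK (fun v => Y i v ^+ 2 * f' (X v)) - a i * EK (fun v => f' (X v))| <=
  M * ga * (a i + a i ^+ 2 + 5 * b i + a i * b i).
Proof.
have pYf := pg_M (pgY i) pgf'.
rewrite (_ : EK (fun v => Y i v ^+ 2 * _) = EK (fun v => Y i v * (Y i v * f' (X v)))); last first.
  by apply: eq_EK => v; rewrite mulrA expr2.
rewrite mecke_Y// [a i in X in _ - X]/a /wdeg mulr_suml -sumrB.
apply: le_trans (ler_norm_sum _ _ _) _.
rewrite [leRHS](_ : _ = \sum_j C i j * m j *
    (2 * M * ga * (2^-1 + 2^-1 * a i + 5/2 * a j + 2^-1 * (a i * a j)))); last first.
  have aE : \sum_j C i j * m j = a i by [].
  transitivity (M * ga * (1 + a i) * (\sum_j C i j * m j) + M * ga * (5 + a i) * b i).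
    by rewrite aE; ring.
  rewrite /b [X in X + _]mulr_sumr [X in _ + X]mulr_sumr -big_split/=; apply: eq_bigr => j _.
  by move: (a i) (a j) (C i j) (m j) => x y z t; field.
apply: ler_sum => j _; rewrite -/(C i j) -mulrBr normrM (ger0_norm (mulr_ge0 (Cge0 i j) (m0 j))).
have [cij|cij] := boolP (c i j); last by rewrite /C (negbTE cij) !mul0r.
rewrite ler_wpM2l// ?mulr_ge0//.
have pi : pg (fun v => Y i (incr j v) * f' (X (incr j v))) by exact: (pg_incr j pYf).
rewrite -(EK_B pK (pg_B pi pYf) pgf').
apply: le_trans (EK_abs_le pK (pg_B (pg_B pi pYf) pgf')
  (pg_poly2 i j (2 * M * ga * (a j * 2^-1 + a j + 2^-1)) (2 * M * ga * (a j * 2^-1 + 2^-1)) (2 * M * ga)) _) _; last first.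
  by rewrite EK_poly2; lra.
move=> v; rewrite Y_incr /C cij/=.
rewrite (_ : _ - _ = (Y i v + 1) * (f' (X (incr j v)) - f' (X v))); last by ring.
rewrite normrM.
have ei : Y i v ^+ 2 = `|Y i v| ^+ 2 by rewrite real_normK// num_real.
have ej : Y j v ^+ 2 = `|Y j v| ^+ 2 by rewrite real_normK// num_real.
rewrite ei ej; have hD := Df' j v.
have hn : `|Y i v + 1| <= `|Y i v| + 1 by rewrite (le_trans (ler_normD _ _))// normr1.
apply: le_trans (ler_pM _ _ hn hD) _ => //.
set y := `|Y i v|; set z := `|Y j v|.
have y0 : 0 <= y by exact: normr_ge0. have z0 : 0 <= z by exact: normr_ge0.
have L0 : 0 <= 2 * M * ga by rewrite !mulr_ge0.
rewrite mulrCA [leRHS](_ : _ = 2 * M * ga * (a j / 2 + a j + 2^-1 + (a j / 2 + 2^-1) * y ^+ 2 + z ^+ 2)); last by ring.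
rewrite ler_wpM2l//.
have := mulr_ge0 (a0 j) (sqr_ge0 (y - 1)); have := sqr_ge0 (z - 1); have := sqr_ge0 (y - z).
nra.
Qed.

(** The leading parts of [ustep2] and [ustep4] add up to the variance of [X] times the mean of
    [f'(X)]; everything else is cubic in [ga]. *)
Lemma stein_univariate :
  `|EK (fun v => X v * f (X v)) -
    (4 * al ^+ 2 * wmom 2 + 2 * be ^+ 2 * wmom 1) * EK (fun v => f' (X v))|
  <= 100 * M * ga ^+ 3 * (wmom 1 + wmom 2 + wmom 3).
Proof.
have s2 := ustep2; have s4 := ustep4.
set E' := EK (fun v => f' (X v)) in s2 s4 *.
rewrite (_ : (4 * al ^+ 2 * _ + _) * E' = \sum_i m i *
   (4 * al ^+ 2 * a i ^+ 2 * E' + 2 * be ^+ 2 * (a i * E'))); last first.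
  rewrite mulrDl /wmom !mulr_sumr !mulr_suml -big_split/=.
  by apply: eq_bigr => i _; rewrite -/(a i); ring.
rewrite ustep1 -sumrB; apply: le_trans (ler_norm_sum _ _ _) _.
(* Summed over [i] with the bounds on [b], this is at most [34 m_1 + 66 m_2 + 52 m_3] up to the
   factor [M ga^3], hence the constant 100. *)
pose err i := M * ga ^+ 3 * (m i * (34 * a i ^+ 1 + 56 * a i ^+ 2 + 32 * a i ^+ 3)) +
   M * ga ^+ 3 * 10 * (m i * b i)
   + M * ga ^+ 3 * 20 * (m i * (a i * b i)).
apply: (@le_trans _ _ (\sum_i err i)).
  apply: ler_sum => i _; rewrite -mulrBr normrM (ger0_norm (m0 i)).
  rewrite (_ : err i = m i * (M * ga ^+ 3 * (32 * a i ^+ 3 + 32 * a i + 48 * a i ^+ 2)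
    + 6 * ga ^+ 2 * a i * (M * ga * (a i + 3 * b i))
    + 2 * ga ^+ 2 * (M * ga * (a i + a i ^+ 2 + 5 * b i + a i * b i)))); last first.
    by rewrite /err; ring.
  rewrite ler_wpM2l//.
  set A := EK (fun v => w i v * _); set B := 4 * al ^+ 2 * _ * _.
  set y1 := EK (fun v => Y i v * f' (X v)).
  set y2 := EK (fun v => Y i v ^+ 2 * f' (X v)).
  rewrite (_ : _ - _ = A - (B + 6 * al * be * a i * y1 + 2 * be ^+ 2 * y2)
    + 6 * al * be * a i * y1 + 2 * be ^+ 2 * (y2 - a i * E')); last by ring.
  apply: le_trans (ler_normD _ _) _; apply: lerD.
    apply: le_trans (ler_normD _ _) _; apply: lerD; first exact: s2.
    rewrite !normrM (ger0_norm (a0 i)) (ger0_norm (ler0n _ 6)).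
    apply: ler_pM; rewrite ?mulr_ge0//; last exact: ustep3.
    by rewrite ler_wpM2r// -mulrA ler_wpM2l// expr2 ler_pM.
  rewrite normrM; apply: ler_pM => //; last exact: s4.
  rewrite normrM (ger0_norm (ler0n _ 2)) ler_wpM2l// normrX.
  by rewrite lerXn2r ?nnegrE.
rewrite /err !big_split/= -!mulr_sumr sum_mb.
rewrite (_ : \sum_i m i * (34 * _ + _ + _) = 34 * wmom 1 + 56 * wmom 2 + 32 * wmom 3); last first.
  rewrite /wmom !mulr_sumr -!big_split/=; apply: eq_bigr => i _.
  by rewrite -/(a i); ring.
rewrite -/(wmom 2).
have Mg : 0 <= M * ga ^+ 3 by rewrite mulr_ge0 ?exprn_ge0.
have := ler_wpM2l Mg sum_mab.
have := mulr_ge0 Mg (wmom_ge0 1); have := mulr_ge0 Mg (wmom_ge0 2).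
have := mulr_ge0 Mg (wmom_ge0 3).
set S := \sum_i _; lra.
Qed.

End univariate.

(** * Stein's method in the first chaos with a weight in the second *)

Section bivariate.
Variables (al be ga M : R) (f f' g g' : R -> R).
Hypotheses (al_le : `|al| <= ga) (be_le : `|be| <= ga).
Hypotheses (hf : C11 M f f') (hg : C11 M g g').

Let X1 v := al * U1 v.
Let X2 v := be * U2 v.
Let M0 : 0 <= M. Proof. exact: C11_ge0 hf. Qed.
Let ga0 : 0 <= ga. Proof. exact: le_trans al_le. Qed.
Let d1 i := 2 * al * a i.
Let d2 i v := 2 * be * Y i v.

Let X1_incr i v : X1 (incr i v) = X1 v + d1 i.
Proof. by rewrite /X1 U1_incr /d1; ring. Qed.

Let X2_incr i v : X2 (incr i v) = X2 v + d2 i v.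
Proof. by rewrite /X2 U2_incr /d2; ring. Qed.

Let absd1 i : `|d1 i| <= 2 * ga * a i.
Proof. by rewrite !normrM (ger0_norm (a0 i)) (ger0_norm (ler0n _ 2)) ler_wpM2r// ler_wpM2l. Qed.

Let absd2 i v : `|d2 i v| <= 2 * ga * `|Y i v|.
Proof. by rewrite !normrM (ger0_norm (ler0n _ 2)) ler_wpM2r// ler_wpM2l. Qed.

Let pgf : pg (fun v => f (X1 v)). Proof. exact: pg_bounded (C11_bound hf). Qed.
Let pgf' : pg (fun v => f' (X1 v)). Proof. exact: pg_bounded (C11_dbound hf). Qed.
Let pgg : pg (fun v => g (X2 v)). Proof. exact: pg_bounded (C11_bound hg). Qed.
Let pgg' : pg (fun v => g' (X2 v)). Proof. exact: pg_bounded (C11_dbound hg). Qed.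
Let pgfg := pg_M pgf pgg.
Let pgf'g := pg_M pgf' pgg.
Let pgfg' := pg_M pgf pgg'.

Let bstep1 : EK (fun v => X1 v * f (X1 v) * g (X2 v)) =
  \sum_i m i * (2 * al * a i *
    EK (fun v => f (X1 (incr i v)) * g (X2 (incr i v)) - f (X1 v) * g (X2 v))).
Proof.
rewrite (_ : EK _ = EK (fun v => \sum_i (2 * al * a i) * (Nt i v * (f (X1 v) * g (X2 v))))); last first.
  apply: eq_EK => v; rewrite {1}/X1 /U1 /chaos1 mulr_sumr !mulr_suml.
  by apply: eq_bigr => i _; rewrite -/(a i); ring.
have p1 i := pg_M (pgNt i) pgfg.
rewrite (EK_sum pK) => [|i _]; last exact: (pg_Z _ (p1 i)).
by apply: eq_bigr => i _; rewrite (EK_Z pK _ (p1 i)) (mecke pK _ pgfg); ring.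
Qed.

(** Discrete product rule: the increment of [f * g] is the sum of its two linear parts, two Taylor
    remainders and one product of increments, and the last three are quadratic in the add-one
    costs. *)
Let bstep2 i :
  `|EK (fun v => f (X1 (incr i v)) * g (X2 (incr i v)) - f (X1 v) * g (X2 v)) -
    (2 * al * a i * EK (fun v => f' (X1 v) * g (X2 v)) +
     2 * be * EK (fun v => Y i v * (f (X1 v) * g' (X2 v))))|
  <= M ^+ 2 * ga ^+ 2 * (6 * a i ^+ 2 + 6 * a i).
Proof.
have pYf := pg_M (pgY i) pgfg'.
have pL := pg_B (pg_incr i pgfg) pgfg.
have p12 := pg_D (pg_Z (2 * al * a i) pgf'g) (pg_Z (2 * be) pYf).
rewrite -(EK_Z pK _ pgf'g) -(EK_Z pK _ pYf).
rewrite -(EK_D pK (pg_Z (2 * al * a i) pgf'g) (pg_Z (2 * be) pYf)) -(EK_B pK pL p12).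
apply: le_trans (EK_abs_le pK (pg_B pL p12)
  (pg_poly2 i i (M ^+ 2 * ga ^+ 2 * (4 * a i ^+ 2 + 2 * a i)) (M ^+ 2 * ga ^+ 2 * (2 * a i + 4)) 0) _) _; last first.
  by rewrite EK_poly2; lra.
move=> v; rewrite X1_incr X2_incr.
have tf := C11_taylor hf (X1 v) (X1 v + d1 i).
have tg := C11_taylor hg (X2 v) (X2 v + d2 i v).
have lf := C11_lip hf (X1 v + d1 i) (X1 v).
have lg := C11_lip hg (X2 v + d2 i v) (X2 v).
have e1 : X1 v + d1 i - X1 v = d1 i by ring.
have e2 : X2 v + d2 i v - X2 v = d2 i v by ring.
rewrite e1 in tf lf; rewrite e2 in tg lg.
have bf := C11_bound hf (X1 v); have bg := C11_bound hg (X2 v).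
set f1 := f (_ + _) in tf lf *; set f0 := f (X1 v) in tf lf bf *.
set g1 := g (_ + _) in tg lg *; set g0 := g (X2 v) in tg lg bg *.
set f0' := f' _ in tf *; set g0' := g' _ in tg *.
rewrite (_ : _ - _ = (f1 - f0 - d1 i * f0') * g0 + (f1 - f0) * (g1 - g0) + f0 * (g1 - g0 - d2 i v * g0')); last first.
  by rewrite /d1 /d2; ring.
have ei : Y i v ^+ 2 = `|Y i v| ^+ 2 by rewrite real_normK// num_real.
rewrite ei mul0r addr0.
have h1 := absd1 i; have h2 := absd2 i v.
set y := `|Y i v| in h2 *; have y0 : 0 <= y by exact: normr_ge0.
have q1 : d1 i ^+ 2 <= (2 * ga * a i) ^+ 2.
  by rewrite -(real_normK (num_real (d1 i))) lerXn2r ?nnegrE ?mulr_ge0.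
have q2 : d2 i v ^+ 2 <= (2 * ga * y) ^+ 2.
  by rewrite -(real_normK (num_real (d2 i v))) lerXn2r ?nnegrE ?mulr_ge0.
apply: (@le_trans _ _ (M * (2 * ga * a i) ^+ 2 * M + (M * (2 * ga * a i)) * (M * (2 * ga * y)) + M * (M * (2 * ga * y) ^+ 2))).
  apply: le_trans (ler_normD _ _) _; apply: lerD.
    apply: le_trans (ler_normD _ _) _; apply: lerD; rewrite normrM ler_pM//.
    - by apply: (le_trans tf); rewrite ler_wpM2l.
    - by apply: (le_trans lf); rewrite ler_wpM2l.
    - by apply: (le_trans lg); rewrite ler_wpM2l.
  by rewrite normrM ler_pM//; apply: (le_trans tg); rewrite ler_wpM2l.
have Mg : 0 <= M ^+ 2 * ga ^+ 2 by rewrite mulr_ge0 ?exprn_ge0.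
rewrite [leLHS](_ : _ = M ^+ 2 * ga ^+ 2 * (4 * a i ^+ 2 + 4 * (a i * y) + 4 * y ^+ 2)); last by ring.
rewrite [leRHS](_ : _ = M ^+ 2 * ga ^+ 2 * (4 * a i ^+ 2 + 2 * a i + (2 * a i + 4) * y ^+ 2)); last by ring.
rewrite ler_wpM2l//.
have := mulr_ge0 (a0 i) (sqr_ge0 (y - 1)); nra.
Qed.

Let Dfg j v : `|f (X1 (incr j v)) * g' (X2 (incr j v)) - f (X1 v) * g' (X2 v)| <=
  2 * M ^+ 2 * ga * (a j + `|Y j v|).
Proof.
rewrite X1_incr X2_incr.
have lf := C11_lip hf (X1 v + d1 j) (X1 v).
have lg := C11_dlip hg (X2 v + d2 j v) (X2 v).
have e1 : X1 v + d1 j - X1 v = d1 j by ring.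
have e2 : X2 v + d2 j v - X2 v = d2 j v by ring.
rewrite e1 in lf; rewrite e2 in lg.
have bf := C11_bound hf (X1 v); have bg := C11_dbound hg (X2 v + d2 j v).
set f1 := f (_ + _) in lf *; set f0 := f (X1 v) in lf bf *.
set g1 := g' (_ + _) in lg bg *; set g0 := g' (X2 v) in lg *.
rewrite (_ : _ - _ = (f1 - f0) * g1 + f0 * (g1 - g0)); last by ring.
apply: le_trans (ler_normD _ _) _.
rewrite [leRHS](_ : _ = (M * (2 * ga * a j)) * M + M * (M * (2 * ga * `|Y j v|))); last by ring.
apply: lerD; rewrite normrM ler_pM//.
  by apply: (le_trans lf); rewrite ler_wpM2l.
by apply: (le_trans lg); rewrite ler_wpM2l.
Qed.

(** The origin of asymptotic independence: the mixed term carries the centred factor [Y i], so one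
    more integration by parts gains a factor [ga]. *)
Let bstep3 i : `|EK (fun v => Y i v * (f (X1 v) * g' (X2 v)))| <= M ^+ 2 * ga * (a i + 3 * b i).
Proof.
have L0 : 0 <= 2 * M ^+ 2 * ga by rewrite !mulr_ge0 ?exprn_ge0.
by apply: le_trans (EK_Y_small i L0 pgfg' Dfg) _; lra.
Qed.

Lemma stein_bivariate :
  `|EK (fun v => X1 v * f (X1 v) * g (X2 v)) -
    4 * al ^+ 2 * wmom 2 * EK (fun v => f' (X1 v) * g (X2 v))|
  <= 100 * M ^+ 2 * ga ^+ 3 * (wmom 1 + wmom 2 + wmom 3).
Proof.
set E' := EK (fun v => f' _ * _).
rewrite (_ : 4 * al ^+ 2 * _ * E' = \sum_i m i *
   (2 * al * a i * (2 * al * a i * E'))); last first.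
  rewrite /wmom mulr_sumr mulr_suml.
  by apply: eq_bigr => i _; rewrite -/(a i); ring.
rewrite bstep1 -sumrB; apply: le_trans (ler_norm_sum _ _ _) _.
pose N := M ^+ 2 * ga ^+ 3.
pose err i := N * (m i * (16 * a i ^+ 2 + 12 * a i ^+ 3)) + N * 12 * (m i * (a i * b i)).
apply: (@le_trans _ _ (\sum_i err i)).
  apply: ler_sum => i _; rewrite -mulrBr normrM (ger0_norm (m0 i)).
  rewrite (_ : err i = m i * (2 * ga * a i * (M ^+ 2 * ga ^+ 2 * (6 * a i ^+ 2 + 6 * a i) +
     2 * ga * (M ^+ 2 * ga * (a i + 3 * b i))))); last first.
    by rewrite /err /N; ring.
  rewrite ler_wpM2l// -mulrBr normrM; apply: ler_pM => //; first exact: absd1.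
  set y1 := EK (fun v => Y i v * (f (X1 v) * g' (X2 v))).
  set A := EK _.
  rewrite (_ : _ - _ = A - (2 * al * a i * E' + 2 * be * y1) + 2 * be * y1); last by ring.
  apply: le_trans (ler_normD _ _) _; apply: lerD; first exact: bstep2.
  rewrite !normrM (ger0_norm (ler0n _ 2)) ler_pM//; last exact: bstep3.
  by rewrite ler_wpM2l.
rewrite /err big_split/= -!mulr_sumr.
rewrite (_ : \sum_i m i * (16 * _ + _) = 16 * wmom 2 + 12 * wmom 3); last first.
  rewrite /wmom !mulr_sumr -!big_split/=; apply: eq_bigr => i _.
  by rewrite -/(a i); ring.
have Mg : 0 <= N by rewrite /N mulr_ge0 ?exprn_ge0.
rewrite (_ : 100 * M ^+ 2 * ga ^+ 3 = 100 * N); last by rewrite /N; ring.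
have := ler_wpM2l Mg sum_mab.
have := mulr_ge0 Mg (wmom_ge0 1); have := mulr_ge0 Mg (wmom_ge0 2).
have := mulr_ge0 Mg (wmom_ge0 3).
set S := \sum_i _; lra.
Qed.

End bivariate.
End stein_poisson_graph.

(** * Stein's equation *)

Section standard_normal.
Import HBNNSimple.
Context (R : realType).
Local Notation mu := (@lebesgue_measure R).
Let phi : R -> R := normal_pdf 0 1.

Definition gaussian : probability (measurableTypeR R) R := normal_prob 0 1.

Let phiE x : phi x = normal_peak 1 * expR (- (x ^+ 2 / 2)).
Proof.
rewrite /phi normal_pdfE ?oner_neq0// /= /normal_fun subr0 expr1n.
by rewrite mulNr.
Qed.

Let mphi : measurable_fun setT phi. Proof. exact: measurable_normal_pdf. Qed.

Let phi0 x : 0 <= phi x. Proof. exact: normal_pdf_ge0. Qed.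

(** Comparison of simple functions below [f] with their integrals against the density. An inequality
    suffices, as it serves only to show that the second moment is finite. *)
Lemma integral_gaussian_le (f : R -> R) : measurable_fun setT f -> (forall x, 0 <= f x) ->
  (\int[gaussian]_x (f x)%:E <= \int[mu]_x (f x * phi x)%:E)%E.
Proof.
move=> mf f0; rewrite ge0_integralTE => [|x]; last by rewrite lee_fin.
apply: ge_ereal_sup => _ [s /= sf <-].
have s0 x : 0 <= s x by [].
have mfib r : measurable (s @^-1` [set r]) by exact: measurable_sfunP.
have step r : range s r -> (r%:E * gaussian (s @^-1` [set r]) =
    \int[mu]_x (r * \1_(s @^-1` [set r]) x * phi x)%:E)%E.
  move=> [x0 _ <-]; rewrite /gaussian/= /normal_prob -/phi.
  rewrite -ge0_integralZl_EFin//; last 2 first.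
  - by move=> x _; rewrite lee_fin.
  - by apply/measurable_EFinP; exact: measurable_funTS.
  rewrite [LHS]integral_mkcond; apply: eq_integral => x _.
  rewrite /patch indicE; case: ifPn => _; first by rewrite mulr1 EFinM.
  by rewrite mulr0 mul0r.
rewrite sintegralE (eq_fsbigr (fun r => \int[mu]_x (r * \1_(s @^-1` [set r]) x * phi x)%:E)%E); last first.
  by move=> r /set_mem; exact: step.
rewrite -ge0_integral_fsum//; last 2 first.
- move=> r; apply/measurable_EFinP/measurable_funM => //.
  by apply: measurable_funM => //; exact: measurable_indic.
- move=> r x _; rewrite lee_fin indicE; case: (boolP (_ \in _)) => [/set_mem/= <-|_].
    by rewrite mulr1 mulr_ge0.
  by rewrite mulr0 mul0r.
apply: ge0_le_integral => //.
- move=> x _; apply: fsume_ge0 => r _; rewrite lee_fin indicE.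
  case: (boolP (_ \in _)) => [/set_mem/= <-|_].
    by rewrite mulr1 mulr_ge0.
  by rewrite mulr0 mul0r.
- apply: emeasurable_fsum => // r; apply/measurable_EFinP/measurable_funM => //.
  by apply: measurable_funM => //; exact: measurable_indic.
- by apply/measurable_EFinP/measurable_funM.
- move=> x _; rewrite fsumEFin// lee_fin.
  rewrite -mulr_fsuml//.
  rewrite -(fimfunE s x) ler_wpM2r//.
  by have := sf x; rewrite lee_fin.
Qed.

Lemma L2_gaussian_id : L2 gaussian (fun x => x).
Proof.
split=> //; apply/integrableP; split; first by apply/measurable_EFinP/measurable_funX.
under eq_integral do rewrite /= ger0_norm ?sqr_ge0//.
apply: (le_lt_trans (integral_gaussian_le _ _)).
- exact: measurable_funX.
- by move=> x; exact: sqr_ge0.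
have two0 : (2 : R) != 0 by rewrite pnatr_eq0.
pose k : R := 4 * normal_peak 1 / normal_peak 2.
have k0 : 0 <= k by rewrite /k mulr_ge0 ?invr_ge0 ?mulr_ge0 ?normal_peak_ge0.
(* The exponent [x^2 / 2] is split as [x^2 / 8 + 3 x^2 / 8]: the first part is that of the normal
   density with standard deviation 2, the second absorbs the factor [x^2]. *)
have key x : x ^+ 2 * phi x <= k * normal_pdf 0 2 x.
  rewrite phiE normal_pdfE// /= /normal_fun subr0.
  rewrite [leRHS](_ : _ = 4 * normal_peak 1 * expR (- x ^+ 2 / (2 ^+ 2 *+ 2))); last first.
    by rewrite /k; field; rewrite gt_eqF// normal_peak_gt0.
  rewrite [leLHS](_ : _ = normal_peak 1 * (x ^+ 2 * expR (- (x ^+ 2 / 2)))); last by ring.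
  rewrite [leRHS](_ : _ = normal_peak 1 * (4 * expR (- x ^+ 2 / (2 ^+ 2 *+ 2)))); last by ring.
  rewrite ler_wpM2l ?normal_peak_ge0//.
  rewrite (_ : - (x ^+ 2 / 2) = - x ^+ 2 / (2 ^+ 2 *+ 2) + - (3/8 * x ^+ 2)); last first.
    by rewrite -mulr_natr; field.
  rewrite expRD mulrCA mulrC ler_wpM2r ?expR_ge0//.
  rewrite expRN ler_pdivrMr ?expR_gt0//.
  have := expR_ge1Dx (3/8 * x ^+ 2); have := sqr_ge0 x; lra.
apply: (@le_lt_trans _ _ (\int[mu]_x (k%:E * (normal_pdf 0 2 x)%:E))%E).
  apply: ge0_le_integral => //.
  - by move=> x _; rewrite lee_fin mulr_ge0// sqr_ge0.
  - by apply/measurable_EFinP/measurable_funM => //; exact: measurable_funX.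
  - by apply/measurable_funeM/measurable_EFinP; exact: measurable_normal_pdf.
  - by move=> x _; rewrite -EFinM lee_fin.
rewrite ge0_integralZl_EFin//; last 2 first.
- by move=> x _; rewrite lee_fin normal_pdf_ge0.
- by apply/measurable_EFinP; exact: measurable_normal_pdf.
by rewrite integral_normal_pdf mule1 ltry.
Qed.

Lemma lipschitz_continuous (h : R -> R) (M : R) :
  (forall x y, `|h x - h y| <= M * `|x - y|) -> continuous h.
Proof.
move=> hl x; apply/cvgrPdist_le => e e0.
have M1 : 0 < `|M| + 1 by rewrite ltr_wpDl.
near=> y; apply: (le_trans (hl x y)).
apply: (@le_trans _ _ ((`|M| + 1) * `|x - y|)).
  by rewrite ler_wpM2r// (le_trans (ler_norm _))// lerDl.
rewrite mulrC -ler_pdivlMr//.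
near: y; exists (e / (`|M| + 1)) => /=; first by rewrite divr_gt0.
by move=> z /= /ltW.
Unshelve. all: by end_near. Qed.

Lemma lipschitz1_measurable (h : R -> R) :
  (forall x y, `|h x - h y| <= `|x - y|) -> measurable_fun setT h.
Proof.
move=> hl; apply: continuous_measurable_fun.
by apply: (@lipschitz_continuous _ 1) => x y; rewrite mul1r.
Qed.

Lemma L1_lipschitz1 d (T : measurableType d) (P : probability T R) (X : T -> R) (h : R -> R) :
  (forall x y, `|h x - h y| <= `|x - y|) -> L1 P X -> L1 P (fun w => h (X w)).
Proof.
move=> hl hX; apply: (@L1_le _ T R P _ (fun w => `|h 0| + `|X w|)).
- exact: (measurableT_comp (lipschitz1_measurable hl) (L1_meas hX)).
- move=> w; have := hl (X w) 0; rewrite subr0; have := ler_normD (h (X w) - h 0) (h 0).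
  by rewrite subrK; lra.
- by apply: L1_D; [exact: L1_cst|exact: L1_abs].
Qed.

Let Phi (x : R) : R := EX gaussian (\1_(`]-oo, x]%classic)).

Let Phi_derive (x : R) : is_derive x 1 Phi (phi x).
Proof.
have PE y : Phi y = (\int[mu]_(t in [set` `]-oo, y]]) (phi t))%R.
  by rewrite /Phi /EX integral_indic//= setIT.
have xu : x < x + 1 by rewrite ltrDl.
have intf : mu.-integrable [set` `]-oo, (x + 1)]] (EFin \o phi).
  apply: (integrableS measurableT) => //; exact: integrable_normal_pdf.
have cf : {for x, continuous phi} by exact: continuous_normal_pdf.
have [] := continuous_FTC1 xu intf (ltNyr _) cf.
have -> : (fun y => (\int[mu]_(t in [set` `]-oo, y]]) (phi t))%R) = Phi by apply/funext => y; rewrite PE.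
move=> h1 h2; apply: DeriveDef; first exact: h1.
by rewrite -derive1E; exact: h2.
Qed.

Let is_derive_small (D w : R -> R) (x : R) : w y @[y --> x] --> (0 : R) ->
  (forall y, `|D y - D x| <= `|y - x| * w y) -> is_derive x 1 D 0.
Proof.
move=> hw hD.
have h : t^-1 *: (D (t *: 1 + x) - D x) @[t --> (0:R)^'] --> (0 : R).
  apply/cvgrPdist_le => e e0.
  have hw' : w (t + x) @[t --> (0:R)] --> (0 : R).
    have := @cvg_comp _ _ _ (fun t => t + x) w (nbhs (0:R)) (nbhs x) (nbhs (0:R)).
    apply => //.
    have : (fun t : R => t + x) @ (0:R) --> 0 + x by apply: cvgD; [exact: cvg_id|exact: cvg_cst].
    by rewrite add0r.
  move/cvgrPdist_le : hw' => /(_ _ e0) hw'.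
  near=> t; rewrite sub0r normrN.
  have t0 : t != 0 by near: t; exact: nbhs_dnbhs_neq.
  rewrite normrZ normfV ler_pdivrMl ?normr_gt0//.
  have := hD (t *: 1 + x); rewrite [t *: 1]mulr1 addrK => /le_trans; apply.
  rewrite ler_wpM2l//.
  have : `|0 - w (t + x)| <= e by near: t; exact: nbhs_dnbhs.
  by rewrite sub0r normrN => /(le_trans (ler_norm _)).
apply: DeriveDef; first by apply/cvg_ex; exists 0.
exact: cvg_lim h.
Unshelve. all: by end_near. Qed.

(** * Gaussian primitive of a centred Lipschitz function *)

Section stein_primitive.
Variable h : R -> R.
Hypothesis hl : forall x y, `|h x - h y| <= `|x - y|.
Let ht x := h x - EX gaussian h.
Definition gauss_abs_moment := EX gaussian (fun x => `|x|).

Let L1id : L1 gaussian (fun x => x). Proof. exact/L2_L1/L2_gaussian_id. Qed.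

Let L1h : L1 gaussian h.
Proof. exact: (L1_lipschitz1 hl L1id). Qed.

Let L1ht : L1 gaussian ht. Proof. by apply: L1_B => //; exact: L1_cst. Qed.

Let EX_ht : EX gaussian ht = 0.
Proof. by rewrite EX_B ?EX_cst ?subrr//; exact: L1_cst. Qed.

Lemma centered_lipschitz_le x : `|h x - EX gaussian h| <= gauss_abs_moment + `|x|.
Proof.
have e : h x - EX gaussian h = EX gaussian (fun t => h x - h t).
  by rewrite (EX_B (L1_cst _ (h x)) L1h) EX_cst.
rewrite e (_ : _ + _ = EX gaussian (fun t => `|t| + `|x|)); last first.
  by rewrite (EX_D (L1_abs L1id) (L1_cst _ `|x|)) EX_cst.
apply: EX_abs_le.
- by apply: L1_B => //; exact: L1_cst.
- by apply: L1_D; [exact: L1_abs|exact: L1_cst].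
by move=> t; rewrite (le_trans (hl _ _))// (le_trans (ler_normB _ _))// addrC.
Qed.

Let cut (x : R) : R -> R := \1_(`]-oo, x]%classic).

Let cutE x t : cut x t = (t <= x)%R%:R.
Proof. by rewrite /cut indicE; congr ((nat_of_bool _)%:R); apply/idP/idP => [/set_mem|tx];
  [|apply/mem_set]; rewrite /= in_itv. Qed.

Let mcut x : measurable_fun setT (cut x). Proof. exact: measurable_indic. Qed.

Let L1cut x (g : R -> R) : L1 gaussian g -> L1 gaussian (fun t => g t * cut x t).
Proof.
move=> hg; apply: (@L1_le _ _ R gaussian _ (fun t => `|g t|)); last exact: L1_abs.
  exact: (measurable_funM (L1_meas hg) (mcut x)).
by move=> t; rewrite normrM cutE; case: (t <= x); rewrite /= ?normr1 ?normr0 ?mulr1 ?mulr0.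
Qed.

Let G x := EX gaussian (fun t => ht t * cut x t).

Let PhiE x : Phi x = EX gaussian (fun t => 1 * cut x t).
Proof. by apply: eq_EX => t; rewrite mul1r. Qed.

(** Freezing [ht] at [x]: between [x] and [y] it moves by at most [|y - x|]. Hence [G - ht x * Phi]
    has derivative 0 at [x], and the derivative of [G] follows from that of [Phi] alone. *)
Let G_diff x y : `|(G y - ht x * Phi y) - (G x - ht x * Phi x)| <= `|y - x| * `|Phi y - Phi x|.
Proof.
have aux z : G z - ht x * Phi z = EX gaussian (fun t => (ht t - ht x) * cut z t).
  have h1 := L1cut z (L1_cst gaussian 1); have h2 := L1cut z L1ht.
  rewrite PhiE -(EX_Z (ht x) h1) -(EX_B h2 (L1_Z (ht x) h1)).
  by apply: eq_EX => t; ring.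
have L1d : L1 gaussian (fun t => ht t - ht x) by apply: L1_B => //; exact: L1_cst.
have cutB z1 z2 : z1 <= z2 -> Phi z2 - Phi z1 = EX gaussian (fun t => 1 * (cut z2 t - cut z1 t)).
  move=> z12; rewrite !PhiE -EX_B; [|exact/L1cut/L1_cst|exact/L1cut/L1_cst].
  by apply: eq_EX => t; ring.
rewrite !aux -EX_B; [|exact: L1cut|exact: L1cut].
have cutsub z1 z2 : z1 <= z2 -> forall t, `|cut z2 t - cut z1 t| = cut z2 t - cut z1 t.
  move=> z12 t; rewrite ger0_norm// subr_ge0 !cutE ler_nat.
  by case: (leP t z1) => // tz1; rewrite (le_trans tz1).
have [xy|/ltW yx] := leP x y.
  have c0 : L1 gaussian (fun t => 1 * (cut y t - cut x t)).
    apply: (eq_L1 _ (L1_B (L1cut y (L1_cst _ 1)) (L1cut x (L1_cst _ 1)))) => t; ring.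
  rewrite (cutB _ _ xy) [X in _ * X]ger0_norm; last first.
    by apply: EX_ge0 => t; rewrite mul1r -cutsub.
  rewrite -EX_Z//; apply: EX_abs_le; [|exact: L1_Z|].
    by apply: L1_B; exact: L1cut.
  move=> t; rewrite -mulrBr normrM (cutsub _ _ xy) mul1r !cutE.
  have [tx|tx] := leP t x; first by rewrite (le_trans tx xy) subrr !mulr0.
  have [ty|ty] := leP t y; last by rewrite subrr !mulr0.
  rewrite subr0 !mulr1 /ht [X in `|X|](_ : _ = h t - h x); last by ring.
  by rewrite (le_trans (hl _ _))// !ger0_norm ?subr_ge0 ?(ltW tx)// lerB.
have c0 : L1 gaussian (fun t => 1 * (cut x t - cut y t)).
  apply: (eq_L1 _ (L1_B (L1cut x (L1_cst _ 1)) (L1cut y (L1_cst _ 1)))) => t; ring.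
rewrite [X in _ * X]distrC (cutB _ _ yx) [X in _ * X]ger0_norm; last first.
  by apply: EX_ge0 => t; rewrite mul1r -cutsub.
rewrite -EX_Z//; apply: EX_abs_le; [|exact: L1_Z|].
  by apply: L1_B; exact: L1cut.
move=> t; rewrite -mulrBr normrM [X in _ * X <= _]distrC (cutsub _ _ yx) mul1r !cutE.
have [ty|ty] := leP t y; first by rewrite (le_trans ty yx) subrr !mulr0.
have [tx|tx] := leP t x; last by rewrite subrr !mulr0.
rewrite subr0 !mulr1 /ht [X in `|X|](_ : _ = h t - h x); last by ring.
rewrite (le_trans (hl _ _))// distrC [leRHS]distrC !ger0_norm ?subr_ge0//.
  by rewrite lerB// ltW.
Qed.

Lemma stein_primitive_derive (x : R) : is_derive x 1 G (ht x * phi x).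
Proof.
have e : G = (fun y => (G y - ht x * Phi y) + ht x * Phi y).
  by apply/funext => y; rewrite subrK.
have PhiD := Phi_derive x.
have h0 : is_derive x 1 (fun y => G y - ht x * Phi y) 0.
  apply: (@is_derive_small _ (fun y => `|Phi y - Phi x|)); last exact: G_diff.
  rewrite -(normr0 R) -(subrr (Phi x)); apply: cvg_norm; apply: cvgB; last exact: cvg_cst.
  by apply: differentiable_continuous; apply/derivable1_diffP; case: PhiD.
rewrite e; apply: is_derive_eq.
by rewrite /GRing.scale/= add0r.
Qed.

(** On the half-line that is integrated, [|x| <= |t|], so [|x|] can be moved inside as [|t|] and a
    second moment bounds the result. This is the growth condition under which the barrier argument
    selects the right solution. *)
Lemma stein_primitive_cvg : exists C, forall x, `|x| * `|G x| <= C.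
Proof.
pose C := EX gaussian (fun t => (gauss_abs_moment + `|t|) * `|t|).
have L2abs : L2 gaussian (fun t => `|t|).
  split; first exact: measurableT_comp.
  by apply: (eq_L1 _ (L2_sq L2_gaussian_id)) => t; rewrite real_normK// num_real.
have hC : L1 gaussian (fun t => (gauss_abs_moment + `|t|) * `|t|).
  by apply: L2_L1_mul => //; apply: L2_D => //; exact: L2_cst.
exists C => x; have [x0|x0] := leP x 0.
  rewrite -normrM /G -EX_Z; last exact: L1cut.
  apply: EX_abs_le => //; first by apply: L1_Z; exact: L1cut.
  move=> t; rewrite cutE; case: (leP t x) => tx /=; last first.
    by rewrite !mulr0 normr0 mulr_ge0// addr_ge0//; apply: EX_ge0.
  rewrite mulr1 normrM mulrC ler_pM// ?centered_lipschitz_le//.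
  by rewrite !ler0_norm ?lerN2// (le_trans tx).
(* For [x > 0] the integral up to [x] contains small [t]; as [ht] is centred, it is replaced by
   minus the integral beyond [x]. *)
have -> : G x = - EX gaussian (fun t => ht t * (1 - cut x t)).
  rewrite /G (eq_EX gaussian (f := fun t => ht t * (1 - cut x t)) (g := fun t => ht t - ht t * cut x t)); last by move=> t; ring.
  by rewrite (EX_B L1ht (L1cut x L1ht)) EX_ht sub0r opprK.
have L1c : L1 gaussian (fun t => ht t * (1 - cut x t)).
  by apply: (eq_L1 _ (L1_B L1ht (L1cut x L1ht))) => t; ring.
rewrite normrN -normrM -EX_Z//; apply: EX_abs_le => //; first exact: L1_Z.
move=> t; rewrite cutE; case: (leP t x) => tx /=.
  by rewrite subrr !mulr0 normr0 mulr_ge0// addr_ge0//; apply: EX_ge0.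
rewrite subr0 mulr1 normrM mulrC ler_pM// ?centered_lipschitz_le//.
by rewrite !gtr0_norm// ?ltW// (lt_trans x0).
Qed.

End stein_primitive.
End standard_normal.

(** * Bounds on the solution of Stein's equation *)

Section stein_solution.
Context (R : realType).
Implicit Types (f r h : R -> R) (x y : R).
Let e x : R := expR (- (x ^+ 2 / 2)).

Let e0 x : 0 < e x. Proof. exact: expR_gt0. Qed.

Let x2e x : x ^+ 2 * e x <= 2.
Proof.
rewrite /e expRN ler_pdivrMr ?expR_gt0//.
have := expR_ge1Dx (x ^+ 2 / 2); lra.
Qed.

(* Comparison of a solution of [f' = x f + r] with the barrier
   [B x = 2 A / (1 + x) + D], which satisfies [x B - B' >= A + D x]:
   the function [(f - B) * exp (- x^2 / 2)] is nondecreasing and tends to 0. *)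
Let barrier_pos f r (A D C : R) : 0 <= A -> 0 <= D ->
  (forall x, is_derive x (1 : R) f (x * f x + r x)) ->
  (forall x, `|r x| <= A + D * `|x|) ->
  (forall x, `|x| * `|f x * e x| <= C) ->
  forall x, 0 <= x -> f x <= 2 * A / (1 + x) + D.
Proof.
move=> A0 D0 hf hr hC x x0; rewrite leNgt; apply/negP => hx.
pose B (y : R) := 2 * A * (1 + y)^-1 + D.
pose u (y : R) := (f y - B y) * e y.
pose B' (y : R) := - (2 * A) * ((1 + y) ^- 2).
have dB (y : R) : 0 <= y -> is_derive y (1 : R) B (B' y).
  move=> y0; have n0 : 1 + y != 0 by rewrite gt_eqF// ltr_pwDl.
  rewrite /B; apply: is_derive_eq.
  by rewrite /GRing.scale/= /B'; field.
have du (y : R) : 0 <= y -> is_derive y (1 : R) u ((r y + (y * B y - B' y)) * e y).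
  move=> y0; have := dB y y0 => HB.
  rewrite /u; apply: is_derive_eq.
  by rewrite /GRing.scale/= /e; field.
have du0 (y : R) : 0 <= y -> 0 <= (r y + (y * B y - B' y)) * e y.
  move=> y0; rewrite mulr_ge0 ?(ltW (e0 y))//.
  have n0 : 0 < 1 + y by rewrite ltr_pwDl.
  have h1 : A + D * y <= y * B y - B' y.
    rewrite -subr_ge0 [leRHS](_ : _ = A * (y ^+ 2 + 1) / (1 + y) ^+ 2); last first.
      by rewrite /B /B'; field; rewrite gt_eqF.
    by rewrite divr_ge0 ?mulr_ge0 ?addr_ge0 ?sqr_ge0.
  have := hr y; rewrite (ger0_norm y0) ler_norml => /andP[h2 _]; lra.
have mono (y : R) : x < y -> u x <= u y.
  move=> xy; have [||c] := @MVT R u (fun z => (r z + (z * B z - B' z)) * e z) _ _ xy.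
  - by move=> z /[!in_itv]/= /andP[xz _]; apply: du; rewrite (le_trans x0)// ltW.
  - apply: derivable_within_continuous => z /[!in_itv]/= /andP[xz _].
    by have [] := du z (le_trans x0 xz).
  move=> /[!in_itv]/= /andP[xc cy] E; rewrite -subr_ge0 E mulr_ge0//.
    by apply: du0; rewrite (le_trans x0)// ltW.
  by rewrite subr_ge0 ltW.
have ux : 0 < u x by rewrite mulr_gt0// subr_gt0.
have C0 : 0 <= C by apply: le_trans (hC 0); rewrite mulr_ge0.
pose K := `|C| + 4 * A + 2 * D + 1.
have small (y : R) : 1 <= y -> `|u y| * y <= K.
  move=> y1; have y0 : 0 <= y by exact: le_trans y1.
  rewrite /u mulrBl (le_trans (ler_wpM2r y0 (ler_normB _ _)))// mulrDl.
  have := hC y; rewrite (ger0_norm y0) mulrC => h1.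
  have B0 : 0 <= B y by rewrite addr_ge0 ?divr_ge0 ?mulr_ge0 ?addr_ge0.
  have B1 : B y <= 2 * A + D.
    rewrite lerD2r ler_pdivrMr; last by rewrite ltr_pwDl.
    by rewrite ler_peMr ?mulr_ge0// lerDl.
  rewrite [`|B y * e y|]ger0_norm ?mulr_ge0 ?(ltW (e0 y))//.
  have h2 : B y * e y * y <= (2 * A + D) * 2.
    rewrite -mulrA ler_pM// ?mulr_ge0 ?(ltW (e0 y))//.
    apply: le_trans (x2e y); rewrite mulrC ler_wpM2r ?(ltW (e0 y))//.
    by rewrite expr2 ler_peMl.
  by have := ler_norm C; rewrite /K; lra.
(* [u] is nondecreasing and [u y * y] stays below [K], while this [y] makes [u x * y] at least
   [K + 1]. *)
pose y := 1 + x + (K + 1) / u x.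
have K0 : 0 <= K by rewrite /K; have := normr_ge0 C; lra.
have z0 : 0 <= (K + 1) / u x.
  by apply: divr_ge0; [exact: addr_ge0|exact: ltW].
have y1 : 1 <= y by rewrite /y; lra.
have xy : x < y by rewrite /y; lra.
have h := mono y xy.
have h2 := small y y1.
have h3 : u x * y <= K.
  apply: le_trans h2; rewrite ler_wpM2r ?(le_trans h) ?ler_norm//; lra.
have h4 : u x * y = u x * (1 + x) + (K + 1).
  by rewrite /y; field; rewrite gt_eqF.
have h5 : 0 <= u x * (1 + x) by rewrite mulr_ge0 ?(ltW ux) ?addr_ge0.
by move: h3; rewrite h4; lra.
Qed.

(** The class of equations and the three bounds are stable under [f] to [- f] and under [x] to [- x]
    with a sign, so the upper bound on the positive half-line yields all the others. *)
Lemma stein_barrier f r (A D C : R) : 0 <= A -> 0 <= D ->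
  (forall x, is_derive x (1 : R) f (x * f x + r x)) ->
  (forall x, `|r x| <= A + D * `|x|) ->
  (forall x, `|x| * `|f x * e x| <= C) ->
  forall x, `|f x| <= 2 * A / (1 + `|x|) + D.
Proof.
move=> A0 D0.
have half f1 r1 : (forall x, is_derive x (1 : R) f1 (x * f1 x + r1 x)) ->
    (forall x, `|r1 x| <= A + D * `|x|) ->
    (forall x, `|x| * `|f1 x * e x| <= C) ->
    forall x, 0 <= x -> `|f1 x| <= 2 * A / (1 + x) + D.
  move=> hf hr hC x x0; rewrite ler_norml; apply/andP; split; last first.
    exact: (barrier_pos A0 D0 hf hr hC).
  rewrite lerNl.
  apply: (@barrier_pos (fun y => - f1 y) (fun y => - r1 y) A D C) => //.
  - move=> y; have := hf y => H; apply: is_derive_eq.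
    by ring.
  - by move=> y; rewrite normrN.
  - by move=> y; rewrite mulNr normrN.
move=> hf hr hC x; have [x0|x0] := leP 0 x.
  by rewrite (ger0_norm x0); exact: (half _ _ hf hr hC).
rewrite (ltr0_norm x0) -{1}(opprK x) -normrN.
apply: (half (fun y => - f (- y)) (fun y => r (- y))); last by rewrite oppr_ge0 ltW.
- move=> y.
  have H := hf (- y).
  have H2 : is_derive y (1 : R) (fun z : R => f (- z)) (- (- y * f (- y) + r (- y))).
    have := @is_derive1_comp R f (fun z : R => - z) y (- y * f (- y) + r (- y)) (-1) H _.
    rewrite mulrN1; apply; apply: is_derive_eq; by [].
  by apply: is_derive_eq; ring.
- by move=> y; rewrite -(normrN y); exact: hr.
- move=> y; rewrite mulNr normrN -(normrN y).
  by have := hC (- y); rewrite /e sqrrN.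
Qed.

(** The solution is the Gaussian primitive of [h - E h] divided by the density. Since [h] is merely
    Lipschitz, the equation cannot be differentiated to control [f']; the barrier is applied to the
    increment [f(x + t) - f(x)] instead, which solves an equation of the same form. *)
Theorem stein_solution : exists C : R, 0 < C /\ forall h,
  (forall x y, `|h x - h y| <= `|x - y|) ->
  exists f f', C11 C f f' /\ forall x, f' x - x * f x = h x - EX (gaussian R) h.
Proof.
pose A := @gauss_abs_moment R.
have A0 : 0 <= A by apply: EX_ge0.
pose C0 := 2 * A + 1; exists (10 * (1 + C0)); split; first by rewrite /C0; lra.
move=> h hl; pose ht x := h x - EX (gaussian R) h.
have np0 : 0 < @normal_peak R 1 by rewrite normal_peak_gt0// oner_neq0.
pose G (x : R) : R := EX (gaussian R) (fun t => (h t - EX (gaussian R) h) * \1_(`]-oo, x]%classic) t).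
have dG (x : R) : is_derive x (1 : R) G (ht x * normal_pdf 0 1 x).
  exact: stein_primitive_derive.
have [C1 hC1] : exists C, forall x, `|x| * `|G x| <= C by exact: stein_primitive_cvg.
have phiE x : normal_pdf 0 1 x = normal_peak 1 * e x.
  by rewrite normal_pdfE ?oner_neq0//= /normal_fun subr0 expr1n mulNr.
pose f (x : R) : R := (normal_peak 1)^-1 * (G x * expR (x ^+ 2 / 2)).
have eV x : expR (x ^+ 2 / 2) * e x = 1 by rewrite /e expRN divff// gt_eqF// expR_gt0.
have df (x : R) : is_derive x (1 : R) f (x * f x + ht x).
  have := dG x => H; rewrite /f; apply: is_derive_eq.
  have := eV x; rewrite phiE /GRing.scale/= => E.
  set E1 := expR _ in E *; set E2 := e x in E *.
  transitivity (x * ((normal_peak 1)^-1 * (G x * E1)) + ht x * (E1 * E2)).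
    by field; rewrite gt_eqF.
  by rewrite E mulr1.
have hht x : `|ht x| <= A + 1 * `|x| by rewrite mul1r; exact: centered_lipschitz_le.
have fe x : f x * e x = (normal_peak 1)^-1 * G x.
  by rewrite /f -[LHS]mulrA -[G x * _ * _]mulrA eV mulr1.
have fb x : `|f x| <= C0.
  have := @stein_barrier f ht A 1 ((normal_peak 1)^-1 * C1) A0 ler01 df hht.
  have hC x1 : `|x1| * `|f x1 * e x1| <= (normal_peak 1)^-1 * C1.
    rewrite fe normrM [`|_^-1|]ger0_norm ?invr_ge0 ?(ltW np0)// mulrCA.
    by rewrite ler_wpM2l ?invr_ge0 ?(ltW np0).
  move=> /(_ hC x) /le_trans; apply; rewrite lerD2r ler_pdivrMr; last by rewrite ltr_pwDl.
  by rewrite ler_peMr ?mulr_ge0// lerDl.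
have C00 : 0 <= C0 by rewrite /C0; lra.
pose f' x := x * f x + ht x.
(* The forcing term of the equation solved by [f(x + t) - f(x)]; it is of size [|t|] uniformly in
   [x]. *)
pose rt t x := h (x + t) - h x + t * f (x + t).
have hrt t x : `|rt t x| <= `|t| * (1 + C0).
  rewrite /rt (le_trans (ler_normD _ _))// mulrDr mulr1 lerD//.
    by rewrite (le_trans (hl _ _))// addrAC subrr add0r.
  by rewrite normrM ler_wpM2l.
have dgt t x : is_derive x (1 : R) (fun y => f (y + t) - f y) (x * (f (x + t) - f x) + rt t x).
  have H1 := df x; have H2 := df (x + t).
  have H3 : is_derive x (1 : R) (fun y => f (y + t)) ((x + t) * f (x + t) + ht (x + t)).
    have := @is_derive1_comp R f (fun z : R => z + t) x ((x + t) * f (x + t) + ht (x + t)) 1 H2 _.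
    by rewrite mulr1; apply; apply: is_derive_eq; rewrite addr0.
  by apply: is_derive_eq; rewrite /rt /ht; ring.
(* The decay in [1 + |x|] is essential: in the increments of [f' = x f + ht], the increment of [f]
   is multiplied by [x]. *)
have fl0 t x : `|f (x + t) - f x| <= 2 * (`|t| * (1 + C0)) / (1 + `|x|).
  have t0 : 0 <= `|t| * (1 + C0) by rewrite mulr_ge0// addr_ge0.
  have := @stein_barrier (fun y => f (y + t) - f y) (rt t) (`|t| * (1 + C0)) 0 (4 * C0) t0 (lexx _) (dgt t).
  move=> H; rewrite -[leRHS]addr0; apply: H => [y|y]; first by rewrite mul0r addr0.
  rewrite normrM [`|e y|]ger0_norm ?(ltW (e0 y))//.
  have h1 : `|f (y + t) - f y| <= 2 * C0.
    by rewrite (le_trans (ler_normB _ _))// mulr_natl mulr2n lerD.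
  have h2 : `|y| * e y <= 2.
    have [y1|y1] := leP `|y| 1.
      have : e y <= 1 by rewrite /e -expR0 ler_expR oppr_le0 mulr_ge0// sqr_ge0.
      by have := e0 y; nra.
    apply: le_trans (x2e y); rewrite ler_wpM2r ?(ltW (e0 y))//.
    by rewrite -real_normK ?num_real// expr2 ler_peMl// ltW.
  rewrite mulrCA (_ : 4 * C0 = 2 * C0 * 2); last by ring.
  by rewrite ler_pM// mulr_ge0// (ltW (e0 y)).
have fl x y : `|f x - f y| <= 2 * (1 + C0) * `|x - y|.
  have := fl0 (x - y) y; rewrite (addrC y) subrK => /le_trans; apply.
  rewrite ler_pdivrMr; last by rewrite ltr_pwDl.
  rewrite [leRHS](_ : _ = 2 * (`|x - y| * (1 + C0)) * (1 + `|y|)); last by ring.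
  rewrite ler_peMr ?mulr_ge0 ?addr_ge0//.
    by rewrite mulr_ge0.
  by rewrite lerDl.
have f'l x y : `|f' x - f' y| <= 3 * (1 + C0) * `|x - y|.
  rewrite /f' [X in `|X|](_ : _ = y * (f x - f y) + rt (x - y) y); last first.
    by rewrite /rt /ht (addrC y) subrK; ring.
  rewrite [leRHS](_ : _ = 2 * (1 + C0) * `|x - y| + (1 + C0) * `|x - y|); last by ring.
  rewrite (le_trans (ler_normD _ _))// lerD//.
    rewrite normrM; have := fl0 (x - y) y; rewrite (addrC y) subrK => hh.
    apply: (le_trans (ler_wpM2l (normr_ge0 y) hh)).
    rewrite [leLHS](_ : _ = `|y| * (2 * (`|x - y| * (1 + C0))) / (1 + `|y|)) ?mulrA// ler_pdivrMr; last by rewrite ltr_pwDl.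
    set t := `|x - y|; have t0 : 0 <= t by exact: normr_ge0.
    set z := `|y|; have z0 : 0 <= z by exact: normr_ge0.
    have : 0 <= (1 + C0) * t by rewrite mulr_ge0// addr_ge0.
    by nra.
  by rewrite mulrC; exact: hrt.
have mvt x y : exists2 c, `|c - x| <= `|y - x| & f y - f x = f' c * (y - x).
  have cf (z : R) : {for z, continuous f}.
    by apply: differentiable_continuous; apply/derivable1_diffP; case: (df z).
  have [xy|yx|<-] := ltgtP x y.
  - have [|c] := @MVT R f f' _ _ xy (fun z _ => df z); first exact: continuous_subspaceT.
    move=> /[!in_itv]/= /andP[xc cy] E; exists c => //.
    by rewrite gtr0_norm ?subr_gt0// gtr0_norm ?subr_gt0//; lra.
  - have [|c] := @MVT R f f' _ _ yx (fun z _ => df z); first exact: continuous_subspaceT.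
    move=> /[!in_itv]/= /andP[xc cy] E; exists c; last by rewrite -opprB E; ring.
    by rewrite ltr0_norm ?subr_lt0// ltr0_norm ?subr_lt0//; lra.
  - by exists x; rewrite ?subrr ?mulr0.
exists f, f'; split; last by move=> x; rewrite /f' /ht; ring.
split.
- by move=> x; apply: (le_trans (fb x)); lra.
- move=> x; have [c hc E] := mvt x (x + 1).
  have := fl (x + 1) x; rewrite E addrAC subrr add0r mulr1 normr1 mulr1 => h1.
  rewrite addrAC subrr add0r normr1 in hc.
  have := f'l x c; rewrite distrC => h2.
  have h3 : `|f' x - f' c| <= 3 * (1 + C0).
    rewrite distrC; apply: (le_trans h2); rewrite distrC -[leRHS]mulr1 ler_wpM2l//.
    by rewrite mulr_ge0// addr_ge0.
  rewrite -(subrK (f' c) (f' x)) (le_trans (ler_normD _ _))//; lra.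
- move=> x y; apply: (le_trans (fl x y)); rewrite ler_wpM2r//; lra.
- move=> x y; apply: (le_trans (f'l x y)); rewrite ler_wpM2r//; lra.
- move=> x y; have [c hc ->] := mvt x y.
  rewrite mulrC -mulrBr normrM -(real_normK (num_real (y - x))) expr2 mulrCA ler_wpM2l//.
  apply: (le_trans (f'l c x)).
  apply: (@le_trans _ _ (3 * (1 + C0) * `|y - x|)).
    by rewrite ler_wpM2l// mulr_ge0// addr_ge0.
  by rewrite ler_wpM2r//; lra.
Qed.

End stein_solution.

(** * Lebesgue measure on tuples *)

Section tuple_measure_theory.
Context d (T : measurableType d) (R : realType).
Variable m : {sigma_finite_measure set T -> \bar R}.

Lemma tuple_measureS n (A : set (n.+1.-tuple T)) :
  tuple_measure m n.+1 A = (m \x tuple_measure m n)%E (@tcons _ T n @^-1` A).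
Proof. by []. Qed.

Lemma ge0_integral_tuple_measureS n (f : n.+1.-tuple T -> \bar R) :
  measurable_fun setT f -> (forall t, 0 <= f t)%E ->
  (\int[tuple_measure m n.+1]_t f t =
   \int[m]_x \int[tuple_measure m n]_t f (tcons (x, t)))%E.
Proof.
move=> mf f0; have mt := @measurable_tcons _ T n.
pose pm : {measure set (n.+1.-tuple T) -> \bar R} :=
  measure_function_pushforward__canonical__measure_function_Measure
    (m \x tuple_measure m n)%E mt.
rewrite (@eq_measure_integral _ _ _ _ pm)//.
rewrite (ge0_integral_pushforward mt)//=.
rewrite preimage_setT fubini_tonelli1//.
exact: (measurableT_comp mf mt).
Qed.

Lemma integral_tuple_measure0 (f : 0.-tuple T -> \bar R) :
  measurable_fun setT f ->
  (\int[tuple_measure m 0]_t f t = f [tuple])%E.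
Proof. by move=> mf; rewrite integral_dirac//= diracT mul1e. Qed.

End tuple_measure_theory.

Section euclidean_measure.
Context (R : realType).
Implicit Types d : nat.

Lemma measurable_vsub d : measurable_fun setT (fun p : Rvec R d * Rvec R d => vsub p.1 p.2).
Proof.
apply/measurable_fun_tnthP => i.
rewrite (_ : _ \o _ = fun p => (tnth p.1 i : R) - (tnth p.2 i : R)); last first.
  by apply/funext => p /=; rewrite tnth_mktuple.
apply: measurable_funB.
  exact: (measurableT_comp (measurable_tnth i) measurable_fst).
exact: (measurableT_comp (measurable_tnth i) measurable_snd).
Qed.

Lemma measurable_vsubr d (x : Rvec R d) : measurable_fun setT (vsub x).
Proof.
apply: (measurableT_comp (@measurable_vsub d) (pair1_measurable x)).
Qed.

Lemma vsubK d (x y : Rvec R d) : vsub x (vsub x y) = y.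
Proof. by apply: eq_from_tnth => i; rewrite !tnth_mktuple; ring. Qed.

Lemma lebesgue_reflect (a : R) (A : set (measurableTypeR R)) : measurable A ->
  lebesgue_measure ((fun y : measurableTypeR R => (a - y : R)) @^-1` A) = lebesgue_measure A.
Proof.
move=> mA.
have mf : measurable_fun setT (fun y : measurableTypeR R => (a - y : R) : measurableTypeR R).
  by apply: measurable_funB.
pose pm : {measure set (measurableTypeR R) -> \bar R} :=
  measure_function_pushforward__canonical__measure_function_Measure
    (@lebesgue_measure R) mf.
rewrite -[LHS]/(pm A); apply/esym; apply: lebesgue_measure_unique => // X [[u v] _ <-].
rewrite /pm/= /pushforward.
rewrite (_ : _ @^-1` _ = `[a - v, a - u[%classic); last first.
  by apply/seteqP; split=> y /=; rewrite !in_itv/=; lra.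
rewrite !lebesgue_measure_itv/= !lte_fin ltrD2l ltrN2.
by case: ifP => // _; rewrite -!EFinD; congr EFin; ring.
Qed.

(** Reflection invariance in one coordinate, propagated by uniqueness of product measures. It turns
    the set of neighbours of [x] into a set of differences, a part of [Hbar l]. *)
Lemma leb_vsub d (x : Rvec R d) (A : set (Rvec R d)) : measurable A ->
  leb R d (vsub x @^-1` A) = leb R d A.
Proof.
elim: d x A => [|d IH] x A mA.
  congr (leb R 0 _); have h (t : Rvec R 0) : vsub x t = t by apply: eq_from_tnth => -[].
  by apply/seteqP; split=> t /=; rewrite h.
rewrite /leb !tuple_measureS.
case/tupleP: x => x0 x'.
pose g (p : measurableTypeR R * Rvec R d) : measurableTypeR R * Rvec R d :=
  ((x0 : R) - p.1, vsub x' p.2).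
have mg : measurable_fun setT g.
  apply/measurable_fun_pairP; split.
    by apply: measurable_funB => //; exact: measurable_fst.
  exact: (measurableT_comp (measurable_vsubr x') measurable_snd).
have gE p : vsub [tuple of x0 :: x'] (tcons p) = tcons (g p).
  apply: eq_from_tnth => i; rewrite tnth_mktuple.
  by have [j ->|->] := unliftP ord0 i; rewrite /tcons ?tnthS ?tnth_mktuple// !tnth0.
have -> : @tcons _ _ d @^-1` (vsub [tuple of x0 :: x'] @^-1` A) = g @^-1` (@tcons _ _ d @^-1` A).
  by apply/seteqP; split=> p; rewrite /preimage/= gE.
have mcA : measurable (@tcons _ (measurableTypeR R) d @^-1` A).
  by rewrite -[X in measurable X]setTI; exact: measurable_tcons.
pose pm : {measure set (measurableTypeR R * Rvec R d) -> \bar R} :=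
  measure_function_pushforward__canonical__measure_function_Measure
    (@lebesgue_measure R \x leb R d)%E mg.
rewrite -[LHS]/(pm (@tcons _ _ d @^-1` A)); apply/esym.
apply: product_measure_unique => // B C mB mC.
rewrite /pm/= /pushforward.
rewrite (_ : g @^-1` (B `*` C) = ((fun y : measurableTypeR R => ((x0 : R) - y : R)) @^-1` B) `*` (vsub x' @^-1` C))//.
rewrite product_measure1E.
- by congr (_ * _)%E; [exact: lebesgue_reflect|exact: IH].
- by rewrite -[X in measurable X]setTI; apply: measurable_funB.
- by rewrite -[X in measurable X]setTI; exact: measurable_vsubr.
Qed.

Definition box d (a : R) : set (Rvec R d) :=
  [set x | forall i, - a <= (tnth x i : R) <= a].

Lemma leb_box d (a : R) : 0 <= a -> leb R d (box a) = ((2 * a) ^+ d)%:E.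
Proof.
move=> a0; rewrite /leb /box.
rewrite (_ : [set x | _] = [set t : Rvec R d | forall i, (fun=> `[- a, a]%classic) i (tnth t i)]); last first.
  by apply/seteqP; split=> x /= h i; have := h i; rewrite /= in_itv.
rewrite (@tuple_measure_box _ _ R lebesgue_measure d (fun=> `[- a, a]%classic)); last first.
  by move=> i; exact: measurable_itv.
rewrite (eq_bigr (fun=> (2 * a)%:E)) => [|i _]; last first.
  apply: (eq_trans (lebesgue_measure_itv `[- a, a])).
  rewrite /= lte_fin; case: ifPn => [_|].
    by rewrite -EFinD; congr EFin; ring.
  by rewrite -leNgt => h; congr EFin; lra.
by rewrite prodEFin prodr_const card_ord.
Qed.

Lemma measurable_box d (a : R) : measurable (@box d a).
Proof.
rewrite (_ : box a = \bigcap_(i in [set: 'I_d]) ((@tnth d (measurableTypeR R))^~ i @^-1` `[- a, a]%classic)); last first.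
  by apply/seteqP; split=> [x h i _|x h i]; [|move: (h i Logic.I)]; rewrite /= in_itv//=; exact: h.
apply: fin_bigcap_measurable => // i _.
by rewrite -[X in measurable X]setTI; apply: measurable_tnth => //; exact: measurable_itv.
Qed.

Lemma cubeE d (s : R) : (0 < d)%N -> 0 <= s -> cube (s ^+ d) = @box d (2^-1 * s).
Proof.
move=> d0 s0; rewrite /cube -powR_mulrn// -powRrM mulfV ?pnatr_eq0 -?lt0n// powRr1//.
Qed.

Lemma cube1E d : @cube R d 1 = @box d 2^-1.
Proof. by rewrite /cube /box powR1 mulr1. Qed.

Lemma measurable_cube d (l : R) : measurable (@cube R d l).
Proof. exact: measurable_box. Qed.

(** The window has volume 1, so that Lebesgue measure restricted to it is a probability measure and
    the rules for [EX] apply to integrals over vertices. *)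
Definition window d : set (Rvec R d) -> \bar R := mrestr (leb R d) (@measurable_cube d 1).

HB.instance Definition _ d := Measure.on (@window d).

Lemma window_setT d : @window d setT = 1%E.
Proof.
rewrite /window /mrestr setTI cube1E leb_box ?invr_ge0//.
by rewrite divff ?pnatr_eq0// expr1n.
Qed.

HB.instance Definition _ d := @Measure_isProbability.Build _ _ R (@window d) (@window_setT d).

Lemma tuple_prob_setT disp (T : measurableType disp) (m : probability T R) n :
  tuple_measure m n setT = 1%E.
Proof.
have := @tuple_measure_box _ T R m n (fun=> setT) (fun=> measurableT).
rewrite big1 => [|i _]; last exact: probability_setT.
by move=> <-; congr (tuple_measure m n _); apply/seteqP; split.
Qed.

Lemma measurable_Wpow d k : measurable (@Wpow R d k).
Proof.
rewrite (_ : @Wpow R d k = \bigcap_(i in [set: 'I_k]) ((@tnth k (Rvec R d))^~ i @^-1` cube 1)); last first.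
  by apply/seteqP; split=> [x h i _|x h i]; [exact: h|exact: (h i Logic.I)].
apply: fin_bigcap_measurable => // i _.
by rewrite -[X in measurable X]setTI; apply: measurable_tnth => //; exact: measurable_cube.
Qed.

(** Turns Lebesgue measures of subsets of [W^n] into probabilities for [n] independent uniform
    points of the window. *)
Lemma tuple_measure_window d n (S : set (n.-tuple (Rvec R d))) : measurable S ->
  tuple_measure (leb R d) n (@Wpow R d n `&` S) = tuple_measure (@window d) n S.
Proof.
elim: n S => [|n IH] S mS.
  congr (\d__ _); apply/seteqP; split=> [t []|t]//; split=> // -[]//.
rewrite !tuple_measureS preimage_setI.
have E : @tcons _ (Rvec R d) n @^-1` @Wpow R d n.+1 = cube 1 `*` @Wpow R d n.
  apply/seteqP; split=> [p h|p [h1 h2] i].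
    split; first by have := h ord0.
    by move=> i; have := h (lift ord0 i); rewrite /tcons tnthS.
  by have [j ->|->//] := unliftP ord0 i; rewrite /tcons tnthS; exact: h2.
have mD : measurable (@cube R d 1 `*` @Wpow R d n).
  by apply: measurableX; [exact: measurable_cube|exact: measurable_Wpow].
rewrite E setIC.
pose pm : {measure set (Rvec R d * n.-tuple (Rvec R d)) -> \bar R} :=
  mrestr (leb R d \x tuple_measure (leb R d) n)%E mD.
rewrite -[LHS]/(pm (@tcons _ _ n @^-1` S)); apply/esym.
apply: product_measure_unique; last first.
  by rewrite -[X in measurable X]setTI; exact: measurable_tcons.
move=> B C mB mC; rewrite /pm/= /mrestr.
rewrite -setXI product_measure1E; last 2 first.
- by apply: measurableI => //; exact: measurable_cube.
- by apply: measurableI => //; exact: measurable_Wpow.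
by rewrite [C `&` _]setIC IH.
Qed.

Lemma EX_window_tupleS d n (S : set (n.+1.-tuple (Rvec R d))) : measurable S ->
  fine (tuple_measure (@window d) n.+1 S) =
  EX (@window d) (fun x => fine (tuple_measure (@window d) n [set t | S (tcons (x, t))])).
Proof.
move=> mS; rewrite /EX tuple_measureS /product_measure1/=; congr fine.
apply: eq_integral => x _; rewrite fineK.
  by congr (tuple_measure _ _ _); apply/seteqP; split=> t /=; rewrite /xsection/= inE.
have mcS : measurable [set t | S (tcons (x, t))].
  rewrite -[X in measurable X]setTI; apply: (measurableT_comp (@measurable_tcons _ _ n) (pair1_measurable x)) => //.
rewrite ge0_fin_numE ?measure_ge0//; apply: (@le_lt_trans _ _ 1%E); last by rewrite ltry.
by rewrite -(tuple_prob_setT (@window d) n) le_measure// inE.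
Qed.

Lemma window_tuple0 d (S : set (0.-tuple (Rvec R d))) :
  fine (tuple_measure (@window d) 0 S) = \1_S [tuple].
Proof. by []. Qed.

End euclidean_measure.

(** * Symmetric kernels and their degrees *)

Section expectation_pairs.
Context d (T : measurableType d) (R : realType) (nu : probability T R).
Implicit Types f : T -> T -> R.

Definition bmeas2 (B : R) f := measurable_fun setT (fun p : T * T => f p.1 p.2) /\
  forall x y, 0 <= f x y <= B.

Definition bmeas1 (B : R) (g : T -> R) := measurable_fun setT g /\ forall x, 0 <= g x <= B.

Lemma bmeas1_L1 B g : bmeas1 B g -> L1 nu g.
Proof.
by move=> [mg hg]; apply: (L1_bounded _ mg (M := B)) => x; have /andP[h1 h2] := hg x; rewrite ger0_norm.
Qed.

Lemma bmeas1_EX B g : bmeas1 B g -> 0 <= EX nu g <= B.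
Proof.
move=> hg; rewrite EX_ge0/= => [|x]; last by have /andP[] := hg.2 x.
by apply: EX_le_cst => [|x]; [exact: bmeas1_L1 hg|have /andP[] := hg.2 x].
Qed.

Lemma bmeas2_l B f x : bmeas2 B f -> bmeas1 B (f x).
Proof. by move=> [mf hf]; split=> //; exact: (measurableT_comp mf (pair1_measurable x)). Qed.

Lemma bmeas2_r B f y : bmeas2 B f -> bmeas1 B (f ^~ y).
Proof. by move=> [mf hf]; split=> //; exact: (measurableT_comp mf (pair2_measurable y)). Qed.

Lemma bmeas2_EX B f : bmeas2 B f -> bmeas1 B (fun x => EX nu (f x)).
Proof.
move=> hf; split; last by move=> x; apply: bmeas1_EX; exact: bmeas2_l hf.
have [mf hb] := hf.
have := @measurable_fun_fubini_tonelli_F _ _ T T R nu (fun p => (f p.1 p.2)%:E).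
move=> /(_ _ _) h; apply: (measurableT_comp (@fine_measurable R setT measurableT)) => //.
apply: h; first exact/measurable_EFinP.
by move=> p; rewrite lee_fin; have /andP[] := hb p.1 p.2.
Qed.

Lemma EX_swap B f : bmeas2 B f ->
  EX nu (fun x => EX nu (f x)) = EX nu (fun y => EX nu (f ^~ y)).
Proof.
move=> hf; have [mf hb] := hf.
have mE : measurable_fun setT (fun p : T * T => (f p.1 p.2)%:E) by exact/measurable_EFinP.
have f0 (p : T * T) : (0 <= (f p.1 p.2)%:E)%E by rewrite lee_fin; have /andP[] := hb p.1 p.2.
have := @fubini_tonelli _ _ T T R nu nu _ mE f0 => /= E.
apply: EFin_inj; rewrite -!L1_E.
- rewrite (eq_integral (fun x => \int[nu]_y (f x y)%:E)%E) => [|x _]; last first.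
    by rewrite -L1_E//; exact: (bmeas1_L1 (bmeas2_l x hf)).
  rewrite E; apply: eq_integral => y _.
  by rewrite L1_E//; exact: (bmeas1_L1 (bmeas2_r _ hf)).
- have [mr hr] := hf; apply: (@bmeas1_L1 B (fun y => EX nu (f ^~ y))).
  apply: (@bmeas2_EX B (fun y x => f x y)); split=> // .
  exact: (measurableT_comp mf (@measurable_swap _ _ T T)).
- exact: (bmeas1_L1 (bmeas2_EX hf)).
Qed.

Lemma bmeas2_mul B C f g : bmeas2 B f -> bmeas2 C g -> bmeas2 (B * C) (fun x y => f x y * g x y).
Proof.
move=> [mf hf] [mg hg]; split; first exact: measurable_funM.
move=> x y; have /andP[h1 h2] := hf x y; have /andP[h3 h4] := hg x y.
by rewrite mulr_ge0//= ler_pM.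
Qed.

Lemma bmeas2_1 B g : bmeas1 B g -> bmeas2 B (fun x _ => g x).
Proof. by move=> [mg hg]; split => //; exact: (measurableT_comp mg measurable_fst). Qed.

Lemma bmeas2_2 B g : bmeas1 B g -> bmeas2 B (fun _ y => g y).
Proof. by move=> [mg hg]; split => //; exact: (measurableT_comp mg measurable_snd). Qed.

Lemma bmeas1_mul B C u g : bmeas1 B u -> bmeas1 C g -> bmeas1 (B * C) (fun x => u x * g x).
Proof.
move=> [mf hf] [mg hg]; split; first exact: measurable_funM.
move=> x; have /andP[h1 h2] := hf x; have /andP[h3 h4] := hg x.
by rewrite mulr_ge0//= ler_pM.
Qed.

Lemma bmeas1_X B g n : bmeas1 B g -> bmeas1 (B ^+ n) (fun x => g x ^+ n).
Proof.
move=> [mf hf]; split; first exact: measurable_funX.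
move=> x; have /andP[h1 h2] := hf x; rewrite exprn_ge0//= lerXn2r// nnegrE//.
exact: le_trans h2.
Qed.

End expectation_pairs.

(** * Integral operator of a symmetric kernel and weights of walks *)

Section symmetric_kernel.
Context d (T : measurableType d) (R : realType) (nu : probability T R).
Variable k : T -> T -> R.
Hypothesis hk : bmeas2 1 k.
Hypothesis ks : forall x y, k x y = k y x.

Definition kop (g : T -> R) x : R := EX nu (fun y => k x y * g y).

Definition kdeg x : R := EX nu (k x).

Definition kmom n : R := EX nu (fun x => kdeg x ^+ n).

Lemma kdeg_bmeas : bmeas1 1 kdeg. Proof. exact: bmeas2_EX. Qed.

Lemma kop1 : kop (fun=> 1) = kdeg.
Proof. by apply/funext => x; apply: eq_EX => y; rewrite mulr1. Qed.

Lemma kop_bmeas B g : bmeas1 B g -> bmeas1 B (kop g).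
Proof.
by move=> hg; rewrite -[B]mul1r; apply: bmeas2_EX; apply: bmeas2_mul => //; exact: bmeas2_2.
Qed.

Lemma kop_self B C f g : bmeas1 B f -> bmeas1 C g ->
  EX nu (fun x => f x * kop g x) = EX nu (fun x => kop f x * g x).
Proof.
move=> hf hg.
have e1 x : f x * kop g x = EX nu (fun y => f x * (k x y * g y)).
  rewrite EX_Z//; apply: (@bmeas1_L1 _ _ _ _ (1 * C)).
  exact: (bmeas1_mul (bmeas2_l x hk) hg).
rewrite (eq_EX _ e1) (@EX_swap _ _ _ _ (B * (1 * C))); last first.
  by apply: bmeas2_mul; [exact: bmeas2_1|apply: bmeas2_mul => //; exact: bmeas2_2].
apply: eq_EX => y; rewrite mulrC /kop -EX_Z.
  by apply: eq_EX => x; rewrite ks; ring.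
by apply: (@bmeas1_L1 _ _ _ _ (1 * B)); apply: bmeas1_mul hf; exact: (bmeas2_l y hk).
Qed.

Variable b : R.
Hypothesis hb : forall x, kdeg x <= b.

Lemma kdeg_ge0 x : 0 <= kdeg x. Proof. by have /andP[] := kdeg_bmeas.2 x. Qed.

Lemma kop_le B g x : bmeas1 B g -> kop g x <= b * B.
Proof.
move=> hg; have B0 : 0 <= B by have /andP[h1 h2] := hg.2 x; exact: le_trans h2.
apply: (@le_trans _ _ (EX nu (fun y => B * k x y))).
  apply: EX_le => [||y].
  - by apply: (@bmeas1_L1 _ _ _ _ (1 * B)); apply: bmeas1_mul hg; exact: (bmeas2_l x hk).
  - by apply: L1_Z; exact: (bmeas1_L1 _ (bmeas2_l x hk)).
  - by have /andP[h1 h2] := hg.2 y; have /andP[h3 h4] := hk.2 x y; nra.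
rewrite EX_Z; last exact: (bmeas1_L1 _ (bmeas2_l x hk)).
by rewrite mulrC ler_wpM2r//; exact: hb.
Qed.

Lemma kdeg_bmeasb : bmeas1 b kdeg.
Proof. by split; [exact: kdeg_bmeas.1|move=> x; rewrite kdeg_ge0/=]. Qed.

Lemma kop_bmeasb B g : bmeas1 B g -> bmeas1 (b * B) (kop g).
Proof.
move=> hg; split; first exact: (kop_bmeas hg).1.
by move=> x; rewrite kop_le// andbT; have /andP[] := (kop_bmeas hg).2 x.
Qed.

Lemma kmom_le n : 0 <= kmom n <= b ^+ n.
Proof. exact: (bmeas1_EX _ (bmeas1_X n kdeg_bmeasb)). Qed.

(** With [T] the operator [kop], walks with four edges weigh [<1, T^4 1>]; self-adjointness cuts
    them in the middle, into [|T^2 1|^2]. *)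
Lemma kwalk4 : EX nu (kop (kop (kop kdeg))) = EX nu (fun x => kop kdeg x ^+ 2).
Proof.
have n1 := kop_bmeas kdeg_bmeas; have n2 := kop_bmeas n1.
have c1 : bmeas1 1 (fun _ : T => 1 : R) by split=> // x; rewrite ler01 lexx.
rewrite -[LHS](_ : EX nu (fun x => 1 * kop (kop (kop kdeg)) x) = _); last first.
  by apply: eq_EX => x; rewrite mul1r.
rewrite (kop_self c1 n2) kop1 (kop_self kdeg_bmeas n1).
by apply: eq_EX => x; rewrite expr2.
Qed.

Lemma EX_kop_kdeg : EX nu (kop kdeg) = kmom 2.
Proof.
have c1 : bmeas1 1 (fun _ : T => 1 : R) by split=> // x; rewrite ler01 lexx.
rewrite -[LHS](_ : EX nu (fun x => 1 * kop kdeg x) = _); last first.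
  by apply: eq_EX => x; rewrite mul1r.
rewrite (kop_self c1 kdeg_bmeas) kop1.
by apply: eq_EX => x; rewrite expr2.
Qed.

(** Jensen's inequality for the square of [T^2 1], whose mean is the second moment of the
    degrees. *)
Lemma kwalk4_ge : kmom 2 ^+ 2 <= EX nu (kop (kop (kop kdeg))).
Proof.
rewrite kwalk4 -EX_kop_kdeg.
have n1 := kop_bmeas kdeg_bmeas.
have h : L2 nu (kop kdeg).
  apply: (L2_bounded _ n1.1 (M := 1)) => x; have /andP[h1 h2] := n1.2 x.
  by rewrite ger0_norm.
apply: le_trans (EX_abs_sq h); rewrite le_eqVlt; apply/orP; left; apply/eqP.
by congr (_ ^+ 2); apply: eq_EX => x; have /andP[h1 h2] := n1.2 x; rewrite ger0_norm.
Qed.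

Lemma kwalk4_le : EX nu (kop (kop (kop kdeg))) <= b ^+ 4.
Proof.
have n3 := kop_bmeasb (kop_bmeasb (kop_bmeasb kdeg_bmeasb)).
have /andP[_ h] := bmeas1_EX nu n3; apply: (le_trans h).
by rewrite !exprS expr0 mulr1 !mulrA.
Qed.

Lemma kwalk3_le : EX nu (kop (kop kdeg)) <= b ^+ 3.
Proof.
have n2 := kop_bmeasb (kop_bmeasb kdeg_bmeasb).
have /andP[_ h] := bmeas1_EX nu n2; apply: (le_trans h).
by rewrite !exprS expr0 mulr1 !mulrA.
Qed.

End symmetric_kernel.

(** * Occupation coefficients and degrees *)

Section random_graph_geometry.
Context (R : realType) (d : nat) (Hbar : R -> set (Rvec R d)) (l : R).
Hypothesis mH : measurable (Hbar l).
Hypothesis Hsym : Hbar l = [set vopp x | x in Hbar l].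
Implicit Types x y : Rvec R d.

Local Notation win := (@window R d).

Definition wadj x y : Prop := [/\ W x, W y & Hbar l (vsub x y)].

Definition kf x y : R := `[< wadj x y >]%:R.

Lemma vopp_vsub x y : vopp (vsub x y) = vsub y x.
Proof. by apply: eq_from_tnth => i; rewrite !tnth_mktuple opprB. Qed.

Lemma adj_sym x y : Hbar l (vsub x y) -> Hbar l (vsub y x).
Proof. by move=> h; rewrite Hsym; exists (vsub x y) => //; exact: vopp_vsub. Qed.

Lemma kf_sym x y : kf x y = kf y x.
Proof.
rewrite /kf; congr (nat_of_bool _)%:R; apply/asboolP/asboolP => -[h1 h2 h3];
  by split=> //; exact: adj_sym.
Qed.

Lemma measurable_wadj : measurable [set p : Rvec R d * Rvec R d | wadj p.1 p.2].
Proof.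
have mW := @measurable_cube R d 1.
rewrite (_ : [set p | _] = (fst @^-1` @W R d) `&` (snd @^-1` @W R d) `&` ((fun p => vsub p.1 p.2) @^-1` Hbar l)); last first.
  by apply/seteqP; split=> p /= => [[]|[[]]].
apply: measurableI; [apply: measurableI|]; rewrite -[X in measurable X]setTI.
- exact: measurable_fst.
- exact: measurable_snd.
- exact: (@measurable_vsub R d).
Qed.

Lemma kf_indic : (fun p : Rvec R d * Rvec R d => kf p.1 p.2) = \1_[set p | wadj p.1 p.2].
Proof.
by apply/funext => p; rewrite indicE /kf; congr (nat_of_bool _)%:R; apply/asboolP/idP;
  rewrite inE.
Qed.

Lemma kf_bmeas : bmeas2 1 kf.
Proof.
split; first by rewrite kf_indic; apply: measurable_indic; exact: measurable_wadj.
by move=> x y; rewrite /kf; case: asboolP; rewrite /= ?ler01 ?lexx.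
Qed.

Definition gdeg : Rvec R d -> R := kdeg win kf.
Definition gmom (r : nat) : R := kmom win kf r.

Lemma indic_asbool T (S : set T) t : \1_S t = `[< S t >]%:R :> R.
Proof. by rewrite indicE; congr (nat_of_bool _)%:R; apply/idP/asboolP; rewrite inE. Qed.

Let kf2 x y z u : kf x y * kf z u = `[< wadj x y /\ wadj z u >]%:R.
Proof. by rewrite /kf -natrM mulnb -asbool_and. Qed.

Lemma measurable_adj n (i j : 'I_n) :
  measurable [set t : n.-tuple (Rvec R d) | Hbar l (vsub (tnth t i) (tnth t j))].
Proof.
have h : measurable_fun setT (fun t : n.-tuple (Rvec R d) => (tnth t i, tnth t j)).
  by apply/measurable_fun_pairP; split; exact: measurable_tnth.
rewrite -[X in measurable X]setTI.
exact: (measurableT_comp (@measurable_vsub R d) h).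
Qed.

Let mI n (A B : set (n.-tuple (Rvec R d))) : measurable A -> measurable B ->
  measurable [set t | A t /\ B t].
Proof. by move=> mA mB; exact: measurableI. Qed.

Lemma ell_window n (S : set (n.-tuple (Rvec R d))) : measurable S ->
  ell (@Wpow R d n `&` S) = fine (tuple_measure win n (@Wpow R d n `&` S)).
Proof.
move=> mS; rewrite /ell -{1}(setIid (@Wpow R d n)) -setIA tuple_measure_window//.
by apply: measurableI => //; exact: measurable_Wpow.
Qed.

Let tW n (S : set (n.-tuple (Rvec R d))) : measurable S -> measurable (@Wpow R d n `&` S).
Proof. by move=> mS; apply: measurableI => //; exact: measurable_Wpow. Qed.

Let msec n (S : set (n.+1.-tuple (Rvec R d))) x : measurable S ->
  measurable [set t | S (tcons (x, t))].
Proof.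
move=> mS; rewrite -[X in measurable X]setTI.
exact: (measurableT_comp (@measurable_tcons _ _ n) (pair1_measurable x)).
Qed.

Let tuple2 (S : set (2.-tuple (Rvec R d))) : measurable S ->
  fine (tuple_measure win 2 S) = EX win (fun x => EX win (fun y => `[< S [tuple x; y] >]%:R)).
Proof.
move=> mS; rewrite (EX_window_tupleS mS); apply: eq_EX => x.
rewrite (EX_window_tupleS (msec x mS)); apply: eq_EX => y; rewrite window_tuple0 indic_asbool/=.
by congr (nat_of_bool (asbool (S _)))%:R; exact/val_inj.
Qed.

Let tuple3 (S : set (3.-tuple (Rvec R d))) : measurable S ->
  fine (tuple_measure win 3 S) =
  EX win (fun x => EX win (fun y => EX win (fun z => `[< S [tuple x; y; z] >]%:R))).
Proof.
move=> mS; rewrite (EX_window_tupleS mS); apply: eq_EX => x.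
rewrite (tuple2 (msec x mS)).
apply: eq_EX => y; apply: eq_EX => z /=.
by congr (nat_of_bool (asbool (S _)))%:R; exact/val_inj.
Qed.

Let tuple4 (S : set (4.-tuple (Rvec R d))) : measurable S ->
  fine (tuple_measure win 4 S) =
  EX win (fun x => EX win (fun y => EX win (fun z => EX win (fun u =>
    `[< S [tuple x; y; z; u] >]%:R)))).
Proof.
move=> mS; rewrite (EX_window_tupleS mS); apply: eq_EX => x.
rewrite (tuple3 (msec x mS)).
apply: eq_EX => y; apply: eq_EX => z; apply: eq_EX => u /=.
by congr (nat_of_bool (asbool (S _)))%:R; exact/val_inj.
Qed.

Let tuple5 (S : set (5.-tuple (Rvec R d))) : measurable S ->
  fine (tuple_measure win 5 S) =
  EX win (fun x => EX win (fun y => EX win (fun z => EX win (fun u => EX win (fun v =>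
    `[< S [tuple x; y; z; u; v] >]%:R))))).
Proof.
move=> mS; rewrite (EX_window_tupleS mS); apply: eq_EX => x.
rewrite (tuple4 (msec x mS)).
apply: eq_EX => y; apply: eq_EX => z; apply: eq_EX => u; apply: eq_EX => v /=.
by congr (nat_of_bool (asbool (S _)))%:R; exact/val_inj.
Qed.

Let L1kf x : L1 win (kf x).
Proof. exact: (bmeas1_L1 _ (bmeas2_l x kf_bmeas)). Qed.

Let EXkZ (c : R) x : EX win (fun y => c * kf x y) = c * gdeg x.
Proof. exact: EX_Z. Qed.

Let WpowP n (s : seq (Rvec R d)) (h : size s == n) :
  Wpow (Tuple h) <-> forall x, x \in s -> W x.
Proof.
split=> [H x xs|H i].
  have xi : (index x s < n)%N by rewrite -(eqP h) index_mem.
  have := H (Ordinal xi); rewrite (tnth_nth x)/= nth_index//.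
by apply: H; exact: (mem_tnth i (Tuple h)).
Qed.

Lemma ell_H0 : ell (@Wpow R d 2 `&` H0 Hbar l) = gmom 1.
Proof.
have mS : measurable (H0 Hbar l) by exact: measurable_adj.
rewrite (ell_window mS) (tuple2 (tW mS)).
apply: eq_EX => x; rewrite expr1; apply: eq_EX => y.
congr (nat_of_bool _)%:R; apply: asbool_equiv_eq.
rewrite /H0 /adj/= (_ : tnth _ 0 = x)// (_ : tnth _ 1 = y)//.
split=> [[/WpowP h1 h2]|[h1 h2 h3]].
  by split=> //; apply: h1; rewrite !inE eqxx ?orbT.
split=> //; apply/WpowP => z; rewrite !inE => /orP[]/eqP ->//.
Qed.

Lemma ell_H1 : ell (@Wpow R d 3 `&` H1 Hbar l) = gmom 2.
Proof.
have mS : measurable (H1 Hbar l) by apply: mI; exact: measurable_adj.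
rewrite (ell_window mS) (tuple3 (tW mS)).
apply: eq_EX => x; rewrite expr2 -EXkZ; apply: eq_EX => y.
rewrite mulrC -EXkZ; apply: eq_EX => z; rewrite kf2.
congr (nat_of_bool _)%:R; apply: asbool_equiv_eq.
rewrite /H1 /adj/= (_ : tnth _ 0 = x)// (_ : tnth _ 1 = y)// (_ : tnth _ 2 = z)//.
split=> [[/WpowP h1 [h2 h3]]|[[h1 h2 h3] [h4 h5 h6]]].
  by split; split=> //; apply: h1; rewrite !inE eqxx ?orbT.
split=> //; apply/WpowP => t; rewrite !inE => /or3P[]/eqP ->//.
Qed.

Let kf4 x y z u v w a b : kf x y * kf z u * (kf v w * kf a b) =
  `[< (wadj x y /\ wadj z u) /\ (wadj v w /\ wadj a b) >]%:R.
Proof. by rewrite !kf2 -natrM mulnb -asbool_and. Qed.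

Lemma ell_H2 : ell (@Wpow R d 5 `&` H2 Hbar l) = gmom 4.
Proof.
have mS : measurable (H2 Hbar l).
  rewrite (_ : H2 Hbar l = [set t | (adj Hbar l (tnth t 0) (tnth t 1) /\ adj Hbar l (tnth t 0) (tnth t 2))
     /\ (adj Hbar l (tnth t 0) (tnth t 3) /\ adj Hbar l (tnth t 0) (tnth t 4))]).
    by apply: mI; apply: mI; exact: measurable_adj.
  by apply/seteqP; split=> t [] => [? ? ? ?|[? ?] [? ?]].
rewrite (ell_window mS) (tuple5 (tW mS)).
apply: eq_EX => x; rewrite (_ : _ ^+ 4 = gdeg x ^+ 3 * gdeg x); last by rewrite -exprSr.
rewrite -EXkZ; apply: eq_EX => y.
rewrite (_ : _ * _ = (kf x y * gdeg x ^+ 2) * gdeg x); last by ring.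
rewrite -EXkZ; apply: eq_EX => z.
rewrite (_ : _ * _ = (kf x y * kf x z * gdeg x) * gdeg x); last by ring.
rewrite -EXkZ; apply: eq_EX => u.
rewrite (_ : _ * _ = (kf x y * kf x z * kf x u) * gdeg x); last by ring.
rewrite -EXkZ; apply: eq_EX => v.
rewrite -[X in _ = X]mulrA kf4.
congr (nat_of_bool _)%:R; apply: asbool_equiv_eq.
rewrite /H2 /adj/= (_ : tnth _ 0 = x)// (_ : tnth _ 1 = y)// (_ : tnth _ 2 = z)//.
rewrite (_ : tnth _ 3 = u)// (_ : tnth _ 4 = v)//.
split=> [[/WpowP h1 [h2 h3 h4 h5]]|[[[h1 h2 h3] [h4 h5 h6]] [[g1 g2 g3] [g4 g5 g6]]]].
  by do !split=> //; apply: h1; rewrite !inE eqxx ?orbT.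
split=> //; apply/WpowP => t; rewrite !inE => /or4P[|||/orP[]]/eqP ->//.
Qed.

Let n0 : bmeas1 1 gdeg. Proof. exact: kdeg_bmeas kf_bmeas. Qed.
Let n1 : bmeas1 1 (kop win kf gdeg). Proof. exact: kop_bmeas kf_bmeas _ _ n0. Qed.
Let n2 : bmeas1 1 (kop win kf (kop win kf gdeg)). Proof. exact: kop_bmeas kf_bmeas _ _ n1. Qed.

Let EX_kop (c : R) g x : bmeas1 1 g -> EX win (fun y => c * (kf x y * g y)) = c * kop win kf g x.
Proof.
move=> hg; apply: EX_Z; apply: (@bmeas1_L1 _ _ _ win (1 * 1)).
by apply: bmeas1_mul => //; exact: (bmeas2_l x kf_bmeas).
Qed.

Let path3 : set (4.-tuple (Rvec R d)) := [set t | (adj Hbar l (tnth t 0) (tnth t 1)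
  /\ adj Hbar l (tnth t 1) (tnth t 2)) /\ adj Hbar l (tnth t 2) (tnth t 3)].

Let mpath3 : measurable path3.
Proof. by apply: mI; [apply: mI|]; exact: measurable_adj. Qed.

Let kf3 x y z u v w : kf x y * kf z u * kf v w =
  `[< (wadj x y /\ wadj z u) /\ wadj v w >]%:R.
Proof. by rewrite kf2 -natrM mulnb -asbool_and. Qed.

Let ell_path3 : ell (@Wpow R d 4 `&` path3) = EX win (kop win kf (kop win kf gdeg)).
Proof.
rewrite (ell_window mpath3) (tuple4 (tW mpath3)).
apply: eq_EX => x; apply: eq_EX => y; rewrite -EX_kop//; apply: eq_EX => z.
rewrite mulrA -EXkZ; apply: eq_EX => u; rewrite kf3.
congr (nat_of_bool _)%:R; apply: asbool_equiv_eq.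
rewrite /path3 /adj/= (_ : tnth _ 0 = x)// (_ : tnth _ 1 = y)// (_ : tnth _ 2 = z)//.
rewrite (_ : tnth _ 3 = u)//.
split=> [[/WpowP h1 [[h2 h3] h4]]|[[[h1 h2 h3] [h4 h5 h6]] [g1 g2 g3]]].
  by do !split=> //; apply: h1; rewrite !inE eqxx ?orbT.
split=> //; apply/WpowP => t; rewrite !inE => /or4P[|||]/eqP ->//.
Qed.

(** Without its closing edge a four-cycle is a path with three edges. Only an upper bound is
    possible in general, since the graph may contain very few four-cycles. *)
Lemma ell_H3_le : ell (@Wpow R d 4 `&` H3 Hbar l) <= EX win (kop win kf (kop win kf gdeg)).
Proof.
have mS : measurable (H3 Hbar l).
  rewrite (_ : H3 Hbar l = [set t | path3 t /\ adj Hbar l (tnth t 3) (tnth t 0)]).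
    by apply: mI => //; exact: measurable_adj.
  by apply/seteqP; split=> t [] => [? ? ? ?|[[? ?] ?] ?].
have fin (S : set (4.-tuple (Rvec R d))) : measurable S -> tuple_measure win 4 S \is a fin_num.
  move=> mS'; rewrite ge0_fin_numE ?measure_ge0//; apply: (@le_lt_trans _ _ 1%E); last by rewrite ltry.
  by rewrite -(tuple_prob_setT win 4) le_measure// inE.
rewrite -ell_path3 (ell_window mS) (ell_window mpath3).
apply: (fine_le (fin _ (tW mS)) (fin _ (tW mpath3))).
apply: le_measure; [exact: (mem_set (tW mS))|exact: (mem_set (tW mpath3))|].
by move=> t [h1 [h2 h3 h4 h5]].
Qed.

Lemma ell_H4 : ell (@Wpow R d 5 `&` H4 Hbar l) = EX win (kop win kf (kop win kf (kop win kf gdeg))).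
Proof.
have mS : measurable (H4 Hbar l).
  rewrite (_ : H4 Hbar l = [set t | (adj Hbar l (tnth t 0) (tnth t 1) /\ adj Hbar l (tnth t 1) (tnth t 2))
     /\ (adj Hbar l (tnth t 2) (tnth t 3) /\ adj Hbar l (tnth t 3) (tnth t 4))]).
    by apply: mI; apply: mI; exact: measurable_adj.
  by apply/seteqP; split=> t [] => [? ? ? ?|[? ?] [? ?]].
rewrite (ell_window mS) (tuple5 (tW mS)).
apply: eq_EX => x; apply: eq_EX => y; rewrite -(EX_kop _ _ n1); apply: eq_EX => z.
rewrite mulrA -(EX_kop _ _ n0); apply: eq_EX => u.
rewrite mulrA -EXkZ; apply: eq_EX => v.
rewrite -[X in _ = X]mulrA kf4.
congr (nat_of_bool _)%:R; apply: asbool_equiv_eq.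
rewrite /H4 /adj/= (_ : tnth _ 0 = x)// (_ : tnth _ 1 = y)// (_ : tnth _ 2 = z)//.
rewrite (_ : tnth _ 3 = u)// (_ : tnth _ 4 = v)//.
split=> [[/WpowP h1 [h2 h3 h4 h5]]|[[[h1 h2 h3] [h4 h5 h6]] [[g1 g2 g3] [g4 g5 g6]]]].
  by do !split=> //; apply: h1; rewrite !inE eqxx ?orbT.
split=> //; apply/WpowP => t; rewrite !inE => /or4P[|||/orP[]]/eqP ->//.
Qed.

Hypothesis d_gt0 : (0 < d)%N.

Let lebfin (A : set (Rvec R d)) (a : R) : measurable A -> (0 <= a) ->
  leb R d (A `&` box a) \is a fin_num.
Proof.
move=> mA a0; have mb := @measurable_box R d a.
rewrite ge0_fin_numE ?measure_ge0//; apply: (@le_lt_trans _ _ (leb R d (box a))).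
  by apply: le_measure; rewrite ?inE//; exact: measurableI.
by rewrite leb_box// ltry.
Qed.

Let c2E : @cube R d (2 ^+ d) = box 1.
Proof. by rewrite cubeE// mulVf. Qed.

Let c4E : @cube R d (2 ^+ d)^-1 = box 4^-1.
Proof. by rewrite -exprVn cubeE//; congr box; field. Qed.

(** The substitution [z = x - y] shows the degree as the measure of [Hbar l] cut by the translate
    [x - W]; the coefficients [psi_hat] and [psi_check] bound it because this translate lies between
    two cubes centred at the origin. *)
Let gdegE x : W x -> gdeg x = fine (leb R d (Hbar l `&` [set z | W (vsub x z)])).
Proof.
move=> Wx; rewrite /gdeg /kdeg.
have mS : measurable [set y | wadj x y].
  rewrite -[X in measurable X]setTI.
  exact: (pair1_measurable x measurableT measurable_wadj).
rewrite (eq_EX win (g := \1_[set y | wadj x y])); last by move=> y; rewrite indic_asbool.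
rewrite /EX integral_indic// setIT /= /window /mrestr; congr fine.
have mZ : measurable (Hbar l `&` [set z | W (vsub x z)]).
  apply: measurableI => //; rewrite -[X in measurable X]setTI.
  by apply: measurable_vsubr => //; exact: measurable_cube.
rewrite -[RHS](leb_vsub x mZ); congr (leb R d _); apply/seteqP; split=> y /=.
  by rewrite vsubK => -[[]].
by rewrite vsubK => -[].
Qed.

Lemma gdeg_out x : ~ W x -> gdeg x = 0.
Proof.
move=> Wx; rewrite /gdeg /kdeg (eq_EX win (g := fun=> 0)) ?EX_cst// => y.
by rewrite /kf; case: asboolP => // -[].
Qed.

(** For [x] in the window, [x - W] lies in [[-1, 1]^d], which is the cube of volume [2^d]. *)
Lemma gdeg_le x : gdeg x <= psi_hat Hbar l.
Proof.
have mZ y : measurable (Hbar l `&` [set z | W (vsub y z)]).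
  apply: measurableI => //; rewrite -[X in measurable X]setTI.
  by apply: measurable_vsubr => //; exact: measurable_cube.
have [Wx|Wx] := pselect (W x); last by rewrite gdeg_out// fine_ge0.
have sub : Hbar l `&` [set z | W (vsub x z)] `<=` Hbar l `&` box 1.
  move=> z [h1 h2]; split=> // i; move: (h2 i) (Wx i).
  by rewrite tnth_mktuple powR1; lra.
rewrite gdegE// /psi_hat c2E; apply: fine_le; last 1 first.
- apply: le_measure; rewrite ?inE//; apply: measurableI => //; exact: measurable_box.
- rewrite (_ : _ `&` _ = (Hbar l `&` [set z | W (vsub x z)]) `&` box 1); first exact: lebfin.
  by apply/esym/setIidl => z /sub[].
- exact: lebfin.
Qed.

Let gdeg_ge x : @cube R d (2 ^+ d)^-1 x -> psi_check Hbar l <= gdeg x.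
Proof.
rewrite c4E => hx.
have Wx : W x by rewrite /W cube1E => i; have := hx i; lra.
have mZ : measurable (Hbar l `&` [set z | W (vsub x z)]).
  apply: measurableI => //; rewrite -[X in measurable X]setTI.
  by apply: measurable_vsubr => //; exact: measurable_cube.
have sub : Hbar l `&` [set z | W (vsub x z)] `<=` Hbar l `&` box 1.
  move=> z [h1 h2]; split=> // i; move: (h2 i) (Wx i).
  by rewrite tnth_mktuple powR1; lra.
rewrite gdegE// /psi_check c4E; apply: fine_le; first exact: lebfin.
- rewrite (_ : _ `&` _ = (Hbar l `&` [set z | W (vsub x z)]) `&` box 1); first exact: lebfin.
  by apply/esym/setIidl => z /sub[].
- apply: le_measure; rewrite ?inE//; first by apply: measurableI => //; exact: measurable_box.
  move=> z [h1 h2]; split=> // i; rewrite tnth_mktuple powR1.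
  by have := h2 i; have := hx i; lra.
Qed.

Lemma gdeg_ge0 x : 0 <= gdeg x. Proof. exact: kdeg_ge0 kf_bmeas x. Qed.

Lemma gmom_bounds n : 0 <= gmom n <= psi_hat Hbar l ^+ n.
Proof. exact: kmom_le kf_bmeas _ gdeg_le n. Qed.

(** The prefactor is the volume of the inner cube, on which the degree is bounded below; elsewhere
    it is only non-negative. *)
Lemma gmom_ge n : (2 ^+ d)^-1 * psi_check Hbar l ^+ n <= gmom n.
Proof.
have pc0 : 0 <= psi_check Hbar l by rewrite fine_ge0.
have mc := @measurable_cube R d (2 ^+ d)^-1.
have e : (2 ^+ d)^-1 = EX win (\1_(@cube R d (2 ^+ d)^-1)).
  rewrite /EX integral_indic// setIT /= /window /mrestr.
  rewrite (_ : _ `&` _ = box 4^-1); first by rewrite leb_box//= -exprVn; congr (_ ^+ _); field.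
  rewrite c4E cube1E; apply: setIidl => x h i; have := h i; lra.
have L1c : L1 win (\1_(@cube R d (2 ^+ d)^-1)).
  by apply: (L1_bounded _ _ (M := 1)) => // x; rewrite indicE; case: (_ \in _); rewrite ?normr1 ?normr0.
rewrite e mulrC -EX_Z//; apply: EX_le; first exact: L1_Z.
  exact: (bmeas1_L1 _ (bmeas1_X n n0)).
move=> x; rewrite indicE; case: (boolP (_ \in _)) => [/set_mem h|_].
  by rewrite mulr1 lerXn2r ?nnegrE ?gdeg_ge0// gdeg_ge.
by rewrite mulr0 exprn_ge0// gdeg_ge0.
Qed.

Lemma psi_check_le : psi_check Hbar l <= psi Hbar l.
Proof.
rewrite /psi_check /psi c4E cube1E; apply: fine_le; [exact: lebfin|exact: lebfin|].
apply: le_measure; rewrite ?inE; [by apply: measurableI => //; exact: measurable_box|by apply: measurableI => //; exact: measurable_box|].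
by move=> z [h1 h2]; split=> // i; have := h2 i; lra.
Qed.

Lemma psi_le_hat : psi Hbar l <= psi_hat Hbar l.
Proof.
rewrite /psi_hat /psi c2E cube1E; apply: fine_le; [exact: lebfin|exact: lebfin|].
apply: le_measure; rewrite ?inE; [by apply: measurableI => //; exact: measurable_box|by apply: measurableI => //; exact: measurable_box|].
by move=> z [h1 h2]; split=> // i; have := h2 i; lra.
Qed.

Lemma psi_gt0 : (0 < leb R d (Hbar l `&` cube 1))%E -> 0 < psi Hbar l.
Proof.
move=> h; rewrite /psi; apply: fine_gt0; rewrite h/= cube1E.
by rewrite -ge0_fin_numE ?measure_ge0// lebfin.
Qed.

Lemma ell_H4_bounds : gmom 2 ^+ 2 <= ell (@Wpow R d 5 `&` H4 Hbar l) <= psi_hat Hbar l ^+ 4.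
Proof.
rewrite ell_H4; apply/andP; split.
  exact: (kwalk4_ge win kf_bmeas kf_sym).
exact: (kwalk4_le kf_bmeas gdeg_le).
Qed.

Lemma ell_H3_bound : ell (@Wpow R d 4 `&` H3 Hbar l) <= psi_hat Hbar l ^+ 3.
Proof. exact: (le_trans ell_H3_le (kwalk3_le kf_bmeas gdeg_le)). Qed.

End random_graph_geometry.

(** * Counts of a Poisson measure *)

Section ae_integrals.
Context d (T : measurableType d) (R : realType) (P : {measure set T -> \bar R}).
Implicit Types f g : T -> \bar R.
Import HBNNSimple.

(** Neither function is assumed measurable: [Fsum] is only known to agree almost surely with a
    measurable function. The integral is handled as a supremum over simple functions, and each of
    them is cut off on the null set. *)
Let ge0_integral_ae_le (N : set T) f g : measurable N -> P N = 0%E ->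
  (forall w, 0 <= f w)%E -> (forall w, 0 <= g w)%E -> (forall w, ~ N w -> f w = g w) ->
  (\int[P]_w f w <= \int[P]_w g w)%E.
Proof.
move=> mN PN f0 g0 fg; rewrite !ge0_integralTE//.
apply: ge_ereal_sup => _ [h /= hf <-].
pose h' := proj_nnsfun h (measurableC mN).
have -> : sintegral P h = sintegral P h'.
  rewrite -!integralT_nnsfun; apply: ge0_ae_eq_integral => //.
  - by apply/measurable_EFinP.
  - by apply/measurable_EFinP.
  - by move=> x _; rewrite lee_fin.
  - by move=> x _; rewrite lee_fin.
  exists N; split=> // w /= hw; apply: contrapT => Nw; apply: hw => _.
  by rewrite mindicE mem_set// mulr1.
apply: ereal_sup_ubound; exists h' => //= w.
rewrite mindicE; case: (boolP (w \in _)) => [/set_mem Nw|_].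
  by rewrite mulr1 -fg.
by rewrite mulr0.
Qed.

Lemma integral_ae (N : set T) f g : measurable N -> P N = 0%E ->
  (forall w, ~ N w -> f w = g w) -> (\int[P]_w f w = \int[P]_w g w)%E.
Proof.
move=> mN PN fg.
have pos f1 g1 : (forall w, ~ N w -> f1 w = g1 w) ->
    (forall w, 0 <= f1 w)%E -> (forall w, 0 <= g1 w)%E ->
    (\int[P]_w f1 w = \int[P]_w g1 w)%E.
  move=> h f0 g0; apply/eqP; rewrite eq_le.
  by apply/andP; split; apply: (ge0_integral_ae_le mN PN) => // w Nw; rewrite h.
rewrite (integralE P setT f) (integralE P setT g).
by congr (_ - _)%E; apply: pos => // w Nw; rewrite ?funeposE ?funenegE fg.
Qed.

End ae_integrals.

Section ae_expectation.
Context d (T : measurableType d) (R : realType) (P : probability T R).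
Implicit Types f g : T -> R.

Lemma EX_ae (N : set T) f g : measurable N -> P N = 0%E ->
  (forall w, ~ N w -> f w = g w) -> EX P f = EX P g.
Proof. by move=> mN PN fg; congr fine; apply: (integral_ae mN PN) => w Nw; rewrite fg. Qed.

Lemma L1_ae (N : set T) f g : measurable N -> P N = 0%E ->
  (forall w, ~ N w -> f w = g w) -> measurable_fun setT g -> L1 P f -> L1 P g.
Proof.
move=> mN PN fg mg /integrableP[_ h]; apply/integrableP; split; first exact/measurable_EFinP.
by rewrite -(integral_ae (P := P) (f := fun x => `|(f x)%:E|%E) mN PN)// => w Nw; rewrite /= fg.
Qed.

End ae_expectation.

Section poisson_counts.
Context (R : realType) (d : nat) d' (Omega : measurableType d') (P : probability Omega R).
Variables (mu : {measure set (Rvec R d) -> \bar R})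
  (eta : Omega -> {measure set (Rvec R d) -> \bar R}).
Hypothesis hp : is_poisson_measure P mu eta.
Implicit Types (A B : set (Rvec R d)) (w : Omega).

(* The number of points in [B]; like [fine], it is [0] when there are
   infinitely many. *)
Definition cnt B w : nat := xget 0%N [set n | eta w B = n%:R%:E].

Lemma fine_cnt B w : measurable B -> fine (eta w B) = (cnt B w)%:R.
Proof.
move=> mB; have [h|[n hn]] := poisson_integer hp w mB.
  by rewrite h /cnt xgetPN// => n /=; rewrite h.
have : [set k | eta w B = k%:R%:E] (cnt B w) by apply: (@xgetPex _ 0%N); exists n.
by move=> /= ->.
Qed.

Lemma cnt_fin B w : measurable B -> (eta w B < +oo)%E -> eta w B = (cnt B w)%:R%:E.
Proof.
by move=> mB fB; rewrite -fine_cnt// fineK// ge0_fin_numE.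
Qed.

Lemma measurable_cnt B : measurable B -> measurable_fun setT (fun w => (cnt B w)%:R : R).
Proof.
move=> mB; rewrite (_ : (fun w => _) = fine \o (eta ^~ B)); last first.
  by apply/funext => w /=; rewrite fine_cnt.
apply: (measurableT_comp (@fine_measurable R setT measurableT)).
exact: poisson_measurable hp B mB.
Qed.

Lemma measurable_cnt_eq B n : measurable B -> measurable [set w | cnt B w = n].
Proof.
move=> mB; rewrite (_ : [set w | _] = (fun w => (cnt B w)%:R : R) @^-1` [set n%:R]).
  rewrite -[X in measurable X]setTI; exact: (measurable_cnt mB).
by apply/seteqP; split=> w /=; [move=> ->|move=> /eqP; rewrite eqr_nat => /eqP].
Qed.

Let mpre B (C : set \bar R) : measurable B -> measurable C -> measurable [set w | C (eta w B)].
Proof.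
by move=> mB mC; rewrite -[X in measurable X]setTI; exact: (poisson_measurable hp mB).
Qed.

(** The events [eta w B = n] are disjoint and their Poisson probabilities add up to 1. *)
Lemma eta_fin_ae B : measurable B -> (mu B < +oo)%E -> P [set w | eta w B = +oo%E] = 0%E.
Proof.
move=> mB fB; pose F n := [set w | eta w B = n%:R%:E].
have mF n : measurable (F n) by apply: (mpre (C := [set n%:R%:E])).
have tF : trivIset setT F.
  apply/trivIsetP => i j _ _ ij; apply/seteqP; split=> // w [] /=; rewrite /F/= => -> [/eqP].
  by rewrite eqr_nat (negbTE ij).
have PU : P (\bigcup_n F n) = 1%E.
  rewrite measure_semi_bigcup//; last exact: bigcup_measurable.
  rewrite (eq_eseriesr (g := fun n => poisson_prob (fine (mu B)) 0%N [set n])); last first.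
    by move=> n _; exact: (poisson_law hp mB fB).
  rewrite -(probability_setT (poisson_prob (fine (mu B)) 0%N)).
  rewrite -measure_semi_bigcup//; last first.
    by apply/trivIsetP => i j _ _ ij; apply/seteqP; split=> // n [/= -> /eqP]; rewrite (negbTE ij).
  by congr (poisson_prob _ _ _); apply/seteqP; split=> // n _; exists n.
have -> : [set w | eta w B = +oo%E] = ~` (\bigcup_n F n).
  apply/seteqP; split=> w /=; first by move=> h [n _]; rewrite /F/= h.
  by move=> h; have [//|[n hn]] := poisson_integer hp w mB; case: h; exists n.
by rewrite probability_setC ?PU ?subee//; exact: bigcup_measurable.
Qed.

Lemma cnt_law B n : measurable B -> (mu B < +oo)%E ->
  P [set w | cnt B w = n] = (pois (fine (mu B)) n)%:E.
Proof.
move=> mB fB.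
have -> : (pois (fine (mu B)) n)%:E = P [set w | eta w B = n%:R%:E].
  rewrite (poisson_law hp)// /pois fineK// ge0_fin_numE//.
  by apply: (@le_lt_trans _ _ 1%E); [exact: probability_le1|rewrite ltry].
have mi : measurable [set w | eta w B = +oo%E] by apply: (mpre (C := [set +oo%E])).
have mn : measurable [set w | eta w B = n%:R%:E] by apply: (mpre (C := [set n%:R%:E])).
have mc := measurable_cnt_eq n mB.
apply/eqP; rewrite eq_le; apply/andP; split.
  apply: (@le_trans _ _ (P ([set w | eta w B = n%:R%:E] `|` [set w | eta w B = +oo%E]))).
    apply: le_measure; rewrite ?inE//; first exact: measurableU.
    move=> w /= h; have [->|[k hk]] := poisson_integer hp w mB; first by right.
    left; rewrite cnt_fin//; first by rewrite h.
    by rewrite hk ltry.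
  have e := eta_fin_ae mB fB.
  apply: (@le_trans _ _ (P [set w | eta w B = n%:R%:E] + P [set w | eta w B = +oo%E])%E).
    exact: measureU2.
  by rewrite e adde0.
apply: le_measure; rewrite ?inE// => w /= h; apply/eqP.
by rewrite -(eqr_nat R) -fine_cnt// h.
Qed.

Lemma poisson_family_counts (I : finType) (D : I -> set (Rvec R d)) :
  (forall i, measurable (D i)) -> (forall i, mu (D i) < +oo)%E -> trivIset setT D ->
  poisson_family P (fun i => fine (mu (D i))) (fun w => [ffun i => cnt (D i) w]).
Proof.
move=> mD fD tD; split.
- by move=> i; rewrite fine_ge0.
- move=> v; rewrite (_ : [set w | _] = \bigcap_(i in [set: I]) [set w | cnt (D i) w = v i]).
    by apply: fin_bigcap_measurable => // i _; exact: measurable_cnt_eq.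
  apply/seteqP; split=> w /= => [<- i _|h]; first by rewrite /= ffunE.
  by apply/ffunP => i; rewrite ffunE; exact: h.
move=> v.
pose B (k : 'I_#|I|) := D (enum_val k).
have tB : trivIset setT B.
  apply/trivIsetP => i j _ _ ij; have /trivIsetP := tD; apply => //.
  by apply: contra ij => /eqP/enum_val_inj ->.
have := poisson_independent hp (fun k => mD (enum_val k)) tB.
pose C (k : 'I_#|I|) : set \bar R := fine @^-1` [set (v (enum_val k))%:R].
move=> /(_ C) h.
have -> : [set w | [ffun i => cnt (D i) w] = v] = [set w | forall k, C k (eta w (B k))].
  apply/seteqP; split=> w /=.
    move=> E k; have Ek : cnt (B k) w = v (enum_val k) by rewrite -E ffunE.
    by rewrite /C /preimage /= (fine_cnt _ (mD _)) Ek.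
  move=> E; apply/ffunP => i; rewrite ffunE; apply/eqP.
  by have := E (enum_rank i); rewrite /C/preimage/= (fine_cnt _ (mD _)) /B enum_rankK => /eqP; rewrite eqr_nat.
rewrite h; last first.
  move=> k; rewrite -[X in measurable X]setTI.
  exact: (@fine_measurable R setT measurableT).
rewrite (eq_bigr (fun k => (pois (fine (mu (B k))) (v (enum_val k)))%:E)) => [|k _]; last first.
  rewrite -(cnt_law _ (mD _) (fD _)); congr (P _); apply/seteqP; split=> w;
    rewrite /preimage/C/= (fine_cnt _ (mD _)).
    by move=> /eqP; rewrite eqr_nat => /eqP.
  by move=> ->.
rewrite prodEFin; congr EFin.
rewrite (reindex (@enum_val I predT))/=; last first.
  by exists enum_rank => k _; [exact: enum_valK|exact: enum_rankK].
by [].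
Qed.

Definition ccnt B w : R := (cnt B w)%:R - fine (mu B).

Lemma cntU A B w : measurable A -> measurable B -> A `&` B = set0 ->
  eta w (A `|` B) <> +oo%E -> (cnt (A `|` B) w = cnt A w + cnt B w)%N.
Proof.
move=> mA mB AB h; have mU := measurableU _ _ mA mB.
have fU : (eta w (A `|` B) < +oo)%E by rewrite ltey; exact/eqP.
have fA : (eta w A < +oo)%E by apply: le_lt_trans fU; rewrite le_measure ?inE//; exact: subsetUl.
have fB : (eta w B < +oo)%E by apply: le_lt_trans fU; rewrite le_measure ?inE//; exact: subsetUr.
have eU : eta w (A `|` B) = (eta w A + eta w B)%E by exact: measureU.
have := cnt_fin mU fU; rewrite eU (cnt_fin mA fA) (cnt_fin mB fB) -EFinD -natrD => -[/eqP].
by rewrite eqr_nat => /eqP.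
Qed.

(** Additivity may fail where the count is infinite, because [cnt] is 0 there; such configurations
    form a null set. *)
Lemma cnt_add_ae A B : measurable A -> measurable B -> A `&` B = set0 ->
  (mu (A `|` B) < +oo)%E -> exists N, [/\ measurable N, P N = 0%E &
  forall w, ~ N w -> (cnt (A `|` B) w = cnt A w + cnt B w)%N].
Proof.
move=> mA mB AB h; exists [set w | eta w (A `|` B) = +oo%E]; split.
- by apply: (mpre (C := [set +oo%E])) => //; exact: measurableU.
- by rewrite eta_fin_ae//; exact: measurableU.
- by move=> w Nw; exact: cntU.
Qed.

Let le_mu A B : measurable A -> measurable B -> A `<=` B -> (mu B < +oo)%E -> (mu A < +oo)%E.
Proof. by move=> mA mB AB; apply: le_lt_trans; rewrite le_measure ?inE. Qed.

(** Over the three disjoint pieces of [A] and [B] the counts form an independent Poisson family, and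
    only the common piece is correlated with itself. *)
Lemma EX_ccnt_mul A B : measurable A -> measurable B ->
  (mu A < +oo)%E -> (mu B < +oo)%E ->
  L1 P (fun w => ccnt A w * ccnt B w) /\
  EX P (fun w => ccnt A w * ccnt B w) = fine (mu (A `&` B)).
Proof.
move=> mA mB fA fB.
pose D (i : 'I_3) := if i == 0 then A `\` B else if i == 1 then A `&` B else B `\` A.
have mD i : measurable (D i).
  by rewrite /D; case: ifP => _; [|case: ifP => _]; [exact: measurableD|exact: measurableI|exact: measurableD].
have fD i : (mu (D i) < +oo)%E.
  rewrite /D; case: ifP => _; [|case: ifP => _].
  - exact: (le_mu (measurableD mA mB) mA _ fA).
  - exact: (le_mu (measurableI _ _ mA mB) mA _ fA).
  - exact: (le_mu (measurableD mB mA) mB _ fB).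
have AE : A = D 0 `|` D 1 by rewrite /D/= setUC setUIDK.
have BE : B = D 1 `|` D (2%:R) by rewrite /D/= setIC setUIDK.
have tD : trivIset setT D.
  apply/trivIsetP => i j _ _; rewrite /D.
  case: i => [[|[|[|]]]]//= ?; case: j => [[|[|[|]]]]//= ? _; apply/seteqP; split=> // x [] /= [? ?] [? ?]//.
have pK := poisson_family_counts mD fD tD.
set K := (fun w => _) in pK; set m := (fun i => _) in pK.
have D01 : D 0 `&` D 1 = set0 by have /trivIsetP := tD; apply.
have D12 : D 1 `&` D (2%:R) = set0 by have /trivIsetP := tD; apply.
have [N1 [mN1 PN1 h1]] := cnt_add_ae (mD 0) (mD 1) D01 ltac:(by rewrite -AE).
have [N2 [mN2 PN2 h2]] := cnt_add_ae (mD 1) (mD 2%:R) D12 ltac:(by rewrite -BE).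
rewrite -AE in h1; rewrite -BE in h2.
have mA' : fine (mu A) = m 0 + m 1.
  have eU : mu (D 0%R `|` D 1%R) = (mu (D 0%R) + mu (D 1%R))%E by exact: measureU.
  by rewrite {1}AE eU fineD// ge0_fin_numE.
have mB' : fine (mu B) = m 1 + m 2%:R.
  have eU : mu (D 1%R `|` D 2%:R%R) = (mu (D 1%R) + mu (D 2%:R%R))%E by exact: measureU.
  by rewrite {1}BE eU fineD// ge0_fin_numE.
pose G (v : {ffun 'I_3 -> nat}) := (Nt m 0 v + Nt m 1 v) * (Nt m 1 v + Nt m 2%:R v).
have mN : measurable (N1 `|` N2) by exact: measurableU.
have PN : P (N1 `|` N2) = 0%E.
  by exact: (etrans (measureU0 mN1 mN2 PN2) PN1).
have GE w : ~ (N1 `|` N2) w -> G (K w) = ccnt A w * ccnt B w.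
  move=> /not_orP[n1 n2]; rewrite /G /ccnt h1// h2// mA' mB' !natrD /Nt /K !ffunE.
  by congr (_ * _); ring.
have p (i : 'I_3) : pg (Nt m i) by exact: pg_Nt.
have pG : pg G by apply: pg_M; apply: pg_D.
have mc : measurable_fun setT (fun w => ccnt A w * ccnt B w).
  by apply: measurable_funM; apply: measurable_funB => //; exact: measurable_cnt.
split; first exact: (L1_ae mN PN GE mc (pg_L1 pK pG)).
rewrite -(EX_ae mN PN GE) -/(EK P K G).
have pospart (i j : 'I_3) : pg (fun v => Nt m i v * Nt m j v) by exact: pg_M.
rewrite (eq_EK P K (G' := fun v => (Nt m 0 v * Nt m 1 v + Nt m 0 v * Nt m 2%:R v) +
   (Nt m 1 v * Nt m 1 v + Nt m 1 v * Nt m 2%:R v))); last by move=> v; rewrite /G; ring.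
rewrite (EK_D pK (pg_D (pospart _ _) (pospart _ _)) (pg_D (pospart _ _) (pospart _ _))) !(EK_D pK (pospart _ _) (pospart _ _)).
by rewrite !(EK_Nt2 pK)/= /m/D/=; ring.
Qed.

Lemma L1_EX_ccnt A : measurable A -> (mu A < +oo)%E ->
  L2 P (ccnt A) /\ EX P (ccnt A) = 0.
Proof.
move=> mA fA; have [h1 h2] := EX_ccnt_mul mA mA fA fA.
have mc : measurable_fun setT (ccnt A).
  by apply: measurable_funB => //; exact: measurable_cnt.
split; first by split => //; apply: (eq_L1 _ h1) => w; rewrite expr2.
have pK := @poisson_family_counts 'I_1 (fun=> A) (fun=> mA) (fun=> fA) ltac:(by apply/trivIsetP => i j _ _; rewrite !ord1 eqxx).
rewrite -[RHS](EK_Nt pK ord0); apply: eq_EX => w.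
by rewrite /= /Nt ffunE.
Qed.

Lemma EX_cnt_mul A B : measurable A -> measurable B ->
  (mu A < +oo)%E -> (mu B < +oo)%E ->
  L1 P (fun w => (cnt A w)%:R * (cnt B w)%:R) /\
  EX P (fun w => (cnt A w)%:R * (cnt B w)%:R) =
    fine (mu A) * fine (mu B) + fine (mu (A `&` B)).
Proof.
move=> mA mB fA fB; have [l1 e1] := EX_ccnt_mul mA mB fA fB.
have [lA eA] := L1_EX_ccnt mA fA; have [lB eB] := L1_EX_ccnt mB fB.
have E : (fun w => (cnt A w)%:R * (cnt B w)%:R) = (fun w => (ccnt A w * ccnt B w +
   fine (mu B) * ccnt A w) + (fine (mu A) * ccnt B w + fine (mu A) * fine (mu B))).
  by apply/funext => w; rewrite /ccnt; ring.
have l2 := L1_Z (fine (mu B)) (L2_L1 lA); have l3 := L1_Z (fine (mu A)) (L2_L1 lB).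
have l4 := L1_cst P (fine (mu A) * fine (mu B)).
rewrite E; split; first by apply: L1_D; apply: L1_D.
rewrite (EX_D (L1_D l1 l2) (L1_D l3 l4)) (EX_D l1 l2) (EX_D l3 l4).
rewrite (EX_Z _ (L2_L1 lA)) (EX_Z _ (L2_L1 lB)) e1 eA eB EX_cst; ring.
Qed.

Lemma ccnt_isometry (J : finType) (A : J -> set (Rvec R d)) (a : J -> R) :
  (forall i, measurable (A i)) -> (forall i, mu (A i) < +oo)%E ->
  EX P (fun w => (\sum_i a i * ccnt (A i) w) ^+ 2) =
  \sum_i \sum_j a i * a j * fine (mu (A i `&` A j)).
Proof.
move=> mA fA.
rewrite (eq_EX P (g := fun w => \sum_i \sum_j (a i * a j) * (ccnt (A i) w * ccnt (A j) w))).
  have h i j := EX_ccnt_mul (mA i) (mA j) (fA i) (fA j).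
  rewrite EX_sum => [|i _]; last by apply: L1_sum => j _; apply: L1_Z; exact: (h i j).1.
  apply: eq_bigr => i _; rewrite EX_sum => [|j _]; last by apply: L1_Z; exact: (h i j).1.
  by apply: eq_bigr => j _; rewrite EX_Z ?(h i j).2//; exact: (h i j).1.
move=> w; rewrite expr2 mulr_suml; apply: eq_bigr => i _.
by rewrite mulr_sumr; apply: eq_bigr => j _; ring.
Qed.

End poisson_counts.

(** * Counts of pairs of points *)

Lemma fin_num_prod (R : realType) d1 d2 (T1 : measurableType d1) (T2 : measurableType d2)
  (m1 : {finite_measure set T1 -> \bar R}) (m2 : {finite_measure set T2 -> \bar R}) E :
  measurable E -> (m1 \x m2)%E E \is a fin_num.
Proof.
move=> mE; rewrite ge0_fin_numE ?measure_ge0//.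
apply: (@le_lt_trans _ _ ((m1 \x m2)%E (setT `*` setT))).
  by apply: le_measure; rewrite ?inE// setXTT.
rewrite product_measure1E// -ge0_fin_numE; last by rewrite mule_ge0.
by rewrite fin_numM// fin_num_measure.
Qed.

Section scaled_window.
Context (R : realType) (d : nat).

Definition lwin (l : R) : set (Rvec R d) -> \bar R :=
  mscale (NngNum (normr_ge0 l)) (@window R d).

HB.instance Definition _ l := Measure.on (lwin l).

Let lwin_fin l : fin_num_fun (lwin l).
Proof.
move=> A mA; rewrite /lwin /mscale/= fin_numM// ge0_fin_numE//.
by apply: (@le_lt_trans _ _ 1%E); [exact: probability_le1|rewrite ltry].
Qed.

HB.instance Definition _ l := @Measure_isFinite.Build _ _ R (lwin l) (@lwin_fin l).

Lemma lwinE l (A : set (Rvec R d)) : lwin l A = intensity d l (A `&` cube 1).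
Proof. by []. Qed.

Lemma lwin_pair l (f : Rvec R d -> Rvec R d -> R) (M : R) : bmeas2 M f ->
  (\int[lwin l]_x \int[lwin l]_y (f x y)%:E =
   (`|l| ^+ 2 * EX (@window R d) (fun x => EX (@window R d) (f x)))%:E)%E.
Proof.
move=> hf; have [mf hb] := hf.
have in1 x : (\int[lwin l]_y (f x y)%:E = (`|l| * EX (@window R d) (f x))%:E)%E.
  have nf := bmeas2_l x hf.
  rewrite ge0_integral_mscale//; last 2 first.
  - by apply/measurable_EFinP; exact: nf.1.
  - by move=> y _; rewrite lee_fin; have /andP[] := hb x y.
  by rewrite L1_E//; exact: bmeas1_L1 nf.
under eq_integral do rewrite in1.
have ne := bmeas2_EX (@window R d) hf.
rewrite ge0_integral_mscale//; last 2 first.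
- by apply/measurable_EFinP/measurable_funM => //; exact: ne.1.
- by move=> x _; rewrite lee_fin mulr_ge0//; have /andP[] := ne.2 x.
rewrite L1_E; last by apply: L1_Z; exact: bmeas1_L1 ne.
by rewrite EX_Z; [rewrite -EFinM mulrA -expr2|exact: bmeas1_L1 ne].
Qed.

Lemma lwin_prod l (A : set (Rvec R d * Rvec R d)) : measurable A ->
  (lwin l \x lwin l)%E A = (`|l| ^+ 2 *
    EX (@window R d) (fun x => EX (@window R d) (fun y => \1_A (x, y))))%:E.
Proof.
move=> mA.
have hf : bmeas2 1 (fun x y => \1_A (x, y) : R).
  split; last by move=> x y; rewrite indicE; case: (_ \in _); rewrite ?ler01 ?lexx.
  rewrite (_ : (fun p => _) = \1_A); first exact: measurable_indic.
  by apply/funext => -[].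
rewrite -(lwin_pair l hf) /product_measure1; apply: eq_integral => x _ /=.
rewrite (_ : (fun y => _) = (fun y => (\1_(xsection A x) y)%:E)); last first.
  by apply/funext => y; rewrite !indicE /xsection; congr ((nat_of_bool _)%:R%:E); apply/idP/idP; rewrite !inE/= ?inE.
by rewrite integral_indic ?setIT//; exact: measurable_xsection.
Qed.

End scaled_window.

(** * Second moment measure of pairs of points in the window *)

Section second_moment.
Context (R : realType) (d : nat) d' (Omega : measurableType d') (P : probability Omega R).
Variables (l : R) (eta : Omega -> {measure set (Rvec R d) -> \bar R}).
Hypothesis hp : is_poisson_measure P (intensity d l) eta.
Implicit Types (A B : set (Rvec R d)) (E : set (Rvec R d * Rvec R d)) (w : Omega).
Local Notation W := (@cube R d 1).
Let mW : measurable W. Proof. exact: measurable_cube. Qed.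

Definition etaW w : set (Rvec R d) -> \bar R := mrestr (eta w) (@measurable_cube R d 1).

HB.instance Definition _ w := Measure.on (etaW w).

Let etaW_lty w A : measurable A -> (eta w (A `&` W) < +oo)%E.
Proof.
move=> mA; apply: le_lt_trans (poisson_locally_finite hp w 1).
by apply: le_measure; rewrite ?inE//; exact: measurableI.
Qed.

Let etaW_fin w : fin_num_fun (etaW w).
Proof. by move=> A mA; rewrite ge0_fin_numE ?measure_ge0// etaW_lty. Qed.

HB.instance Definition _ w := @Measure_isFinite.Build _ _ R (etaW w) (@etaW_fin w).

Lemma etaW_cnt A w : measurable A -> etaW w A = (cnt eta (A `&` W) w)%:R%:E.
Proof.
move=> mA; apply: (cnt_fin hp); first exact: measurableI.
exact: etaW_lty.
Qed.

(** Counts ordered pairs with multiplicity, the diagonal included; as a measure in [E], it makes the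
    approximation of the edge set additive. *)
Definition N2e w E : \bar R := (etaW w \x etaW w)%E E.

Definition N2 w E : R := fine (N2e w E).

Let N2e_rect w A B : measurable A -> measurable B ->
  N2e w (A `*` B) = ((cnt eta (A `&` W) w)%:R * (cnt eta (B `&` W) w)%:R)%:E.
Proof.
move=> mA mB; transitivity (etaW w A * etaW w B)%E; first exact: product_measure1E.
by rewrite (etaW_cnt w mA) (etaW_cnt w mB) EFinM.
Qed.

Let mdiag : measurable_fun setT (fun x : Rvec R d => (x, x)).
Proof. by apply/measurable_fun_pairP; split; exact: measurable_id. Qed.

(** Candidate for the mean of [N2e]: two independent points, plus one point taken twice, which lives
    on the diagonal. *)
Let nu2 : {measure set (Rvec R d * Rvec R d) -> \bar R} :=
  measure_add (lwin l \x lwin l)%E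
    (measure_function_pushforward__canonical__measure_function_Measure (lwin l) mdiag).

Let nu2E E : nu2 E = ((lwin l \x lwin l)%E E + lwin l ((fun x => (x, x)) @^-1` E))%E.
Proof. exact: measure_addE. Qed.

Let nu2_fin E : measurable E -> nu2 E \is a fin_num.
Proof.
move=> mE; rewrite nu2E fin_numD; apply/andP; split; first exact: fin_num_prod.
by apply: fin_num_measure; rewrite -[X in measurable X]setTI; exact: mdiag.
Qed.

Let N2e_fin w E : measurable E -> N2e w E \is a fin_num.
Proof. by move=> mE; exact: fin_num_prod. Qed.

Let lty_mu A : measurable A -> (intensity d l (A `&` W) < +oo)%E.
Proof. by move=> mA; rewrite -lwinE -ge0_fin_numE// fin_num_measure. Qed.

(** On rectangles this is the second moment formula for counts. Dynkin's argument extends it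
    together with measurability; passing to complements subtracts, which is possible because all
    these measures are finite. *)
Let N2_spec E : measurable E ->
  measurable_fun setT (N2e ^~ E) /\ (\int[P]_w N2e w E = nu2 E)%E.
Proof.
have rect A B : measurable A -> measurable B ->
    measurable_fun setT (N2e ^~ (A `*` B)) /\ (\int[P]_w N2e w (A `*` B) = nu2 (A `*` B))%E.
  move=> mA mB; have mAW := measurableI _ _ mA mW; have mBW := measurableI _ _ mB mW.
  have [h1 h2] := EX_cnt_mul hp mAW mBW (lty_mu mA) (lty_mu mB).
  have -> : N2e ^~ (A `*` B) = (fun w => ((cnt eta (A `&` W) w)%:R * (cnt eta (B `&` W) w)%:R)%:E).
    by apply/funext => w; rewrite N2e_rect.
  split; first by apply/measurable_EFinP; exact: (L1_meas h1).
  have fI : (intensity d l (A `&` W `&` (B `&` W)) < +oo)%E.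
    apply: le_lt_trans (lty_mu mA).
    by apply: le_measure; rewrite ?inE//; try exact: measurableI; exact: subIsetl.
  have f1 := lty_mu mA; have f2 := lty_mu mB.
  rewrite L1_E// h2 EFinD EFinM !fineK ?ge0_fin_numE//.
  rewrite nu2E; congr (_ + _)%E; first by rewrite product_measure1E.
  by rewrite lwinE; congr (intensity d l _); apply/seteqP; split=> x [[? ?]] => [[? ?]|?].
move=> mE; pose G : set (set (Rvec R d * Rvec R d)) :=
  [set A `*` B | A in measurable & B in measurable].
have GE : @measurable _ (Rvec R d * Rvec R d)%type = <<s G >> by exact: measurable_prod_measurableType.
have mE' : <<s G >> E by rewrite -GE.
apply: (@dynkin_induction _ _ G [set E | measurable_fun setT (N2e ^~ E) /\
  (\int[P]_w N2e w E = nu2 E)%E] GE _ _ _ _ _ E mE').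
- move=> _ _ [A1 mA1 [B1 mB1 <-]] [A2 mA2 [B2 mB2 <-]].
  by exists (A1 `&` A2); [exact: measurableI|exists (B1 `&` B2); [exact: measurableI|rewrite setXI]].
- by rewrite -setXTT; apply: rect.
- by move=> _ [A mA [B mB <-]]; exact: rect.
- move=> S mS [m1 i1]; have [mT iT] := rect setT setT measurableT measurableT.
  rewrite setXTT in mT iT.
  have sumE w : (N2e w S + N2e w (~` S) = N2e w setT)%E.
    by rewrite -(setUv S) [RHS](measureU _ _ _ (setICr S))//; exact: measurableC.
  have eC w : N2e w (~` S) = (N2e w setT - N2e w S)%E.
    by rewrite -sumE [X in (X - _)%E]addeC addeK// N2e_fin.
  have mC : measurable_fun setT (N2e ^~ (~` S)).
    rewrite (_ : N2e ^~ _ = (fun w => N2e w setT - N2e w S)%E); last by apply/funext.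
    by apply: emeasurable_funB.
  split=> //.
  have mSC := measurableC mS.
  have h : (nu2 S + \int[P]_w N2e w (~` S) = nu2 S + nu2 (~` S))%E.
    rewrite -{1}i1 -ge0_integralD//.
    under eq_integral do rewrite sumE.
    by rewrite iT -(setUv S) [LHS](measureU _ _ _ (setICr S)).
  have f1 := nu2_fin mS.
  by move: h; rewrite ![(nu2 S + _)%E]addeC => /(congr1 (fun z => z - nu2 S)%E); rewrite !addeK.
- move=> F mF tF h; split.
    rewrite (_ : N2e ^~ _ = (fun w => \sum_(n <oo) N2e w (F n))%E); last first.
      by apply/funext => w; rewrite /N2e measure_semi_bigcup//; exact: bigcup_measurable.
    by apply: ge0_emeasurable_sum => // n _; exact: (h n).1.
  rewrite (eq_integral (fun w => \sum_(n <oo) N2e w (F n))%E) => [|w _]; last first.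
    by rewrite /N2e measure_semi_bigcup//; exact: bigcup_measurable.
  rewrite integral_nneseries//; last by move=> n; exact: (h n).1.
  rewrite measure_semi_bigcup//; last exact: bigcup_measurable.
  by apply: eq_eseriesr => n _; exact: (h n).2.
Qed.

Lemma L1_N2 E : measurable E -> L1 P (N2 ^~ E).
Proof.
move=> mE; have [m1 i1] := N2_spec mE; apply/integrableP; split.
  apply/measurable_EFinP.
  exact: (measurableT_comp (@fine_measurable R setT measurableT) m1).
rewrite (eq_integral (N2e ^~ E)) => [|w _]; last first.
  by rewrite /= /N2 ger0_norm ?fine_ge0// fineK// N2e_fin.
by rewrite i1 -ge0_fin_numE// nu2_fin.
Qed.

Lemma EX_N2 E : measurable E -> (forall x, ~ E (x, x)) ->
  EX P (N2 ^~ E) = `|l| ^+ 2 *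
    EX (@window R d) (fun x => EX (@window R d) (fun y => \1_E (x, y))).
Proof.
move=> mE Ed; have [m1 i1] := N2_spec mE; rewrite /EX.
rewrite (eq_integral (N2e ^~ E)) => [|w _]; last by rewrite /= /N2 fineK// N2e_fin.
rewrite i1 nu2E (_ : _ @^-1` E = set0) ?measure0 ?adde0; last first.
  by apply/seteqP; split=> // x /Ed.
by rewrite lwin_prod.
Qed.

Lemma N2_rect w A B : measurable A -> measurable B ->
  N2 w (A `*` B) = (cnt eta (A `&` W) w)%:R * (cnt eta (B `&` W) w)%:R.
Proof. by move=> mA mB; rewrite /N2 N2e_rect. Qed.

Lemma N2_sum w (I : finType) (F : I -> set (Rvec R d * Rvec R d)) E :
  (forall i, measurable (F i)) -> measurable E ->
  (forall p, \1_E p = \sum_i \1_(F i) p :> R) -> N2 w E = \sum_i N2 w (F i).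
Proof.
move=> mF mE h; apply: EFin_inj; rewrite /N2 fineK ?N2e_fin// -sumEFin.
rewrite (eq_bigr (fun i => N2e w (F i))) => [|i _]; last by rewrite fineK ?N2e_fin.
have e E' : measurable E' -> N2e w E' = (\int[etaW w \x etaW w]_p (\1_E' p)%:E)%E.
  by move=> mE'; rewrite integral_indic// setIT.
rewrite e// (eq_bigr (fun i => \int[etaW w \x etaW w]_p (\1_(F i) p)%:E)%E) => [|i _]; last exact: e.
rewrite -ge0_integral_sum//.
  by apply: eq_integral => p _; rewrite sumEFin h.
by move=> i; apply/measurable_EFinP; exact: measurable_indic.
Qed.

Lemma N2_dist_le w E1 E2 : measurable E1 -> measurable E2 ->
  `|N2 w E1 - N2 w E2| <= N2 w ((E1 `\` E2) `|` (E2 `\` E1)).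
Proof.
move=> m1 m2; have m12 := measurableD m1 m2; have m21 := measurableD m2 m1.
have mI := measurableI _ _ m1 m2.
have N0 E : 0 <= N2 w E by rewrite fine_ge0.
have U E E' : measurable E -> measurable E' -> E `&` E' = set0 -> N2 w (E `|` E') = N2 w E + N2 w E'.
  move=> mE mE' EE'; rewrite /N2 -fineD ?N2e_fin//; congr fine.
  exact: (measureU _ mE mE' EE').
rewrite U//; last by apply/seteqP; split=> // p [[? ?] [? ?]].
have e1 : N2 w E1 = N2 w (E1 `&` E2) + N2 w (E1 `\` E2).
  by rewrite -{1}(setUIDK E1 E2) U//; apply/seteqP; split=> // p [[? ?] [? ?]].
have e2 : N2 w E2 = N2 w (E1 `&` E2) + N2 w (E2 `\` E1).
  rewrite -{1}(setUIDK E2 E1) [E2 `&` E1]setIC U//.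
  by apply/seteqP; split=> // p [[? ?] [? ?]].
rewrite e1 e2 (_ : _ - _ = N2 w (E1 `\` E2) - N2 w (E2 `\` E1)); last by ring.
by rewrite (le_trans (ler_normB _ _))// !ger0_norm.
Qed.

End second_moment.

(** * Simplicity of a Poisson measure *)

Section dirac_structure.
Context (R : realType) (d : nat).
Implicit Types (B : set (Rvec R d)) (x : Rvec R d).

Let half (p : 'I_d * rat) : set (Rvec R d) := [set t | ratr p.2 < (tnth t p.1 : R)].

Let mhalf p : measurable (half p).
Proof.
rewrite (_ : half p = (@tnth d (measurableTypeR R))^~ p.1 @^-1` `]ratr p.2, +oo[%classic); last first.
  by apply/seteqP; split=> t; rewrite /half /preimage/= in_itv/= andbT.
by rewrite -[X in measurable X]setTI; apply: measurable_tnth => //; exact: measurable_itv.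
Qed.

Lemma measurable_point x : measurable [set x].
Proof.
rewrite (_ : [set x] = \bigcap_(i in [set: 'I_d]) ((@tnth d (measurableTypeR R))^~ i @^-1` [set tnth x i])); last first.
  apply/seteqP; split=> [y -> i _//|y h]; apply: eq_from_tnth => i; exact: (h i Logic.I).
apply: fin_bigcap_measurable => // i _.
by rewrite -[X in measurable X]setTI; apply: measurable_tnth => //; exact: measurable_set1.
Qed.

(** For each coordinate and each rational threshold, either the half-space or its complement has
    full measure. The countable intersection of these choices has full measure too, and it contains
    only one point because the rationals separate coordinates. *)
Lemma zero_one_measure_dirac (nu : {measure set (Rvec R d) -> \bar R}) :
  nu setT = 1%E -> (forall B, measurable B -> nu B = 0%E \/ nu B = 1%E) ->
  exists x, forall B, measurable B -> nu B = (\1_B x)%:E.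
Proof.
move=> nuT nu01.
have compl B : measurable B -> nu B = 1%E -> nu (~` B) = 0%E.
  move=> mB B1; have [//|C1] := nu01 _ (measurableC mB).
  have : nu (B `|` ~` B) = (nu B + nu (~` B))%E.
    by apply: measureU; rewrite ?setICr//; exact: measurableC.
  rewrite setUv nuT B1 C1 -[1%E]/(1%:E) -EFinD => /eqP; rewrite eqe => /eqP.
  by rewrite -[LHS]addr0 => /addrI/esym/eqP; rewrite oner_eq0.
pose good p := if asbool (nu (half p) = 1%E) then half p else ~` half p.
have mgood p : measurable (good p) by rewrite /good; case: ifP => _ //; exact: measurableC.
have goodC p : nu.-negligible (~` good p).
  apply/negligibleP; first exact: measurableC.
  rewrite /good; case: asboolP => h; first exact: compl.
  by rewrite setCK; have [] := nu01 _ (mhalf p).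
pose C := \bigcap_n (if @pickle_inv ('I_d * rat)%type n is Some p then good p else setT).
have negC : nu.-negligible (~` C).
  rewrite /C setC_bigcap; apply: negligible_bigcup => k.
  by case: pickle_inv => [p|]; [exact: goodC|rewrite setCT; exact: negligible_set0].
have Cgood y p : C y -> good p y.
  by move=> /(_ (pickle p) Logic.I); rewrite pickleK_inv.
have [x Cx] : exists x, C x.
  apply: contrapT => h; have : nu.-negligible setT.
    by apply: negligibleS negC => y _ Cy; apply: h; exists y.
  move=> /(proj1 (negligibleP nu measurableT)) h0.
  by case: (etrans (esym h0) nuT) => /eqP; rewrite eq_sym oner_eq0.
have lex y z i : C y -> C z -> (tnth y i : R) <= tnth z i.
  move=> Cy Cz; rewrite leNgt; apply/negP => /rat_in_itvoo[q].
  rewrite in_itv/= => /andP[h1 h2].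
  have := Cgood _ (i, q) Cy; have := Cgood _ (i, q) Cz.
  rewrite /good; case: asboolP => _; rewrite /half/=; first by move=> h; have := lt_trans h h1; rewrite ltxx.
  by [].
have Cx1 y : C y -> y = x.
  by move=> Cy; apply: eq_from_tnth => i; apply/eqP; rewrite eq_le !lex.
exists x => B mB; rewrite indicE; case: (boolP (x \in B)) => [/set_mem xB|xB].
  have [B0|//] := nu01 B mB.
  have : nu.-negligible setT.
    apply: negligibleS (negligibleU (proj2 (negligibleP nu mB) B0) negC) => y _.
    by have [/Cx1 ->|] := pselect (C y); [left|right].
  move=> /(proj1 (negligibleP nu measurableT)) h0.
  by case: (etrans (esym h0) nuT) => /eqP; rewrite eq_sym oner_eq0.
apply: (proj1 (negligibleP nu mB)); apply: negligibleS negC => y yB Cy.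
by move/negP: xB; apply; apply/mem_set; rewrite -(Cx1 y).
Qed.

End dirac_structure.

(** * Almost sure absence of multiple points *)

Section simple_event.
Context (R : realType) (d : nat) d' (Omega : measurableType d') (P : probability Omega R).
Variables (l : R) (eta : Omega -> {measure set (Rvec R d) -> \bar R}).
Hypothesis hp : is_poisson_measure P (intensity d l) eta.
Hypothesis d_gt0 : (0 < d)%N.
Implicit Types (A B : set (Rvec R d)) (w : Omega).
Local Notation W := (@cube R d 1).
Let mW : measurable W. Proof. exact: measurable_cube. Qed.
Let i0 : 'I_d := Ordinal d_gt0.

(* Slabs of width [1 / n] orthogonal to the first coordinate axis. *)
Let slab (n : nat) (i : nat) : set (Rvec R d) :=
  [set x | W x /\ i%:R <= n%:R * ((tnth x i0 : R) + 2^-1) < i.+1%:R].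

Let mslab n i : measurable (slab n i).
Proof.
rewrite (_ : slab n i = W `&` ((fun x : Rvec R d => n%:R * ((tnth x i0 : R) + 2^-1)) @^-1` `[i%:R, i.+1%:R[%classic)); last first.
  by apply/seteqP; split=> x [? h]; split=> //; move: h; rewrite /preimage/= in_itv.
have mf : measurable_fun setT (fun x : Rvec R d => n%:R * ((tnth x i0 : R) + 2^-1) : R).
  by apply: measurable_funM => //; apply: measurable_funD => //; exact: measurable_tnth.
apply: measurableI => //; rewrite -[X in measurable X]setTI.
by apply: mf => //; exact: measurable_itv.
Qed.

Let slabW n i : slab n i `<=` W. Proof. by move=> x []. Qed.

Let slab_cover n x : W x -> exists i : 'I_n.+1, slab n i x.
Proof.
move=> Wx; pose y := n%:R * ((tnth x i0 : R) + 2^-1).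
have := Wx i0; rewrite powR1 mulr1 => /andP[h1 h2].
have y0 : 0 <= y by rewrite mulr_ge0//; lra.
have yn : y <= n%:R by rewrite -[leRHS]mulr1 ler_wpM2l//; lra.
have /andP[t1 t2] := truncn_itv y0.
have tn : (Num.truncn y < n.+1)%N by rewrite ltnS -(ler_nat R) (le_trans t1).
by exists (Ordinal tn); split=> //; rewrite t1 t2.
Qed.

Let slab_disj n i j x : slab n i x -> slab n j x -> i = j.
Proof.
move=> [_ /andP[h1 h2]] [_ /andP[h3 h4]].
have := le_lt_trans h1 h4; have := le_lt_trans h3 h2; rewrite !ltr_nat; lia.
Qed.

Let slab_measure n i : fine (intensity d l (slab n.+1 i)) <= `|l| * n.+1%:R^-1.
Proof.
have n0 : 0 < n.+1%:R :> R by rewrite ltr0n.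
pose A (j : 'I_d) : set (measurableTypeR R) :=
  if j == i0 then `[i%:R / n.+1%:R - 2^-1, i.+1%:R / n.+1%:R - 2^-1]%classic else `[- 2^-1, 2^-1]%classic.
have mA j : measurable (A j) by rewrite /A; case: ifP => _; exact: measurable_itv.
have sub : slab n.+1 i `<=` [set t | forall j, A j (tnth t j)].
  move=> x [Wx /andP[h1 h2]] j; rewrite /A; case: eqP => [->|_] /=; last first.
    by rewrite in_itv/=; have := Wx j; rewrite powR1 mulr1.
  rewrite in_itv/= lerBlDr ler_pdivrMr// mulrC h1/= lerBrDr ler_pdivlMr// mulrC.
  exact: ltW.
have mbox : measurable [set t : Rvec R d | forall j, A j (tnth t j)].
  rewrite (_ : [set t | _] = \bigcap_(j in [set: 'I_d]) ((@tnth d (measurableTypeR R))^~ j @^-1` A j)); last first.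
    by apply/seteqP; split=> [t h j _|t h j]; [exact: h|exact: (h j Logic.I)].
  by apply: fin_bigcap_measurable => // j _; rewrite -[X in measurable X]setTI; apply: measurable_tnth.
have E : leb R d [set t | forall j, A j (tnth t j)] = (n.+1%:R^-1)%:E.
  rewrite /leb (tuple_measure_box _ mA) (bigD1 i0)//= big1 ?mule1 => [|j ji].
    rewrite /A eqxx; apply: (eq_trans (lebesgue_measure_itv `[_, _])).
    rewrite /= lte_fin ltrD2r ltr_pM2r ?invr_gt0// ltr_nat ltnSn.
    by rewrite -EFinD; congr EFin; rewrite -natr1; field; rewrite gt_eqF.
  rewrite /A (negbTE ji); apply: (eq_trans (lebesgue_measure_itv `[_, _])).
  have h : (- 2^-1 : R) < 2^-1 by lra.
  rewrite /= lte_fin h.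
  by rewrite -EFinD; congr EFin; field.
have h : (leb R d (slab n.+1 i) <= (n.+1%:R^-1)%:E)%E.
  by rewrite -E; apply: le_measure; rewrite ?inE.
rewrite /intensity /mscale/= fineM//; last first.
  by rewrite ge0_fin_numE//; apply: (le_lt_trans h); rewrite ltry.
by rewrite ler_wpM2l// -lee_fin fineK// ge0_fin_numE//; apply: (le_lt_trans h); rewrite ltry.
Qed.

Let lty A : measurable A -> A `<=` W -> (intensity d l A < +oo)%E.
Proof.
move=> mA AW; rewrite -(setIidl AW) -lwinE -ge0_fin_numE// fin_num_measure//.
Qed.

Let mtwo A : measurable A -> measurable [set w | (1 < cnt eta A w)%N].
Proof.
move=> mA; rewrite (_ : [set w | _] = \bigcup_(k in [set k | (1 < k)%N]) [set w | cnt eta A w = k]).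
  by apply: bigcup_measurable => k _; exact: (measurable_cnt_eq hp).
by apply/seteqP; split=> [w h|w [k hk /= h]]; [exists (cnt eta A w)|rewrite /= h].
Qed.

(** The indicator of at least two points is below [k (k - 1)], whose Poisson mean is the square of
    the intensity. *)
Let two_points A : measurable A -> A `<=` W ->
  (P [set w | (1 < cnt eta A w)%N] <= (fine (intensity d l A) ^+ 2)%:E)%E.
Proof.
move=> mA AW; have fA := lty mA AW.
have [h1 h2] := EX_cnt_mul hp mA mA fA fA.
have [[lA _] eA] := L1_EX_ccnt hp mA fA.
have l2A : L2 P (ccnt (intensity d l) eta A) by have [] := L1_EX_ccnt hp mA fA.
have lc : L1 P (fun w => (cnt eta A w)%:R).
  apply: (eq_L1 _ (L1_D (L2_L1 l2A) (L1_cst P (fine (intensity d l A))))) => w.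
  by rewrite /ccnt subrK.
have ec : EX P (fun w => (cnt eta A w)%:R) = fine (intensity d l A).
  rewrite (eq_EX P (g := fun w => ccnt (intensity d l) eta A w + fine (intensity d l A))).
    by rewrite (EX_D (L2_L1 l2A) (L1_cst P _)) eA EX_cst add0r.
  by move=> w; rewrite /ccnt subrK.
have mS := mtwo mA.
have l1 : L1 P (\1_[set w | (1 < cnt eta A w)%N]).
  apply: (L1_bounded _ _ (M := 1)); first exact: measurable_indic.
  by move=> w; rewrite indicE; case: (_ \in _); rewrite ?normr1 ?normr0.
rewrite -[leLHS]fineK; last by rewrite fin_num_measure.
have -> : fine (P [set w | (1 < cnt eta A w)%N]) = EX P (\1_[set w | (1 < cnt eta A w)%N]).
  by rewrite /EX integral_indic// setIT.
rewrite lee_fin; apply: (@le_trans _ _ (EX P (fun w => (cnt eta A w)%:R * (cnt eta A w)%:R - (cnt eta A w)%:R))).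
  apply: EX_le => //; first exact: L1_B.
  move=> w; rewrite indicE; set k := cnt eta A w.
  case: (boolP (_ \in _)) => [/set_mem/= k1|_].
    have : 2 <= k%:R :> R by rewrite ler_nat.
    by nra.
  by case: k => [|k]; [rewrite mulr0 subrr|rewrite -natr1 /=; have := ler0n R k; nra].
by rewrite EX_B// h2 ec setIid addrK expr2.
Qed.

(** There is one slab more than the inverse width: the last index holds the face of the closed cube
    where the first coordinate is [1/2]. *)
Let good n : set Omega := [set w | forall i : 'I_n.+2, (cnt eta (slab n.+1 i) w <= 1)%N].

Definition simple_event : set Omega := \bigcup_n good n.

Let mgood n : measurable (good n).
Proof.
rewrite (_ : good n = \bigcap_(i in [set: 'I_n.+2]) ([set w | cnt eta (slab n.+1 i) w = 0%N] `|` [set w | cnt eta (slab n.+1 i) w = 1%N])).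
  apply: fin_bigcap_measurable => // i _.
  by apply: measurableU; apply: (measurable_cnt_eq hp); exact: mslab.
apply/seteqP; split=> [w h i _|w h i].
  by have := h i; rewrite leq_eqVlt ltnS leqn0 => /orP[]/eqP; [right|left].
by have [/= ->|/= ->] := h i Logic.I.
Qed.

Lemma measurable_simple_event : measurable simple_event.
Proof. by apply: bigcup_measurable => n _; exact: mgood. Qed.

(** Union bound: about [N] slabs contain two points with probability at most [(l / N)^2] each, and
    the sum tends to 0. *)
Lemma simple_event_full : P (~` simple_event) = 0%E.
Proof.
apply/eqP; rewrite -measure_le0; apply/lee_addgt0Pr => e e0; rewrite add0e.
(* The 2 bounds the ratio of the [n + 2] slabs to [n + 1]. *)
have [n hn] : exists n, 2 * `|l| ^+ 2 / n.+1%:R <= e.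
  exists (Num.truncn (2 * `|l| ^+ 2 / e)).
  rewrite ler_pdivrMr ?ltr0n// [e * _]mulrC -ler_pdivrMr//.
  have : 0 <= 2 * `|l| ^+ 2 / e by rewrite divr_ge0 ?mulr_ge0 ?sqr_ge0// ltW.
  by move=> /truncn_itv/andP[_ /ltW].
apply: (@le_trans _ _ (P (\big[setU/set0]_(i < n.+2) [set w | (1 < cnt eta (slab n.+1 i) w)%N]))).
  have mS i := mtwo (mslab n.+1 i).
  apply: le_measure; rewrite ?inE; [exact/measurableC/measurable_simple_event|exact: bigsetU_measurable|].
  move=> w hw; rewrite -(bigcup_mkord n.+2 (fun i => [set w | (1 < cnt eta (slab n.+1 i) w)%N])).
  apply: contrapT => h; apply: hw; exists n => // i.
  by rewrite leqNgt; apply/negP => hi; apply: h; exists i => //=.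
pose S i := [set w | (1 < cnt eta (slab n.+1 i) w)%N].
have mS i : measurable (S i) by exact: mtwo.
apply: (@le_trans _ _ (\sum_(i < n.+2) P (S i))%E).
  apply: (@content_subadditive _ _ _ P _ S n.+2) => [i _||].
  - exact: mS.
  - by apply: bigsetU_measurable => i _; exact: mS.
  - exact: subset_refl.
apply: (@le_trans _ _ (\sum_(i < n.+2) ((`|l| * n.+1%:R^-1) ^+ 2)%:E)%E).
  apply: lee_sum => i _; apply: le_trans (two_points _ _) _ => //.
  by rewrite lee_fin lerXn2r ?nnegrE ?fine_ge0 ?mulr_ge0// slab_measure.
rewrite sumEFin lee_fin sumr_const card_ord -[leLHS]mulr_natr.
apply: le_trans hn; rewrite -[n.+2%:R]natr1.
have : 1 <= n.+1%:R :> R by rewrite ler1n.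
move: (n.+1%:R : R) => N N1; have N0 : 0 < N by exact: lt_le_trans N1.
rewrite ler_pdivlMr// [leLHS](_ : _ = `|l| ^+ 2 * ((N + 1) / N)); last first.
  by field; rewrite gt_eqF.
by rewrite mulrC ler_wpM2r ?sqr_ge0// ler_pdivrMr//; lra.
Qed.

(** In a slab with exactly one point the measure takes only the values 0 and 1, hence is a Dirac
    mass. Distinct slabs are disjoint, so the atoms are distinct. *)
Lemma simple_event_support w : simple_event w -> exists s : seq (Rvec R d),
  [/\ uniq s, forall x, x \in s -> W x &
  forall B, measurable B -> etaW eta w B = (\sum_(x <- s) \1_B x)%:E].
Proof.
move=> [n _ gw].
have fin B : measurable B -> (eta w (B `&` W) < +oo)%E.
  move=> mB; apply: le_lt_trans (poisson_locally_finite hp w 1).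
  by apply: le_measure; rewrite ?inE//; exact: measurableI.
have fins B i : measurable B -> (eta w (B `&` slab n.+1 i) < +oo)%E.
  move=> mB; apply: le_lt_trans (fin _ (mslab n.+1 i)).
  apply: le_measure; [exact: (mem_set (measurableI _ _ mB (mslab _ _)))|exact: (mem_set (measurableI _ _ (mslab _ _) mW))|].
  by move=> x [h1 h2]; split=> //; exact: (slabW h2).
have fins0 i : (eta w (slab n.+1 i) < +oo)%E.
  by rewrite -[slab _ _]setTI; exact: fins.
have pt (i : 'I_n.+2) : exists x, (cnt eta (slab n.+1 i) w = 1%N -> slab n.+1 i x) /\ forall B, measurable B ->
    eta w (B `&` slab n.+1 i) = ((cnt eta (slab n.+1 i) w)%:R * \1_B x)%:E.
  have := gw i; rewrite leq_eqVlt ltnS leqn0 => /orP[]/eqP c1; last first.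
    (* An arbitrary point: the slab is empty and the atom gets coefficient 0. *)
    exists (vzero R d); split; first by rewrite c1.
    move=> B mB; rewrite c1 mul0r; apply/eqP; rewrite -measure_le0.
    have <- : eta w (slab n.+1 i) = 0%E by rewrite (cnt_fin hp)// c1.
    by apply: le_measure; rewrite ?inE//; exact: measurableI.
  pose nu : {measure set (Rvec R d) -> \bar R} := mrestr (eta w) (mslab n.+1 i).
  have [||x hx] := @zero_one_measure_dirac _ _ nu.
  - by rewrite /nu/= /mrestr setTI (cnt_fin hp)// c1.
  - move=> B mB; rewrite /nu/= /mrestr.
    have mI := measurableI _ _ mB (mslab n.+1 i).
    have le1 : (eta w (B `&` slab n.+1 i) <= 1)%E.
      have <- : eta w (slab n.+1 i) = 1%E by rewrite (cnt_fin hp)// c1.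
      by apply: le_measure; rewrite ?inE.
    have e := cnt_fin hp mI (fins B i mB).
    move: le1; rewrite e; rewrite lee_fin (ler_nat R _ 1) leq_eqVlt ltnS leqn0 => /orP[]/eqP ->; [by right|by left].
  exists x; split; last by move=> B mB; rewrite c1 mul1r -hx.
  move=> _; have := hx _ (mslab n.+1 i); rewrite /nu/= /mrestr setIid (cnt_fin hp)// c1 indicE.
  by case: (boolP (x \in _)) => [/set_mem//|_] [/eqP]; rewrite oner_eq0.
have [f hf] := choice pt.
pose s := [seq f i | i : 'I_n.+2 <- enum 'I_n.+2 & cnt eta (slab n.+1 (val i)) w == 1%N].
exists s; split.
- rewrite map_inj_in_uniq; first by apply: filter_uniq; exact: enum_uniq.
  move=> i j.
  rewrite !mem_filter => /andP[/eqP ci _] /andP[/eqP cj _] fij.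
  have h1 := (hf i).1 ci; have h2 := (hf j).1 cj; rewrite fij in h1.
  by apply/val_inj; exact: (slab_disj h1 h2).
- move=> x /mapP[i]; rewrite mem_filter => /andP[/eqP ci _] ->.
  exact: (slabW ((hf i).1 ci)).
- move=> B mB.
  have -> : etaW eta w B = (\sum_(i < n.+2) eta w (B `&` slab n.+1 i))%E.
    rewrite /etaW /mrestr -measure_bigsetU_ord => [|i|]; [|exact: measurableI|]; last first.
      apply/trivIsetP => i j _ _ ij; apply/seteqP; split=> // x [[_ h1] [_ h2]].
      by move: ij; rewrite (val_inj (slab_disj h1 h2)) eqxx.
    congr (eta w _); rewrite -(bigcup_mkord n.+2 (fun i => B `&` slab n.+1 i)); apply/seteqP; split=> x.
      by move=> [Bx /(slab_cover n.+1)[i hi]]; exists i => //=.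
    by move=> [i _ [Bx /slabW]].
  rewrite (eq_bigr (fun i : 'I_n.+2 => ((cnt eta (slab n.+1 i) w)%:R * \1_B (f i))%:E)) => [|i _]; last exact: (hf i).2.
  rewrite sumEFin big_map big_filter big_enum_cond/=; congr EFin.
  rewrite [RHS]big_mkcond/=; apply: eq_bigr => i _.
  have := gw i; rewrite leq_eqVlt ltnS leqn0 => /orP[]/eqP ->; rewrite ?mul1r ?mul0r//.
Qed.

End simple_event.

(** * Edge count as a functional of pairs *)

Section edge_sum.
Context (R : realType) (d : nat) d' (Omega : measurableType d') (P : probability Omega R).
Variables (Hbar : R -> set (Rvec R d)) (eta : R -> Omega -> {measure set (Rvec R d) -> \bar R}) (l : R).
Hypothesis hp : is_poisson_measure P (intensity d l) (eta l).
Hypothesis d_gt0 : (0 < d)%N.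
Hypothesis mH : measurable (Hbar l).
Hypothesis H0n : ~ Hbar l (vzero R d).
Local Notation W := (@cube R d 1).
Implicit Types (w : Omega).

(** An integrable version of [Fsum], monotone and additive in the edge set; the two agree when there
    are no multiple points. *)
Definition edge_sum w : R := N2 (eta l) w [set p | wadj Hbar l p.1 p.2].

Lemma wadj_irr x : ~ wadj Hbar l x x.
Proof.
move=> [_ _]; rewrite (_ : vsub x x = vzero R d)//.
by apply: eq_from_tnth => i; rewrite !tnth_mktuple subrr.
Qed.

Lemma Fsum_edge_sum w : simple_event (eta l) d_gt0 w -> Fsum Hbar eta l w = edge_sum w.
Proof.
move=> /(simple_event_support hp)[s [us sW hs]].
have mE := measurable_wadj mH.
have intE (g : Rvec R d -> \bar R) : measurable_fun setT g -> (forall x, 0 <= g x)%E ->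
    (\int[etaW (eta l) w]_x g x = \sum_(x <- s) g x)%E.
  move=> mg g0; pose ms n : {measure set (Rvec R d) -> \bar R} := \d_(nth (vzero R d) s n).
  rewrite (@eq_measure_integral _ _ _ _ (msum ms (size s))); last first.
    move=> A mA _; transitivity (\sum_(x <- s) (\1_A x : R))%:E; first exact: hs.
    rewrite /msum -sumEFin (big_nth (vzero R d)) big_mkord.
    by apply: eq_bigr => i _; rewrite indicE.
  rewrite ge0_integral_measure_sum// [RHS](big_nth (vzero R d)) big_mkord.
  by apply: eq_bigr => i _; rewrite integral_dirac// diracT mul1e.
have -> : edge_sum w = \sum_(x <- s) \sum_(y <- s) kf Hbar l x y.
  rewrite /edge_sum /N2 /N2e /product_measure1.
  have sec x : etaW (eta l) w (xsection [set p | wadj Hbar l p.1 p.2] x) = (\sum_(y <- s) kf Hbar l x y)%:E.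
    rewrite hs; last exact: measurable_xsection.
    congr EFin; apply: eq_bigr => y _; rewrite indic_asbool /kf.
    by congr (nat_of_bool _)%:R; apply: asbool_equiv_eq; rewrite /xsection/= inE.
  under eq_integral do rewrite /= sec.
  rewrite intE.
  - by rewrite sumEFin.
  - apply/measurable_EFinP; apply: measurable_sum => y.
    exact: (bmeas2_r y (kf_bmeas mH)).1.
  - by move=> x; rewrite lee_fin sumr_ge0// => y _; rewrite /kf ler0n.
have ptE x : (points (eta l w) `&` W) x <-> x \in s.
  have m1 := @measurable_point R d x.
  have e1 : W x -> eta l w [set x] = (\sum_(y <- s) (\1_[set x] y : R))%:E.
    move=> Wx; rewrite -(hs _ m1) /etaW /mrestr; congr (eta l w _).
    by apply/esym/setIidl => y ->.
  have cnt1 : \sum_(y <- s) (\1_[set x] y : R) = (x \in s)%:R :> R.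
    rewrite (eq_bigr (fun y => (y == x)%:R)) => [|y _]; last first.
      by rewrite indicE; congr (nat_of_bool _)%:R; apply/idP/eqP; rewrite inE.
    have [xs|xs] := boolP (x \in s).
      rewrite (bigD1_seq x)//= eqxx big1 ?addr0// => y /negbTE ->//.
    rewrite big_seq big1// => y ys; case: eqP => // yx; by rewrite -yx ys in xs.
  split=> [[h1 Wx]|xs].
    by move: h1; rewrite /points/= (e1 Wx) cnt1 lte_fin; case: (x \in s) => //=; rewrite ltxx.
  by split; [rewrite /points/= (e1 (sW _ xs)) cnt1 xs lte_fin|exact: sW].
pose r := [seq p <- [seq (x, y) | x <- s, y <- s] | p.1 != p.2].
have ur : uniq r by apply: filter_uniq; apply: allpairs_uniq => // -[? ?] [? ?].
rewrite /Fsum (_ : [set p | _] = [set` r]); last first.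
  apply/seteqP; split=> -[x y] /=.
    move=> [/ptE xs /ptE ys /eqP xy]; rewrite mem_filter/= xy/=.
    by apply/allpairsP; exists (x, y).
  rewrite mem_filter/= => /andP[/eqP xy /allpairsP[[x' y']/= [x's y's [ex ey]]]].
  by move: xy; rewrite ex ey => xy; split; [exact/ptE|exact/ptE|exact: xy].
rewrite -fsbig_seq// big_filter [LHS]big_mkcond/= big_allpairs.
apply: eq_big_seq => x xs; apply: eq_big_seq => y ys /=.
(* The product measure also counts pairs of equal points; they are not adjacent because [Hbar l]
   avoids the origin. *)
have [->|xy] := eqVneq x y.
  by rewrite /kf; case: asboolP => // /wadj_irr.
rewrite /= indic_asbool /kf; congr (nat_of_bool _)%:R; apply: asbool_equiv_eq.
by split=> [h|[]//]; split=> //; exact: sW.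
Qed.

End edge_sum.

(** * Double integrals of step kernels *)

Section iterated_integral.
Context d (T : measurableType d) (R : realType) (mu : {sigma_finite_measure set T -> \bar R}).
Implicit Types f g : T -> T -> R.

Definition nneg2 f := measurable_fun setT (fun p : T * T => f p.1 p.2) /\ forall x y, 0 <= f x y.

Definition II f : \bar R := (\int[mu]_x \int[mu]_y (f x y)%:E)%E.

Lemma nneg2_D f g : nneg2 f -> nneg2 g -> nneg2 (fun x y => f x y + g x y).
Proof.
by move=> [mf hf] [mg hg]; split=> [|x y]; [exact: measurable_funD|exact: addr_ge0].
Qed.

Lemma nneg2_Z (k : R) f : 0 <= k -> nneg2 f -> nneg2 (fun x y => k * f x y).
Proof.
by move=> k0 [mf hf]; split=> [|x y]; [exact: measurable_funM|exact: mulr_ge0].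
Qed.

Lemma nneg2_T f : nneg2 f -> nneg2 (fun x y => f y x).
Proof.
move=> [mf hf]; split=> // ; apply: (measurableT_comp mf (g := fun p : T * T => (p.2, p.1))).
by apply/measurable_fun_pairP; split; [exact: measurable_snd|exact: measurable_fst].
Qed.

Lemma nneg2_l f x : nneg2 f -> measurable_fun setT (fun y => (f x y)%:E).
Proof. by move=> [mf hf]; apply/measurable_EFinP; exact: (measurableT_comp mf (pair1_measurable x)). Qed.

Lemma nneg2_int f : nneg2 f -> measurable_fun setT (fun x => \int[mu]_y (f x y)%:E)%E.
Proof.
move=> [mf hf].
have := @measurable_fun_fubini_tonelli_F _ _ T T R mu (fun p => (f p.1 p.2)%:E).
by rewrite /fubini_F; apply => [|p]; [exact/measurable_EFinP|rewrite lee_fin].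
Qed.

Lemma II_prod f : nneg2 f -> II f = (\int[mu \x mu]_p (f p.1 p.2)%:E)%E.
Proof.
move=> [mf hf]; rewrite (@fubini_tonelli1 _ _ _ _ _ mu mu (fun p => (f p.1 p.2)%:E))//.
  exact/measurable_EFinP.
by move=> p; rewrite lee_fin.
Qed.

Lemma II_T f : nneg2 f -> II (fun x y => f y x) = II f.
Proof.
move=> [mf hf]; rewrite /II (@fubini_tonelli _ _ _ _ _ mu mu (fun p => (f p.2 p.1)%:E))//.
  by apply/measurable_EFinP; exact: (nneg2_T (conj mf hf)).1.
by move=> p; rewrite lee_fin.
Qed.

Lemma II_le f g : nneg2 f -> nneg2 g -> (forall x y, f x y <= g x y) -> (II f <= II g)%E.
Proof.
move=> hf hg fg; rewrite !II_prod//.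
by apply: ge0_le_integral; rewrite ?lee_fin//=; try (move=> *; rewrite lee_fin//; first [exact: hf.2|exact: hg.2|exact: fg]); apply/measurable_EFinP; first [exact: hf.1|exact: hg.1].
Qed.

Lemma II_D f g : nneg2 f -> nneg2 g -> II (fun x y => f x y + g x y) = (II f + II g)%E.
Proof.
move=> hf hg; rewrite !II_prod//; last exact: nneg2_D.
under eq_integral do rewrite EFinD.
by rewrite ge0_integralD//; try (move=> p _; rewrite lee_fin; first [exact: hf.2|exact: hg.2]); apply/measurable_EFinP; first [exact: hf.1|exact: hg.1].
Qed.

Lemma II_Z (k : R) f : 0 <= k -> nneg2 f -> II (fun x y => k * f x y) = (k%:E * II f)%E.
Proof.
move=> k0 hf; rewrite !II_prod//; last exact: nneg2_Z.
under eq_integral do rewrite EFinM.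
by rewrite ge0_integralZl_EFin//; [move=> p _; rewrite lee_fin; exact: hf.2|apply/measurable_EFinP; exact: hf.1].
Qed.

End iterated_integral.

(** * Step functions on disjoint cells *)

Section step_functions.
Context d (T : measurableType d) (R : realType) (J : finType) (D : J -> set T).
Hypothesis mD : forall j, measurable (D j).
Hypothesis tD : trivIset setT D.

Definition sf1 (g : J -> R) x : R := \sum_j g j * \1_(D j) x.

Definition sf2 (g : J -> J -> R) x y : R := sf1 (fun i => sf1 (g i) y) x.

(** Evaluation at [x] picks the same coefficient for every [g], so that pointwise identities between
    step functions reduce to identities between coefficients. *)
Lemma sf1_case x : (exists2 j, D j x & forall g, sf1 g x = g j) \/
  ((forall j, ~ D j x) /\ forall g, sf1 g x = 0).
Proof.
have [[j Dj]|h] := pselect (exists j, D j x); [left|right].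
  exists j => // g; rewrite /sf1 (bigD1 j)//= big1 ?addr0 => [|i ij].
    by rewrite indicE mem_set// mulr1.
  rewrite indicE memNset ?mulr0// => Di; move/trivIsetP: tD => /(_ i j Logic.I Logic.I ij).
  by move=> e; have : (D i `&` D j) x by []; rewrite e.
have h' j : ~ D j x by move=> Dj; apply: h; exists j.
by split=> // g; rewrite /sf1 big1// => j _; rewrite indicE memNset ?mulr0.
Qed.

Lemma sf2_sum g x y : sf2 g x y = \sum_i \sum_j g i j * (\1_(D i) x * \1_(D j) y).
Proof.
rewrite /sf2 /sf1; apply: eq_bigr => i _; rewrite mulr_suml; apply: eq_bigr => j _.
by rewrite -mulrA [X in _ * X]mulrC.
Qed.

Lemma measurable_sf1 g : measurable_fun setT (sf1 g).
Proof.
by apply: measurable_sum => j; apply: measurable_funM => //; exact: measurable_indic.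
Qed.

Lemma measurable_sf2 g : measurable_fun setT (fun p : T * T => sf2 g p.1 p.2).
Proof.
rewrite (_ : (fun p => _) = (fun p : T * T => \sum_i \sum_j g i j * (\1_(D i) p.1 * \1_(D j) p.2))); last first.
  by apply/funext => p; rewrite sf2_sum.
apply: measurable_sum => i; apply: measurable_sum => j; apply: measurable_funM => //.
have mI k : measurable_fun setT (\1_(D k) : T -> R) by exact: measurable_indic.
apply: measurable_funM.
  exact: (measurableT_comp (mI i) measurable_fst).
exact: (measurableT_comp (mI j) measurable_snd).
Qed.

Lemma sf1_comp (h : R -> R) g x : h 0 = 0 -> h (sf1 g x) = sf1 (h \o g) x.
Proof. by move=> h0; have [[j _ e]|[_ e]] := sf1_case x; rewrite !e. Qed.

Lemma sf1_ge0 g x : (forall j, 0 <= g j) -> 0 <= sf1 g x.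
Proof. by move=> g0; have [[j _ ->]|[_ ->]] := sf1_case x. Qed.

Lemma sf2_ge0 g x y : (forall i j, 0 <= g i j) -> 0 <= sf2 g x y.
Proof. by move=> g0; apply: sf1_ge0 => i; apply: sf1_ge0. Qed.

Lemma nneg2_sf2 g : (forall i j, 0 <= g i j) -> nneg2 (sf2 g).
Proof. by move=> g0; split; [exact: measurable_sf2|move=> x y; exact: sf2_ge0]. Qed.

Lemma EX_sf1 (nu : probability T R) g : EX nu (sf1 g) = \sum_j g j * fine (nu (D j)).
Proof.
have l1 j : L1 nu (\1_(D j)).
  apply: (L1_bounded _ _ (M := 1)); first exact: measurable_indic.
  by move=> w; rewrite indicE; case: (_ \in _); rewrite ?normr1 ?normr0.
rewrite EX_sum => [|j _]; last exact: L1_Z.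
by apply: eq_bigr => j _; rewrite EX_Z// /EX integral_indic// setIT.
Qed.

Variable mu : {sigma_finite_measure set T -> \bar R}.
Hypothesis fD : forall j, (mu (D j) < +oo)%E.

Lemma integral_sf1 g : (forall j, 0 <= g j) ->
  (\int[mu]_x (sf1 g x)%:E = (\sum_j g j * fine (mu (D j)))%:E)%E.
Proof.
move=> g0; rewrite -sumEFin.
rewrite (eq_integral (fun x => \sum_j (g j)%:E * (\1_(D j) x)%:E)%E) => [|x _]; last first.
  by rewrite /sf1 -sumEFin.
have mi j : measurable_fun setT (fun x => (\1_(D j) x : R)%:E).
  by apply/measurable_EFinP; exact: measurable_indic.
rewrite ge0_integral_sum//.
- apply: eq_bigr => j _; rewrite ge0_integralZl_EFin//.
  by rewrite integral_indic// setIT EFinM fineK// ge0_fin_numE.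
- by move=> j; apply/measurable_EFinP; apply: measurable_funM => //; exact: measurable_indic.
- by move=> j x _; rewrite mule_ge0 ?lee_fin.
Qed.

Lemma II_sf2 g : (forall i j, 0 <= g i j) ->
  II mu (sf2 g) = (\sum_i \sum_j g i j * (fine (mu (D i)) * fine (mu (D j))))%:E.
Proof.
move=> g0; rewrite /II.
rewrite (eq_integral (fun x => (sf1 (fun i => \sum_j g i j * fine (mu (D j))) x)%:E)) => [|x _]; last first.
  have [[i _ e]|[_ e]] := sf1_case x.
    rewrite e (eq_integral (fun y => (sf1 (g i) y)%:E)) => [|y _]; last by rewrite /sf2 e.
    by rewrite integral_sf1.
  by rewrite e; apply: integral0_eq => y _; rewrite /sf2 e.
rewrite integral_sf1 => [|i]; last by apply: sumr_ge0 => j _; rewrite mulr_ge0 ?fine_ge0.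
congr EFin; apply: eq_bigr => i _; rewrite mulr_suml; apply: eq_bigr => j _.
by rewrite -mulrA [X in _ * X]mulrC.
Qed.

End step_functions.

Section general_step.
Context d (T : measurableType d) (R : realType) (J : finType) (A : J -> set T).
Hypothesis mA : forall j, measurable (A j).
Variable mu : {sigma_finite_measure set T -> \bar R}.
Hypothesis fA : forall j, (mu (A j) < +oo)%E.

(** The same bilinear form as in [ccnt_isometry]. The sets may overlap, which allows a step function
    on elementary sets to be compared with one on cells. *)
Lemma integral_sf1_sq (a : J -> R) :
  (\int[mu]_x (sf1 A a x ^+ 2)%:E =
   (\sum_i \sum_j a i * a j * fine (mu (A i `&` A j)))%:E)%E.
Proof.
have mAA i j := measurableI _ _ (mA i) (mA j).
have fI i j : (mu (A i `&` A j) < +oo)%E.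
  by apply: le_lt_trans (fA i); apply: le_measure; rewrite ?inE//; exact: subIsetl.
pose F i j x := ((a i * a j)%:E * (\1_(A i `&` A j) x)%:E)%E.
have iI i j : mu.-integrable setT (fun x => (\1_(A i `&` A j) x : R)%:E).
  apply/integrableP; split; first by apply/measurable_EFinP; exact: measurable_indic.
  rewrite (eq_integral (fun x => (\1_(A i `&` A j) x : R)%:E)) => [|x _].
    by rewrite integral_indic// setIT; exact: fI.
  by rewrite /= ger0_norm.
have iF i j : mu.-integrable setT (F i j).
  by apply: integrableZl.
rewrite (eq_integral (fun x => \sum_i \sum_j F i j x)%E) => [|x _]; last first.
  rewrite /sf1 expr2 mulr_suml -sumEFin; apply: eq_bigr => i _.
  rewrite mulr_sumr -sumEFin; apply: eq_bigr => j _.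
  by rewrite /F indicI -EFinM; congr EFin; rewrite /=; ring.
rewrite integral_sum// => [|i]; last by apply: integrable_sum.
rewrite -sumEFin; apply: eq_bigr => i _; rewrite integral_sum// -sumEFin.
apply: eq_bigr => j _; rewrite /F integralZl//.
rewrite integral_indic// setIT [in RHS]EFinM fineK// ge0_fin_numE//; exact: fI.
Qed.

End general_step.

Section window_integral.
Context (R : realType) (d : nat) (l : R).
Local Notation W := (@cube R d 1).
Local Notation mu := (intensity d l).
Let mW : measurable W. Proof. exact: measurable_cube. Qed.

Let rest : {measure set (Rvec R d) -> \bar R} := mrestr mu (measurableC mW).

Let split (f : Rvec R d -> \bar R) : measurable_fun setT f -> (forall x, 0 <= f x)%E ->
  (\int[mu]_x f x = \int[lwin l]_x f x + \int[rest]_x f x)%E.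
Proof.
move=> mf f0; rewrite -ge0_integral_measure_add//.
apply: eq_measure_integral => A mA _.
transitivity (lwin l A + rest A)%E; last by rewrite -measure_addE.
rewrite lwinE /rest/= /mrestr -setDE.
rewrite -{1}(setUIDK A W); apply: (@measureU _ _ _ mu) => //; [exact: measurableI|exact: measurableD|].
by apply/seteqP; split=> // x [[? ?] [? ?]].
Qed.

Lemma lwin_integral_le (f : Rvec R d -> \bar R) :
  measurable_fun setT f -> (forall x, 0 <= f x)%E ->
  (\int[lwin l]_x f x <= \int[mu]_x f x)%E.
Proof. by move=> mf f0; rewrite split// leeDl// integral_ge0. Qed.

Lemma lwin_integral_eq (f : Rvec R d -> \bar R) :
  measurable_fun setT f -> (forall x, 0 <= f x)%E -> (forall x, ~ W x -> f x = 0%E) ->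
  (\int[mu]_x f x = \int[lwin l]_x f x)%E.
Proof.
move=> mf f0 fW; rewrite split//.
rewrite (@ge0_negligible_integral _ _ _ rest setT W)//; last first.
  by rewrite /rest/= /mrestr setICr measure0.
by rewrite [X in (_ + X)%E]integral0_eq ?adde0// => x [_ /fW].
Qed.

Lemma lwin_integral (g : Rvec R d -> R) (M : R) : bmeas1 M g ->
  (\int[lwin l]_x (g x)%:E = (`|l| * EX (@window R d) g)%:E)%E.
Proof.
move=> hg; have [mg gb] := hg.
have g0 x : 0 <= g x by have /andP[] := gb x.
rewrite ge0_integral_mscale//; last 2 first.
- exact/measurable_EFinP.
- by move=> x _; rewrite lee_fin.
by rewrite L1_E; [rewrite EFinM|exact: bmeas1_L1 hg].
Qed.

Lemma EX2_le_II (f : Rvec R d -> Rvec R d -> R) (M : R) : bmeas2 M f ->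
  ((`|l| ^+ 2 * EX (@window R d) (fun x => EX (@window R d) (f x)))%:E <= II mu f)%E.
Proof.
move=> hf; have [mf fb] := hf.
have nf : nneg2 f by split=> // x y; have /andP[] := fb x y.
rewrite -(lwin_pair l hf) /II.
have mi := nneg2_int mu nf.
have mi' : measurable_fun setT (fun x => \int[lwin l]_y (f x y)%:E)%E.
  rewrite (_ : (fun x => _) = (fun x => (`|l| * EX (@window R d) (f x))%:E)); last first.
    by apply/funext => x; exact: (lwin_integral (bmeas2_l x hf)).
  by apply/measurable_EFinP; apply: measurable_funM => //; exact: (bmeas2_EX _ hf).1.
apply: le_trans (lwin_integral_le mi _); last first.
  by move=> x; apply: integral_ge0 => y _; rewrite lee_fin; exact: nf.2.
apply: ge0_le_integral => //.
- by move=> x _; apply: integral_ge0 => y _; rewrite lee_fin; exact: nf.2.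
- move=> x _; apply: lwin_integral_le; first exact: nneg2_l.
  by move=> y; rewrite lee_fin; exact: nf.2.
Qed.

End window_integral.

(** * Discretization of the chaoses *)

(* An L2-approximation [q] of the adjacency indicator by step functions is
   rounded to the indicator [c] of a graph on the cells; the step function of
   [c] is then L1-close to the adjacency indicator. *)
Section cell_graph.
Context (R : realType) (d : nat) d' (Omega : measurableType d') (P : probability Omega R).
Variables (Hbar : R -> set (Rvec R d)) (eta : R -> Omega -> {measure set (Rvec R d) -> \bar R}) (l : R).
Hypothesis l0 : 0 < l.
Hypothesis hp : is_poisson_measure P (intensity d l) (eta l).
Hypothesis mH : measurable (Hbar l).
Hypothesis Hsym : Hbar l = [set vopp x | x in Hbar l].
Local Notation W := (@cube R d 1).
Local Notation win := (@window R d).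
Local Notation mu := (intensity d l).
Local Notation kw := (kf Hbar l).
Local Notation gdeg := (gdeg Hbar l).
Variables (J : finType) (D : J -> set (Rvec R d)) (inW : pred J) (q : J -> J -> R).
Hypothesis mD : forall j, measurable (D j).
Hypothesis tD : trivIset setT D.
Hypothesis fD : forall j, (mu (D j) < +oo)%E.
Hypothesis hin : forall j, inW j -> D j `<=` W.
Hypothesis hout : forall j x, ~~ inW j -> D j x -> ~ W x.
Hypothesis q0 : forall j, q j j = 0.

(** The symmetrized kernel [(q i j + q j i) / 2] is rounded at [1/2]. This gives a symmetric graph,
    without loops since [q] vanishes on the diagonal, and confined to the cells of the window. *)
Definition cadj : rel J := fun i j => [&& inW i, inW j & 1 <= q i j + q j i].

Definition cmass j : R := fine (mu (D j)).

Definition ccount (w : Omega) : {ffun J -> nat} := [ffun j => cnt (eta l) (D j) w].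

Lemma cadj_sym i j : cadj i j = cadj j i.
Proof. by rewrite /cadj andbCA [q i j + _]addrC. Qed.

Lemma cadj_irr i : cadj i i = false.
Proof. by rewrite /cadj q0 addr0 (ler_nat R 1 0) !andbF. Qed.

Lemma ccount_pfam : poisson_family P cmass ccount.
Proof. exact: poisson_family_counts. Qed.

Let cR i j : R := (cadj i j)%:R.
Let S := sf2 D cR.
Let k := sf2 D q.
Variable e : R.
Hypothesis he : (II mu (fun x y => (kw x y - k x y) ^+ 2)%R <= e%:E)%E.

Let kf01 x y : kw x y = 0 \/ kw x y = 1.
Proof. by rewrite /kf; case: asboolP => _; [right|left]. Qed.

Let kfW x y : ~ W x \/ ~ W y -> kw x y = 0.
Proof. by rewrite /kf; case: asboolP => // -[h1 h2 _] []. Qed.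

Let sf2_eq i j x y (g : J -> J -> R) : (forall h : J -> R, sf1 D h x = h i) -> (forall h : J -> R, sf1 D h y = h j) ->
  sf2 D g x y = g i j.
Proof. by move=> ex ey; rewrite /sf2 ex ey. Qed.

Let sf2_0l x y (g : J -> J -> R) : (forall h : J -> R, sf1 D h x = 0) -> sf2 D g x y = 0.
Proof. by move=> ex; rewrite /sf2 ex. Qed.

Let sf2_0r x y (g : J -> J -> R) : (forall h : J -> R, sf1 D h y = 0) -> sf2 D g x y = 0.
Proof. by move=> ey; rewrite /sf2 /sf1 big1// => i _; rewrite [X in X * _]ey mul0r. Qed.

Let S01 x y : S x y = 0 \/ S x y = 1.
Proof.
have [[i _ ex]|[_ ex]] := sf1_case R tD x; last by left; exact: sf2_0l.
have [[j _ ey]|[_ ey]] := sf1_case R tD y; last by left; exact: sf2_0r.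
by rewrite /S (sf2_eq _ ex ey) /cR; case: cadj; [right|left].
Qed.

(** If the rounded value is wrong, the average of [k x y] and [k y x] misses the adjacency indicator
    by at least [1/2], so the two squared errors add up to at least [1/2]. *)
Let round x y : `|kw x y - S x y| <= 2 * ((kw x y - k x y) ^+ 2 + (kw y x - k y x) ^+ 2).
Proof.
rewrite (kf_sym Hsym y x).
have z (g : J -> J -> R) : sf2 D g x y = 0 -> sf2 D g y x = 0 ->
    `|kw x y - 0| <= 2 * ((kw x y - 0) ^+ 2 + (kw x y - 0) ^+ 2).
  by case: (kf01 x y) => ->; rewrite !subr0 ?normr0 ?normr1; nra.
have [[i Di ex]|[_ ex]] := sf1_case R tD x; last first.
  by rewrite /S /k !(sf2_0l _ _ ex) !(sf2_0r _ _ ex); apply: (z q); [exact: sf2_0l|exact: sf2_0r].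
have [[j Dj ey]|[_ ey]] := sf1_case R tD y; last first.
  by rewrite /S /k !(sf2_0l _ _ ey) !(sf2_0r _ _ ey); apply: (z q); [exact: sf2_0r|exact: sf2_0l].
rewrite /S /k !(sf2_eq _ ex ey) !(sf2_eq _ ey ex) /cR /cadj.
have [Wi|/hout/(_ Di) nW] := boolP (inW i); last first.
  by rewrite (kfW (or_introl nW)) subrr normr0; nra.
have [Wj|/hout/(_ Dj) nW] := boolP (inW j); last first.
  by rewrite (kfW (or_intror nW)) subrr normr0; nra.
move: (q i j) (q j i) => a b /=.
have hab := sqr_ge0 (a - b).
have hab1 := sqr_ge0 (a + b - 1).
case: (kf01 x y) => ->; have [h|h] := leP 1 (a + b) => /=.
- by rewrite sub0r normrN normr1; nra.
- by rewrite subrr normr0 mulr_ge0 ?addr_ge0 ?sqr_ge0.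
- by rewrite subrr normr0 mulr_ge0 ?addr_ge0 ?sqr_ge0.
- by rewrite subr0 normr1; nra.
Qed.

Let mkf : measurable_fun setT (fun p : Rvec R d * Rvec R d => kw p.1 p.2).
Proof. exact: (kf_bmeas mH).1. Qed.
Let mS : measurable_fun setT (fun p : Rvec R d * Rvec R d => S p.1 p.2).
Proof. exact: measurable_sf2. Qed.
Let mk : measurable_fun setT (fun p : Rvec R d * Rvec R d => k p.1 p.2).
Proof. exact: measurable_sf2. Qed.

Let gap x y : R := `|kw x y - S x y|.
Let gap_bmeas : bmeas2 1 gap.
Proof.
split; first by apply: (measurableT_comp (@normr_measurable R setT)); exact: measurable_funB.
move=> x y; rewrite normr_ge0 /gap.
by case: (kf01 x y) => ->; case: (S01 x y) => ->; rewrite ?subr0 ?sub0r ?subrr ?normrN ?normr0 ?normr1 ?ler01 ?lexx.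
Qed.
Let gap_nneg : nneg2 gap.
Proof. by split=> [|x y]; [exact: gap_bmeas.1|exact: normr_ge0]. Qed.
Let err x y : R := (kw x y - k x y) ^+ 2.
Let err_nneg : nneg2 err.
Proof. by split=> [|x y]; [apply: measurable_funX; exact: measurable_funB|exact: sqr_ge0]. Qed.

Let II_gap : (II mu gap <= (4 * e)%:E)%E.
Proof.
have nT := nneg2_T err_nneg.
have n2 : nneg2 (fun x y => 2 * (err x y + err y x)) by apply: nneg2_Z => //; exact: nneg2_D.
apply: (le_trans (II_le mu gap_nneg n2 round)).
rewrite II_Z//; last exact: nneg2_D.
rewrite II_D// (II_T mu err_nneg).
apply: (@le_trans _ _ (2%:E * (e%:E + e%:E))%E).
  by apply: lee_wpmul2l => //; apply: leeD.
by rewrite -EFinD -EFinM lee_fin; lra.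
Qed.

Definition cgap : R := EX win (fun x => EX win (gap x)).

Lemma cgap_le : l ^+ 2 * cgap <= 4 * e.
Proof.
have := le_trans (EX2_le_II l gap_bmeas) II_gap.
by rewrite lee_fin gtr0_norm.
Qed.

Let e0 : 0 <= e.
Proof.
rewrite -lee_fin; apply: le_trans he; apply: integral_ge0 => x _.
by apply: integral_ge0 => y _; rewrite lee_fin sqr_ge0.
Qed.

(** [(k - S)^2] is at most twice the squared error plus twice the gap, as the gap is 0 or 1. This
    gives [2 e + 8 e], and the isometry for a kernel that need not be symmetric costs another factor
    2. *)
Lemma EK_cell_kernel_gap :
  EK P ccount (fun v => (chaos2 cmass q v - U2 cmass cadj v) ^+ 2) <= 20 * e.
Proof.
have n3 : nneg2 (fun x y => 2 * err x y + 2 * gap x y).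
  by apply: nneg2_D; exact: nneg2_Z.
have n4 : nneg2 (sf2 D (fun i j => (q i j - cR i j) ^+ 2)).
  by apply: nneg2_sf2 => // i j; exact: sqr_ge0.
have h x y : sf2 D (fun i j => (q i j - cR i j) ^+ 2) x y <= 2 * err x y + 2 * gap x y.
  have -> : sf2 D (fun i j => (q i j - cR i j) ^+ 2) x y = (k x y - S x y) ^+ 2.
    have [[i _ ex]|[_ ex]] := sf1_case R tD x; last by rewrite /S /k !(sf2_0l _ _ ex) subrr expr0n.
    have [[j _ ey]|[_ ey]] := sf1_case R tD y; last by rewrite /S /k !(sf2_0r _ _ ey) subrr expr0n.
    by rewrite /S /k !(sf2_eq _ ex ey).
  rewrite /err /gap; move: (k x y) => z; have := sqr_ge0 (kw x y - z - (S x y - kw x y)).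
  by case: (kf01 x y) => ->; case: (S01 x y) => ->; rewrite ?subr0 ?sub0r ?subrr ?normrN ?normr0 ?normr1; nra.
have := II_le mu n4 n3 h.
rewrite II_D//; [|exact: nneg2_Z|exact: nneg2_Z]; rewrite !II_Z// (II_sf2 mD tD fD) => [hl|i j]; last exact: sqr_ge0.
have {}hl : \sum_i \sum_j (q i j - cR i j) ^+ 2 * (cmass i * cmass j) <= 10 * e.
  rewrite -lee_fin; apply: (le_trans hl); apply: (@le_trans _ _ (2%:E * e%:E + 2%:E * (4 * e)%:E)%E).
    by apply: leeD; apply: lee_wpmul2l.
  by rewrite -!EFinM -EFinD lee_fin; lra.
rewrite (_ : EK _ _ _ = EK P ccount (fun v => chaos2 cmass (fun i j => q i j - cR i j) v ^+ 2)); last first.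
  apply: eq_EK => v; congr (_ ^+ 2); rewrite /U2 /chaos2 -sumrB; apply: eq_bigr => i _.
  by rewrite -sumrB; apply: eq_bigr => j _; rewrite [in RHS]mulrBl.
apply: (le_trans (EK_chaos2_sq_le ccount_pfam _)); last by lra.
by move=> i; rewrite q0 /cR cadj_irr subrr.
Qed.

Let sdeg x : R := EX win (S x).
Let cwin j : R := fine (win (D j)).

Let cmassE j : inW j -> cmass j = l * cwin j.
Proof.
move=> Wj; rewrite /cmass /cwin /window /mrestr (setIidl (hin Wj)) /intensity /mscale/= fineM//.
  by rewrite gtr0_norm.
by rewrite -(setIidl (hin Wj)); exact: (@fin_num_measure _ _ _ win).
Qed.

Let wdegE i : wdeg cmass cadj i = l * \sum_j cR i j * cwin j.
Proof.
rewrite /wdeg mulr_sumr; apply: eq_bigr => j _; rewrite /cR.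
by have [/and3P[_ Wj _]|_] := boolP (cadj i j); rewrite ?mul0r ?mulr0// cmassE//; ring.
Qed.

Let sdegE x : sdeg x = sf1 D (fun i => \sum_j cR i j * cwin j) x.
Proof.
have [[i _ ex]|[_ ex]] := sf1_case R tD x.
  by rewrite ex -(EX_sf1 mD win); apply: eq_EX => y; rewrite /S /sf2 ex.
by rewrite ex /sdeg (eq_EX win (g := fun=> 0)) ?EX_cst// => y; exact: sf2_0l.
Qed.

Let S_bmeas : bmeas2 1 S.
Proof. by split=> // x y; case: (S01 x y) => ->; rewrite ?ler01 ?lexx. Qed.

Let sdeg_bmeas : bmeas1 1 sdeg. Proof. exact: bmeas2_EX. Qed.
Let gdeg_bmeas : bmeas1 1 gdeg. Proof. exact: (kdeg_bmeas win (kf_bmeas mH)). Qed.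

Let deg_gap x : `|gdeg x - sdeg x| <= EX win (gap x).
Proof.
have h1 := bmeas1_L1 win (bmeas2_l x (kf_bmeas mH)); have h2 := bmeas1_L1 win (bmeas2_l x S_bmeas).
rewrite -(EX_B h1 h2); apply: EX_abs_le => //; first exact: L1_B.
exact: (bmeas1_L1 win (bmeas2_l x gap_bmeas)).
Qed.

Let L1_gap : L1 win (fun x => EX win (gap x)).
Proof. exact: (bmeas1_L1 win (bmeas2_EX win gap_bmeas)). Qed.

(** Degrees lie in [[0, 1]], where the n-th power is n-Lipschitz; the degree of a cell is, up to the
    factor [l], the degree for the rounded kernel. *)
Lemma wmom_gap r : `|wmom cmass cadj r.+1 - l ^+ r.+2 * gmom Hbar l r.+1| <= r.+1%:R * l ^+ r.+2 * cgap.
Proof.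
have -> : wmom cmass cadj r.+1 = l ^+ r.+2 * EX win (fun x => sdeg x ^+ r.+1).
  rewrite (eq_EX win (g := sf1 D (fun i => (\sum_j cR i j * cwin j) ^+ r.+1))); last first.
    by move=> x; rewrite sdegE (@sf1_comp _ _ R J D tD (fun z => z ^+ r.+1))//= expr0n.
  rewrite (EX_sf1 mD) mulr_sumr; apply: eq_bigr => i _; rewrite wdegE.
  have [Wi|Wi] := boolP (inW i).
    by rewrite cmassE// exprMn !exprS -/(cwin i); ring.
  rewrite big1 ?mulr0 ?expr0n ?mulr0 ?mul0r ?mulr0// => j _.
  by rewrite /cR /cadj (negbTE Wi) mul0r.
have ns := bmeas1_X r.+1 sdeg_bmeas; have ng := bmeas1_X r.+1 gdeg_bmeas.
rewrite -mulrBr normrM ger0_norm; last by rewrite exprn_ge0// ltW.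
rewrite [leRHS](_ : _ = l ^+ r.+2 * (r.+1%:R * cgap)); last by rewrite [RHS]mulrCA mulrA.
rewrite ler_wpM2l ?exprn_ge0 ?(ltW l0)//.
rewrite /gmom /kmom -EX_B; [|exact: bmeas1_L1 ns|exact: bmeas1_L1 ng].
rewrite /cgap -EX_Z//; apply: EX_abs_le; [|exact: L1_Z|].
  by apply: L1_B; [exact: bmeas1_L1 ns|exact: bmeas1_L1 ng].
move=> x; apply: le_trans (_ : r.+1%:R * `|gdeg x - sdeg x| <= _); last first.
  by rewrite ler_wpM2l.
have pw (s g : R) n : 0 <= s <= 1 -> 0 <= g <= 1 -> `|s ^+ n - g ^+ n| <= n%:R * `|g - s|.
  move=> /andP[s0 s1] /andP[g0 g1]; rewrite distrC subrXX normrM mulrC ler_wpM2r//.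
  apply: (le_trans (ler_norm_sum _ _ _)).
  rewrite -[n in n%:R]card_ord -sum1_card natr_sum; apply: ler_sum => i _.
  by rewrite ger0_norm ?mulr_ge0 ?exprn_ge0// mulr_ile1 ?exprn_ge0 ?exprn_ile1.
exact: pw (sdeg_bmeas.2 x) (gdeg_bmeas.2 x).
Qed.

(** By the isometry it suffices to compare kernels. Half of the bound is the given approximation of
    [2 l gdeg]; the rest is [8 l^2] times the squared error on degrees, whose integral is at most
    [l * cgap]. *)
Lemma U1_gap (n : finType) (B : n -> set (Rvec R d)) (a : n -> R) :
  (forall i, measurable (B i)) -> (forall i, mu (B i) < +oo)%E ->
  (\int[mu]_x ((2 * l * gdeg x - sf1 B a x) ^+ 2)%:E <= e%:E)%E ->
  EX P (fun w => (\sum_i a i * ccnt mu (eta l) (B i) w - U1 cmass cadj (ccount w)) ^+ 2) <= 2 * e + 32 * l * e.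
Proof.
move=> mB fB hB.
(* Elementary sets and cells overlap; indexing by the disjoint sum makes the difference of the two
   integrals one linear combination of counts. *)
pose A (z : n + J) := match z with inl i => B i | inr j => D j end.
pose b (z : n + J) := match z with inl i => a i | inr j => - (2 * wdeg cmass cadj j) end.
have mA z : measurable (A z) by case: z.
have fA z : (mu (A z) < +oo)%E by case: z.
rewrite (eq_EX P (g := fun w => (\sum_z b z * ccnt mu (eta l) (A z) w) ^+ 2)); last first.
  move=> w; congr (_ ^+ 2); rewrite big_sumType/=; congr (_ + _).
  rewrite /U1 /chaos1 -sumrN; apply: eq_bigr => j _.
  by rewrite mulNr /Nt /ccnt /cmass ffunE.
rewrite ccnt_isometry// -lee_fin -(integral_sf1_sq mA fA).
have mg : measurable_fun setT gdeg := gdeg_bmeas.1.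
have ms : measurable_fun setT sdeg := sdeg_bmeas.1.
pose u x := (2 * l * gdeg x - sf1 B a x) ^+ 2.
pose v x := (gdeg x - sdeg x) ^+ 2.
have mu_ : measurable_fun setT u.
  by apply: measurable_funX; apply: measurable_funB; [exact: measurable_funM|exact: measurable_sf1].
have mv : measurable_fun setT v by apply: measurable_funX; exact: measurable_funB.
apply: (@le_trans _ _ (\int[mu]_x (2%:E * (u x)%:E + (8 * l ^+ 2)%:E * (v x)%:E))%E).
  apply: ge0_le_integral => //.
  - by move=> x _; rewrite lee_fin sqr_ge0.
  - by apply/measurable_EFinP; apply: measurable_funX; exact: measurable_sf1.
  - by apply/measurable_EFinP; apply: measurable_funD; exact: measurable_funM.
  move=> x _; rewrite -!EFinM -EFinD lee_fin.
  have -> : sf1 A b x = sf1 B a x - 2 * l * sdeg x.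
    rewrite /sf1 big_sumType/=; congr (_ + _); rewrite sdegE /sf1 mulr_sumr -sumrN.
    by apply: eq_bigr => j _; rewrite wdegE; ring.
  rewrite /u /v; move: (sf1 B a x) (gdeg x) (sdeg x) => y g s.
  have := sqr_ge0 ((2 * l * g - y) + (2 * l * g - 2 * l * s)); lra.
have u0 x : 0 <= u x := sqr_ge0 _; have v0 x : 0 <= v x := sqr_ge0 _.
have Eu : measurable_fun setT (fun x => (u x)%:E) by exact/measurable_EFinP.
have Ev : measurable_fun setT (fun x => (v x)%:E) by exact/measurable_EFinP.
have l20 : 0 <= 8 * l ^+ 2 by rewrite mulr_ge0// sqr_ge0.
rewrite ge0_integralD//; last 4 first.
- by move=> x _; rewrite -EFinM lee_fin mulr_ge0.
- exact: measurable_funeM.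
- by move=> x _; rewrite -EFinM lee_fin mulr_ge0.
- exact: measurable_funeM.
have Eu0 x : setT x -> (0%R <= (u x)%:E)%E by rewrite lee_fin.
have Ev0 x : setT x -> (0%R <= (v x)%:E)%E by rewrite lee_fin.
rewrite !ge0_integralZl_EFin//.
have nv : bmeas1 1 v.
  split=> // x; rewrite v0/= /v; have /andP[? ?] := gdeg_bmeas.2 x; have /andP[? ?] := sdeg_bmeas.2 x.
  by nra.
have vW x : ~ W x -> (v x)%:E = 0%E.
  move=> nW; rewrite /v gdeg_out// sdegE.
  have [[i Di ex]|[_ ex]] := sf1_case R tD x; last by rewrite ex subrr expr0n.
  rewrite ex big1 ?subrr ?expr0n// => j _; rewrite /cR /cadj.
  by have [/hin/(_ _ Di)//|_] := boolP (inW i); rewrite mul0r.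
have hv : (\int[mu]_x (v x)%:E <= (l * cgap)%:E)%E.
  rewrite lwin_integral_eq// (lwin_integral l nv) lee_fin gtr0_norm// ler_wpM2l ?(ltW l0)//.
  apply: EX_le => //; first exact: bmeas1_L1 nv.
  move=> x; apply: le_trans (deg_gap x); rewrite /v -real_normK ?num_real//.
  have /andP[? ?] := gdeg_bmeas.2 x; have /andP[? ?] := sdeg_bmeas.2 x.
  by rewrite -[leRHS]mul1r expr2 ler_wpM2r// ler_norml; apply/andP; split; lra.
apply: (@le_trans _ _ (2%:E * e%:E + (8 * l ^+ 2)%:E * (l * cgap)%:E)%E).
  by apply: leeD; apply: lee_wpmul2l => //; rewrite lee_fin.
rewrite -!EFinM -EFinD lee_fin lerD2l.
have := cgap_le; rewrite -(ler_pM2l l0); lra.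
Qed.

Hypothesis d_gt0 : (0 < d)%N.
Hypothesis H0n : ~ Hbar l (vzero R d).

(** The two counts differ at most by the number of pairs in the symmetric difference of the edge
    sets, whose mean is [l^2 * cgap]. An L1 bound is enough to identify the limit almost surely. *)
Lemma edge_sum_gap :
  EX P (fun w => `|edge_sum Hbar eta l w -
    \sum_i \sum_j (cadj i j)%:R * ((ccount w i)%:R * (ccount w j)%:R)|) <= 4 * e.
Proof.
pose E := [set p | wadj Hbar l p.1 p.2].
pose F (z : J * J) := if cadj z.1 z.2 then D z.1 `*` D z.2 else set0.
pose G := [set p | S p.1 p.2 = 1].
have mE : measurable E := measurable_wadj mH.
have mF z : measurable (F z) by rewrite /F; case: ifP => // _; exact: measurableX.
have mG : measurable G.
  rewrite (_ : G = (fun p => S p.1 p.2) @^-1` [set 1])//.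
  by rewrite -[X in measurable X]setTI; exact: mS.
have GS p : \1_G p = S p.1 p.2.
  rewrite indicE; case: (boolP (_ \in _)) => [/set_mem/= ->//|].
  by case: (S01 p.1 p.2) => // h; rewrite notin_setE.
have N20 w : N2 (eta l) w set0 = 0.
  have e00 : set0 `*` set0 = set0 :> set (Rvec R d * Rvec R d) by apply/seteqP; split=> // x [].
  by rewrite -e00 (N2_rect hp)// set0I -(fine_cnt hp)// measure0 mulr0.
have eG w : N2 (eta l) w G = \sum_i \sum_j (cadj i j)%:R * ((ccount w i)%:R * (ccount w j)%:R).
  rewrite (N2_sum hp w mF mG) => [|p].
    rewrite pair_big/=; apply: eq_bigr => -[i j] _ /=; rewrite /F/= !ffunE.
    case: ifP => [/and3P[Wi Wj _]|_].
      by rewrite (N2_rect hp)// mul1r !setIidl//; exact: hin.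
    by rewrite mul0r N20.
  rewrite GS /S sf2_sum pair_big/=; apply: eq_bigr => -[i j] _ /=; rewrite /F/= /cR.
  case: ifP => _; last by rewrite mul0r indic0.
  by rewrite mul1r !indicE -natrM mulnb in_setX.
have mEG : measurable ((E `\` G) `|` (G `\` E)) by apply: measurableU; exact: measurableD.
rewrite (eq_EX P (g := fun w => `|N2 (eta l) w E - N2 (eta l) w G|)); last by move=> w; rewrite eG.
have indE x y : \1_((E `\` G) `|` (G `\` E)) (x, y) = gap x y.
  have kE : kw x y = \1_E (x, y) by have := kf_indic Hbar l => /(congr1 (fun f => f (x, y))).
  rewrite /gap kE -(GS (x, y)) !indicE in_setU !in_setD.
  by case: (_ \in E); case: (_ \in G); rewrite /= ?subrr ?subr0 ?sub0r ?normrN ?normr0 ?normr1.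
apply: (@le_trans _ _ (EX P (N2 (eta l) ^~ ((E `\` G) `|` (G `\` E))))).
  apply: EX_le; [|exact: (L1_N2 hp)|by move=> w; exact: (N2_dist_le hp)].
  by apply: L1_abs; apply: L1_B; exact: (L1_N2 hp).
rewrite (EX_N2 hp)//.
  rewrite gtr0_norm//; apply: le_trans cgap_le; rewrite le_eqVlt; apply/orP; left; apply/eqP.
  by congr (_ * _); apply: eq_EX => x; apply: eq_EX => y; rewrite indE.
move=> x h; have : \1_((E `\` G) `|` (G `\` E)) (x, x) = 1 :> R by rewrite indicE mem_set.
have kxx : kw x x = 0 by rewrite /kf; case: asboolP => // /(wadj_irr H0n).
rewrite indE /gap kxx sub0r normrN.
have [[i _ ex]|[_ ex]] := sf1_case R tD x.
  by rewrite /S (sf2_eq _ ex ex) /cR cadj_irr normr0 => /eqP; rewrite eq_sym oner_eq0.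
by rewrite /S (sf2_0l _ _ ex) normr0 => /eqP; rewrite eq_sym oner_eq0.
Qed.

End cell_graph.

Section small_tuples.
Context (R : realType).

Lemma sum_tuple1 (I : finType) (F : 1.-tuple I -> R) : \sum_s F s = \sum_i F [tuple i].
Proof.
rewrite (reindex (fun i : I => [tuple i])) //=; exists (fun s => thead s) => [i _|s _] //=.
by rewrite [RHS]tuple_eta; congr [tuple of _ :: _]; exact/esym/tuple0.
Qed.

Lemma sum_tuple2 (I : finType) (F : 2.-tuple I -> R) :
  \sum_s F s = \sum_i \sum_j F [tuple i; j].
Proof.
rewrite pair_big (reindex (fun p : I * I => [tuple p.1; p.2])) //=.
exists (fun s => (tnth s 0, tnth s 1)) => [[i j] _|s _] //=.
by apply/val_inj; case: s => -[|i [|j []]].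
Qed.

Lemma cvge0_lt (u : nat -> \bar R) (e : R) : u n @[n --> \oo] --> 0%E -> 0 < e ->
  \forall n \near \oo, (u n < e%:E)%E.
Proof.
move=> h e0; have e0' : (0 < e%:E)%E by rewrite lte_fin.
exact: (h _ (open_ereal_lt' e0')).
Qed.

End small_tuples.

Section L2_limit.
Context d (T : measurableType d) (R : realType) (P : probability T R).

(** [is_multiple_integral] does not require its value to be square integrable; this follows from
    closeness to an elementary integral. *)
Lemma L2_close (f g : T -> R) (e : R) : measurable_fun setT f -> L2 P g ->
  (\int[P]_w ((f w - g w) ^+ 2)%:E <= e%:E)%E ->
  L2 P f /\ EX P (fun w => (f w - g w) ^+ 2) <= e.
Proof.
move=> mf hg h.
have mfg : measurable_fun setT (fun w => f w - g w) by apply: measurable_funB => //; exact: (L2_meas hg).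
have i0 : (0 <= \int[P]_w ((f w - g w) ^+ 2)%:E)%E.
  by apply: integral_ge0 => w _; rewrite lee_fin sqr_ge0.
have ify : (\int[P]_w ((f w - g w) ^+ 2)%:E)%E \is a fin_num.
  by rewrite ge0_fin_numE// (le_lt_trans h)// ltry.
have h2 : L2 P (fun w => f w - g w).
  split=> //; apply/integrableP; split; first by apply/measurable_EFinP; exact: measurable_funX.
  rewrite (eq_integral (fun w => ((f w - g w) ^+ 2)%:E)) => [|w _].
    by rewrite -ge0_fin_numE.
  by rewrite /= ger0_norm// sqr_ge0.
split; last by rewrite /EX -lee_fin fineK.
have := L2_D h2 hg; rewrite (_ : (fun x => _) = f)//.
by apply/funext => x; rewrite subrK.
Qed.

Lemma EX_sq_triangle (f g h : T -> R) (a b : R) : L2 P f -> L2 P g -> L2 P h ->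
  EX P (fun w => (f w - g w) ^+ 2) <= a -> EX P (fun w => (g w - h w) ^+ 2) <= b ->
  EX P (fun w => (f w - h w) ^+ 2) <= 2 * a + 2 * b.
Proof.
move=> hf hg hh ha hb.
have l1 := L2_sq (L2_B hf hg); have l2 := L2_sq (L2_B hg hh); have l3 := L2_sq (L2_B hf hh).
apply: (@le_trans _ _ (EX P (fun w => 2 * (f w - g w) ^+ 2 + 2 * (g w - h w) ^+ 2))).
  apply: EX_le => //; first by apply: L1_D; exact: L1_Z.
  by move=> w; have := sqr_ge0 ((f w - g w) - (g w - h w)); nra.
by rewrite (EX_D (L1_Z 2 l1) (L1_Z 2 l2)) !EX_Z//; lra.
Qed.

End L2_limit.

(** * From Wiener-Ito integrals to finite graphs *)

Section discretization.
Context (R : realType) (d : nat) d' (Omega : measurableType d') (P : probability Omega R).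
Variables (Hbar : R -> set (Rvec R d)) (eta : R -> Omega -> {measure set (Rvec R d) -> \bar R}) (l : R).
Hypothesis l0 : 0 < l.
Hypothesis hp : is_poisson_measure P (intensity d l) (eta l).
Hypothesis mH : measurable (Hbar l).
Hypothesis Hsym : Hbar l = [set vopp x | x in Hbar l].
Hypothesis d_gt0 : (0 < d)%N.
Hypothesis H0n : ~ Hbar l (vzero R d).
Variables (F1 F2 : {RV P >-> R}).
Hypothesis F1_def : is_multiple_integral (intensity d l) P (eta l) (f1 Hbar l) F1.
Hypothesis F2_def : is_multiple_integral (intensity d l) P (eta l) (f2 Hbar l) F2.
Local Notation W := (@cube R d 1).
Local Notation win := (@window R d).
Local Notation mu := (intensity d l).
Local Notation kw := (kf Hbar l).
Let mW : measurable W. Proof. exact: measurable_cube. Qed.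

Let f2E (t : 2.-tuple (Rvec R d)) : f2 Hbar l t = kw (tnth t 0) (tnth t 1).
Proof.
rewrite /f2 indic_asbool /kf; congr (nat_of_bool _)%:R; apply: asbool_equiv_eq.
split=> [[h1 h2]|[h1 h2 h3]]; first by split; [exact: h2|exact: h2|].
split=> //; case=> -[|[|//]] hi.
  by rewrite (_ : Ordinal hi = 0)//; exact/val_inj.
by rewrite (_ : Ordinal hi = 1)//; exact/val_inj.
Qed.

Let f1E (t : 1.-tuple (Rvec R d)) : f1 Hbar l t = 2 * l * gdeg Hbar l (tnth t 0).
Proof.
rewrite /f1; congr (_ * _); rewrite /Rintegral /gdeg /kdeg /EX.
set x := tnth t 0; congr fine.
pose A := xsection [set p | wadj Hbar l p.1 p.2] x.
have mA : measurable A by apply: measurable_xsection; exact: measurable_wadj.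
have kA y : kw x y = \1_A y.
  by rewrite indic_asbool /kf; congr (nat_of_bool _)%:R; apply: asbool_equiv_eq; rewrite /A /xsection/= inE.
rewrite (eq_integral (fun y => (\1_A y)%:E)) => [|y _]; last by rewrite f2E /= -kA.
rewrite [RHS](eq_integral (fun y => (\1_A y)%:E)) => [|y _]; last by rewrite kA.
rewrite !integral_indic// !setIT.
have AW : A `<=` W by move=> y; rewrite /A /xsection/= inE => -[].
have e : window A = leb R d A by rewrite /window /mrestr (setIidl AW).
by rewrite [RHS]e.
Qed.

Section order_two.
Variable k : elementary mu 2.
Let n := el_size k.
Let A := @el_set _ _ _ _ _ k.
Let q (i j : 'I_n) : R := el_coef (e:=k) [tuple i; j].
Let q0 i : q i i = 0.
Proof. by apply: el_diagonal; rewrite /= inE eqxx. Qed.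
Let mA i : measurable (A i). Proof. exact: el_measurable. Qed.
Let fA i : (mu (A i) < +oo)%E. Proof. exact: el_finite. Qed.

(** The sets of an elementary kernel may straddle the boundary of the window, whereas adjacency is
    confined to it; each set is therefore cut by [W] and its complement. *)
Let cell (z : 'I_n * bool) : set (Rvec R d) := A z.1 `&` (if z.2 then W else ~` W).
Let inw (z : 'I_n * bool) := z.2.
Let qq (z z' : 'I_n * bool) : R := q z.1 z'.1.

Let mcell z : measurable (cell z).
Proof. by apply: measurableI => //; case: z.2 => //; exact: measurableC. Qed.

Let fcell z : (mu (cell z) < +oo)%E.
Proof.
apply: le_lt_trans (fA z.1).
by apply: le_measure; rewrite ?inE//; exact: subIsetl.
Qed.

Let tcell : trivIset setT cell.
Proof.
apply/trivIsetP => -[i b] [j b'] _ _ ij; apply/seteqP; split=> // x [[/= Ai Wb] [/= Aj Wb']].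
have [eij|nij] := eqVneq i j; last first.
  have /trivIsetP/(_ i j Logic.I Logic.I nij) := el_disjoint (e:=k).
  by move=> e; have : (A i `&` A j) x by []; rewrite e.
by move: ij Wb Wb'; rewrite -eij; case: b; case: b'; rewrite ?eqxx.
Qed.

Let cellin z : inw z -> cell z `<=` W.
Proof. by case: z => i [] //= _ x []. Qed.

Let cellout z x : ~~ inw z -> cell z x -> ~ W x.
Proof. by case: z => i [] //= _ []. Qed.

Let qq0 z : qq z z = 0. Proof. exact: q0. Qed.

Let A_cell i : A i = cell (i, true) `|` cell (i, false).
Proof. by rewrite /cell/= -setIUr setUv setIT. Qed.

Let sf1_cell (g : 'I_n -> R) x : sf1 cell (fun z => g z.1) x = sf1 A g x.
Proof.
rewrite /sf1 -(pair_big xpredT xpredT (fun i b => g i * \1_(cell (i, b)) x))/=.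
apply: eq_bigr => i _; rewrite big_bool/= -mulrDr; congr (_ * _).
rewrite /cell/= !indic_asbool -natrD; congr (_%:R).
have [Ax|Ax] := asboolP (A i x); have [Wx|Wx] := pselect (W x).
- by rewrite asboolT ?asboolF// => -[].
- by rewrite asboolF ?asboolT// => -[].
- by rewrite !asboolF// => -[].
- by rewrite !asboolF// => -[].
Qed.

Let sf2_cell x y : sf2 cell qq x y = \sum_i \sum_j q i j * (\1_(A i) x * \1_(A j) y).
Proof.
rewrite -sf2_sum /sf2 -(sf1_cell (fun i => sf1 A (q i) y) x) /sf1; apply: eq_bigr => z _.
by congr (_ * _); exact: (sf1_cell (q z.1) y).
Qed.

Let el_funE t : elementary_fun k t = sf2 cell qq (tnth t 0) (tnth t 1).
Proof.
rewrite /elementary_fun sum_tuple2 sf2_cell; apply: eq_bigr => i _; apply: eq_bigr => j _.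
by rewrite !big_ord_recl big_ord0 mulr1; congr (_ * (_ * \1_(el_set _) (tnth _ _))); exact/val_inj.
Qed.

Let II_err : II mu (fun x y => (kw x y - sf2 cell qq x y) ^+ 2) =
  (\int[tuple_measure mu 2]_t ((f2 Hbar l t - elementary_fun k t) ^+ 2)%:E)%E.
Proof.
pose g x y : R := (kw x y - sf2 cell qq x y) ^+ 2.
have mg : measurable_fun setT (fun p : Rvec R d * Rvec R d => g p.1 p.2).
  by apply: measurable_funX; apply: measurable_funB; [exact: (kf_bmeas mH).1|exact: measurable_sf2].
have mg2 : measurable_fun setT (fun t : 2.-tuple (Rvec R d) => (g (tnth t 0) (tnth t 1))%:E).
  apply/measurable_EFinP; apply: (measurableT_comp mg (g := fun t : 2.-tuple (Rvec R d) => (tnth t 0, tnth t 1))).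
  by apply/measurable_fun_pairP; split; exact: measurable_tnth.
rewrite (eq_integral (fun t : 2.-tuple (Rvec R d) => (g (tnth t 0) (tnth t 1))%:E)) => [|t _]; last first.
  by rewrite f2E el_funE.
rewrite (ge0_integral_tuple_measureS _ mg2) => [|t]; last by rewrite lee_fin sqr_ge0.
apply: eq_integral => x _.
have mgx : measurable_fun setT (fun t : 1.-tuple (Rvec R d) => (g x (tnth t 0))%:E).
  apply/measurable_EFinP; apply: (measurableT_comp (measurableT_comp mg (pair1_measurable x))).
  exact: measurable_tnth.
rewrite [RHS](_ : _ = \int[tuple_measure mu 1]_t (g x (tnth t 0))%:E)%E; last first.
  by apply: eq_integral => t _; congr (g _ _)%:E; rewrite /tcons !(tnth_nth x)//= -(tnth_nth x t 0).
rewrite (ge0_integral_tuple_measureS _ mgx) => [|t]; last by rewrite lee_fin sqr_ge0.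
apply: eq_integral => y _; transitivity (\int[tuple_measure mu 0]_t (g x y)%:E)%E => //.
by rewrite integral_tuple_measure0//; exact: measurable_cst.
Qed.

(** Both halves of a set carry the same coefficient, so only their total count matters; the counts
    add up outside the null set of [cnt_add_ae]. *)
Let int_ae : exists N, [/\ measurable N, P N = 0%E & forall w, ~ N w ->
  chaos2 (cmass l cell) qq (ccount eta l cell w) = elementary_int (eta l) k w].
Proof.
have h i : exists N, [/\ measurable N, P N = 0%E & forall w, ~ N w ->
    (cnt (eta l) (A i) w = cnt (eta l) (cell (i, true)) w + cnt (eta l) (cell (i, false)) w)%N].
  have AA : cell (i, true) `&` cell (i, false) = set0.
    by apply/seteqP; split=> // x [[_ /= h1] [_ /= h2]].
  have fU : (mu (cell (i, true) `|` cell (i, false)) < +oo)%E by rewrite -A_cell.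
  by rewrite A_cell; exact: (cnt_add_ae hp (mcell _) (mcell _) AA fU).
have [N hN] := choice h.
exists (\big[setU/set0]_(i < n) N i); split.
- by apply: bigsetU_measurable => i _; have [] := hN i.
- apply/eqP; rewrite -measure_le0.
  apply: le_trans (_ : \sum_(i < n) P (N i) <= _)%E; last by rewrite big1// => i _; have [] := hN i.
  pose N' (i : nat) := if insub i is Some j then N j else set0.
  have e (i : 'I_n) : N i = N' i by rewrite /N' valK.
  have mN' i : measurable (N' i) by rewrite /N'; case: insubP => // j _ _; have [] := hN j.
  rewrite (eq_bigr (fun i : 'I_n => N' i)) => [|i _]; last exact: e.
  rewrite [leRHS](eq_bigr (fun i : 'I_n => P (N' i))) => [|i _]; last by rewrite e.
  by apply: content_subadditive => //; exact: bigsetU_measurable.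
move=> w hw.
have cntE i : cnt (eta l) (A i) w = (cnt (eta l) (cell (i, true)) w + cnt (eta l) (cell (i, false)) w)%N.
  have [_ _] := hN i; apply => Nw; apply: hw.
  by rewrite (bigD1 i)//=; left.
have NtE i : \sum_b Nt (cmass l cell) (i, b) (ccount eta l cell w) = fine (eta l w (A i)) - fine (mu (A i)).
  rewrite big_bool /Nt /ccount !ffunE (fine_cnt hp)// cntE natrD.
  have -> : fine (mu (A i)) = cmass l cell (i, true) + cmass l cell (i, false).
    rewrite /cmass -fineD; [|by rewrite ge0_fin_numE//; exact: fcell|by rewrite ge0_fin_numE//; exact: fcell].
    congr fine; rewrite {1}A_cell.
    apply: (@measureU _ _ _ mu) => //.
    by apply/seteqP; split=> // x [[_ /= h1] [_ /= h2]].
  by rewrite /=; ring.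
rewrite /elementary_int sum_tuple2 /chaos2.
have sp (F : 'I_n * bool -> R) : \sum_z F z = \sum_i \sum_b F (i, b).
  by rewrite pair_big/=; apply: eq_bigr => -[i b].
rewrite sp; apply: eq_bigr => i _.
under eq_bigr do rewrite sp.
rewrite exchange_big/=; apply: eq_bigr => j _.
rewrite !big_ord_recl big_ord0 mulr1.
rewrite (_ : tnth _ _ = i)// (_ : tnth _ _ = j)//.
rewrite -(NtE i) -(NtE j) !big_bool /qq/= /q; ring.
Qed.

Lemma discretization_of_kernel (e : R) (n1 : finType) (B : n1 -> set (Rvec R d)) (a : n1 -> R) :
  (\int[tuple_measure mu 2]_t ((f2 Hbar l t - elementary_fun k t) ^+ 2)%:E <= e%:E)%E ->
  (forall i, measurable (B i)) -> (forall i, mu (B i) < +oo)%E ->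
  (\int[mu]_x ((2 * l * gdeg Hbar l x - sf1 B a x) ^+ 2)%:E <= e%:E)%E ->
  exists (J : finType) (m : J -> R) (K : Omega -> {ffun J -> nat}) (c : rel J),
  [/\ poisson_family P m K, symmetric c & irreflexive c] /\
  [/\ EX P (fun w => (\sum_i a i * ccnt mu (eta l) (B i) w - U1 m c (K w)) ^+ 2) <= 2 * e + 32 * l * e,
    L2 P (elementary_int (eta l) k) /\
      EX P (fun w => (elementary_int (eta l) k w - U2 m c (K w)) ^+ 2) <= 20 * e,
    forall r, `|wmom m c r.+1 - l ^+ r.+2 * gmom Hbar l r.+1| <= 4 * r.+1%:R * l ^+ r * e &
    EX P (fun w => `|edge_sum Hbar eta l w - \sum_i \sum_j (c i j)%:R * ((K w i)%:R * (K w j)%:R)|) <= 4 * e].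
Proof.
rewrite -II_err => h2 mB fB h1.
have pK := ccount_pfam hp mcell tcell fcell.
exists ('I_n * bool)%type, (cmass l cell), (ccount eta l cell), (cadj inw qq).
split; first by split=> //; [move=> i j; exact: cadj_sym|move=> i; exact: cadj_irr].
have [N [mN PN hN]] := int_ae.
split.
- exact: (U1_gap l0 hp mH Hsym mcell tcell fcell cellin cellout h2 mB fB h1).
- have h := EK_cell_kernel_gap hp mH Hsym mcell tcell fcell cellout qq0 h2.
  have mI : measurable_fun setT (elementary_int (eta l) k).
    apply: measurable_sum => s; apply: measurable_funM => //; apply: measurable_prod => j _.
    apply: measurable_funB => //.
    rewrite (_ : (fun w => _) = (fun w => (cnt (eta l) (el_set (tnth s j)) w)%:R)).
      by apply: (measurable_cnt hp); exact: el_measurable.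
    by apply/funext => w; rewrite (fine_cnt hp)//; exact: el_measurable.
  split.
    split=> //; apply: (L1_ae mN PN (f := fun w => chaos2 (cmass l cell) qq (ccount eta l cell w) ^+ 2)).
    + by move=> w Nw; rewrite hN.
    + exact: measurable_funX.
    + by apply: (pg_L1 pK (G := fun v => chaos2 (cmass l cell) qq v ^+ 2)); apply: pg_X; exact: pg_chaos2.
  apply: le_trans h; rewrite le_eqVlt; apply/orP; left; apply/eqP.
  by apply: (EX_ae mN PN) => w Nw; rewrite /= hN.
- move=> r; apply: (le_trans (wmom_gap l0 mH qq mcell tcell cellin r)).
  have := cgap_le l0 mH Hsym mcell tcell cellout h2.
  rewrite -(ler_pM2l (_ : 0 < r.+1%:R * l ^+ r)); last by rewrite mulr_gt0 ?ltr0n ?exprn_gt0.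
  by move=> h; rewrite !exprS; lra.
- exact: (edge_sum_gap l0 hp mH Hsym mcell tcell cellin cellout qq0 h2 H0n).
Qed.

End order_two.

Let int1 (k : elementary mu 1) :
  (\int[tuple_measure mu 1]_t ((f1 Hbar l t - elementary_fun k t) ^+ 2)%:E =
   \int[mu]_x ((2 * l * gdeg Hbar l x - sf1 (@el_set _ _ _ _ _ k) (fun i => el_coef (e:=k) [tuple i]) x) ^+ 2)%:E)%E.
Proof.
pose B := @el_set _ _ _ _ _ k; pose a (i : 'I_(el_size k)) := el_coef (e:=k) [tuple i].
pose g x : R := (2 * l * gdeg Hbar l x - sf1 B a x) ^+ 2.
have mg : measurable_fun setT g.
  apply: measurable_funX; apply: measurable_funB; last by apply: measurable_sf1 => i; exact: el_measurable.
  by apply: measurable_funM => //; exact: (kdeg_bmeas win (kf_bmeas mH)).1.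
have mg1 : measurable_fun setT (fun t : 1.-tuple (Rvec R d) => (g (tnth t 0))%:E).
  by apply/measurable_EFinP; apply: (measurableT_comp mg); exact: measurable_tnth.
rewrite (eq_integral (fun t : 1.-tuple (Rvec R d) => (g (tnth t 0))%:E)) => [|t _]; last first.
  rewrite f1E /g; congr ((_ - _) ^+ 2)%:E; rewrite /elementary_fun sum_tuple1; apply: eq_bigr => i _.
  by rewrite big_ord_recl big_ord0 mulr1.
rewrite (ge0_integral_tuple_measureS _ mg1) => [|t]; last by rewrite lee_fin sqr_ge0.
apply: eq_integral => x _; transitivity (\int[tuple_measure mu 0]_t (g x)%:E)%E => //.
by rewrite integral_tuple_measure0//; exact: measurable_cst.
Qed.

Lemma discretization (e : R) : 0 < e ->
  [/\ L2 P F1, L2 P F2 &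
  exists (J : finType) (m : J -> R) (K : Omega -> {ffun J -> nat}) (c : rel J),
  [/\ poisson_family P m K, symmetric c & irreflexive c] /\
  [/\ EX P (fun w => (F1 w - U1 m c (K w)) ^+ 2) <= e,
    EX P (fun w => (F2 w - U2 m c (K w)) ^+ 2) <= e,
    forall r, (r < 3)%N -> `|wmom m c r.+1 - l ^+ r.+2 * gmom Hbar l r.+1| <= e &
    EX P (fun w => `|edge_sum Hbar eta l w - \sum_i \sum_j (c i j)%:R * ((K w i)%:R * (K w j)%:R)|) <= e]].
Proof.
(* [D] absorbs the constants of the four errors, of which the largest involve [64 l] and [12 l^2]
   after the triangle inequality. *)
move=> e0; pose D := 100 * (1 + l + l ^+ 2).
have D1 : 100 <= D by rewrite /D; have := sqr_ge0 l; move: l0; lra.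
have D0 : 0 < D by lra.
pose u := e / D; have u0 : 0 < u by exact: divr_gt0.
have uD : 100 * (1 + l + l ^+ 2) * u = e by rewrite /u -/D mulrC divfK// gt_eqF.
have [k1 [c1 c2]] := F1_def; have [k2 [c3 c4]] := F2_def.
near \oo => n.
have h1 : (\int[tuple_measure mu 1]_t ((f1 Hbar l t - elementary_fun (k1 n) t) ^+ 2)%:E <= u%:E)%E.
  by apply: ltW; near: n; exact: cvge0_lt.
have h2 : ('E_P[(fun w => (F1 w - elementary_int (eta l) (k1 n) w) ^+ 2)%R] <= u%:E)%E.
  by apply: ltW; near: n; exact: cvge0_lt.
have h3 : (\int[tuple_measure mu 2]_t ((f2 Hbar l t - elementary_fun (k2 n) t) ^+ 2)%:E <= u%:E)%E.
  by apply: ltW; near: n; exact: cvge0_lt.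
have h4 : ('E_P[(fun w => (F2 w - elementary_int (eta l) (k2 n) w) ^+ 2)%R] <= u%:E)%E.
  by apply: ltW; near: n; exact: cvge0_lt.
have eE (X : Omega -> R) : ('E_P[X] = \int[P]_w (X w)%:E)%E by rewrite unlock.
rewrite eE in h2; rewrite eE in h4.
pose B := @el_set _ _ _ _ _ (k1 n); pose a (i : 'I_(el_size (k1 n))) := el_coef (e:=k1 n) [tuple i].
have mB i : measurable (B i) by exact: el_measurable.
have fB i : (mu (B i) < +oo)%E by exact: el_finite.
have i1E w : elementary_int (eta l) (k1 n) w = \sum_i a i * ccnt mu (eta l) (B i) w.
  rewrite /elementary_int sum_tuple1; apply: eq_bigr => i _.
  by rewrite big_ord_recl big_ord0 mulr1 (fine_cnt hp).
move: h1; rewrite int1 => h1.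
have [J [m [K [c [[pK cs ci] [g1 [l2I g2] g3 g4]]]]]] := discretization_of_kernel h3 mB fB h1.
have l1I : L2 P (fun w => \sum_i a i * ccnt mu (eta l) (B i) w).
  have : forall s : seq _, L2 P (fun w => \sum_(i <- s) a i * ccnt mu (eta l) (B i) w).
    elim=> [|i s IH]; first by rewrite (_ : (fun w => _) = fun=> 0); [exact: L2_cst|apply/funext => w; rewrite big_nil].
    rewrite (_ : (fun w => _) = fun w => a i * ccnt mu (eta l) (B i) w + \sum_(j <- s) a j * ccnt mu (eta l) (B j) w); last by apply/funext => w; rewrite big_cons.
    by apply: L2_D => //; apply: L2_Z; exact: (L1_EX_ccnt hp (mB i) (fB i)).1.
  exact.
have [lF1 hF1] : L2 P F1 /\ EX P (fun w => (F1 w - \sum_i a i * ccnt mu (eta l) (B i) w) ^+ 2) <= u.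
  apply: (L2_close (measurable_funPT F1) l1I).
  by under eq_integral do rewrite -i1E.
have [lF2 hF2] : L2 P F2 /\ EX P (fun w => (F2 w - elementary_int (eta l) (k2 n) w) ^+ 2) <= u.
  exact: (L2_close (measurable_funPT F2) l2I h4).
have L2U (G : {ffun J -> nat} -> R) : pg G -> L2 P (fun w => G (K w)).
  by move=> pG; split; [exact: (measurable_pfam pK)|exact: (pg_L1 pK (G := fun v => G v ^+ 2) (pg_X 2 pG))].
have lu : 0 <= l * u by rewrite mulr_ge0// ltW.
have llu : 0 <= l ^+ 2 * u by rewrite mulr_ge0 ?sqr_ge0// ltW.
split=> //; exists J, m, K, c; split=> //; split.
- apply: le_trans (EX_sq_triangle lF1 l1I (L2U _ (pg_chaos1 _ _)) hF1 g1) _.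
  by rewrite -uD; lra.
- apply: le_trans (EX_sq_triangle lF2 l2I (L2U _ (pg_chaos2 _ _)) hF2 g2) _.
  by rewrite -uD; lra.
- case=> [_|[_|[_|]]]; last by [].
  + by apply: (le_trans (g3 0%N)); rewrite -uD expr0; lra.
  + by apply: (le_trans (g3 1%N)); rewrite -uD expr1; lra.
  + by apply: (le_trans (g3 2%N)); rewrite -uD; lra.
- by apply: le_trans g4 _; rewrite -uD; lra.
Unshelve. all: by end_near.
Qed.

End discretization.

(* Limits of the chaoses and of the edge count of Poisson-weighted finite
   graphs; [w r] is the limit of the r-th moment of the degrees. *)
Definition graph_limit d' (Omega : measurableType d') (R : realType) (P : probability Omega R)
    (X1 X2 G : Omega -> R) (w : nat -> R) : Prop :=
  forall e : R, 0 < e ->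
  exists (J : finType) (m : J -> R) (K : Omega -> {ffun J -> nat}) (c : rel J),
  [/\ poisson_family P m K, symmetric c & irreflexive c] /\
  [/\ EX P (fun t => (X1 t - U1 m c (K t)) ^+ 2) <= e,
    EX P (fun t => (X2 t - U2 m c (K t)) ^+ 2) <= e,
    forall r, (r < 3)%N -> `|wmom m c r.+1 - w r.+1| <= e &
    EX P (fun t => `|G t - \sum_i \sum_j (c i j)%:R * ((K t i)%:R * (K t j)%:R)|) <= e].

(** * Passage from finite graphs to their limits *)

Section poisson_graph_limit.
Context d' (Omega : measurableType d') (R : realType) (P : probability Omega R).
Variables (X1 X2 G : Omega -> R) (w : nat -> R).
Implicit Types phi : R -> R -> R.
Hypotheses (hX1 : L2 P X1) (hX2 : L2 P X2) (hG : L1 P G).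
Hypothesis w_ge0 : forall r, 0 <= w r.
Hypothesis hdisc : graph_limit P X1 X2 G w.

(** The modulus constant of [transfer]: 17 is [1 + 8 * 2], from its two quadratic bounds. *)
Let S : R := 17 + EX P (fun t => X1 t ^+ 2) + EX P (fun t => X2 t ^+ 2).

(** A local Lipschitz constant of linear growth: such functionals are continuous under L2
    convergence of both arguments. The class contains squares, products and [x f(x)] for [f] in
    [C11]. *)
Definition quadratic_lipschitz (L : R) phi : Prop :=
  measurable_fun setT (fun p : R * R => phi p.1 p.2) /\
  forall x1 x2 u1 u2, `|phi x1 x2 - phi u1 u2| <=
    L * ((1 + `|x1| + `|x2| + `|u1| + `|u2|) * (`|x1 - u1| + `|x2 - u2|)).

Let quad_L1 L phi (Y1 Y2 : Omega -> R) : quadratic_lipschitz L phi -> 0 <= L -> L2 P Y1 -> L2 P Y2 ->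
  L1 P (fun t => phi (Y1 t) (Y2 t)).
Proof.
move=> [mphi hphi] L0 h1 h2.
apply: (@L1_le _ _ _ _ _ (fun t => `|phi 0 0| + L * (2 + 4 * (Y1 t ^+ 2) + 4 * (Y2 t ^+ 2)))).
- apply: (measurableT_comp mphi (g := fun t => (Y1 t, Y2 t))).
  by apply/measurable_fun_pairP; split; [exact: (L2_meas h1)|exact: (L2_meas h2)].
- move=> t; rewrite -lerBlDl; apply: le_trans (_ : `|phi (Y1 t) (Y2 t) - phi 0 0| <= _).
    exact: lerB_dist.
  apply: (le_trans (hphi _ _ _ _)); rewrite ler_wpM2l// !subr0 normr0 !addr0.
  rewrite -(real_normK (num_real (Y1 t))) -(real_normK (num_real (Y2 t))).
  move: (normr_ge0 (Y1 t)) (normr_ge0 (Y2 t)) => a0 b0.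
  move: `|Y1 t| `|Y2 t| a0 b0 => a b a0 b0.
  by have := sqr_ge0 (a - b); have := sqr_ge0 (a - 1); have := sqr_ge0 (b - 1); nra.
- apply: L1_D; first exact: L1_cst.
  apply: L1_Z; apply: L1_D; last by apply: L1_Z; exact: L2_sq.
  by apply: L1_D; [exact: L1_cst|apply: L1_Z; exact: L2_sq].
Qed.

(** Young's inequality with weight [de]: the size of the arguments is multiplied by [de] and their
    squared distance, at most [de^2], by [8 / de]. *)
Let transfer L phi (Y1 Y2 : Omega -> R) (de : R) : quadratic_lipschitz L phi -> 0 <= L ->
  L2 P Y1 -> L2 P Y2 -> 0 < de <= 1 ->
  EX P (fun t => (X1 t - Y1 t) ^+ 2) <= de ^+ 2 ->
  EX P (fun t => (X2 t - Y2 t) ^+ 2) <= de ^+ 2 ->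
  `|EX P (fun t => phi (X1 t) (X2 t)) - EX P (fun t => phi (Y1 t) (Y2 t))| <= L * S * de.
Proof.
move=> hphi L0 h1 h2 /andP[de0 de1] e1 e2.
have l1 := quad_L1 hphi L0 hX1 hX2; have l2 := quad_L1 hphi L0 h1 h2.
have s1 := L2_sq hX1; have s2 := L2_sq hX2.
have q1 := L2_sq (L2_B hX1 h1); have q2 := L2_sq (L2_B hX2 h2).
rewrite -(EX_B l1 l2).
have la : L1 P (fun t => 1 + X1 t ^+ 2 + X2 t ^+ 2).
  by apply: L1_D => //; apply: L1_D => //; exact: L1_cst.
have lb : L1 P (fun t => (X1 t - Y1 t) ^+ 2 + (X2 t - Y2 t) ^+ 2) by exact: L1_D.
apply: (@le_trans _ _ (EX P (fun t => L * (de * (1 + X1 t ^+ 2 + X2 t ^+ 2) +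
   8 / de * ((X1 t - Y1 t) ^+ 2 + (X2 t - Y2 t) ^+ 2))))).
  apply: EX_abs_le; first exact: L1_B.
    by apply: L1_Z; apply: L1_D; exact: L1_Z.
  move=> t; apply: (le_trans (hphi.2 _ _ _ _)); rewrite ler_wpM2l//.
  move: (X1 t) (X2 t) (Y1 t) (Y2 t) => x1 x2 u1 u2.
  have t1 : `|u1| <= `|x1| + `|x1 - u1| by have := ler_normB x1 (x1 - u1); rewrite opprB addrC subrK; lra.
  have t2 : `|u2| <= `|x2| + `|x2 - u2| by have := ler_normB x2 (x2 - u2); rewrite opprB addrC subrK; lra.
  rewrite -(real_normK (num_real x1)) -(real_normK (num_real x2)).
  rewrite -(real_normK (num_real (x1 - u1))) -(real_normK (num_real (x2 - u2))).
  move: t1 t2 (normr_ge0 x1) (normr_ge0 x2) (normr_ge0 u1) (normr_ge0 u2) (normr_ge0 (x1 - u1)) (normr_ge0 (x2 - u2)).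
  move: `|x1| `|x2| `|u1| `|u2| `|x1 - u1| `|x2 - u2| => {x1 x2 u1 u2} a b u v p q t1 t2 a0 b0 u0 v0 p0 q0.
  rewrite -(ler_pM2l de0) [leRHS](_ : _ = de * (de * (1 + a ^+ 2 + b ^+ 2)) + 8 * (p ^+ 2 + q ^+ 2)); last first.
    by field; rewrite gt_eqF.
  apply: (@le_trans _ _ (de * (1 + 2 * a + 2 * b) * (p + q) + (p + q) ^+ 2)).
    have : (1 + a + b + u + v) * (p + q) <= (1 + 2 * a + 2 * b + (p + q)) * (p + q).
      by rewrite ler_wpM2r//; lra.
    rewrite -(ler_pM2l de0) => h; apply: (le_trans h).
    rewrite mulrDl mulrDr mulrA lerD2l -expr2 -[leRHS]mul1r ler_wpM2r// sqr_ge0//.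
  have := sqr_ge0 (de - (p + q)); have := sqr_ge0 (de * a - (p + q)); have := sqr_ge0 (de * b - (p + q)).
  have := sqr_ge0 (p - q).
  have : 0 <= de ^+ 2 by exact: sqr_ge0.
  rewrite !expr2; nra.
rewrite EX_Z; last by apply: L1_D; exact: L1_Z.
rewrite (EX_D (L1_Z de la) (L1_Z (8 / de) lb)) !EX_Z// (EX_D q1 q2).
rewrite (EX_D (L1_D (L1_cst P 1) s1) s2) (EX_D (L1_cst P 1) s1) EX_cst.
rewrite -mulrA ler_wpM2l// /S.
apply: (@le_trans _ _ (de * (1 + EX P (fun t => X1 t ^+ 2) + EX P (fun t => X2 t ^+ 2)) + 8 / de * (2 * de ^+ 2))).
  by rewrite lerD2l ler_wpM2l ?divr_ge0 ?(ltW de0)//; lra.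
by rewrite le_eqVlt; apply/orP; left; apply/eqP; field; rewrite gt_eqF.
Qed.

Let small (a b C : R) : (forall de, 0 < de <= 1 -> a <= b + C * de) -> a <= b.
Proof.
move=> h; apply/ler_addgt0Pr => e e0; pose C' := `|C| + 1.
have C'0 : 0 < C' by rewrite /C' ltr_wpDl.
pose de := Num.min 1 (e / C').
have de0 : 0 < de by rewrite lt_min ltr01 divr_gt0.
have de1 : de <= 1 by rewrite ge_min lexx.
apply: (le_trans (h de _)); first by rewrite de0.
rewrite lerD2l; apply: (@le_trans _ _ (C' * (e / C'))); last by rewrite mulrC divfK// gt_eqF.
apply: (@le_trans _ _ (C' * de)).
  by rewrite ler_wpM2r ?(ltW de0)// /C' (le_trans (ler_norm _))// lerDl.
by rewrite ler_wpM2l ?(ltW C'0)// ge_min lexx orbT.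
Qed.

Let L2K (J : finType) (m : J -> R) K (H : {ffun J -> nat} -> R) : poisson_family P m K -> pg H ->
  L2 P (fun t => H (K t)).
Proof.
move=> pK pH; split; first exact: (measurable_pfam pK).
exact: (pg_L1 pK (G := fun v => H v ^+ 2) (pg_X 2 pH)).
Qed.

(** Covers inequalities and identities alike: [b = 0] turns an exact moment formula on finite graphs
    into one for the limit. *)
Lemma stein_limit (phi phi' : R -> R -> R) (L B k1 k2 b : R) :
  0 <= L -> 0 <= b -> quadratic_lipschitz L phi -> quadratic_lipschitz L phi' ->
  (forall x y, `|phi' x y| <= B) ->
  (forall (J : finType) (m : J -> R) (K : Omega -> {ffun J -> nat}) (c : rel J),
    poisson_family P m K -> symmetric c -> irreflexive c ->
    `|EK P K (fun v => phi (U1 m c v) (U2 m c v)) -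
      (k2 * wmom m c 2 + k1 * wmom m c 1) * EK P K (fun v => phi' (U1 m c v) (U2 m c v))| <=
    b * (wmom m c 1 + wmom m c 2 + wmom m c 3)) ->
  `|EX P (fun t => phi (X1 t) (X2 t)) -
    (k2 * w 2 + k1 * w 1) * EX P (fun t => phi' (X1 t) (X2 t))| <= b * (w 1 + w 2 + w 3).
Proof.
move=> L0 b0 hphi hphi' hB hK; have B0 : 0 <= B by exact: le_trans (hB 0 0).
pose k := k2 * w 2 + k1 * w 1.
apply: (@small _ _ (L * S + 3 * b + (`|k2| + `|k1|) * B + `|k| * (L * S))) => de hde.
have /andP[de0 de1] := hde.
have [J [m [K [c [[pK cs ci] [g1 g2 g3 _]]]]]] := hdisc (exprn_gt0 2 de0).
have dd : de ^+ 2 <= de by rewrite expr2 -[leRHS]mul1r ler_wpM2r// ltW.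
have y1 := L2K pK (pg_chaos1 m (fun i => 2 * wdeg m c i)).
have y2 := L2K pK (pg_chaos2 m (fun i j => (c i j)%:R)).
have t1 := transfer hphi L0 y1 y2 hde g1 g2; have t2 := transfer hphi' L0 y1 y2 hde g1 g2.
have h := hK J m K c pK cs ci.
have a1 := g3 0%N erefl; have a2 := g3 1%N erefl; have a3 := g3 2%N erefl.
have bB : `|EK P K (fun v => phi' (U1 m c v) (U2 m c v))| <= B.
  rewrite -[leRHS](EX_cst P); apply: EX_abs_le; [|exact: L1_cst|by move=> t; exact: hB].
  exact: (quad_L1 hphi' L0 y1 y2).
move: t1 t2 h bB; rewrite -/(EK P K (fun v => phi (U1 m c v) (U2 m c v))).
rewrite -/(EK P K (fun v => phi' (U1 m c v) (U2 m c v))).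
move: (EK _ _ _) (EK _ _ _) (EX _ _) (EX _ _) => ek' ek ex' ex t1 t2 h bB.
pose ke := k2 * wmom m c 2 + k1 * wmom m c 1.
have dk : `|ke - k| <= (`|k2| + `|k1|) * de.
  rewrite (_ : ke - k = k2 * (wmom m c 2 - w 2) + k1 * (wmom m c 1 - w 1)); last by rewrite /ke /k; ring.
  rewrite (le_trans (ler_normD _ _))// !normrM mulrDl lerD// ler_wpM2l//; lra.
have e : ex - k * ex' = (ex - ek) + (ek - ke * ek') + ((ke - k) * ek' + k * (ek' - ex')) by ring.
rewrite -/k e; apply: (le_trans (ler_normD _ _)); apply: (@le_trans _ _ ((L * S * de + b * (w 1 + w 2 + w 3 + 3 * de)) +
   ((`|k2| + `|k1|) * de * B + `|k| * (L * S * de)))).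
  apply: lerD; apply: (le_trans (ler_normD _ _)); apply: lerD => //.
  - apply: (le_trans h); rewrite ler_wpM2l//.
    move: a1 a2 a3; rewrite !ler_norml => /andP[_ a1] /andP[_ a2] /andP[_ a3]; lra.
  - by rewrite normrM ler_pM.
  - by rewrite normrM ler_wpM2l// distrC.
by rewrite le_eqVlt; apply/orP; left; apply/eqP; ring.
Qed.

Let mp1 : measurable_fun setT (fun p : R * R => p.1) := measurable_fst.
Let mp2 : measurable_fun setT (fun p : R * R => p.2) := measurable_snd.

Let ql_cst (c L : R) : 0 <= L -> quadratic_lipschitz L (fun _ _ => c).
Proof.
move=> L0; split=> // x1 x2 u1 u2; rewrite subrr normr0.
by rewrite mulr_ge0// mulr_ge0// ?addr_ge0// normr_ge0.
Qed.

(** The case [b = 0] with the constant 1 as second functional. *)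
Let exact1 (phi : R -> R -> R) (k1 k2 : R) : quadratic_lipschitz 1 phi ->
  (forall (J : finType) (m : J -> R) (K : Omega -> {ffun J -> nat}) (c : rel J),
    poisson_family P m K -> symmetric c -> irreflexive c ->
    EK P K (fun v => phi (U1 m c v) (U2 m c v)) = k2 * wmom m c 2 + k1 * wmom m c 1) ->
  EX P (fun t => phi (X1 t) (X2 t)) = k2 * w 2 + k1 * w 1.
Proof.
move=> hphi h; apply/eqP; rewrite -subr_eq0 -normr_le0.
have := @stein_limit phi (fun _ _ => 1) 1 1 k1 k2 0 ler01 (lexx 0) hphi (ql_cst 1 ler01).
rewrite EX_cst mulr1 mul0r; apply=> [_ _|J m K c pK cs ci]; first by rewrite normr1.
by rewrite (h _ _ _ _ pK cs ci) EK_cst mulr1 subrr normr0 mul0r.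
Qed.

Lemma EX_X1 : EX P X1 = 0.
Proof.
have := @exact1 (fun x _ => x) 0 0; rewrite !mul0r addr0; apply.
  split=> // x1 x2 u1 u2; rewrite mul1r mulrDr -[leLHS]addr0 lerD//.
    by rewrite -[leLHS]mul1r ler_wpM2r// -!addrA lerDl !addr_ge0.
by move=> J m K c pK cs ci; rewrite (EK_U1 pK) !mul0r addr0.
Qed.

Lemma EX_X2 : EX P X2 = 0.
Proof.
have := @exact1 (fun _ x => x) 0 0; rewrite !mul0r addr0; apply.
  split=> // x1 x2 u1 u2; rewrite mul1r mulrDr -[leLHS]add0r lerD//.
  by rewrite -[leLHS]mul1r ler_wpM2r// -!addrA lerDl !addr_ge0.
by move=> J m K c pK cs ci; rewrite (EK_U2 pK)// !mul0r addr0.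
Qed.

Let prod_lip (x1 x2 u1 u2 : R) : `|x1 * x2 - u1 * u2| <= (1 + `|x1| + `|x2| + `|u1| + `|u2|) * (`|x1 - u1| + `|x2 - u2|).
Proof.
rewrite (_ : x1 * x2 - u1 * u2 = x1 * (x2 - u2) + (x1 - u1) * u2); last by ring.
apply: (le_trans (ler_normD _ _)); rewrite !normrM.
move: (normr_ge0 x1) (normr_ge0 x2) (normr_ge0 u1) (normr_ge0 u2) (normr_ge0 (x1 - u1)) (normr_ge0 (x2 - u2)).
move: `|x1| `|x2| `|u1| `|u2| `|x1 - u1| `|x2 - u2| => a b u v p q a0 b0 u0 v0 p0 q0.
have := mulr_ge0 a0 p0; have := mulr_ge0 b0 p0; have := mulr_ge0 u0 p0; have := mulr_ge0 v0 p0.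
have := mulr_ge0 a0 q0; have := mulr_ge0 b0 q0; have := mulr_ge0 u0 q0; have := mulr_ge0 v0 q0; lra.
Qed.

Lemma EX_X1X2 : EX P (fun t => X1 t * X2 t) = 0.
Proof.
have := @exact1 (fun x y => x * y) 0 0; rewrite !mul0r addr0; apply.
  by split=> [|x1 x2 u1 u2]; [exact: measurable_funM|rewrite mul1r prod_lip].
by move=> J m K c pK cs ci; rewrite (EK_U12 pK)// !mul0r addr0.
Qed.

Let sq_lip (x1 x2 u1 u2 : R) : `|x1 ^+ 2 - u1 ^+ 2| <= (1 + `|x1| + `|x2| + `|u1| + `|u2|) * (`|x1 - u1| + `|x2 - u2|).
Proof.
rewrite subr_sqr normrM mulrC.
apply: ler_pM => //; last by rewrite lerDl.
by apply: (le_trans (ler_normD _ _)); have := normr_ge0 x2; have := normr_ge0 u2; lra.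
Qed.

Lemma EX_X1_sq : EX P (fun t => X1 t ^+ 2) = 4 * w 2.
Proof.
have := @exact1 (fun x _ => x ^+ 2) 0 4; rewrite !mul0r addr0; apply.
  by split=> [|x1 x2 u1 u2]; [exact: measurable_funX|rewrite mul1r sq_lip].
by move=> J m K c pK cs ci; rewrite (EK_U1_sq pK) !mul0r addr0.
Qed.

Lemma EX_X2_sq : EX P (fun t => X2 t ^+ 2) = 2 * w 1.
Proof.
have := @exact1 (fun _ x => x ^+ 2) 2 0; rewrite !mul0r add0r; apply.
  split=> [|x1 x2 u1 u2]; first exact: measurable_funX.
  rewrite mul1r; apply: le_trans (sq_lip x2 x1 u2 u1) _.
  by rewrite [X in _ * X]addrC ler_wpM2r ?addr_ge0//; lra.
by move=> J m K c pK cs ci; rewrite (EK_U2_sq pK)// !mul0r add0r.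
Qed.

(** On a finite graph the decomposition is an algebraic identity; the four approximation errors show
    that the defect has arbitrarily small L1 norm. *)
Lemma count_decomposition_ae : exists N, [/\ measurable N, P N = 0%E &
  forall t, ~ N t -> G t = w 1 + X1 t + X2 t].
Proof.
pose D t := G t - (w 1 + X1 t + X2 t).
have lX1 := L2_L1 hX1; have lX2 := L2_L1 hX2.
have lD : L1 P D by apply: L1_B => //; apply: L1_D => //; apply: L1_D => //; exact: L1_cst.
have E0 : EX P (fun t => `|D t|) = 0.
  apply/eqP; rewrite eq_le EX_ge0 ?andbT//.
  apply: (@small _ _ 4) => de /andP[de0 de1]; rewrite add0r.
  have [J [m [K [c [[pK cs ci] [g1 g2 g3 g4]]]]]] := hdisc (exprn_gt0 2 de0).
  have dd : de ^+ 2 <= de by rewrite expr2 -[leRHS]mul1r ler_wpM2r// ltW.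
  have y1 : L2 P (fun t => X1 t - U1 m c (K t)) := L2_B hX1 (L2K pK (pg_chaos1 m (fun i => 2 * wdeg m c i))).
  have y2 : L2 P (fun t => X2 t - U2 m c (K t)) := L2_B hX2 (L2K pK (pg_chaos2 m (fun i j => (c i j)%:R))).
  have sq (Y : Omega -> R) : L2 P Y -> EX P (fun t => Y t ^+ 2) <= de ^+ 2 -> EX P (fun t => `|Y t|) <= de.
    move=> hY hle; apply: (le_trans (EX_abs_sqrt hY)).
    by rewrite -[leRHS]ger0_norm ?(ltW de0)// -sqrtr_sqr ler_wsqrtr.
  pose C t := \sum_i \sum_j (c i j)%:R * ((K t i)%:R * (K t j)%:R) : R.
  have lC : L1 P C.
    apply: (pg_L1 pK (G := fun v => \sum_i \sum_j (c i j)%:R * ((v i)%:R * (v j)%:R))).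
    by apply: pg_sum => i _; apply: pg_sum => j _; apply: pg_Z; apply: pg_M; exact: pg_coord.
  have lGC : L1 P (fun t => `|G t - C t|) by apply: L1_abs; exact: L1_B.
  have l1 := L1_abs (L2_L1 y1); have l2 := L1_abs (L2_L1 y2).
  have lc := L1_cst P `|wmom m c 1 - w 1|.
  apply: (@le_trans _ _ (EX P (fun t => ((`|G t - C t| + `|wmom m c 1 - w 1|) + `|X1 t - U1 m c (K t)|) + `|X2 t - U2 m c (K t)|))).
    apply: EX_le; [exact: L1_abs|by apply: L1_D => //; apply: L1_D => //; exact: L1_D|].
    move=> t; rewrite /D (_ : _ - _ = (G t - C t) + (wmom m c 1 - w 1) - (X1 t - U1 m c (K t)) - (X2 t - U2 m c (K t))).
      apply: (le_trans (ler_normB _ _)); rewrite lerD2r.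
      by apply: (le_trans (ler_normB _ _)); rewrite lerD2r ler_normD.
    by rewrite /C (edge_count_decomposition m cs); ring.
  rewrite (EX_D (L1_D (L1_D lGC lc) l1) l2) (EX_D (L1_D lGC lc) l1) (EX_D lGC lc) EX_cst.
  by have := g3 0%N erefl; have := sq _ y1 g1; have := sq _ y2 g2; move: g4; rewrite -/C; lra.
have i0 : (\int[P]_t `|(D t)%:E| = 0)%E.
  have := L1_E (L1_abs lD); rewrite E0 => h; rewrite -[RHS]h.
  by apply: eq_integral.
have mD : measurable_fun setT (fun t => (D t)%:E) by apply/measurable_EFinP; exact: L1_meas lD.
have [N [mN PN hN]] := proj1 (ae_eq_integral_abs P measurableT mD) i0.
exists N; split=> // t Nt; apply/eqP; rewrite -subr_eq0; apply/eqP; apply: EFin_inj.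
by apply: contrapT => h; apply: Nt; apply: hN => /= h'; apply: h; exact: h'.
Qed.

Let mlip (M : R) (f : R -> R) : (forall x y, `|f x - f y| <= M * `|x - y|) -> measurable_fun setT f.
Proof. by move=> h; apply: continuous_measurable_fun; exact: lipschitz_continuous h. Qed.

Let mlin (a b : R) : measurable_fun setT (fun p : R * R => a * p.1 + b * p.2).
Proof. by apply: measurable_funD; exact: measurable_funM. Qed.

Let id_mul_lip (M : R) f f' u v : C11 M f f' -> `|u * f u - v * f v| <= M * (1 + `|u|) * `|u - v|.
Proof.
move=> hf; rewrite (_ : _ - _ = u * (f u - f v) + (u - v) * f v); last by ring.
apply: (le_trans (ler_normD _ _)); rewrite !normrM.
have h1 := ler_wpM2l (normr_ge0 u) (C11_lip hf u v).
have h2 := ler_wpM2l (normr_ge0 (u - v)) (C11_bound hf v); lra.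
Qed.

Lemma stein_chaos (al be ga M : R) (f f' : R -> R) :
  `|al| <= ga -> `|be| <= ga -> C11 M f f' ->
  `|EX P (fun t => (al * X1 t + be * X2 t) * f (al * X1 t + be * X2 t)) -
    (4 * al ^+ 2 * w 2 + 2 * be ^+ 2 * w 1) * EX P (fun t => f' (al * X1 t + be * X2 t))|
  <= 100 * M * ga ^+ 3 * (w 1 + w 2 + w 3).
Proof.
move=> hal hbe hf; have M0 := C11_ge0 hf.
have ga0 : 0 <= ga by exact: le_trans (normr_ge0 al) hal.
have mf := mlip (C11_lip hf); have mf' := mlip (C11_dlip hf).
have dl x1 x2 u1 u2 : `|(al * x1 + be * x2) - (al * u1 + be * u2)| <= ga * (`|x1 - u1| + `|x2 - u2|).
  rewrite (_ : _ - _ = al * (x1 - u1) + be * (x2 - u2)); last by ring.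
  by rewrite (le_trans (ler_normD _ _))// !normrM mulrDr lerD// ler_wpM2r.
have bl x1 x2 : `|al * x1 + be * x2| <= ga * (`|x1| + `|x2|).
  by have := dl x1 x2 0 0; rewrite !mulr0 addr0 !subr0.
apply: (@stein_limit (fun x y => (al * x + be * y) * f (al * x + be * y)) (fun x y => f' (al * x + be * y))
  (M * (1 + ga) * ga) M (2 * be ^+ 2) (4 * al ^+ 2) (100 * M * ga ^+ 3)).
- by rewrite !mulr_ge0// addr_ge0.
- by rewrite !mulr_ge0// exprn_ge0.
- split; first by apply: measurable_funM => //; exact: (measurableT_comp mf).
  move=> x1 x2 u1 u2; apply: (le_trans (id_mul_lip _ _ hf)).
  rewrite -!mulrA ler_wpM2l// mulrA [leRHS](_ : _ = ((1 + ga) * (1 + `|x1| + `|x2| + `|u1| + `|u2|)) * (ga * (`|x1 - u1| + `|x2 - u2|))); last by ring.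
  apply: ler_pM => //.
  have := bl x1 x2; have := normr_ge0 x1; have := normr_ge0 x2; have := normr_ge0 u1; have := normr_ge0 u2.
  move: `|x1| `|x2| `|u1| `|u2| => a b c e e0 c0 b0 a0 h.
  by have := mulr_ge0 ga0 c0; have := mulr_ge0 ga0 e0; have := mulr_ge0 ga0 a0; have := mulr_ge0 ga0 b0; lra.
- split; first exact: (measurableT_comp mf').
  move=> x1 x2 u1 u2; apply: (le_trans (C11_dlip hf _ _)); rewrite -!mulrA ler_wpM2l//.
  apply: (le_trans (dl _ _ _ _)).
  set D := `|x1 - u1| + `|x2 - u2|; have D0 : 0 <= D by exact: addr_ge0.
  have h1 : 1 <= (1 + ga) * (1 + `|x1| + `|x2| + `|u1| + `|u2|).
    by rewrite -[1 in leLHS]mul1r; apply: ler_pM => //; rewrite ?lerDl// -!addrA lerDl !addr_ge0.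
  rewrite [leRHS](_ : _ = ((1 + ga) * (1 + `|x1| + `|x2| + `|u1| + `|u2|)) * (ga * D)); last by ring.
  by rewrite -[leLHS]mul1r ler_wpM2r// mulr_ge0.
- by move=> x y; exact: (C11_dbound hf).
- by move=> J m K c pK cs ci; exact: (stein_univariate pK cs ci hal hbe hf).
Qed.

Lemma stein_chaos2 (al be ga M : R) (f f' g g' : R -> R) :
  `|al| <= ga -> `|be| <= ga -> C11 M f f' -> C11 M g g' ->
  `|EX P (fun t => al * X1 t * f (al * X1 t) * g (be * X2 t)) -
    4 * al ^+ 2 * w 2 * EX P (fun t => f' (al * X1 t) * g (be * X2 t))|
  <= 100 * M ^+ 2 * ga ^+ 3 * (w 1 + w 2 + w 3).
Proof.
move=> hal hbe hf hg; have M0 := C11_ge0 hf.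
have ga0 : 0 <= ga by exact: le_trans (normr_ge0 al) hal.
have mf := mlip (C11_lip hf); have mf' := mlip (C11_dlip hf); have mg := mlip (C11_lip hg).
have ma : measurable_fun setT (fun p : R * R => al * p.1) by exact: measurable_funM.
have mb : measurable_fun setT (fun p : R * R => be * p.2) by exact: measurable_funM.
have d1 x u : `|al * x - al * u| <= ga * `|x - u| by rewrite -mulrBr normrM ler_wpM2r.
have d2 x u : `|be * x - be * u| <= ga * `|x - u| by rewrite -mulrBr normrM ler_wpM2r.
have b1 x : `|al * x| <= ga * `|x| by rewrite normrM ler_wpM2r.
have gM x : `|g x| <= M := C11_bound hg x.
have glip x u : `|g (be * x) - g (be * u)| <= M * (ga * `|x - u|).
  by apply: (le_trans (C11_lip hg _ _)); rewrite ler_wpM2l.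
have L0 : 0 <= 2 * M ^+ 2 * (1 + ga) * ga by rewrite !mulr_ge0 ?sqr_ge0// addr_ge0.
rewrite (_ : 4 * al ^+ 2 * w 2 = 4 * al ^+ 2 * w 2 + 0 * w 1); last by rewrite mul0r addr0.
apply: (@stein_limit (fun x y => al * x * f (al * x) * g (be * y)) (fun x y => f' (al * x) * g (be * y))
  (2 * M ^+ 2 * (1 + ga) * ga) (M * M) 0 (4 * al ^+ 2) (100 * M ^+ 2 * ga ^+ 3)) => //.
- by rewrite !mulr_ge0 ?sqr_ge0// exprn_ge0.
- split.
    apply: measurable_funM; last exact: (measurableT_comp mg).
    by apply: measurable_funM => //; exact: (measurableT_comp mf).
  move=> x1 x2 u1 u2.
  rewrite (_ : _ - _ = (al * x1 * f (al * x1) - al * u1 * f (al * u1)) * g (be * x2) +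
     al * u1 * f (al * u1) * (g (be * x2) - g (be * u2))); last by ring.
  apply: (le_trans (ler_normD _ _)).
  apply: (@le_trans _ _ (M * (1 + ga * `|x1|) * (ga * `|x1 - u1|) * M + ga * `|u1| * M * (M * (ga * `|x2 - u2|)))).
    apply: lerD; rewrite normrM; apply: ler_pM => //; last first.
      by rewrite normrM; apply: ler_pM => //; exact: C11_bound hf _.
    apply: (le_trans (id_mul_lip _ _ hf)); rewrite -!mulrA ler_wpM2l//.
    by apply: ler_pM => //; rewrite lerD2l.
  move: (normr_ge0 x1) (normr_ge0 x2) (normr_ge0 u1) (normr_ge0 u2) (normr_ge0 (x1 - u1)) (normr_ge0 (x2 - u2)).
  move: `|x1| `|x2| `|u1| `|u2| `|x1 - u1| `|x2 - u2| => a b c e p q a0 b0 c0 e0 p0 q0.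
  rewrite [leLHS](_ : _ = M ^+ 2 * ga * ((1 + ga * a) * p + ga * c * q)); last by ring.
  rewrite [leRHS](_ : _ = M ^+ 2 * ga * (2 * ((1 + ga) * ((1 + a + b + c + e) * (p + q))))); last by ring.
  rewrite ler_wpM2l ?mulr_ge0 ?sqr_ge0//.
  have p1 : (1 + ga * a) * p <= (1 + ga) * ((1 + a + b + c + e) * (p + q)).
    rewrite mulrA; apply: ler_pM => //; [by rewrite addr_ge0// mulr_ge0| |by rewrite lerDl].
    have := mulr_ge0 ga0 b0; have := mulr_ge0 ga0 c0; have := mulr_ge0 ga0 e0; have := mulr_ge0 ga0 a0; lra.
  have p2 : ga * c * q <= (1 + ga) * ((1 + a + b + c + e) * (p + q)).
    rewrite mulrA; apply: ler_pM => //; [by rewrite mulr_ge0| |by rewrite lerDr].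
    have := mulr_ge0 ga0 b0; have := mulr_ge0 ga0 c0; have := mulr_ge0 ga0 e0; have := mulr_ge0 ga0 a0; lra.
  lra.
- split; first by apply: measurable_funM; [exact: (measurableT_comp mf')|exact: (measurableT_comp mg)].
  move=> x1 x2 u1 u2.
  rewrite (_ : _ - _ = (f' (al * x1) - f' (al * u1)) * g (be * x2) + f' (al * u1) * (g (be * x2) - g (be * u2))); last by ring.
  apply: (le_trans (ler_normD _ _)).
  apply: (@le_trans _ _ (M * (ga * `|x1 - u1|) * M + M * (M * (ga * `|x2 - u2|)))).
    apply: lerD; rewrite normrM; apply: ler_pM => //; last exact: C11_dbound hf _.
    by apply: (le_trans (C11_dlip hf _ _)); rewrite ler_wpM2l.
  move: (normr_ge0 x1) (normr_ge0 x2) (normr_ge0 u1) (normr_ge0 u2) (normr_ge0 (x1 - u1)) (normr_ge0 (x2 - u2)).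
  move: `|x1| `|x2| `|u1| `|u2| `|x1 - u1| `|x2 - u2| => a b c e p q a0 b0 c0 e0 p0 q0.
  rewrite [leLHS](_ : _ = M ^+ 2 * ga * (p + q)); last by ring.
  rewrite [leRHS](_ : _ = M ^+ 2 * ga * ((2 * (1 + ga) * (1 + a + b + c + e)) * (p + q))); last by ring.
  rewrite ler_wpM2l ?mulr_ge0 ?sqr_ge0// -[leLHS]mul1r ler_wpM2r ?addr_ge0//.
  by have := mulr_ge0 ga0 b0; have := mulr_ge0 ga0 c0; have := mulr_ge0 ga0 e0; have := mulr_ge0 ga0 a0; lra.
- by move=> x y; rewrite normrM; apply: ler_pM => //; exact: C11_dbound hf _.
- move=> J m K c pK cs ci; rewrite mul0r addr0.
  exact: (stein_bivariate pK cs ci hal hbe hf hg).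
Qed.

End poisson_graph_limit.

(** * Passage to the limit *)

Section normal_expectation.
Context d (T : measurableType d) (R : realType) (P : probability T R).
Variables (N : {RV P >-> R}).
Hypothesis hN : std_normal N.

Lemma std_normal_EX (g : R -> R) : measurable_fun setT g -> L1 (gaussian R) g ->
  L1 P (fun t => g (N t)) /\ EX P (fun t => g (N t)) = EX (gaussian R) g.
Proof.
move=> mg lg; have mN : measurable_fun setT (N : T -> measurableTypeR R) := measurable_funPT N.
pose nu : {measure set (measurableTypeR R) -> \bar R} :=
  measure_function_pushforward__canonical__measure_function_Measure P mN.
have nuE A : measurable A -> A `<=` setT -> nu A = gaussian R A by move=> mA _; exact: hN.
have l : L1 P (fun t => g (N t)).
  have mgN : measurable_fun setT (fun t => g (N t)) by exact: (measurableT_comp mg).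
  apply/integrableP; split; first exact/measurable_EFinP.
  have mag : measurable_fun setT (fun x => `|(g x)%:E|%E).
    by apply: measurableT_comp => //; exact/measurable_EFinP.
  have := @ge0_integral_pushforward _ _ _ _ R _ mN P setT (fun x => `|(g x)%:E|%E) measurableT mag.
  rewrite preimage_setT => <- //.
  apply: (@le_lt_trans _ _ (\int[gaussian R]_y `|(g y)%:E|)%E); last by have /integrableP[] := lg.
  rewrite le_eqVlt; apply/orP; left; apply/eqP.
  exact: (@eq_measure_integral _ _ _ setT (gaussian R) nu (fun x => `|(g x)%:E|%E)).
split=> //; rewrite /EX; congr fine.
have mgE : measurable_fun setT (EFin \o g) by exact/measurable_EFinP.
have := @integral_pushforward _ _ _ _ R _ mN P setT (EFin \o g) mgE _ measurableT.
rewrite preimage_setT => <- //.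
exact: (@eq_measure_integral _ _ _ setT (gaussian R) nu (EFin \o g)).
Qed.

End normal_expectation.

(** * Rates of normal approximation in dimensions one and two *)

Section normal_approximation.
Context (R : realType).

Lemma C11_lipschitz_gaussian (M : R) (f f' : R -> R) : C11 M f f' -> L1 (gaussian R) f.
Proof.
move=> hf; apply: (L1_bounded _ _ (M := M)); last exact: C11_bound hf.
by apply: continuous_measurable_fun; exact: lipschitz_continuous (C11_lip hf).
Qed.

(** The constant is fixed before the probability space and the functionals, so that one value serves
    all intensities and all test functions. *)
Definition univariate_rate (C : R) : Prop :=
  forall d' (Omega : measurableType d') (P : probability Omega R)
    (X1 X2 G : Omega -> R) (w : nat -> R),
  L2 P X1 -> L2 P X2 -> L1 P G -> (forall r, 0 <= w r) -> graph_limit P X1 X2 G w ->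
  forall al be ga, `|al| <= ga -> `|be| <= ga -> 4 * al ^+ 2 * w 2 + 2 * be ^+ 2 * w 1 = 1 ->
  forall h : R -> R, (forall x y, `|h x - h y| <= `|x - y|) ->
  `|EX P (fun t => h (al * X1 t + be * X2 t)) - EX (gaussian R) h| <= C * ga ^+ 3 * (w 1 + w 2 + w 3).

Definition bivariate_rate (M C : R) : Prop :=
  forall d' (Omega : measurableType d') (P : probability Omega R)
    (X1 X2 G : Omega -> R) (w : nat -> R),
  L2 P X1 -> L2 P X2 -> L1 P G -> (forall r, 0 <= w r) -> graph_limit P X1 X2 G w ->
  forall al be ga, `|al| <= ga -> `|be| <= ga -> 4 * al ^+ 2 * w 2 = 1 -> 2 * be ^+ 2 * w 1 = 1 ->
  forall f f' g g' : R -> R, C11 M f f' -> C11 M g g' ->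
  `|EX P (fun t => f (al * X1 t) * g (be * X2 t)) - EX (gaussian R) f * EX (gaussian R) g|
    <= C * ga ^+ 3 * (w 1 + w 2 + w 3).

Lemma normal_approximation : exists2 C : R, 0 < C & univariate_rate C.
Proof.
have [C [C0 hC]] := stein_solution R.
exists (100 * C); first by rewrite mulr_gt0.
move=> d' Omega P X1 X2 G w hX1 hX2 hG w0 hdisc al be ga hal hbe hvar h hl.
have [f [f' [hf hff]]] := hC h hl.
have := stein_chaos hX1 hX2 hdisc hal hbe hf.
rewrite hvar mul1r; set X := fun t => al * X1 t + be * X2 t.
have l2X : L2 P X by apply: L2_D; exact: L2_Z.
have mX := L2_meas l2X.
have mf : measurable_fun setT f by apply: continuous_measurable_fun; exact: lipschitz_continuous (C11_lip hf).
have mf' : measurable_fun setT f' by apply: continuous_measurable_fun; exact: lipschitz_continuous (C11_dlip hf).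
have l2f : L2 P (fun t => f (X t)).
  by apply: (L2_bounded _ (M := C)); [exact: (measurableT_comp mf mX)|move=> t; exact: C11_bound hf _].
have l1 : L1 P (fun t => X t * f (X t)) by exact: L2_L1_mul.
have l2 : L1 P (fun t => f' (X t)).
  by apply: (L1_bounded _ _ (M := C)); [exact: (measurableT_comp mf' mX)|move=> t; exact: C11_dbound hf _].
have lh : L1 P (fun t => h (X t)) by exact: (L1_lipschitz1 hl (L2_L1 l2X)).
have e : EX P (fun t => h (X t)) - EX (gaussian R) h = EX P (fun t => f' (X t)) - EX P (fun t => X t * f (X t)).
  rewrite -(EX_B l2 l1) -[X in _ - X = _](EX_cst P) -(EX_B lh (L1_cst P _)).
  by apply: eq_EX => t; rewrite -hff.
by rewrite -[fun t => h _]/(fun t => h (X t)) e distrC.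
Qed.

(** The Stein equation for [f] is solved in the first coordinate with [g] as a weight, which
    replaces [f] by its Gaussian mean; the univariate bound then handles the remaining mean of
    [g]. *)
Lemma bivariate_normal_approximation (M : R) : exists2 C : R, 0 < C & bivariate_rate M C.
Proof.
have [C1 C10 h1] := normal_approximation.
have [C2 [C20 h2]] := stein_solution R.
(* Dividing by [Q] makes [f] and [g] 1-Lipschitz; [D] below is then a common [C11] constant for [g]
   and the Stein solution. *)
pose Q := `|M| + 1; have Q0 : 0 < Q by rewrite /Q ltr_wpDl.
have MQ : M <= Q by rewrite /Q (le_trans (ler_norm M))// lerDl.
pose D := C2 + Q.
have D0 : 0 < D by rewrite addr_gt0.
exists (Q * (100 * D ^+ 2) + Q * (Q * C1)).
  by rewrite addr_gt0 ?mulr_gt0// exprn_gt0.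
move=> d' Omega P X1 X2 G w hX1 hX2 hG w0 hdisc al be ga hal hbe va vb f f' g g' hf hg.
have ga0 : 0 <= ga by exact: le_trans (normr_ge0 al) hal.
have scale (u u' : R -> R) : C11 M u u' -> forall x y, `|Q^-1 * u x - Q^-1 * u y| <= `|x - y|.
  move=> hu x y; rewrite -mulrBr normrM gtr0_norm ?invr_gt0// ler_pdivrMl//.
  by apply: (le_trans (C11_lip hu _ _)); rewrite ler_wpM2r.
have weak (A B : R) (u u' : R -> R) : A <= B -> C11 A u u' -> C11 B u u'.
  move=> AB [a1 a2 a3 a4 a5]; split=> *; first [exact: le_trans (a1 _) AB|exact: le_trans (a2 _) AB|
    by apply: le_trans (a3 _ _) _; rewrite ler_wpM2r|by apply: le_trans (a4 _ _) _; rewrite ler_wpM2r|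
    by apply: le_trans (a5 _ _) _; rewrite ler_wpM2r// sqr_ge0].
have [s [s' [hs hss]]] := h2 _ (scale _ _ hf).
have hs' : C11 D s s' by apply: weak hs; rewrite lerDl ltW.
have hg' : C11 D g g' by apply: weak hg; rewrite (le_trans MQ)// lerDr ltW.
have := stein_chaos2 hX1 hX2 hdisc hal hbe hs' hg'; rewrite va mul1r.
have lf := C11_lipschitz_gaussian hf; have lg := C11_lipschitz_gaussian hg.
have l2a : L2 P (fun t => al * X1 t) by exact: L2_Z.
have l2b : L2 P (fun t => be * X2 t) by exact: L2_Z.
have mlip (A : R) (u : R -> R) : (forall x y, `|u x - u y| <= A * `|x - y|) -> measurable_fun setT u.
  by move=> hu; apply: continuous_measurable_fun; exact: lipschitz_continuous hu.
have bL2 (A : R) (u : R -> R) Y : L2 P Y -> measurable_fun setT u -> (forall x, `|u x| <= A) -> L2 P (fun t => u (Y t)).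
  by move=> hY mu uA; apply: (L2_bounded _ (M := A)); [exact: (measurableT_comp mu (L2_meas hY))|].
have l2g := bL2 _ _ _ l2b (mlip _ _ (C11_lip hg)) (C11_bound hg).
have l2f := bL2 _ _ _ l2a (mlip _ _ (C11_lip hf)) (C11_bound hf).
have l2s := bL2 _ _ _ l2a (mlip _ _ (C11_lip hs)) (C11_bound hs).
have l2s' := bL2 _ _ _ l2a (mlip _ _ (C11_dlip hs)) (C11_dbound hs).
have ls'g := L2_L1_mul l2s' l2g.
have lfg := L2_L1_mul l2f l2g.
have lxsg : L1 P (fun t => al * X1 t * s (al * X1 t) * g (be * X2 t)).
  have l2sg : L2 P (fun t => s (al * X1 t) * g (be * X2 t)).
    apply: (L2_bounded _ (M := C2 * M)); first exact: (measurable_funM (L2_meas l2s) (L2_meas l2g)).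
    by move=> t; rewrite normrM ler_pM//; [exact: C11_bound hs _|exact: C11_bound hg _].
  by apply: (eq_L1 _ (L2_L1_mul l2a l2sg)) => t; rewrite mulrA.
set Ef := EX (gaussian R) f; set Eg := EX (gaussian R) g.
have Efs : EX (gaussian R) (fun x => Q^-1 * f x) = Q^-1 * Ef by rewrite EX_Z.
have e1 : EX P (fun t => s' (al * X1 t) * g (be * X2 t)) - EX P (fun t => al * X1 t * s (al * X1 t) * g (be * X2 t))
   = Q^-1 * (EX P (fun t => f (al * X1 t) * g (be * X2 t)) - Ef * EX P (fun t => g (be * X2 t))).
  rewrite -(EX_B ls'g lxsg) -(EX_Z Ef (L2_L1 l2g)) -(EX_B lfg (L1_Z _ (L2_L1 l2g))).
  rewrite -(EX_Z _ (L1_B lfg (L1_Z _ (L2_L1 l2g)))); apply: eq_EX => t.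
  by rewrite -mulrBl hss Efs; ring.
rewrite distrC e1 normrM gtr0_norm ?invr_gt0// ler_pdivrMl// => b1.
have b2 : `|EX P (fun t => g (be * X2 t)) - Eg| <= Q * (C1 * ga ^+ 3 * (w 1 + w 2 + w 3)).
  (* The univariate bound is used with coefficient 0 on the first chaos, leaving the second chaos
     alone. *)
  have v0 : 4 * 0 ^+ 2 * w 2 + 2 * be ^+ 2 * w 1 = 1 by rewrite expr0n mulr0 mul0r add0r.
  have := h1 _ _ P X1 X2 G w hX1 hX2 hG w0 hdisc 0 be ga _ hbe v0 _ (scale _ _ hg).
  rewrite normr0 => /(_ ga0); rewrite (EX_Z Q^-1 lg) -/Eg.
  rewrite (eq_EX P (g := fun t => Q^-1 * g (be * X2 t))); last by move=> t; rewrite mul0r add0r.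
  by rewrite (EX_Z _ (L2_L1 l2g)) -mulrBr normrM gtr0_norm ?invr_gt0// ler_pdivrMl.
have EfQ : `|Ef| <= Q.
  apply: le_trans (EX_abs lf) _; apply: EX_le_cst; first exact: L1_abs.
  by move=> x; exact: le_trans (C11_bound hf x) MQ.
rewrite (_ : _ - _ = (EX P (fun t => f (al * X1 t) * g (be * X2 t)) - Ef * EX P (fun t => g (be * X2 t))) +
  Ef * (EX P (fun t => g (be * X2 t)) - Eg)); last by ring.
apply: (le_trans (ler_normD _ _)); rewrite -mulrA mulrDl; apply: lerD.
  by apply: (le_trans b1); rewrite -!mulrA.
rewrite normrM -!mulrA; apply: ler_pM => //.
by apply: (le_trans b2); rewrite -!mulrA.
Qed.

End normal_approximation.

Section wasserstein_bound.
Context (R : realType) d d1 (Omega : measurableType d) (Omega1 : measurableType d1).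
Variables (P : probability Omega R) (P1 : probability Omega1 R).

Lemma expectationE (X : Omega -> R) : ('E_P[X] = \int[P]_w (X w)%:E)%E.
Proof. by rewrite unlock. Qed.

Lemma VarE (X : Omega -> R) : Var P X = EX P (fun t => (X t - EX P X) ^+ 2).
Proof.
rewrite /Var /variance covariance.unlock expectationE /EX; congr fine.
by apply: eq_integral => t _; rewrite expectationE /= expr2.
Qed.

Variables (N : {RV P1 >-> R}).
Hypothesis hN : std_normal N.

Lemma wasserstein_le (U V : Omega -> R) (Z : set Omega) (B : R) : measurable Z -> P Z = 0%E ->
  (forall t, ~ Z t -> U t = V t) -> L1 P V ->
  (forall h : R -> R, (forall x y, `|h x - h y| <= `|x - y|) ->
     `|EX P (fun t => h (V t)) - EX (gaussian R) h| <= B) ->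
  (wasserstein P P1 U N <= B%:E)%E.
Proof.
move=> mZ PZ UV lV hB; apply: ge_ereal_sup => _ [h /= hl <-].
have lh := L1_lipschitz1 hl lV.
have lg : L1 (gaussian R) h.
  exact: (@L1_lipschitz1 _ _ _ (gaussian R) id h hl (L2_L1 (L2_gaussian_id R))).
have [lN eN] := std_normal_EX hN (lipschitz1_measurable hl) lg.
rewrite !unlock (integral_ae (P := P) (g := fun t => (h (V t))%:E) mZ PZ) => [|t Zt]; last by rewrite /= UV.
by rewrite (L1_E lh) (L1_E lN) eN -EFinB lee_fin; exact: hB.
Qed.

End wasserstein_bound.

(** * Moments and normal approximation at a fixed intensity *)

Section fixed_intensity.
Context (R : realType) (d : nat) d' (Omega : measurableType d') (P : probability Omega R).
Variables (Hbar : R -> set (Rvec R d)) (eta : R -> Omega -> {measure set (Rvec R d) -> \bar R}) (l : R).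
Hypothesis l0 : 0 < l.
Hypothesis hp : is_poisson_measure P (intensity d l) (eta l).
Hypothesis mH : measurable (Hbar l).
Hypothesis Hsym : Hbar l = [set vopp x | x in Hbar l].
Hypothesis d_gt0 : (0 < d)%N.
Hypothesis H0n : ~ Hbar l (vzero R d).
Variables (F1 F2 : {RV P >-> R}).
Hypothesis F1_def : is_multiple_integral (intensity d l) P (eta l) (f1 Hbar l) F1.
Hypothesis F2_def : is_multiple_integral (intensity d l) P (eta l) (f2 Hbar l) F2.

Definition gw (r : nat) : R := l ^+ r.+1 * gmom Hbar l r.

Lemma gw_ge0 r : 0 <= gw r.
Proof.
rewrite mulr_ge0 ?exprn_ge0 ?(ltW l0)//.
by have /andP[] := gmom_bounds mH d_gt0 r.
Qed.

Let L2F : L2 P F1 /\ L2 P F2.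
Proof. by have [] := discretization l0 hp mH Hsym H0n F1_def F2_def ltr01. Qed.
Let hdisc : graph_limit P F1 F2 (edge_sum Hbar eta l) gw.
Proof. by move=> e e0; have [] := discretization l0 hp mH Hsym H0n F1_def F2_def e0. Qed.
Let hF1 : L2 P F1 := L2F.1.
Let hF2 : L2 P F2 := L2F.2.
Let hG : L1 P (edge_sum Hbar eta l). Proof. exact: (L1_N2 hp (measurable_wadj mH)). Qed.

Lemma V1sqE : V1sq Hbar l = 4 * gw 2.
Proof. by rewrite /V1sq (ell_H1 mH) /gw; ring. Qed.

Lemma V2sqE : V2sq Hbar l = 2 * gw 1.
Proof. by rewrite /V2sq (ell_H0 mH) /gw; ring. Qed.

Lemma Var_F1 : Var P F1 = 4 * gw 2.
Proof.
rewrite VarE (EX_X1 hF1 hF2 hdisc) -(EX_X1_sq hF1 hF2 hdisc).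
by apply: eq_EX => t; rewrite subr0.
Qed.

Lemma Var_F2 : Var P F2 = 2 * gw 1.
Proof.
rewrite VarE (EX_X2 hF1 hF2 hdisc) -(EX_X2_sq hF1 hF2 hdisc).
by apply: eq_EX => t; rewrite subr0.
Qed.

Lemma Fsum_decomposition : exists N, [/\ measurable N, P N = 0%E &
  forall t, ~ N t -> Fsum Hbar eta l t = gw 1 + F1 t + F2 t].
Proof.
have [N [mN PN hN]] := count_decomposition_ae hF1 hF2 hG hdisc.
have mS := measurable_simple_event hp d_gt0.
exists (N `|` ~` simple_event (eta l) d_gt0); split.
- by apply: measurableU => //; exact: measurableC.
- apply/eqP; rewrite -measure_le0 -[0%E]adde0 -{1}PN -(simple_event_full hp d_gt0).
  by apply: measureU2 => //; exact: measurableC.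
move=> t Nt; rewrite -hN; last by move=> h; apply: Nt; left.
by apply: (Fsum_edge_sum hp mH H0n (d_gt0 := d_gt0)); apply: contrapT => h; apply: Nt; right.
Qed.

Let V : Omega -> R := fun t => F1 t + F2 t.
Let lV : L2 P V. Proof. exact: L2_D. Qed.
Let EV : EX P V = 0.
Proof. by rewrite (EX_D (L2_L1 hF1) (L2_L1 hF2)) (EX_X1 hF1 hF2 hdisc) (EX_X2 hF1 hF2 hdisc) addr0. Qed.

Lemma EX_Fsum : EX P (Fsum Hbar eta l) = gw 1.
Proof.
have [N [mN PN hN]] := Fsum_decomposition.
rewrite (EX_ae (g := fun t => gw 1 + V t) mN PN) => [|t Nt]; last by rewrite hN// addrA.
by rewrite (EX_D (L1_cst P _) (L2_L1 lV)) EX_cst EV addr0.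
Qed.

Lemma Var_Fsum : Var P (Fsum Hbar eta l) = 4 * gw 2 + 2 * gw 1.
Proof.
have [N [mN PN hN]] := Fsum_decomposition.
rewrite VarE EX_Fsum.
rewrite (EX_ae (g := fun t => (F1 t ^+ 2 + F2 t ^+ 2) + 2 * (F1 t * F2 t)) mN PN) => [|t Nt]; last first.
  by rewrite hN//; ring.
have s1 := L2_sq hF1; have s2 := L2_sq hF2; have s12 := L2_L1_mul hF1 hF2.
rewrite (EX_D (L1_D s1 s2) (L1_Z 2 s12)) (EX_D s1 s2) (EX_Z 2 s12).
by rewrite (EX_X1_sq hF1 hF2 hdisc) (EX_X2_sq hF1 hF2 hdisc) (EX_X1X2 hF1 hF2 hdisc) mulr0 addr0.
Qed.

Let sg : R := Num.sqrt (4 * gw 2 + 2 * gw 1).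

Lemma normalized_Fsum : exists N, [/\ measurable N, P N = 0%E &
  forall t, ~ N t -> normalized P (Fsum Hbar eta l) t = sg^-1 * F1 t + sg^-1 * F2 t].
Proof.
have [N [mN PN hN]] := Fsum_decomposition; exists N; split=> // t Nt.
rewrite /normalized Var_Fsum expectationE -/(EX P (Fsum Hbar eta l)) EX_Fsum hN// -/sg.
by ring.
Qed.

Lemma EX_normalized (h : R -> R) : measurable_fun setT h ->
  ('E_P[h \o normalized P (Fsum Hbar eta l)] = \int[P]_t (h (sg^-1 * F1 t + sg^-1 * F2 t))%:E)%E.
Proof.
move=> mh; have [N [mN PN hN]] := normalized_Fsum.
by rewrite expectationE; apply: (integral_ae mN PN) => t Nt; rewrite /= hN.
Qed.

Hypothesis g1_gt0 : 0 < gw 1.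

Let sg2_gt0 : 0 < 4 * gw 2 + 2 * gw 1.
Proof. by have := gw_ge0 2; move: g1_gt0; lra. Qed.

Let sg_gt0 : 0 < sg. Proof. by rewrite sqrtr_gt0. Qed.

Let sgV : 4 * sg^-1 ^+ 2 * gw 2 + 2 * sg^-1 ^+ 2 * gw 1 = 1.
Proof.
have e : sg ^+ 2 = 4 * gw 2 + 2 * gw 1 by rewrite sqr_sqrtr// ltW.
rewrite exprVn [LHS](_ : _ = (sg ^+ 2)^-1 * (4 * gw 2 + 2 * gw 1)); last by ring.
by rewrite e mulVf// gt_eqF.
Qed.

Lemma stein_bound (C : R) (h : R -> R) : univariate_rate C -> (forall x y, `|h x - h y| <= `|x - y|) ->
  `|EX P (fun t => h (sg^-1 * F1 t + sg^-1 * F2 t)) - EX (gaussian R) h| <= C * sg^-1 ^+ 3 * (gw 1 + gw 2 + gw 3).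
Proof.
move=> hC hl; have n1 : `|sg^-1| <= sg^-1 by rewrite ger0_norm// invr_ge0 ltW.
exact: (hC _ _ P _ _ _ _ hF1 hF2 hG gw_ge0 hdisc _ _ _ n1 n1 sgV h hl).
Qed.

Lemma wasserstein_Fsum (C : R) dN (OmegaN : measurableType dN) (PN : probability OmegaN R) (N : {RV PN >-> R}) :
  univariate_rate C -> std_normal N ->
  (wasserstein P PN (normalized P (Fsum Hbar eta l)) N <= (C * sg^-1 ^+ 3 * (gw 1 + gw 2 + gw 3))%:E)%E.
Proof.
move=> hC hN; have [Z [mZ PZ hZ]] := normalized_Fsum.
apply: (wasserstein_le hN mZ PZ hZ).
  by apply: L1_D; apply: L1_Z; exact: L2_L1.
by move=> h hl; exact: stein_bound.
Qed.

Lemma pair_Fsum (C M : R) (f f' g g' : R -> R) : bivariate_rate M C -> 0 < gw 2 ->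
  C11 M f f' -> C11 M g g' ->
  `|EX P (fun t => f (F1 t / Num.sqrt (Var P F1)) * g (F2 t / Num.sqrt (Var P F2)))
     - EX (gaussian R) f * EX (gaussian R) g|
  <= C * (Num.max (Num.sqrt (4 * gw 2))^-1 (Num.sqrt (2 * gw 1))^-1) ^+ 3 * (gw 1 + gw 2 + gw 3).
Proof.
move=> hC g2_gt0 hf hg; rewrite Var_F1 Var_F2.
have s1 : 0 < 4 * gw 2 by rewrite mulr_gt0.
have s2 : 0 < 2 * gw 1 by rewrite mulr_gt0.
set a := (Num.sqrt (4 * gw 2))^-1; set b := (Num.sqrt (2 * gw 1))^-1.
have a0 : 0 < a by rewrite invr_gt0 sqrtr_gt0.
have b0 : 0 < b by rewrite invr_gt0 sqrtr_gt0.
have va : 4 * a ^+ 2 * gw 2 = 1.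
  by rewrite /a exprVn sqr_sqrtr ?(ltW s1)// mulrAC mulfV// gt_eqF.
have vb : 2 * b ^+ 2 * gw 1 = 1.
  by rewrite /b exprVn sqr_sqrtr ?(ltW s2)// mulrAC mulfV// gt_eqF.
have na : `|a| <= Num.max a b by rewrite gtr0_norm// le_max lexx.
have nb : `|b| <= Num.max a b by rewrite gtr0_norm// le_max lexx orbT.
have := hC _ _ P _ _ _ _ hF1 hF2 hG gw_ge0 hdisc _ _ _ na nb va vb _ _ _ _ hf hg.
rewrite (eq_EX P (g := fun t => f (F1 t / Num.sqrt (4 * gw 2)) * g (F2 t / Num.sqrt (2 * gw 1))))// => t.
by rewrite (mulrC (F1 t)) (mulrC (F2 t)).
Qed.

End fixed_intensity.

(** * Bounds on the moments of the degrees *)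

Section max_scalar.
Context (R : realType).

(** Here [s], [t] are the square roots of [l] and [psi], and [p] has order [s^4 t^2]. Term by term,
    the quotients compare with [t], [1/s], [1/(s^2 t)] and [s t^2]; the first has no lower bound,
    which is why [sqrt psi] enters only the upper estimate. *)
Lemma max_scalar (s t a b ra rb p v1 v2 v3 v4 : R) :
  0 < s -> 0 < t -> 0 < a -> 0 < b -> 0 < ra -> 0 < rb -> 0 < p ->
  a * (s ^+ 4 * t ^+ 2) <= p -> p <= b * (s ^+ 4 * t ^+ 2) ->
  ra * t <= v1 -> v1 <= rb * t -> ra * t ^+ 2 <= v2 -> v2 <= rb * t ^+ 2 ->
  0 <= v3 -> v3 <= rb * t ^+ 3 -> ra * t ^+ 4 <= v4 -> v4 <= rb * t ^+ 4 ->
  ra / (2 * b) * Num.max s^-1 (Num.max (s ^+ 2 * t)^-1 (s * t ^+ 2))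
    <= (2 * p)^-1 * Num.max ((s ^+ 2) ^+ 2 * v3) (Num.max (s ^+ 2 * s * v2) (Num.max (s ^+ 2 * v1) ((s ^+ 2) ^+ 2 * s * v4))) /\
  (2 * p)^-1 * Num.max ((s ^+ 2) ^+ 2 * v3) (Num.max (s ^+ 2 * s * v2) (Num.max (s ^+ 2 * v1) ((s ^+ 2) ^+ 2 * s * v4)))
    <= rb / (2 * a) * Num.max t (Num.max s^-1 (Num.max (s ^+ 2 * t)^-1 (s * t ^+ 2))).
Proof.
move=> s0 t0 a0 b0 ra0 rb0 p0' p1 p2 k1 k1' k2 k2' k3 k3' k4 k4'.
have up (v c m w : R) : 0 <= w -> 0 <= v -> v <= rb * c -> c * w = m * (s ^+ 4 * t ^+ 2) -> (2 * p)^-1 * (w * v) <= rb / (2 * a) * m.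
  move=> w0 v0 vc e; rewrite mulrC ler_pdivrMr ?mulr_gt0//.
  have c1 : w * v <= rb * (m * (s ^+ 4 * t ^+ 2)).
    by rewrite -e mulrA [w * v]mulrC ler_wpM2r.
  apply: (le_trans c1).
  have m0 : 0 <= m.
    have h : 0 <= m * (s ^+ 4 * t ^+ 2).
      by rewrite -e mulr_ge0//; move: (le_trans v0 vc); rewrite pmulr_rge0.
    by move: h; rewrite pmulr_lge0// mulr_gt0// exprn_gt0.
  rewrite [leRHS](_ : _ = rb * (m * (p / a))); last by field; rewrite gt_eqF.
  by rewrite ler_wpM2l ?(ltW rb0)// ler_wpM2l// ler_pdivlMr// mulrC.
have dn (v c m w : R) : 0 <= w -> 0 <= m -> ra * c <= v -> c * w = m * (s ^+ 4 * t ^+ 2) -> ra / (2 * b) * m <= (2 * p)^-1 * (w * v).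
  move=> w0 m0 vc e; rewrite [leRHS]mulrC ler_pdivlMr ?mulr_gt0//.
  have c1 : ra * (m * (s ^+ 4 * t ^+ 2)) <= w * v.
    by rewrite -e mulrA [w * v]mulrC ler_wpM2r.
  apply: le_trans c1.
  rewrite [leLHS](_ : _ = ra * (m * (p / b))); last by field; rewrite gt_eqF.
  by rewrite ler_wpM2l ?(ltW ra0)// ler_wpM2l// ler_pdivrMr// mulrC.
have s2 : 0 <= s ^+ 2 by exact: sqr_ge0.
have s0' := ltW s0; have t0' := ltW t0.
have v1_0 : 0 <= v1 by apply: le_trans k1; rewrite mulr_ge0// ltW.
have v2_0 : 0 <= v2 by apply: le_trans k2; rewrite mulr_ge0 ?sqr_ge0// ltW.
have v4_0 : 0 <= v4 by apply: le_trans k4; rewrite mulr_ge0 ?exprn_ge0// ltW.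
have eC : t ^+ 2 * (s ^+ 2 * s) = s^-1 * (s ^+ 4 * t ^+ 2) by field; rewrite gt_eqF.
have eD : t * s ^+ 2 = (s ^+ 2 * t)^-1 * (s ^+ 4 * t ^+ 2) by field; rewrite !gt_eqF.
have eE : t ^+ 4 * ((s ^+ 2) ^+ 2 * s) = s * t ^+ 2 * (s ^+ 4 * t ^+ 2) by ring.
have eB : t ^+ 3 * (s ^+ 2) ^+ 2 = t * (s ^+ 4 * t ^+ 2) by ring.
have wC : 0 <= s ^+ 2 * s by exact: mulr_ge0.
have wE : 0 <= (s ^+ 2) ^+ 2 * s by rewrite mulr_ge0// sqr_ge0.
have mC : 0 <= s^-1 by rewrite invr_ge0.
have mD : 0 <= (s ^+ 2 * t)^-1 by rewrite invr_ge0 mulr_ge0.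
have mE : 0 <= s * t ^+ 2 by rewrite mulr_ge0// sqr_ge0.
have c0 : 0 <= (2 * p)^-1 by rewrite invr_ge0 mulr_ge0// ltW.
have c1 : 0 <= ra / (2 * b) by rewrite divr_ge0 ?mulr_ge0// ltW.
have c2 : 0 <= rb / (2 * a) by rewrite divr_ge0 ?mulr_ge0// ltW.
rewrite !maxr_pMr// !ge_max !le_max; split.
  by rewrite (dn _ _ _ _ wC mC k2 eC) (dn _ _ _ _ s2 mD k1 eD) (dn _ _ _ _ wE mE k4 eE) !orbT.
by rewrite (up _ _ _ _ (sqr_ge0 _) k3 k3' eB) (up _ _ _ _ wC v2_0 k2' eC) (up _ _ _ _ s2 v1_0 k1' eD) (up _ _ _ _ wE v4_0 k4' eE) !orbT.
Qed.

End max_scalar.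

Section degree_bounds.
Context (R : realType) (d : nat) (Hbar : R -> set (Rvec R d)).
Hypothesis d_gt0 : (0 < d)%N.
Hypothesis mH : forall l, 0 < l -> measurable (Hbar l).
Hypothesis Hsym : forall l, 0 < l -> Hbar l = [set vopp x | x in Hbar l].
Hypothesis Hpos : forall l, 0 < l -> (0 < leb R d (Hbar l `&` cube 1))%E.
Local Notation psi := (psi Hbar).

Record degree_bounds (a b l : R) : Prop := DegreeBounds {
  db_l : 0 < l;
  db_psi : 0 < psi l;
  db_gmom : forall n, (n <= 4)%N -> a * psi l ^+ n <= gmom Hbar l n <= b * psi l ^+ n;
  db_H3 : ell (@Wpow R d 4 `&` H3 Hbar l) <= b * psi l ^+ 3;
  db_H4 : a * psi l ^+ 4 <= ell (@Wpow R d 5 `&` H4 Hbar l) <= b * psi l ^+ 4 }.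

(** All the moments and walk counts are squeezed between powers of [psi_check] and [psi_hat], and
    [psi] lies between these two comparable coefficients. *)
Lemma degree_bounds_near : asymp (psi_check Hbar) (psi_hat Hbar) ->
  exists a b : R, [/\ 0 < a, 0 < b & \forall l \near +oo, degree_bounds a b l].
Proof.
move=> [C [C' [C0 C'0 hC]]]; pose K := Num.max 1 C'; pose k : R := (2 ^+ d)^-1.
have K1 : 1 <= K by rewrite le_max lexx.
have K0 : 0 < K by exact: lt_le_trans K1.
have k0 : 0 < k by rewrite invr_gt0 exprn_gt0.
have k1 : k <= 1 by rewrite invf_le1 ?exprn_gt0// exprn_ege1// ler1n.
(* [k] is the volume of the inner cube. The square comes from the lower bound on walks with four
   edges by the squared second moment; since [k / K^4 <= 1], it also serves the moments. *)
exists ((k / K ^+ 4) ^+ 2), (K ^+ 4); split; [by rewrite exprn_gt0// divr_gt0// exprn_gt0|by rewrite exprn_gt0|].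
near=> l; have l0 : 0 < l by near: l; exact: nbhs_pinfty_gt.
have h1 := psi_check_le (mH l0) d_gt0; have h2 := psi_le_hat (mH l0) d_gt0.
have p0 := psi_gt0 (mH l0) (Hpos l0).
have h3 : psi_hat Hbar l <= K * psi_check Hbar l.
  have [_ h] : C * psi_check Hbar l <= psi_hat Hbar l /\ psi_hat Hbar l <= C' * psi_check Hbar l by near: l.
  by apply: (le_trans h); rewrite ler_wpM2r ?fine_ge0// le_max lexx orbT.
have c0 : 0 <= psi_check Hbar l by rewrite fine_ge0.
have h4 : psi_hat Hbar l <= K * psi l by apply: (le_trans h3); rewrite ler_wpM2l// ltW.
have h5 : psi l <= K * psi_check Hbar l by exact: le_trans h3.
have up n : (n <= 4)%N -> psi_hat Hbar l ^+ n <= K ^+ 4 * psi l ^+ n.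
  move=> n4; apply: (@le_trans _ _ ((K * psi l) ^+ n)).
    apply: lerXn2r => //; rewrite nnegrE ?fine_ge0//.
    by rewrite mulr_ge0// ltW.
  by rewrite exprMn ler_wpM2r ?exprn_ge0 ?(ltW p0)// ler_weXn2l.
have lo n : (n <= 4)%N -> k / K ^+ 4 * psi l ^+ n <= gmom Hbar l n.
  move=> n4; apply: le_trans (gmom_ge (mH l0) d_gt0 n); rewrite -/k -mulrA ler_wpM2l ?(ltW k0)//.
  rewrite mulrC ler_pdivrMr ?exprn_gt0//; apply: (@le_trans _ _ ((K * psi_check Hbar l) ^+ n)).
    by apply: lerXn2r; rewrite ?nnegrE ?(ltW p0)// mulr_ge0// ltW.
  by rewrite exprMn mulrC ler_wpM2l ?exprn_ge0// ler_weXn2l.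
have kK0 : 0 < k / K ^+ 4 by rewrite divr_gt0// exprn_gt0.
have kK1 : k / K ^+ 4 <= 1.
  by rewrite ler_pdivrMr ?exprn_gt0// mul1r (le_trans k1)// exprn_ege1.
have sqk : (k / K ^+ 4) ^+ 2 <= k / K ^+ 4 by rewrite expr2 ler_piMr// ltW.
have /andP[q1 q2] := ell_H4_bounds (mH l0) (Hsym l0) d_gt0.
split=> //.
- move=> n n4; apply/andP; split.
    by apply: le_trans (lo n n4); rewrite ler_wpM2r// exprn_ge0// ltW.
  by have /andP[_ h] := gmom_bounds (mH l0) d_gt0 n; exact: le_trans (up n n4).
- by apply: (le_trans (ell_H3_bound (mH l0) d_gt0)); exact: up.
- apply/andP; split; last by apply: (le_trans q2); exact: up.
  apply: le_trans q1; rewrite (_ : psi l ^+ 4 = (psi l ^+ 2) ^+ 2); last by rewrite -exprM.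
  rewrite -exprMn; apply: lerXn2r; rewrite ?nnegrE.
  + by rewrite mulr_ge0 ?(ltW kK0)// sqr_ge0.
  + by have /andP[] := gmom_bounds (mH l0) d_gt0 2.
  + exact: lo.
Unshelve. all: by end_near.
Qed.

Variables (a b l : R).
Hypothesis (a0 : 0 < a) (b0 : 0 < b).
Hypothesis hb : degree_bounds a b l.
Let l0 := db_l hb.
Let p0 := db_psi hb.
Let s := Num.sqrt l.
Let t := Num.sqrt (psi l).
Let s0 : 0 < s. Proof. by rewrite sqrtr_gt0. Qed.
Let t0 : 0 < t. Proof. by rewrite sqrtr_gt0. Qed.
Let ls : l = s ^+ 2. Proof. by rewrite sqr_sqrtr// ltW. Qed.
Let pt : psi l = t ^+ 2. Proof. by rewrite sqr_sqrtr// ltW. Qed.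
Let ra := Num.sqrt a.
Let rb := Num.sqrt b.
Let ra0 : 0 < ra. Proof. by rewrite sqrtr_gt0. Qed.
Let rb0 : 0 < rb. Proof. by rewrite sqrtr_gt0. Qed.
Let x := l * psi l.
Let x0 : 0 < x. Proof. exact: mulr_gt0. Qed.
Local Notation gwl := (gw Hbar l).

Lemma gw_bounds r : (r <= 4)%N -> a * (l * x ^+ r) <= gwl r <= b * (l * x ^+ r).
Proof.
move=> r4; have /andP[h1 h2] := db_gmom hb r4; rewrite /gw /x exprMn exprS.
have lr : 0 < l * l ^+ r by rewrite mulr_gt0// exprn_gt0.
rewrite [in X in X <= _ <= _](_ : a * _ = l * l ^+ r * (a * psi l ^+ r)); last by ring.
rewrite [in X in _ <= _ <= X](_ : b * _ = l * l ^+ r * (b * psi l ^+ r)); last by ring.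
by rewrite !ler_pM2l// h1 h2.
Qed.

Lemma gw_gt0 r : (r <= 4)%N -> 0 < gwl r.
Proof.
by move=> /gw_bounds/andP[h _]; apply: lt_le_trans h; rewrite !mulr_gt0// exprn_gt0.
Qed.

Let gw1 : a * (l * x) <= gwl 1 <= b * (l * x). Proof. exact: (gw_bounds (r := 1)). Qed.
Let gw2 : a * (l * x ^+ 2) <= gwl 2 <= b * (l * x ^+ 2). Proof. exact: gw_bounds. Qed.
Let gw3 : a * (l * x ^+ 3) <= gwl 3 <= b * (l * x ^+ 3). Proof. exact: gw_bounds. Qed.

Let invsqrt : l `^ (- 2^-1) = s^-1. Proof. by rewrite powRN powR12_sqrt// ltW. Qed.
Let sqrtl : l `^ 2^-1 = s. Proof. by rewrite powR12_sqrt// ltW. Qed.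
Let pow32 : l `^ (3 / 2) = l * s.
Proof.
rewrite (_ : 3 / 2 = 1 + 2^-1); last by field.
by rewrite powRD ?powRr1 ?sqrtl ?(ltW l0)//; apply/implyP => _; rewrite gt_eqF.
Qed.
Let pow52 : l `^ (5 / 2) = l ^+ 2 * s.
Proof.
rewrite (_ : 5 / 2 = 2%:R + 2^-1); last by field.
by rewrite powRD ?powR_mulrn ?sqrtl ?(ltW l0)//; apply/implyP => _; rewrite gt_eqF.
Qed.
Let inv2 : (l ^+ 2 * psi l) `^ (- 2^-1) = (s ^+ 2 * t)^-1.
Proof.
have e : l ^+ 2 * psi l = (s ^+ 2 * t) ^+ 2 by rewrite {1}ls pt; ring.
have h : 0 <= s ^+ 2 * t by rewrite mulr_ge0 ?sqr_ge0// ltW.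
by rewrite powRN powR12_sqrt e ?sqr_ge0// sqrtr_sqr ger0_norm.
Qed.

Lemma V_ratio_bounds : V1sq Hbar l / V2sq Hbar l * (a / (2 * b)) <= l * psi l <=
  V1sq Hbar l / V2sq Hbar l * (b / (2 * a)).
Proof.
rewrite (V1sqE (mH l0)) (V2sqE (mH l0)) -/x.
have /andP[p1 p2] := gw1; have /andP[q1 q2] := gw2.
have p0' := gw_gt0 (isT : (1 <= 4)%N).
move: (gwl 1) (gwl 2) p0' p1 p2 q1 q2 => p q p0' p1 p2 q1 q2; apply/andP; split.
  rewrite [leLHS](_ : _ = a * q / (b * p)); last by field; rewrite !gt_eqF.
  rewrite ler_pdivrMr ?mulr_gt0//.
  have := ler_wpM2l (ltW a0) q2; have := ler_wpM2l (ltW (mulr_gt0 b0 x0)) p1; lra.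
rewrite [leRHS](_ : _ = b * q / (a * p)); last by field; rewrite !gt_eqF.
rewrite ler_pdivlMr ?mulr_gt0//.
have := ler_wpM2l (ltW b0) q1; have := ler_wpM2l (ltW (mulr_gt0 a0 x0)) p2; lra.
Qed.

Let sqrtE (u y : R) n : 0 <= u -> 0 <= y -> Num.sqrt (u * (y ^+ n) ^+ 2) = Num.sqrt u * y ^+ n.
Proof. by move=> u0 y0; rewrite sqrtrM// sqrtr_sqr ger0_norm// exprn_ge0. Qed.

Let sqrt_bounds (v y : R) n : 0 <= y -> a * (y ^+ n) ^+ 2 <= v -> ra * y ^+ n <= Num.sqrt v.
Proof. by move=> y0 h; rewrite -sqrtE ?(ltW a0)// ler_wsqrtr. Qed.

Let sqrt_bounds' (v y : R) n : 0 <= y -> v <= b * (y ^+ n) ^+ 2 -> Num.sqrt v <= rb * y ^+ n.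
Proof. by move=> y0 h; rewrite -sqrtE ?(ltW b0)// ler_wsqrtr. Qed.

Lemma A_ratio_bounds : (V1sq Hbar l)^-1 * Aq Hbar l * (4 * a / rb) <= l `^ (- 2^-1) <=
  (V1sq Hbar l)^-1 * Aq Hbar l * (4 * b / ra).
Proof.
rewrite (V1sqE (mH l0)) /Aq (ell_H2 (mH l0)) pow52 invsqrt.
have /andP[q1 q2] := gw2; have q0 := gw_gt0 (isT : (2 <= 4)%N).
have /andP[g1 g2] := db_gmom hb (isT : (4 <= 4)%N).
have e4 : psi l ^+ 4 = (psi l ^+ 2) ^+ 2 by rewrite -exprM.
rewrite e4 in g1 g2.
have h1 := sqrt_bounds (ltW p0) g1; have h2 := sqrt_bounds' (ltW p0) g2.
move: (gwl 2) q0 q1 q2 (Num.sqrt (gmom _ _ _)) h1 h2 => q q0 q1 q2 v h1 h2.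
have e : l * x ^+ 2 = s ^+ 2 * (l ^+ 2 * psi l ^+ 2) by rewrite {1}ls /x; ring.
rewrite e in q1 q2; set y := l ^+ 2 * psi l ^+ 2 in q1 q2.
have y0 : 0 < y by rewrite mulr_gt0// exprn_gt0.
have hh1 : ra * y <= l ^+ 2 * v by rewrite mulrCA ler_wpM2l// exprn_ge0// ltW.
have hh2 : l ^+ 2 * v <= rb * y by rewrite mulrCA ler_wpM2l// exprn_ge0// ltW.
rewrite (_ : l ^+ 2 * s * v = s * (l ^+ 2 * v)); last by ring.
move: (l ^+ 2 * v) hh1 hh2 => z hh1 hh2.
have z0 : 0 < z by apply: lt_le_trans hh1; rewrite mulr_gt0.
apply/andP; split.
  rewrite [leLHS](_ : _ = (a * z * s ^+ 2) / (rb * q) / s); last by field; rewrite !gt_eqF.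
  rewrite -[leRHS]mul1r ler_wpM2r ?invr_ge0 ?(ltW s0)// ler_pdivrMr ?mulr_gt0// mul1r.
  apply: (@le_trans _ _ (a * (rb * y) * s ^+ 2)); first by rewrite ler_wpM2r ?sqr_ge0// ler_wpM2l// ltW.
  rewrite [leLHS](_ : _ = rb * (a * (s ^+ 2 * y))); last by ring.
  by rewrite ler_wpM2l// ltW.
rewrite [leRHS](_ : _ = (b * z * s ^+ 2) / (ra * q) / s); last by field; rewrite !gt_eqF.
rewrite -[leLHS]mul1r ler_wpM2r ?invr_ge0 ?(ltW s0)// ler_pdivlMr ?mulr_gt0// mul1r.
apply: (@le_trans _ _ (b * (ra * y) * s ^+ 2)); last by rewrite ler_wpM2r ?sqr_ge0// ler_wpM2l// ltW.
rewrite [leRHS](_ : _ = ra * (b * (s ^+ 2 * y))); last by ring.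
by rewrite ler_wpM2l// ltW.
Qed.

Lemma max_ratio_bounds :
  ra / (2 * b) * Num.max (l `^ (- 2^-1)) (Num.max ((l ^+ 2 * psi l) `^ (- 2^-1)) (l `^ 2^-1 * psi l))
    <= (V2sq Hbar l)^-1 * Num.max (Bq Hbar l) (Num.max (Cq Hbar l) (Num.max (Dq Hbar l) (Eq Hbar l))) /\
  (V2sq Hbar l)^-1 * Num.max (Bq Hbar l) (Num.max (Cq Hbar l) (Num.max (Dq Hbar l) (Eq Hbar l)))
    <= rb / (2 * a) * Num.max (Num.sqrt (psi l)) (Num.max (l `^ (- 2^-1))
        (Num.max ((l ^+ 2 * psi l) `^ (- 2^-1)) (l `^ 2^-1 * psi l))).
Proof.
rewrite (V2sqE (mH l0)) /Bq /Cq /Dq /Eq (ell_H1 (mH l0)) (ell_H0 (mH l0)) pow52 pow32 invsqrt sqrtl inv2 -/t pt.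
have /andP[p1 p2] := gw1; have p0' := gw_gt0 (isT : (1 <= 4)%N).
have elx : l * x = s ^+ 4 * t ^+ 2 by rewrite /x pt ls; ring.
rewrite elx in p1 p2.
have /andP[g1 g1'] := db_gmom hb (isT : (1 <= 4)%N).
have /andP[g2 g2'] := db_gmom hb (isT : (2 <= 4)%N).
have /andP[g4 g4'] := db_H4 hb; have g3' := db_H3 hb.
rewrite pt expr1 in g1 g1'; rewrite pt in g2 g2' g3'; rewrite pt in g4 g4'.
have e4 : (t ^+ 2) ^+ 4 = (t ^+ 4) ^+ 2 by rewrite -!exprM.
have e3 : (t ^+ 2) ^+ 3 = (t ^+ 3) ^+ 2 by rewrite -!exprM.
rewrite e4 in g4 g4'; rewrite e3 in g3'.
have t0' := ltW t0.
have k1 := sqrt_bounds (n := 1) t0' g1; have k1' := sqrt_bounds' (n := 1) t0' g1'.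
have k2 := sqrt_bounds t0' g2; have k2' := sqrt_bounds' t0' g2'.
have k4 := sqrt_bounds t0' g4; have k4' := sqrt_bounds' t0' g4'.
have k3' := sqrt_bounds' t0' g3'.
rewrite expr1 in k1 k1'.
have := max_scalar s0 t0 a0 b0 ra0 rb0 p0' p1 p2 k1 k1' k2 k2' (sqrtr_ge0 _) k3' k4 k4'.
by rewrite -!ls.
Qed.

Let sqrt_ge (u v : R) : 0 <= u -> u ^+ 2 <= v -> u <= Num.sqrt v.
Proof. by move=> u0 uv; rewrite -[u]ger0_norm// -sqrtr_sqr ler_wsqrtr. Qed.

Let aE : a = ra ^+ 2. Proof. by rewrite sqr_sqrtr// ltW. Qed.

Let cube_rate (u v A B : R) : 0 < u -> u <= v -> A <= B -> 0 <= B -> v^-1 ^+ 3 * A <= B / u ^+ 3.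
Proof.
move=> u0 uv AB B0; have v0 := lt_le_trans u0 uv.
apply: (@le_trans _ _ (v^-1 ^+ 3 * B)); first by rewrite ler_wpM2l// exprn_ge0// invr_ge0 ltW.
rewrite mulrC ler_wpM2l// -exprVn; apply: lerXn2r; rewrite ?nnegrE ?invr_ge0 ?(ltW u0) ?(ltW v0)//.
by rewrite lef_pV2.
Qed.

(** The first-chaos variance alone bounds the normalization below, by order [l x^2]; for [x >= c]
    the numerator is at most of order [l x^3], with a loss of [c^(-2)], and the powers of [x]
    cancel. *)
Lemma rate_dense c : 0 < c <= 1 -> c <= l * psi l ->
  (Num.sqrt (4 * gwl 2 + 2 * gwl 1))^-1 ^+ 3 * (gwl 1 + gwl 2 + gwl 3) <=
  3 * b / (c ^+ 2 * ra ^+ 3) * l `^ (- 2^-1).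
Proof.
move=> /andP[c0 c1]; rewrite -/x => cx; rewrite invsqrt.
have /andP[p1 p2] := gw1; have /andP[q1 q2] := gw2; have /andP[r1 r2] := gw3.
have p0' := gw_gt0 (isT : (1 <= 4)%N).
have u0 : 0 < ra * s * x by rewrite !mulr_gt0.
have uv : ra * s * x <= Num.sqrt (4 * gwl 2 + 2 * gwl 1).
  apply: sqrt_ge; first exact: ltW.
  rewrite (_ : (ra * s * x) ^+ 2 = a * (l * x ^+ 2)); last by rewrite aE {1}ls; ring.
  have : 0 <= a * (l * x ^+ 2) by rewrite !mulr_ge0 ?sqr_ge0// ltW.
  move: p0' q1; lra.
have B0 : 0 <= 3 * b / c ^+ 2 * (l * x ^+ 3).
  by rewrite mulr_ge0 ?divr_ge0 ?sqr_ge0 ?mulr_ge0 ?exprn_ge0// ltW.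
have AB : gwl 1 + gwl 2 + gwl 3 <= 3 * b / c ^+ 2 * (l * x ^+ 3).
  have z1 : 1 <= x / c by rewrite ler_pdivlMr// mul1r.
  have xc : x <= x / c by rewrite ler_pdivlMr// ler_piMr// ltW.
  have e1 : x <= (x / c) ^+ 2 * x by rewrite -[leLHS]mul1r ler_wpM2r ?(ltW x0)// exprn_ege1.
  have e2 : x ^+ 2 <= (x / c) ^+ 2 * x.
    by rewrite expr2 ler_wpM2r ?(ltW x0)// (le_trans xc)// expr2 ler_peMr// (le_trans _ z1).
  have e3 : x ^+ 3 <= (x / c) ^+ 2 * x.
    rewrite exprSr ler_wpM2r ?(ltW x0)//; apply: lerXn2r; rewrite ?nnegrE ?(ltW x0)//.
    by rewrite divr_ge0// ltW.
  have bl : 0 <= b * l by rewrite mulr_ge0// ltW.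
  have h1 := ler_wpM2l bl e1; have h2 := ler_wpM2l bl e2; have h3 := ler_wpM2l bl e3.
  rewrite [leRHS](_ : _ = 3 * (b * l * ((x / c) ^+ 2 * x))); last by field; rewrite gt_eqF.
  by move: p2 q2 r2 h1 h2 h3; rewrite !mulrA; lra.
apply: (le_trans (cube_rate u0 uv AB B0)); rewrite le_eqVlt; apply/orP; left; apply/eqP.
by rewrite {1}ls; field; rewrite !gt_eqF.
Qed.

(** The second-chaos variance bounds the normalization below, by order [l x], which for [x <= 1] is
    also the order of the numerator; [l x] is the square of [l * sqrt psi]. *)
Lemma rate_sparse : l * psi l <= 1 ->
  (Num.sqrt (4 * gwl 2 + 2 * gwl 1))^-1 ^+ 3 * (gwl 1 + gwl 2 + gwl 3) <=
  3 * b / ra ^+ 3 / (l * Num.sqrt (psi l)).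
Proof.
rewrite -/x -/t => x1.
have /andP[p1 p2] := gw1; have /andP[q1 q2] := gw2; have /andP[r1 r2] := gw3.
have q0' := gw_gt0 (isT : (2 <= 4)%N).
have lx : l * x = (l * t) ^+ 2 by rewrite /x pt; ring.
have u0 : 0 < ra * (l * t) by rewrite !mulr_gt0.
have uv : ra * (l * t) <= Num.sqrt (4 * gwl 2 + 2 * gwl 1).
  apply: sqrt_ge; first exact: ltW.
  rewrite exprMn -aE -lx; have : 0 <= a * (l * x) by rewrite !mulr_ge0// ltW.
  move: q0' p1; lra.
have B0 : 0 <= 3 * b * (l * x) by rewrite !mulr_ge0// ltW.
have AB : gwl 1 + gwl 2 + gwl 3 <= 3 * b * (l * x).
  have x0' := ltW x0.
  have e2 : x ^+ 2 <= x by rewrite expr2 ler_piMr.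
  have e3 : x ^+ 3 <= x by rewrite exprS ler_piMr// exprn_ile1.
  have bl : 0 <= b * l by rewrite mulr_ge0// ltW.
  have h2 := ler_wpM2l bl e2; have h3 := ler_wpM2l bl e3.
  by move: p2 q2 r2 h2 h3; rewrite !mulrA; lra.
apply: (le_trans (cube_rate u0 uv AB B0)); rewrite le_eqVlt; apply/orP; left; apply/eqP.
by rewrite lx; field; rewrite !gt_eqF.
Qed.

(** Each variance separately is at least of order [l], as required when the two chaoses are
    normalized one by one. *)
Lemma rate_balanced c D : 0 < c <= 1 -> c <= l * psi l -> 1 <= D -> l * psi l <= D ->
  (Num.max (Num.sqrt (4 * gwl 2))^-1 (Num.sqrt (2 * gwl 1))^-1) ^+ 3 * (gwl 1 + gwl 2 + gwl 3) <=
  3 * b * D ^+ 3 / (ra * c) ^+ 3 * l `^ (- 2^-1).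
Proof.
move=> /andP[c0 c1]; rewrite -/x => cx D1 xD; rewrite invsqrt.
have /andP[p1 p2] := gw1; have /andP[q1 q2] := gw2; have /andP[r1 r2] := gw3.
have u0 : 0 < ra * c * s by rewrite !mulr_gt0.
have ex : (ra * c * s) ^+ 2 = a * (l * c ^+ 2) by rewrite aE {1}ls; ring.
have al : 0 <= a * l by rewrite mulr_ge0// ltW.
have c2x : c ^+ 2 <= x by apply: le_trans cx; rewrite expr2 ler_piMr// ltW.
have c2x2 : c ^+ 2 <= x ^+ 2 by apply: lerXn2r; rewrite ?nnegrE ?(ltW c0) ?(ltW x0).
have uv1 : ra * c * s <= Num.sqrt (4 * gwl 2).
  apply: sqrt_ge; first exact: ltW.
  rewrite ex; have g0 := gw_gt0 (isT : (2 <= 4)%N).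
  have h : a * (l * c ^+ 2) <= a * (l * x ^+ 2) by rewrite !ler_wpM2l// ltW.
  by apply: (le_trans h); apply: (le_trans q1); lra.
have uv2 : ra * c * s <= Num.sqrt (2 * gwl 1).
  apply: sqrt_ge; first exact: ltW.
  rewrite ex; have g0 := gw_gt0 (isT : (1 <= 4)%N).
  have h : a * (l * c ^+ 2) <= a * (l * x) by rewrite !ler_wpM2l// ltW.
  by apply: (le_trans h); apply: (le_trans p1); lra.
have D0 : 0 <= D by exact: le_trans D1.
have bl : 0 <= b * l by rewrite mulr_ge0// ltW.
have B0 : 0 <= 3 * b * D ^+ 3 * l.
  by rewrite !mulr_ge0 ?exprn_ge0// ltW.
have AB : gwl 1 + gwl 2 + gwl 3 <= 3 * b * D ^+ 3 * l.
  have e n : (0 < n)%N -> (n <= 3)%N -> x ^+ n <= D ^+ 3.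
    move=> n0 n3; apply: (@le_trans _ _ (D ^+ n)); last exact: ler_weXn2l.
    by apply: lerXn2r; rewrite ?nnegrE ?(ltW x0).
  have := ler_wpM2l bl (e 1%N isT isT); have := ler_wpM2l bl (e 2%N isT isT); have := ler_wpM2l bl (e 3%N isT isT).
  by move: p2 q2 r2; rewrite expr1 !mulrA; lra.
set m := Num.max _ _; rewrite -[m]invrK.
have um : ra * c * s <= m^-1.
  rewrite -[leLHS]invrK lef_pV2 ?posrE ?invr_gt0//.
    by rewrite /m ge_max !lef_pV2 ?posrE// ?uv1 ?uv2 ?(lt_le_trans u0 uv1) ?(lt_le_trans u0 uv2).
  by rewrite /m lt_max invr_gt0 (lt_le_trans u0 uv1).
apply: (le_trans (cube_rate u0 um AB B0)); rewrite le_eqVlt; apply/orP; left; apply/eqP.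
by rewrite {1}ls; field; rewrite !gt_eqF.
Qed.

End degree_bounds.

(** * Convergence in distribution from smooth product tests *)

Section smooth_step.
Context (R : realType).
Implicit Types (x y z : R) (f g : R -> R).

Definition pospart z : R := Num.max 0 z.

Lemma pospart_taylor x y : `|pospart y ^+ 2 - pospart x ^+ 2 - (y - x) * (2 * pospart x)| <= (y - x) ^+ 2.
Proof.
have h1 := sqr_ge0 (y - x); have h2 := sqr_ge0 x; have h3 := sqr_ge0 y.
rewrite /pospart ler_norml; case: (leP 0 y) => hy; case: (leP 0 x) => hx.
- by apply/andP; split; lra.
- have nx : 0 <= - x by lra.
  by have := mulr_ge0 hy nx => h; apply/andP; split; lra.
- have ny : 0 <= - y by lra.
  by have := mulr_ge0 hx ny => h; apply/andP; split; lra.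
- by lra.
Qed.

Lemma pospart_lip x y : `|pospart x - pospart y| <= `|x - y|.
Proof.
rewrite /pospart; case: (leP 0 x) => hx; case: (leP 0 y) => hy //.
- by rewrite !ger0_norm; lra.
- by rewrite !ler0_norm; lra.
- by rewrite subrr normr0.
Qed.

(* The quadratic spline rising from 0 at 0 to 1 at 1. *)
Definition sstep z : R := 2 * pospart z ^+ 2 - 4 * pospart (z - 2^-1) ^+ 2 + 2 * pospart (z - 1) ^+ 2.
Definition dsstep z : R := 4 * pospart z - 8 * pospart (z - 2^-1) + 4 * pospart (z - 1).

Lemma sstep_le0 z : z <= 0 -> sstep z = 0.
Proof.
move=> h; rewrite /sstep /pospart !max_l; [by ring|lra|lra|lra].
Qed.

Lemma sstep_ge1 z : 1 <= z -> sstep z = 1.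
Proof.
by move=> h; rewrite /sstep /pospart !max_r; [field|lra|lra|lra].
Qed.

Lemma sstep01 z : 0 <= sstep z <= 1.
Proof.
have [h|h] := leP z 0; first by rewrite sstep_le0// lexx ler01.
have [h1|h1] := leP 1 z; first by rewrite sstep_ge1// lexx ler01.
rewrite /sstep /pospart (max_r (ltW h)) (@max_l _ _ 0 (z - 1)); last lra.
by have [h2|h2] := leP 0 (z - 2^-1); apply/andP; split; nra.
Qed.

Lemma dsstep_bound z : `|dsstep z| <= 2.
Proof.
rewrite /dsstep /pospart ler_norml.
by case: (leP 0 z) => h1; case: (leP 0 (z - 2^-1)) => h2; case: (leP 0 (z - 1)) => h3; apply/andP; split; lra.
Qed.

(** 16 is [4 + 8 + 4], the Lipschitz constant of the derivative read off its three kinks. *)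
Lemma C11_sstep : C11 16 sstep dsstep.
Proof.
have tay x y : `|sstep y - sstep x - (y - x) * dsstep x| <= 8 * (y - x) ^+ 2.
  have h1 := pospart_taylor x y; have h2 := pospart_taylor (x - 2^-1) (y - 2^-1); have h3 := pospart_taylor (x - 1) (y - 1).
  have e c : y - c - (x - c) = y - x by ring.
  rewrite !e in h2 h3.
  move: h1 h2 h3; rewrite /sstep /dsstep !ler_norml => /andP[? ?] /andP[? ?] /andP[? ?]; apply/andP; split; lra.
split.
- by move=> x; have /andP[? ?] := sstep01 x; rewrite ger0_norm//; lra.
- by move=> x; apply: (le_trans (dsstep_bound x)); lra.
- move=> x y; have /andP[a1 a2] := sstep01 x; have /andP[b1 b2] := sstep01 y.
  have [h|h] := leP 1 `|x - y|.
    by rewrite ler_norml; apply/andP; split; lra.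
  have := tay y x; have := dsstep_bound y; have : (x - y) ^+ 2 <= `|x - y|.
    by rewrite -real_normK ?num_real// expr2 ler_piMr// ltW.
  move=> h1 h2 h3; have h4 : `|(x - y) * dsstep y| <= `|x - y| * 2 by rewrite normrM ler_wpM2l.
  rewrite -[sstep x - sstep y](subrK ((x - y) * dsstep y)) (le_trans (ler_normD _ _))//.
  by have := normr_ge0 (x - y); lra.
- move=> x y; have h1 := pospart_lip x y; have h2 := pospart_lip (x - 2^-1) (y - 2^-1); have h3 := pospart_lip (x - 1) (y - 1).
  have e c : x - c - (y - c) = x - y by ring.
  rewrite !e in h2 h3; rewrite (_ : _ - _ = 4 * (pospart x - pospart y) + - 8 * (pospart (x - 2^-1) - pospart (y - 2^-1)) + 4 * (pospart (x - 1) - pospart (y - 1))); last by rewrite /dsstep; ring.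
  apply: (le_trans (ler_normD _ _)).
  apply: (@le_trans _ _ (`|4 * (pospart x - pospart y)| + `|- 8 * (pospart (x - 2^-1) - pospart (y - 2^-1))| + `|4 * (pospart (x - 1) - pospart (y - 1))|)).
    by rewrite lerD2r ler_normD.
  have n8 : `|-8| = 8 :> R by rewrite normrN ger0_norm.
  have n4 : `|4| = 4 :> R by rewrite ger0_norm.
  by rewrite !normrM n8 n4; lra.
- by move=> x y; apply: (le_trans (tay x y)); have := sqr_ge0 (y - x); lra.
Qed.

Lemma C11_affine (M A a b : R) f f' : C11 M f f' -> 1 <= A -> `|a| <= A ->
  C11 (M * A ^+ 2) (fun x => f (a * x + b)) (fun x => a * f' (a * x + b)).
Proof.
move=> hf A1 aA; have M0 := C11_ge0 hf; have A0 : 0 <= A by exact: le_trans A1.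
have AA : A <= A ^+ 2 by rewrite expr2 ler_peMr.
have MA : M <= M * A ^+ 2 by rewrite ler_peMr// exprn_ege1.
have dl x y : `|a * x + b - (a * y + b)| <= A * `|x - y|.
  by rewrite (_ : _ - _ = a * (x - y)); [rewrite normrM ler_wpM2r|ring].
have AAx x y : A * `|x - y| <= A ^+ 2 * `|x - y| by rewrite ler_wpM2r.
split.
- by move=> x; exact: le_trans (C11_bound hf _) MA.
- move=> x; rewrite normrM mulrC; apply: ler_pM => //; first exact: C11_dbound hf _.
  exact: le_trans AA.
- move=> x y; apply: (le_trans (C11_lip hf _ _)); rewrite -mulrA ler_wpM2l//.
  exact: le_trans (dl x y) _.
- move=> x y; rewrite -mulrBr normrM; apply: (@le_trans _ _ (A * (M * (A * `|x - y|)))).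
    apply: ler_pM => //; apply: (le_trans (C11_dlip hf _ _)); rewrite ler_wpM2l//.
  by rewrite [leLHS](_ : _ = M * A ^+ 2 * `|x - y|)//; ring.
- move=> x y; have := C11_taylor hf (a * x + b) (a * y + b).
  have -> : a * y + b - (a * x + b) = a * (y - x) by ring.
  rewrite [X in _ - X](_ : _ = (y - x) * (a * f' (a * x + b))); last by ring.
  have aA2 : (a * (y - x)) ^+ 2 <= A ^+ 2 * (y - x) ^+ 2.
    rewrite exprMn ler_wpM2r ?sqr_ge0//.
    by rewrite -real_normK ?num_real//; apply: lerXn2r; rewrite ?nnegrE.
  by move=> /le_trans; apply; rewrite -mulrA ler_wpM2l.
Qed.

Lemma C11_B (M1 M2 : R) f f' g g' : C11 M1 f f' -> C11 M2 g g' ->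
  C11 (M1 + M2) (fun x => f x - g x) (fun x => f' x - g' x).
Proof.
move=> hf hg; split.
- by move=> x; rewrite (le_trans (ler_normB _ _))// lerD//; [exact: C11_bound hf _|exact: C11_bound hg _].
- by move=> x; rewrite (le_trans (ler_normB _ _))// lerD//; [exact: C11_dbound hf _|exact: C11_dbound hg _].
- move=> x y; rewrite (_ : _ - _ = (f x - f y) - (g x - g y)); last by ring.
  by rewrite (le_trans (ler_normB _ _))// mulrDl lerD//; [exact: C11_lip hf _ _|exact: C11_lip hg _ _].
- move=> x y; rewrite (_ : _ - _ = (f' x - f' y) - (g' x - g' y)); last by ring.
  by rewrite (le_trans (ler_normB _ _))// mulrDl lerD//; [exact: C11_dlip hf _ _|exact: C11_dlip hg _ _].
- move=> x y; rewrite (_ : _ - _ - _ = (f y - f x - (y - x) * f' x) - (g y - g x - (y - x) * g' x)); last by ring.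
  by rewrite (le_trans (ler_normB _ _))// [leRHS]mulrDl lerD//; [exact: C11_taylor hf _ _|exact: C11_taylor hg _ _].
Qed.

(** The difference of two consecutive steps: a smooth bump supported where [0 < a x + b < 2], whose
    integer shifts telescope to a partition of unity. *)
Definition sbump (a b x : R) : R := sstep (a * x + b) - sstep (a * x + (b - 1)).
Definition dsbump (a b x : R) : R := a * dsstep (a * x + b) - a * dsstep (a * x + (b - 1)).

Lemma C11_sbump (A a b : R) : 1 <= A -> `|a| <= A -> C11 (32 * A ^+ 2) (sbump a b) (dsbump a b).
Proof.
move=> A1 aA; rewrite (_ : 32 * A ^+ 2 = 16 * A ^+ 2 + 16 * A ^+ 2); last by ring.
by apply: C11_B; exact: (C11_affine _ C11_sstep).
Qed.

Lemma sbump_ge0 a b x : 0 <= sbump a b x.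
Proof.
rewrite /sbump; have /andP[h0 h1] := sstep01 (a * x + b).
have [h|h] := leP (a * x + b) 1; last by rewrite (sstep_ge1 (ltW h)); have /andP[] := sstep01 (a * x + (b - 1)); lra.
by rewrite (@sstep_le0 (a * x + (b - 1))) ?subr0//; lra.
Qed.

Lemma sbump_support a b x : sbump a b x != 0 -> 0 < a * x + b < 2.
Proof.
move=> h; rewrite !ltNge -negb_or; apply: contra h => /orP[h|h]; rewrite /sbump.
  by rewrite !sstep_le0 ?subrr//; lra.
by rewrite !sstep_ge1 ?subrr//; lra.
Qed.

Lemma sum_sbump a (b : R) x n : \sum_(k < n) sbump a (b - k%:R) x = sstep (a * x + b) - sstep (a * x + (b - n%:R)).
Proof.
elim: n => [|n IH]; first by rewrite big_ord0 subr0 subrr.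
rewrite big_ord_recr/= IH /sbump -natr1 [b - (n%:R + 1)](_ : _ = b - n%:R - 1); last by ring.
by ring.
Qed.

End smooth_step.

(** * Approximation by sums of products of bumps *)

Section bump_approximation.
Context (R : realType).
Variables (phi : R * R -> R) (M : R).
Hypothesis cphi : continuous phi.
Hypothesis bphi : forall p, `|phi p| <= M.

(** Only the first point has to lie in the box, so that centres of bumps slightly outside cause no
    difficulty. *)
Lemma uniform_continuity_box (T e : R) : 0 < e -> exists de : R, 0 < de <= 1 /\
  forall x y x' y', `|x| <= T -> `|y| <= T -> `|x - x'| <= de -> `|y - y'| <= de ->
    `|phi (x, y) - phi (x', y')| <= e.
Proof.
move=> e0; have cK : compact (`[- T, T] `*` `[- T, T] : set (R * R)).
  by apply: compact_setX; exact: segment_compact.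
pose Q (r : R) (p : R * R) := forall x' y', `|p.1 - x'| <= r -> `|p.2 - y'| <= r ->
  `|phi p - phi (x', y')| <= e.
have cov := proj1 (compact_near_coveringP _) cK.
have : \forall r \near (0 : R)^'+, (`[- T, T] `*` `[- T, T] : set (R * R)) `<=` Q r.
  apply: cov => p _.
  have e20 : 0 < e / 2 by rewrite divr_gt0.
  have cp : phi q @[q --> p] --> phi p := @cphi p.
  move: cp => /cvgrPdist_le/(_ _ e20); rewrite nearE => /nbhs_ballP[r /= r0 hr].
  have r20 : 0 < r / 2 by rewrite divr_gt0.
  exists (ball p (r / 2), [set z : R | z < r / 2]) => /=.
    split; first exact: nbhsx_ballx.
    by apply: nbhs_right_lt.
  move=> [q z] /= [bq zr] x' y' h1 h2.
  have bp1 : ball p r q by apply: le_ball bq; lra.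
  have bp2 : ball p r (x', y').
    move: bq => [/= b1 b2]; split=> /=.
      rewrite -ball_normE/=; move: b1; rewrite -ball_normE/= => b1.
      rewrite (_ : p.1 - x' = (p.1 - q.1) + (q.1 - x')); last by ring.
      by rewrite (le_lt_trans (ler_normD _ _))//; move: h1 b1; lra.
    rewrite -ball_normE/=; move: b2; rewrite -ball_normE/= => b2.
    rewrite (_ : p.2 - y' = (p.2 - q.2) + (q.2 - y')); last by ring.
    by rewrite (le_lt_trans (ler_normD _ _))//; move: h2 b2; lra.
  have := hr _ bp1; have := hr _ bp2 => /= k1 k2.
  rewrite (_ : _ - _ = (phi p - phi (x', y')) - (phi p - phi q)); last by ring.
  by rewrite (le_trans (ler_normB _ _))//; lra.
move=> hnear.
near ((0 : R)^'+) => r.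
have h : (`[- T, T] `*` `[- T, T] : set (R * R)) `<=` Q r by near: r; exact: hnear.
have r0 : 0 < r by near: r; exact: nbhs_right_gt.
have r1 : r < 1 by near: r; exact: nbhs_right_lt.
exists r; split; first by rewrite r0 ltW.
move=> x y x' y' hx hy h1 h2; apply: (h (x, y)) => //.
by split; rewrite /= in_itv/= -ler_norml.
Unshelve. all: by end_near.
Qed.

(** A partition of unity in each coordinate, with bumps narrower than the modulus of continuity.
    Where the bumps do not sum to 1, the error is charged to the missing mass times the bound on
    [phi]. *)
Lemma bump_approximation (T e : R) : 0 < T -> 0 < e ->
  exists (A : R) (n : nat) (b : 'I_n -> R) (c : 'I_n -> 'I_n -> R), [/\ 1 <= A,
    forall x, 0 <= \sum_k sbump A (b k) x <= 1,
    forall x, `|x| <= T -> \sum_k sbump A (b k) x = 1 &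
    forall x y, `|phi (x, y) - \sum_k \sum_j c k j * (sbump A (b k) x * sbump A (b j) y)| <=
      e + M * (1 - (\sum_k sbump A (b k) x) * (\sum_k sbump A (b k) y))].
Proof.
move=> T0 e0; have [de [/andP[de0 de1] hde]] := uniform_continuity_box (T + 3) e0.
(* The 2 makes [T / de < n - 1], so that the rising step is already 1 at [- T]; the centres [u k] of
   the bumps stay within the enlarged box. *)
pose n := (Num.truncn (T / de)).+2.
have /andP[n1 n2] : n%:R - 2 <= T / de < n%:R - 1.
  have h0 : 0 <= T / de by rewrite divr_ge0// ltW.
  have /andP[h1 h2] := truncn_itv h0.
  rewrite /n -[(Num.truncn (T / de)).+2%:R]natr1 -[(Num.truncn (T / de)).+1%:R]natr1.
  by move: h2; rewrite -natr1 => h2; apply/andP; split; lra.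
pose A := de^-1; have A1 : 1 <= A by rewrite invf_ge1.
have A0 : 0 < A by rewrite invr_gt0.
pose b (k : 'I_(n + n)) : R := n%:R - k%:R.
pose u (k : 'I_(n + n)) : R := de * (k%:R - n%:R + 1).
exists A, (n + n)%N, b, (fun k j => phi (u k, u j)).
have sumE x : \sum_k sbump A (b k) x = sstep (A * x + n%:R) - sstep (A * x - n%:R).
  by rewrite sum_sbump natrD; congr (_ - sstep _); ring.
have Th0 x : 0 <= \sum_k sbump A (b k) x by apply: sumr_ge0 => k _; exact: sbump_ge0.
have Th1 x : \sum_k sbump A (b k) x <= 1.
  rewrite sumE; have /andP[_ h1] := sstep01 (A * x + n%:R).
  by have /andP[h0 _] := sstep01 (A * x - n%:R); lra.
have supp x k : sbump A (b k) x != 0 -> `|x - u k| <= de /\ `|x| <= T + 3.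
  move=> /sbump_support/andP[h1 h2].
  have e1 : de * (A * x + b k) = x - u k + de by rewrite /b /u /A; field; rewrite gt_eqF.
  have h1' : 0 < x - u k + de by rewrite -e1 mulr_gt0.
  have h2' : x - u k + de < 2 * de by rewrite -e1 mulrC ltr_pM2r.
  split; first by rewrite ler_norml; apply/andP; split; lra.
  have hk : (k : nat)%:R + 1 <= n%:R + n%:R :> R by rewrite natr1 -natrD ler_nat.
  have k0 : 0 <= k%:R :> R by [].
  have n1' : n%:R * de <= T + 2 * de.
    have e2 : T / de * de = T by rewrite divfK// gt_eqF.
    by have := ler_wpM2r (ltW de0) n1; rewrite mulrBl e2; lra.
  have uk : u k = de * k%:R - n%:R * de + de by rewrite /u; ring.
  have dk0 : 0 <= de * k%:R by rewrite mulr_ge0// ltW.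
  have dk1 : de * k%:R + de <= n%:R * de + n%:R * de.
    by rewrite -{2}[de]mulr1 -mulrDr -mulrDl mulrC ler_wpM2r// ltW.
  rewrite ler_norml; apply/andP; split; lra.
split=> //.
- by move=> x; rewrite Th0 Th1.
- move=> x; rewrite ler_norml => /andP[x1 x2]; rewrite sumE.
  have h : T / de = A * T by rewrite mulrC.
  rewrite h in n2; have h1 : A * - T <= A * x by rewrite ler_pM2l.
  have h2 : A * x <= A * T by rewrite ler_pM2l.
  by rewrite sstep_ge1 ?sstep_le0 ?subr0//; move: h1; rewrite mulrN; lra.
- move=> x y; set tx := \sum_k sbump A (b k) x; set ty := \sum_k sbump A (b k) y.
  have txy : tx * ty = \sum_k \sum_j sbump A (b k) x * sbump A (b j) y.
    by rewrite /tx mulr_suml; apply: eq_bigr => k _; rewrite mulr_sumr.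
  rewrite (_ : _ - _ = phi (x, y) * (1 - tx * ty) + \sum_k \sum_j (phi (x, y) - phi (u k, u j)) * (sbump A (b k) x * sbump A (b j) y)); last first.
    have -> : \sum_k \sum_j (phi (x, y) - phi (u k, u j)) * (sbump A (b k) x * sbump A (b j) y) =
        phi (x, y) * (tx * ty) - \sum_k \sum_j phi (u k, u j) * (sbump A (b k) x * sbump A (b j) y).
      rewrite txy mulr_sumr -sumrB; apply: eq_bigr => k _; rewrite mulr_sumr -sumrB.
      by apply: eq_bigr => j _; rewrite mulrBl.
    by ring.
  have tt1 : tx * ty <= 1 by exact: mulr_ile1 (Th0 x) (Th0 y) (Th1 x) (Th1 y).
  rewrite (le_trans (ler_normD _ _))// [leRHS]addrC lerD//.
    have q0 : 0 <= 1 - tx * ty by rewrite subr_ge0.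
    by rewrite normrM (ger0_norm q0) ler_wpM2r.
  rewrite -[leRHS]mulr1; apply: (@le_trans _ _ (e * (tx * ty))); last by rewrite ler_wpM2l// ltW.
  rewrite txy mulr_sumr (le_trans (ler_norm_sum _ _ _))//; apply: ler_sum => k _.
  rewrite mulr_sumr (le_trans (ler_norm_sum _ _ _))//; apply: ler_sum => j _.
  have b0 : 0 <= sbump A (b k) x * sbump A (b j) y by rewrite mulr_ge0// sbump_ge0.
  rewrite normrM (ger0_norm b0).
  have [->|bk] := eqVneq (sbump A (b k) x) 0; first by rewrite mul0r !mulr0.
  have [->|bj] := eqVneq (sbump A (b j) y) 0; first by rewrite !mulr0.
  have [h1 h2] := supp _ _ bk; have [h3 h4] := supp _ _ bj.
  by rewrite ler_wpM2r// hde.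
Qed.

End bump_approximation.

(** A pointwise limit of bump sums on growing boxes, each a finite sum of products of measurable
    functions of one coordinate. *)
Lemma measurable_bounded_continuous2 (R : realType) (phi : R * R -> R) (M : R) :
  continuous phi -> (forall p, `|phi p| <= M) -> measurable_fun setT phi.
Proof.
move=> cphi bphi.
have h (n : nat) : exists psi : R * R -> R, measurable_fun setT psi /\
    forall x y, `|x| <= n.+1%:R -> `|y| <= n.+1%:R -> `|phi (x, y) - psi (x, y)| <= n.+1%:R^-1.
  have n0 : 0 < n.+1%:R :> R by rewrite ltr0n.
  have n0' : 0 < n.+1%:R^-1 :> R by rewrite invr_gt0.
  have [a [m [b [c [a1 th01 thT happ]]]]] := bump_approximation cphi bphi n0 n0'.
  exists (fun p => \sum_k \sum_j c k j * (sbump a (b k) p.1 * sbump a (b j) p.2)); split.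
    have a0 : `|a| <= a by rewrite ger0_norm// (le_trans _ a1).
    have mb k : measurable_fun setT (sbump a (b k)).
      apply: continuous_measurable_fun; exact: lipschitz_continuous (C11_lip (C11_sbump (b k) a1 a0)).
    apply: measurable_sum => k; apply: measurable_sum => j; apply: measurable_funM => //.
    apply: measurable_funM.
      exact: (measurableT_comp (mb k) measurable_fst).
    exact: (measurableT_comp (mb j) measurable_snd).
  by move=> x y hx hy; have := happ x y; rewrite !thT// mulr1 subrr mulr0 addr0.
have [psi hpsi] := choice h.
apply: (@measurable_fun_cvg _ _ _ setT psi phi) => [m|[x y] _]; first exact: (hpsi m).1.
apply/cvgrPdist_le => e e0; near=> n; apply: le_trans ((hpsi n).2 x y _ _) _.
- by apply: (@le_trans _ _ n%:R); [near: n; exact: nbhs_infty_ger|rewrite ler_nat].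
- by apply: (@le_trans _ _ n%:R); [near: n; exact: nbhs_infty_ger|rewrite ler_nat].
- by apply: ltW; near: n; exact: near_infty_natSinv_lt (PosNum e0).
Unshelve. all: by end_near.
Qed.

(** * Weak convergence from convergence on smooth product tests *)

Section portmanteau.
Context (R : realType) d (Omega : measurableType d) (P : probability Omega R).
Context d1 (Omega1 : measurableType d1) (P1 : probability Omega1 R).
Variables (A B : R -> Omega -> R) (Y1 Y2 : Omega1 -> R).
Hypothesis mAB : \forall l \near +oo, measurable_fun setT (A l) /\ measurable_fun setT (B l).
Hypotheses (hY1 : L2 P1 Y1) (hY2 : L2 P1 Y2).
Hypothesis hAB : forall (M : R) (f f' g g' : R -> R), C11 M f f' -> C11 M g g' ->
  EX P (fun t => f (A l t) * g (B l t)) @[l --> +oo] --> EX P1 (fun t => f (Y1 t) * g (Y2 t)).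

Let mC11 (M : R) (f f' : R -> R) : C11 M f f' -> measurable_fun setT f.
Proof. by move=> hf; apply: continuous_measurable_fun; exact: lipschitz_continuous (C11_lip hf). Qed.

Let L1_C11 dd (T : measurableType dd) (Q : probability T R) (X Y : T -> R) (M : R) (f f' g g' : R -> R) :
  C11 M f f' -> C11 M g g' -> measurable_fun setT X -> measurable_fun setT Y ->
  L1 Q (fun t => f (X t) * g (Y t)).
Proof.
move=> hf hg mX mY; apply: (L1_bounded _ _ (M := M * M)).
  by apply: measurable_funM; [exact: (measurableT_comp (mC11 hf))|exact: (measurableT_comp (mC11 hg))].
by move=> t; rewrite normrM ler_pM//; [exact: C11_bound hf _|exact: C11_bound hg _].
Qed.

(** Tightness need not be assumed: the mass missed by the bumps is itself a sum of product tests,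
    hence converges to the mass missed by the limit, which Chebyshev's inequality makes small. *)
Lemma portmanteau (phi : R * R -> R) (M : R) : continuous phi -> (forall p, `|phi p| <= M) ->
  EX P (fun t => phi (A l t, B l t)) @[l --> +oo] --> EX P1 (fun t => phi (Y1 t, Y2 t)).
Proof.
move=> cphi bphi; have M0 : 0 <= M by exact: le_trans (bphi (0, 0)).
(* Two errors for the limit, one for the convergence of the sums, three for the prelimit, whose
   missing mass is controlled through that of the limit. *)
apply/cvgrPdist_le => e e0; pose ep := e / 6; have ep0 : 0 < ep by rewrite divr_gt0.
pose V := EX P1 (fun t => Y1 t ^+ 2) + EX P1 (fun t => Y2 t ^+ 2).
have V0 : 0 <= V by rewrite addr_ge0// EX_ge0// => t; exact: sqr_ge0.
pose T := 1 + M * V / ep.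
have T1 : 1 <= T by rewrite /T lerDl divr_ge0 ?mulr_ge0// ltW.
have T0 : 0 < T by exact: lt_le_trans T1.
have [a [n [b [c [a1 th01 thT happ]]]]] := bump_approximation cphi bphi T0 ep0.
pose Th x : R := \sum_k sbump a (b k) x.
pose psi x y : R := \sum_k \sum_j c k j * (sbump a (b k) x * sbump a (b j) y).
have a0 : `|a| <= a by rewrite ger0_norm// (le_trans _ a1).
have hb k := C11_sbump (b k) a1 a0.
have mb k : measurable_fun setT (sbump a (b k)) := mC11 (hb k).
have mTh : measurable_fun setT Th by exact: measurable_sum.
have mphi : measurable_fun setT phi by exact: measurable_bounded_continuous2 bphi.
have bTh x : `|Th x| <= 1 by have /andP[h0 h1] := th01 x; rewrite /Th ger0_norm.
pose S := `|ep| + M * 2.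
have common dd (O : measurableType dd) (Q : probability O R) (X Y : O -> R) :
    measurable_fun setT X -> measurable_fun setT Y ->
    [/\ L1 Q (fun t => Th (X t) * Th (Y t)),
      EX Q (fun t => psi (X t) (Y t)) = \sum_k \sum_j c k j * EX Q (fun t => sbump a (b k) (X t) * sbump a (b j) (Y t)) ,
      EX Q (fun t => Th (X t) * Th (Y t)) = \sum_k \sum_j EX Q (fun t => sbump a (b k) (X t) * sbump a (b j) (Y t)) &
      `|EX Q (fun t => phi (X t, Y t)) - EX Q (fun t => psi (X t) (Y t))| <=
        ep + M * (1 - EX Q (fun t => Th (X t) * Th (Y t)))].
  move=> mX mY.
  have lb k j : L1 Q (fun t => sbump a (b k) (X t) * sbump a (b j) (Y t)) := L1_C11 Q (hb k) (hb j) mX mY.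
  have lth : L1 Q (fun t => Th (X t) * Th (Y t)).
    apply: (L1_bounded _ _ (M := 1)).
      by apply: measurable_funM; exact: (measurableT_comp mTh).
    by move=> t; rewrite normrM mulr_ile1.
  have lpsi : L1 Q (fun t => psi (X t) (Y t)).
    by apply: L1_sum => k _; apply: L1_sum => j _; exact: L1_Z.
  have lphi : L1 Q (fun t => phi (X t, Y t)).
    apply: (L1_bounded _ _ (M := M)) => //.
    apply: (measurableT_comp mphi (g := fun t => (X t, Y t))).
    by apply/measurable_fun_pairP; split.
  split=> //.
  - rewrite EX_sum => [|k _]; last by apply: L1_sum => j _; exact: L1_Z.
    by apply: eq_bigr => k _; rewrite EX_sum => [|j _]; [apply: eq_bigr => j _; rewrite EX_Z|exact: L1_Z].
  - rewrite (eq_EX Q (g := fun t => \sum_k \sum_j sbump a (b k) (X t) * sbump a (b j) (Y t))) => [|t]; last first.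
      by rewrite /Th mulr_suml; apply: eq_bigr => k _; rewrite mulr_sumr.
    rewrite EX_sum => [|k _]; last exact: L1_sum.
    by apply: eq_bigr => k _; rewrite EX_sum.
  - have lr := L1_B (L1_cst Q 1) lth.
    rewrite -(EX_B lphi lpsi) -[X in _ + M * (X - _)](EX_cst Q) -(EX_B (L1_cst Q 1) lth) -(EX_Z M lr).
    rewrite -{1}[ep](EX_cst Q) -(EX_D (L1_cst Q ep) (L1_Z M lr)).
    apply: EX_abs_le; [exact: L1_B|by apply: L1_D; [exact: L1_cst|exact: L1_Z]|].
    by move=> t; exact: happ.
have [lth1 psi1 th1 app1] := common _ _ P1 Y1 Y2 (L2_meas hY1) (L2_meas hY2).
(* [T] was chosen so that [M V / T <= ep]; as [T >= 1], [y^2 >= T] as soon as [|y| > T]. *)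
have tail : M * (1 - EX P1 (fun t => Th (Y1 t) * Th (Y2 t))) <= ep.
  have s1 := L2_sq hY1; have s2 := L2_sq hY2; have s := L1_D s1 s2.
  have : 1 - EX P1 (fun t => Th (Y1 t) * Th (Y2 t)) <= V / T.
    rewrite -{1}(EX_cst P1 1) -(EX_B (L1_cst P1 1) lth1) /V -(EX_D s1 s2) mulrC -(EX_Z _ s).
    apply: EX_le; [by apply: L1_B => //; exact: L1_cst|exact: L1_Z|].
    move=> t; have /andP[u0 u1] := th01 (Y1 t); have /andP[v0 v1] := th01 (Y2 t).
    have big y : T < `|y| -> 1 <= T^-1 * y ^+ 2.
      move=> h; rewrite mulrC ler_pdivlMr// mul1r -real_normK ?num_real// expr2.
      by apply: (le_trans (ltW h)); rewrite ler_peMl// (le_trans T1)// ltW.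
    have sq y : 0 <= T^-1 * y ^+ 2 by rewrite mulr_ge0 ?sqr_ge0// invr_ge0 ltW.
    have p0 : 0 <= Th (Y1 t) * Th (Y2 t) by exact: mulr_ge0.
    rewrite mulrDr; have [h1|h1] := leP `|Y1 t| T; last by have := big _ h1; have := sq (Y2 t); lra.
    have [h2|h2] := leP `|Y2 t| T; last by have := big _ h2; have := sq (Y1 t); lra.
    by rewrite /Th !thT// mulr1 subrr addr_ge0.
  move=> h; apply: (le_trans (ler_wpM2l M0 h)); rewrite mulrA ler_pdivrMr//.
  have -> : ep * T = ep + M * V by rewrite /T; field; rewrite gt_eqF.
  by rewrite lerDr ltW.
have csum m (u : 'I_m -> R -> R) (v : 'I_m -> R) : (forall k, u k l @[l --> +oo] --> v k) ->
    \sum_k u k l @[l --> +oo] --> \sum_k v k.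
  elim: m u v => [|m IH] u v huv.
    by rewrite big_ord0; under eq_fun do rewrite big_ord0; exact: cvg_cst.
  by rewrite big_ord_recr/=; under eq_fun do rewrite big_ord_recr/=; apply: cvgD; [exact: IH|exact: huv].
have c1 : (fun l => \sum_k \sum_j c k j * EX P (fun t => sbump a (b k) (A l t) * sbump a (b j) (B l t))) @ +oo
    --> \sum_k \sum_j c k j * EX P1 (fun t => sbump a (b k) (Y1 t) * sbump a (b j) (Y2 t)).
  apply: (csum n) => k; apply: (csum n) => j; apply: cvgM; first exact: cvg_cst.
  exact: hAB (hb k) (hb j).
have c2 : (fun l => M * (\sum_k \sum_j EX P (fun t => sbump a (b k) (A l t) * sbump a (b j) (B l t)))) @ +oo
    --> M * (\sum_k \sum_j EX P1 (fun t => sbump a (b k) (Y1 t) * sbump a (b j) (Y2 t))).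
  apply: cvgM; first exact: cvg_cst.
  by apply: (csum n) => k; apply: (csum n) => j; exact: hAB (hb k) (hb j).
near=> l.
have [mA mB] : measurable_fun setT (A l) /\ measurable_fun setT (B l) by near: l.
have [lth2 psi2 th2 app2] := common _ _ P _ _ mA mB.
have d1' : `|EX P1 (fun t => psi (Y1 t) (Y2 t)) - EX P (fun t => psi (A l t) (B l t))| <= ep.
  by rewrite psi1 psi2; near: l; move/cvgrPdist_le: c1; exact.
have d2' : `|M * EX P1 (fun t => Th (Y1 t) * Th (Y2 t)) - M * EX P (fun t => Th (A l t) * Th (B l t))| <= ep.
  by rewrite th1 th2; near: l; move/cvgrPdist_le: c2; exact.
move: app1 app2 d1' d2' tail.
move: (EX P1 (fun t => phi _)) (EX P (fun t => phi _)) (EX P1 (fun t => psi _ _)) (EX P (fun t => psi _ _)).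
move: (EX P1 (fun t => Th _ * _)) (EX P (fun t => Th _ * _)) => t1 t2 e1 e2 s1 s2.
rewrite !ler_norml => /andP[? ?] /andP[? ?] /andP[? ?] /andP[? ?] ?.
have : e = 6 * ep by rewrite /ep mulrC divfK.
by move=> ->; apply/andP; split; lra.
Unshelve. all: by end_near.
Qed.

End portmanteau.

(** * Lattice obstruction *)

Section gaussian_positivity.
Context (R : realType).

Lemma gaussian_itv_gt0 (a b : R) : a < b -> 0 < fine (gaussian R `[a, b]%classic).
Proof.
move=> ab; pose r := `|a| + `|b|; pose c : R := normal_peak 1 * expR (- (r ^+ 2 / 2)).
have c0 : 0 < c by rewrite mulr_gt0 ?expR_gt0// normal_peak_gt0.
have low x : x \in `[a, b]%classic -> c <= normal_pdf 0 1 x.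
  rewrite inE/= in_itv/= => /andP[ax xb].
  rewrite normal_pdfE ?oner_neq0// /= /normal_fun subr0 expr1n ler_wpM2l ?normal_peak_ge0//.
  rewrite ler_expR mulNr lerN2 ler_wpM2r ?invr_ge0//.
  rewrite -real_normK ?num_real//; apply: lerXn2r; rewrite ?nnegrE ?addr_ge0//.
  have h1 := ler_norm b; have h2 := ler_norm (- a); rewrite normrN in h2.
  rewrite ler_norml /r; apply/andP; split; have := normr_ge0 a; have := normr_ge0 b; lra.
have : ((c * (b - a))%:E <= gaussian R `[a, b]%classic)%E.
  rewrite /gaussian/= /normal_prob.
  apply: (@le_trans _ _ (\int[lebesgue_measure]_(x in `[a, b]%classic) cst c%:E x)%E).
    rewrite integral_cst//= lebesgue_measure_itv/= lte_fin ab -EFinD -EFinM.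
    by rewrite le_eqVlt eqxx.
  apply: ge0_le_integral => //.
  - by move=> x _; rewrite lee_fin ltW.
  - by apply/measurable_EFinP; exact: measurable_funTS (measurable_normal_pdf _ _).
  - by move=> x abx; rewrite lee_fin /= low// inE.
have fin : gaussian R `[a, b]%classic \is a fin_num by rewrite fin_num_measure.
rewrite -{1}(fineK fin) lee_fin; apply: lt_le_trans.
by rewrite mulr_gt0// subr_gt0.
Qed.

Lemma EX_gaussian_sbump_gt0 (a b : R) : 0 < a -> 0 < EX (gaussian R) (sbump a b).
Proof.
move=> a0; pose A := Num.max 1 a.
have A1 : 1 <= A by rewrite le_max lexx.
have aA : `|a| <= A by rewrite gtr0_norm// le_max lexx orbT.
have hb := C11_sbump b A1 aA; have lb := C11_lipschitz_gaussian hb.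
pose u := (2^-1 - b) / a; pose v := (1 - b) / a.
have uv : u < v by rewrite ltr_pM2r ?invr_gt0// ltrD2r; lra.
have ind : L1 (gaussian R) (\1_(`[u, v]%classic)).
  apply: (L1_bounded _ _ (M := 1)); first exact: measurable_indic.
  by move=> w; rewrite indicE; case: (_ \in _); rewrite ?normr1 ?normr0.
apply: (@lt_le_trans _ _ (EX (gaussian R) (fun x => 2^-1 * \1_(`[u, v]%classic) x))).
  rewrite EX_Z// mulr_gt0//.
  have -> : EX (gaussian R) (\1_(`[u, v]%classic)) = fine (gaussian R `[u, v]%classic).
    by rewrite /EX integral_indic// setIT.
  exact: gaussian_itv_gt0.
apply: EX_le => //; first exact: L1_Z.
move=> x; rewrite indicE; case: (boolP (_ \in _)) => [|_]; last by rewrite mulr0 sbump_ge0.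
rewrite inE/= in_itv/= mulr1 => /andP[h1 h2].
have z1 : 2^-1 <= a * x + b by move: h1; rewrite /u ler_pdivrMr// mulrC; lra.
have z2 : a * x + b <= 1 by move: h2; rewrite /v ler_pdivlMr// mulrC; lra.
rewrite /sbump (@sstep_le0 _ (a * x + (b - 1))) ?subr0; last lra.
rewrite /sstep /pospart max_r; last lra.
rewrite max_r; last lra.
rewrite max_l; last lra.
by move: (a * x + b) z1 z2 => z z1 z2; nra.
Qed.

End gaussian_positivity.

Section independent_pair.
Context (R : realType) d (T : measurableType d) (P : probability T R).
Variables (N1 N2 : {RV P >-> R}).
Hypotheses (h1 : std_normal N1) (h2 : std_normal N2).
Hypothesis hind : mutually_independent P (fun b : bool => if b then N1 : T -> R else N2).

Let m1 : measurable_fun setT (N1 : T -> measurableTypeR R) := measurable_funPT N1.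
Let m2 : measurable_fun setT (N2 : T -> measurableTypeR R) := measurable_funPT N2.
Let m12 : measurable_fun setT (fun t => (N1 t, N2 t) : measurableTypeR R * measurableTypeR R).
Proof. by apply/measurable_fun_pairP; split. Qed.

Let nu : {measure set (measurableTypeR R * measurableTypeR R) -> \bar R} :=
  measure_function_pushforward__canonical__measure_function_Measure P m12.

Let nuE X : measurable X -> (gaussian R \x gaussian R)%E X = nu X.
Proof.
apply: product_measure_unique => A B mA mB.
have hC (b : bool) : measurable ((if b then A else B) : set R) by case: b.
have := hind hC; rewrite big_bool/= -(h1 mA) -(h2 mB) => e.
transitivity (P [set w | forall i : bool, (if i then A else B) ((if i then N1 : T -> R else N2) w)]); last exact: e.
rewrite /nu/= /pushforward; congr (P _); apply/seteqP; split=> [t [a b] [] //|t h].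
by split; [exact: (h true)|exact: (h false)].
Qed.

Let EX_ge0_indep (M : R) (f g : R -> R) : measurable_fun setT f -> measurable_fun setT g ->
  (forall x, 0 <= f x <= M) -> (forall x, 0 <= g x <= M) ->
  EX P (fun t => f (N1 t) * g (N2 t)) = EX (gaussian R) f * EX (gaussian R) g.
Proof.
move=> mf mg f0 g0.
have hn : bmeas2 (M * M) (fun x y : measurableTypeR R => f x * g y).
  split; last first.
    move=> x y; have /andP[? ?] := f0 x; have /andP[? ?] := g0 y.
    by rewrite mulr_ge0// ler_pM.
  apply: measurable_funM.
    exact: (measurableT_comp (mf : measurable_fun setT (f : measurableTypeR R -> R)) measurable_fst).
  exact: (measurableT_comp (mg : measurable_fun setT (g : measurableTypeR R -> R)) measurable_snd).
have p0 x y : 0 <= f x * g y by have /andP[] := hn.2 x y.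
have mE : measurable_fun setT (fun p : measurableTypeR R * measurableTypeR R => (f p.1 * g p.2)%:E).
  by apply/measurable_EFinP; exact: hn.1.
have e1 : (\int[P]_t (f (N1 t) * g (N2 t))%:E = \int[nu]_p (f p.1 * g p.2)%:E)%E.
  have := @ge0_integral_pushforward _ _ _ _ R _ m12 P setT (fun p => (f p.1 * g p.2)%:E) measurableT mE.
  by rewrite preimage_setT => -> //= p _; rewrite lee_fin.
have e2 : (\int[nu]_p (f p.1 * g p.2)%:E = \int[gaussian R \x gaussian R]_p (f p.1 * g p.2)%:E)%E.
  by apply: eq_measure_integral => X mX _; first [exact: nuE mX|exact: (esym (nuE mX))].
have e3 : (\int[gaussian R \x gaussian R]_p (f p.1 * g p.2)%:E = \int[gaussian R]_x \int[gaussian R]_y (f x * g y)%:E)%E.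
  rewrite (@fubini_tonelli1 _ _ _ _ _ (gaussian R) (gaussian R) (fun p => (f p.1 * g p.2)%:E))//.
  by move=> p; rewrite lee_fin.
have lf : L1 (gaussian R) f.
  by apply: (L1_bounded _ _ (M := M)); [exact: mf|move=> x; have /andP[? ?] := f0 x; rewrite ger0_norm].
have lg : L1 (gaussian R) g.
  by apply: (L1_bounded _ _ (M := M)); [exact: mg|move=> x; have /andP[? ?] := g0 x; rewrite ger0_norm].
rewrite {1}/EX e1 e2 e3 (eq_integral (fun x : measurableTypeR R => (EX (gaussian R) g * f x)%:E)) => [|x _]; last first.
  by rewrite (L1_E (L1_Z (f x) lg)) EX_Z// mulrC.
have := EX_Z (EX (gaussian R) g) lf; rewrite {1}/EX => ->; exact: mulrC.
Qed.

(** Adding [M] to both functions makes them non-negative, where Tonelli's theorem for the product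
    law applies; expanding the product removes the shift. *)
Lemma EX_indep (M : R) (f g : R -> R) : measurable_fun setT f -> measurable_fun setT g ->
  (forall x, `|f x| <= M) -> (forall x, `|g x| <= M) ->
  EX P (fun t => f (N1 t) * g (N2 t)) = EX (gaussian R) f * EX (gaussian R) g.
Proof.
move=> mf mg fM gM.
have lf : L1 (gaussian R) f by apply: (L1_bounded _ _ (M := M)); [exact: mf|exact: fM].
have lg : L1 (gaussian R) g by apply: (L1_bounded _ _ (M := M)); [exact: mg|exact: gM].
have [lf1 ef] := std_normal_EX h1 mf lf; have [lg1 eg] := std_normal_EX h2 mg lg.
have mfM : measurable_fun setT (fun x => f x + M) by exact: measurable_funD.
have mgM : measurable_fun setT (fun x => g x + M) by exact: measurable_funD.
have b (u : R -> R) : (forall x, `|u x| <= M) -> forall x, 0 <= u x + M <= M + M.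
  by move=> h x; have := h x; rewrite ler_norml => /andP[? ?]; apply/andP; split; lra.
have := EX_ge0_indep mfM mgM (b _ fM) (b _ gM).
rewrite (EX_D lf (L1_cst _ M)) (EX_D lg (L1_cst _ M)) EX_cst.
have lfg : L1 P (fun t => f (N1 t) * g (N2 t)).
  apply: (L1_bounded _ _ (M := M * M)).
    by apply: measurable_funM; [exact: (L1_meas lf1)|exact: (L1_meas lg1)].
  by move=> t; rewrite normrM ler_pM.
rewrite (eq_EX P (g := fun t => (f (N1 t) * g (N2 t) + M * f (N1 t)) + (M * g (N2 t) + M * M))); last by move=> t; ring.
rewrite (EX_D (L1_D lfg (L1_Z M lf1)) (L1_D (L1_Z M lg1) (L1_cst P _))).
rewrite (EX_D lfg (L1_Z M lf1)) (EX_D (L1_Z M lg1) (L1_cst P _)) EX_cst !EX_Z// ef eg; lra.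
Qed.

End independent_pair.

Section lattice.
Context (R : realType) (d : nat) d' (Omega : measurableType d').
Variables (Hbar : R -> set (Rvec R d)) (eta : R -> Omega -> {measure set (Rvec R d) -> \bar R}) (l : R).

Lemma Fsum_integer w : exists k : nat, Fsum Hbar eta l w = k%:R.
Proof.
rewrite /Fsum; set s := finite_support _ _ _.
elim: (X in \big[_/_]_(_ <- X) _) => [|p r [k IH]]; first by exists 0%N; rewrite big_nil.
rewrite big_cons IH indicE; exists ((vsub p.1 p.2 \in Hbar l) + k)%N.
by rewrite natrD.
Qed.

Variables (P : probability Omega R) (de : R).
Hypothesis de0 : 0 < de.
Let sg := Num.sqrt (Var P (Fsum Hbar eta l)).
Hypothesis sg0 : 0 < sg.
Hypothesis sgde : de <= sg^-1.

Lemma normalized_Fsum_gap w w' :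
  0 < normalized P (Fsum Hbar eta l) w' - normalized P (Fsum Hbar eta l) w < de -> False.
Proof.
have [k hk] := Fsum_integer w; have [k' hk'] := Fsum_integer w'.
rewrite /normalized hk hk' -/sg -mulrBl (_ : _ - _ = k'%:R - k%:R); last by ring.
move=> /andP[h1 h2]; have := lt_le_trans h2 sgde.
rewrite -[ltRHS]mul1r ltr_pM2r ?invr_gt0// => h3.
have h4 : 0 < k'%:R - k%:R :> R by move: h1; rewrite pmulr_lgt0// invr_gt0.
have {}h4 : (k < k')%N by rewrite -(ltr_nat R) -subr_gt0.
have {}h3 : (k' < k.+1)%N by rewrite -(ltr_nat R) -natr1; lra.
by move: h3; rewrite ltnS leqNgt h4.
Qed.

(** The bumps are supported in [(0, de / 4)] and [(de / 2, 3 de / 4)]. Values in both would differ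
    by a positive amount below the mesh, so one of the bumps vanishes identically along the
    variable. *)
Lemma lattice_bumps :
  EX P (fun w => sbump (8 / de) 0 (normalized P (Fsum Hbar eta l) w)) *
  EX P (fun w => sbump (8 / de) (- 4) (normalized P (Fsum Hbar eta l) w)) = 0.
Proof.
set X := normalized P _.
have [h|h] := pselect (forall w, sbump (8 / de) 0 (X w) = 0).
  by rewrite (eq_EX P (g := fun=> 0)) ?EX_cst ?mul0r.
have [h'|h'] := pselect (forall w, sbump (8 / de) (- 4) (X w) = 0).
  by rewrite [X in _ * X](eq_EX P (g := fun=> 0)) ?EX_cst ?mulr0.
move/existsNP: h => [w /eqP hw]; move/existsNP: h' => [w' /eqP hw'].
have /andP[a1 a2] := sbump_support hw; have /andP[b1 b2] := sbump_support hw'.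
exfalso; apply: (@normalized_Fsum_gap w w'); rewrite -/X.
have e0 x : 8 / de * x = 8 * (x / de) by ring.
rewrite e0 in a1 a2; rewrite e0 in b1 b2.
have : 0 < X w' / de - X w / de < 1 by apply/andP; split; lra.
rewrite -mulrBl => /andP[c1 c2]; rewrite pmulr_lgt0 ?invr_gt0// in c1; rewrite c1/=.
by move: c2; rewrite ltr_pdivrMr// mul1r.
Qed.

End lattice.

(** * Asymptotic regimes *)

Lemma asympI (R : realType) (f g : R -> R) (u1 u2 v1 v2 : R) :
  0 < u1 -> 0 < u2 -> 0 < v1 -> 0 < v2 ->
  (\forall l \near +oo, u1 * f l <= u2 * g l /\ v1 * g l <= v2 * f l) -> asymp f g.
Proof.
move=> hu1 hu2 hv1 hv2 h; exists (u1 / u2), (v2 / v1); split; [exact: divr_gt0|exact: divr_gt0|].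
near=> l; have [h1 h2] : u1 * f l <= u2 * g l /\ v1 * g l <= v2 * f l by near: l.
split; first by rewrite mulrAC ler_pdivrMr// [g l * _]mulrC.
by rewrite mulrAC ler_pdivlMr// mulrC.
Unshelve. all: by end_near.
Qed.

Lemma cvg_EFin_near (R : realType) (u : R -> \bar R) (v : R -> R) (c : R) :
  (\forall l \near +oo, u l = (v l)%:E) -> v l @[l --> +oo] --> c ->
  u l @[l --> +oo] --> c%:E.
Proof.
move=> huv hv; apply/fine_cvgP; split.
  by near=> l; rewrite (near huv l).
apply: cvg_trans hv; apply: near_eq_cvg; near=> l.
by rewrite /= (near huv l).
Unshelve. all: by end_near.
Qed.

Lemma near_powR_small (R : realType) (K e : R) : 0 < e ->
  \forall l \near +oo, K * l `^ (- 2^-1) <= e.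
Proof.
move=> e0; near=> l; have l0 : 0 < l by near: l; exact: nbhs_pinfty_gt.
have s0 : 0 < Num.sqrt l by rewrite sqrtr_gt0.
rewrite powRN powR12_sqrt ?(ltW l0)// ler_pdivrMr// mulrC -ler_pdivrMr//.
apply: (le_trans (ler_norm _)); rewrite -sqrtr_sqr; apply: ler_wsqrtr.
by near: l; apply: nbhs_pinfty_ge; rewrite num_real.
Unshelve. all: by end_near.
Qed.

Lemma std_normal_L2 (R : realType) d (T : measurableType d) (P : probability T R) (N : {RV P >-> R}) :
  std_normal N -> L2 P N.
Proof.
move=> hN; have [l _] := std_normal_EX hN (g := fun x => x ^+ 2) (measurable_funX 2 (@measurable_id _ _ setT)) (L2_sq (@L2_gaussian_id R)).
by split=> //; exact: measurable_funPT.
Qed.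

(** * Dense, balanced and sparse regimes *)

Section asymptotic_regimes.
Context (R : realType) (d : nat) (d_gt0 : (1 <= d)%N)
    (dO : measure_display) (Omega : measurableType dO)
    (P : probability Omega R)
    (Hbar : R -> set (Rvec R d)).
Hypothesis mH : forall l : R, 0 < l -> measurable (Hbar l).
Hypothesis Hsym : forall l : R, 0 < l -> Hbar l = [set vopp x | x in Hbar l].
Hypothesis H0n : forall l : R, 0 < l -> ~ Hbar l (vzero R d).
Variable eta : R -> Omega -> {measure set (Rvec R d) -> \bar R}.
Hypothesis hp : forall l : R, 0 < l -> is_poisson_measure P (intensity d l) (eta l).
Variables F1 F2 : R -> {RV P >-> R}.
Hypothesis F1_def : forall l : R, 0 < l ->
  is_multiple_integral (intensity d l) P (eta l) (f1 Hbar l) (F1 l).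
Hypothesis F2_def : forall l : R, 0 < l ->
  is_multiple_integral (intensity d l) P (eta l) (f2 Hbar l) (F2 l).
Variables (a b : R).
Hypotheses (a0 : 0 < a) (b0 : 0 < b).
Hypothesis hdb : \forall l \near +oo, degree_bounds Hbar a b l.
Local Notation psi := (psi Hbar).
Local Notation F := (Fsum Hbar eta).
Local Notation gw := (gw Hbar).
Local Notation ra := (Num.sqrt a).
Let Ftilde (l : R) := normalized P (F l).

Let gwb l (h : degree_bounds Hbar a b l) :
  [/\ 0 < l * psi l, 0 < l, a * (l * (l * psi l)) <= gw l 1 <= b * (l * (l * psi l)) &
   a * (l * (l * psi l) ^+ 2) <= gw l 2 <= b * (l * (l * psi l) ^+ 2)].
Proof.
split; [exact: mulr_gt0 (db_l h) (db_psi h)|exact: db_l h| |exact: (gw_bounds h (r := 2))].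
exact: (gw_bounds h (r := 1)).
Qed.

Let V1 l (l0 : 0 < l) : Var P (F1 l) = 4 * gw l 2.
Proof. exact: (Var_F1 l0 (hp l0) (mH l0) (Hsym l0) (H0n l0) (F1_def l0) (F2_def l0)). Qed.
Let V2 l (l0 : 0 < l) : Var P (F2 l) = 2 * gw l 1.
Proof. exact: (Var_F2 l0 (hp l0) (mH l0) (Hsym l0) (H0n l0) (F1_def l0) (F2_def l0)). Qed.
Let VF l (l0 : 0 < l) : Var P (F l) = 4 * gw l 2 + 2 * gw l 1.
Proof. exact: (Var_Fsum l0 (hp l0) (mH l0) (Hsym l0) d_gt0 (H0n l0) (F1_def l0) (F2_def l0)). Qed.

Section wasserstein.
Variables (dN : measure_display) (OmegaN : measurableType dN)
  (PN : probability OmegaN R) (N : {RV PN >-> R}).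
Hypothesis hN : std_normal N.
Variable C : R.
Hypotheses (C0 : 0 < C) (hC : univariate_rate C).

Lemma wasserstein_dense c : 0 < c <= 1 -> (\forall l \near +oo, c <= l * psi l) ->
  \forall l \near +oo, (wasserstein P PN (Ftilde l) N <= (C * (3 * b / (c ^+ 2 * ra ^+ 3)) * l `^ (- 2^-1))%:E)%E.
Proof.
move=> c01 hc; near=> l; have hb : degree_bounds Hbar a b l by near: l.
have l0 := db_l hb; have g1 := gw_gt0 a0 hb (isT : (1 <= 4)%N).
apply: (le_trans (wasserstein_Fsum l0 (hp l0) (mH l0) (Hsym l0) d_gt0 (H0n l0) (F1_def l0) (F2_def l0) g1 hC hN)).
rewrite lee_fin -[leLHS]mulrA -[leRHS]mulrA; apply: ler_wpM2l; first exact: ltW.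
have cx : c <= l * psi l by near: l.
exact: (rate_dense a0 b0 hb c01 cx).
Unshelve. all: by end_near.
Qed.

Lemma wasserstein_sparse : (\forall l \near +oo, l * psi l <= 1) ->
  \forall l \near +oo, (wasserstein P PN (Ftilde l) N <= (C * (3 * b / ra ^+ 3) / (l * Num.sqrt (psi l)))%:E)%E.
Proof.
move=> hc; near=> l; have hb : degree_bounds Hbar a b l by near: l.
have l0 := db_l hb; have g1 := gw_gt0 a0 hb (isT : (1 <= 4)%N).
apply: (le_trans (wasserstein_Fsum l0 (hp l0) (mH l0) (Hsym l0) d_gt0 (H0n l0) (F1_def l0) (F2_def l0) g1 hC hN)).
rewrite lee_fin -[leLHS]mulrA -[leRHS]mulrA; apply: ler_wpM2l; first exact: ltW.
have cx : l * psi l <= 1 by near: l.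
exact: (rate_sparse a0 b0 hb cx).
Unshelve. all: by end_near.
Qed.

End wasserstein.

Section dense.
Hypothesis hx : l * psi l @[l --> +oo] --> +oo.

Let xge (A : R) : \forall l \near +oo, A <= l * psi l.
Proof. by move/cvgryPge : hx; apply. Qed.

Lemma dense_equivalent : equivalent (fun l : R => Var P (F1 l)) (fun l : R => Var P (F l)).
Proof.
split.
  near=> l; have hb : degree_bounds Hbar a b l by near: l.
  rewrite (VF (db_l hb)).
  by have := gw_gt0 a0 hb (isT : (1 <= 4)%N); have := gw_gt0 a0 hb (isT : (2 <= 4)%N); lra.
apply/cvgrPdist_le => e e0; near=> l; have hb : degree_bounds Hbar a b l by near: l.
have [x0 l0 /andP[p1 p2] /andP[q1 q2]] := gwb hb.
(* The defect of the ratio is at most [p / (2 q)], that is, at most [b / (2 a x)]. *)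
have xe : b / (2 * a * e) <= l * psi l by near: l; exact: xge.
have g1 := gw_gt0 a0 hb (isT : (1 <= 4)%N); have g2 := gw_gt0 a0 hb (isT : (2 <= 4)%N).
rewrite (VF l0) (V1 l0).
move: (l * psi l) (gw l 1) (gw l 2) x0 p1 p2 q1 q2 xe g1 g2 => x p q x0 p1 p2 q1 q2 xe g1 g2.
have pq : 0 < 4 * q + 2 * p by lra.
rewrite (_ : 1 - _ = 2 * p / (4 * q + 2 * p)); last by field; rewrite gt_eqF.
rewrite ger0_norm; last by rewrite divr_ge0//; lra.
rewrite ler_pdivrMr//.
rewrite ler_pdivrMr ?mulr_gt0// in xe.
have h1 := ler_wpM2l (ltW l0) (ler_wpM2l (ltW x0) xe).
have h2 : 2 * p <= e * (4 * q).
  have h3 := ler_wpM2l (ltW e0) q1.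
  by move: h1 h3 p2; lra.
by have := mulr_ge0 (ltW e0) (ltW g1); lra.
Unshelve. all: by end_near.
Qed.

Lemma dense_variance : asymp (fun l : R => Var P (F l)) (fun l : R => l ^+ 3 * psi l ^+ 2).
Proof.
apply: (@asympI _ _ _ 1 (6 * b) (4 * a) 1); rewrite ?mulr_gt0//.
near=> l; have hb : degree_bounds Hbar a b l by near: l.
have [x0 l0 /andP[p1 p2] /andP[q1 q2]] := gwb hb.
have x1 : 1 <= l * psi l by near: l; exact: xge.
have g1 := gw_gt0 a0 hb (isT : (1 <= 4)%N).
rewrite (VF l0) (_ : l ^+ 3 * psi l ^+ 2 = l * (l * psi l) ^+ 2); last by ring.
move: (l * psi l) (gw l 1) (gw l 2) x0 p1 p2 q1 q2 x1 g1 => x p q x0 p1 p2 q1 q2 x1 g1.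
have xx : x <= x ^+ 2 by rewrite expr2 ler_peMl// ltW.
have := ler_wpM2l (ltW b0) (ler_wpM2l (ltW l0) xx).
by split; lra.
Unshelve. all: by end_near.
Qed.

Lemma dense_variance_pinfty : l ^+ 3 * psi l ^+ 2 @[l --> +oo] --> +oo.
Proof.
apply/cvgryPge => A; near=> l; have hb : degree_bounds Hbar a b l by near: l.
have l0 := db_l hb; have x1 : 1 <= l * psi l by near: l; exact: xge.
rewrite (_ : l ^+ 3 * psi l ^+ 2 = l * (l * psi l) ^+ 2); last by ring.
apply: (@le_trans _ _ l); first by near: l; apply: nbhs_pinfty_ge; rewrite num_real.
by rewrite ler_peMr ?(ltW l0)// exprn_ege1.
Unshelve. all: by end_near.
Qed.

End dense.

Section balanced.
Variables c D : R.
Hypotheses (c01 : 0 < c <= 1) (D1 : 1 <= D).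
Hypothesis hx : \forall l \near +oo, c <= l * psi l <= D.
Let c0 : 0 < c. Proof. by have /andP[] := c01. Qed.
Let D0 : 0 < D. Proof. exact: lt_le_trans D1. Qed.

Lemma balanced_variance : [/\ asymp (fun l : R => Var P (F l)) (fun l : R => Var P (F1 l)),
  asymp (fun l : R => Var P (F1 l)) (fun l : R => Var P (F2 l)) &
  asymp (fun l : R => Var P (F2 l)) (fun l : R => l)].
Proof.
have ac : 0 < a * c by exact: mulr_gt0.
have bD : 0 < b * D by exact: mulr_gt0.
have key : \forall l \near +oo, [/\ 0 < l, 0 < gw l 1, 0 < gw l 2 &
    [/\ a * c * gw l 1 <= b * gw l 2, a * gw l 2 <= b * D * gw l 1, gw l 1 <= b * D * l & a * c * l <= gw l 1]].
  near=> l; have hb : degree_bounds Hbar a b l by near: l.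
  have [x0 l0 /andP[p1 p2] /andP[q1 q2]] := gwb hb.
  have /andP[xc xD] : c <= l * psi l <= D by near: l.
  have g1 := gw_gt0 a0 hb (isT : (1 <= 4)%N); have g2 := gw_gt0 a0 hb (isT : (2 <= 4)%N).
  split=> //; move: (l * psi l) (gw l 1) (gw l 2) x0 p1 p2 q1 q2 xc xD g1 g2 => x p q x0 p1 p2 q1 q2 xc xD g1 g2.
  have lx := mulr_ge0 (ltW l0) (ltW x0).
  split.
  + have h1 := ler_wpM2l (ltW b0) q1; have h2 := ler_wpM2l (ltW ac) p2.
    by have h3 := ler_wpM2l (mulr_ge0 (mulr_ge0 (ltW b0) (ltW a0)) lx) xc; lra.
  + have h1 := ler_wpM2l (ltW a0) q2; have h2 := ler_wpM2l (ltW bD) p1.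
    by have h3 := ler_wpM2l (mulr_ge0 (mulr_ge0 (ltW b0) (ltW a0)) lx) xD; lra.
  + by have h3 := ler_wpM2l (mulr_ge0 (ltW b0) (ltW l0)) xD; lra.
  + by have h3 := ler_wpM2l (mulr_ge0 (ltW a0) (ltW l0)) xc; lra.
split.
- apply: (@asympI _ _ _ (a * c) (a * c + b) 1 1); rewrite ?addr_gt0//.
  near=> l; have [l0 g1 g2 [k1 k2 k3 k4]] : [/\ 0 < l, 0 < gw l 1, 0 < gw l 2 &
    [/\ a * c * gw l 1 <= b * gw l 2, a * gw l 2 <= b * D * gw l 1, gw l 1 <= b * D * l & a * c * l <= gw l 1]] by near: l.
  by rewrite (VF l0) (V1 l0); have := mulr_gt0 b0 g2; split; lra.
- apply: (@asympI _ _ _ a (2 * (b * D)) (a * c) b); rewrite ?mulr_gt0//.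
  near=> l; have [l0 g1 g2 [k1 k2 k3 k4]] : [/\ 0 < l, 0 < gw l 1, 0 < gw l 2 &
    [/\ a * c * gw l 1 <= b * gw l 2, a * gw l 2 <= b * D * gw l 1, gw l 1 <= b * D * l & a * c * l <= gw l 1]] by near: l.
  by rewrite (V1 l0) (V2 l0); have := mulr_gt0 b0 g2; split; lra.
- apply: (@asympI _ _ _ 1 (2 * (b * D)) (2 * (a * c)) 1); rewrite ?mulr_gt0//.
  near=> l; have [l0 g1 g2 [k1 k2 k3 k4]] : [/\ 0 < l, 0 < gw l 1, 0 < gw l 2 &
    [/\ a * c * gw l 1 <= b * gw l 2, a * gw l 2 <= b * D * gw l 1, gw l 1 <= b * D * l & a * c * l <= gw l 1]] by near: l.
  by rewrite (V2 l0); split; lra.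
Unshelve. all: by end_near.
Qed.

Lemma balanced_pair (dM : measure_display) (M : measurableType dM)
    (PM : probability M R) (N1 N2 : {RV PM >-> R}) :
  std_normal N1 -> std_normal N2 ->
  mutually_independent PM (fun b : bool => if b then N1 : M -> R else N2) ->
  cvg_in_distribution P PM
    (fun (l : R) w => (F1 l w / Num.sqrt (Var P (F1 l)), F2 l w / Num.sqrt (Var P (F2 l))))
    (fun w => (N1 w, N2 w)).
Proof.
move=> hN1 hN2 hind g cg [B gB].
pose X l t := F1 l t / Num.sqrt (Var P (F1 l)); pose Y l t := F2 l t / Num.sqrt (Var P (F2 l)).
have mg := measurable_bounded_continuous2 cg gB.
have mX l : measurable_fun setT (X l) by apply: measurable_funM => //; exact: measurable_funPT.
have mY l : measurable_fun setT (Y l) by apply: measurable_funM => //; exact: measurable_funPT.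
have lg dd (T : measurableType dd) (Q : probability T R) (U V : T -> R) :
    measurable_fun setT U -> measurable_fun setT V -> L1 Q (fun t => g (U t, V t)).
  move=> mU mV; apply: (L1_bounded _ _ (M := B)) => //.
  apply: (measurableT_comp mg (g := fun t => (U t, V t))).
  by apply/measurable_fun_pairP; split.
rewrite [X in _ --> X](_ : _ = (EX PM (fun t => g (N1 t, N2 t)))%:E); last first.
  by rewrite expectationE; apply: L1_E; apply: lg; exact: measurable_funPT.
apply: (@cvg_EFin_near _ _ (fun l => EX P (fun t => g (X l t, Y l t)))).
  by near=> l; rewrite expectationE; apply: (L1_E (lg _ _ P (X l) (Y l) _ _)).
apply: (portmanteau _ (std_normal_L2 hN1) (std_normal_L2 hN2) _ cg gB).
  by near=> l; split.
move=> A f f' h h' hf hh.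
have [C C0 hC] := bivariate_normal_approximation A.
have mf := continuous_measurable_fun (lipschitz_continuous (C11_lip hf)).
have mh := continuous_measurable_fun (lipschitz_continuous (C11_lip hh)).
rewrite (EX_indep hN1 hN2 hind mf mh (C11_bound hf) (C11_bound hh)).
apply/cvgrPdist_le => e e0; near=> l; have hb : degree_bounds Hbar a b l by near: l.
have l0 := db_l hb; have g1 := gw_gt0 a0 hb (isT : (1 <= 4)%N); have g2 := gw_gt0 a0 hb (isT : (2 <= 4)%N).
have /andP[xc xD] : c <= l * psi l <= D by near: l.
rewrite distrC.
apply: (le_trans (pair_Fsum l0 (hp l0) (mH l0) (Hsym l0) d_gt0 (H0n l0) (F1_def l0) (F2_def l0) g1 hC g2 hf hh)).
rewrite -mulrA.
apply: (le_trans (ler_wpM2l (ltW C0) (rate_balanced a0 b0 hb c01 xc D1 xD))).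
by rewrite mulrA; near: l; exact: near_powR_small.
Unshelve. all: by end_near.
Qed.

End balanced.

Section sparse.
Hypothesis hx : l * psi l @[l --> +oo] --> (0 : R).

Let xle (e : R) : 0 < e -> \forall l \near +oo, l * psi l <= e.
Proof.
move=> e0; move/cvgrPdist_le : hx => /(_ _ e0); apply: filterS => l.
by rewrite sub0r normrN; apply: le_trans; exact: ler_norm.
Qed.

Let varb : \forall l \near +oo, 2 * a * (l ^+ 2 * psi l) <= Var P (F l) <= 6 * b * (l ^+ 2 * psi l).
Proof.
near=> l; have hb : degree_bounds Hbar a b l by near: l.
have [x0 l0 /andP[p1 p2] /andP[q1 q2]] := gwb hb.
have x1 : l * psi l <= 1 by near: l; exact: xle.
have g2 := gw_gt0 a0 hb (isT : (2 <= 4)%N).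
rewrite (VF l0) (_ : l ^+ 2 * psi l = l * (l * psi l)); last by ring.
move: (l * psi l) (gw l 1) (gw l 2) x0 p1 p2 q1 q2 x1 g2 => x p q x0 p1 p2 q1 q2 x1 g2.
have xx : x ^+ 2 <= x by rewrite expr2 ler_piMr// ltW.
have h := ler_wpM2l (ltW b0) (ler_wpM2l (ltW l0) xx).
by apply/andP; split; lra.
Unshelve. all: by end_near.
Qed.

Lemma sparse_equivalent : equivalent (fun l : R => Var P (F l)) (fun l : R => Var P (F2 l)).
Proof.
split.
  near=> l; have hb : degree_bounds Hbar a b l by near: l.
  by rewrite (V2 (db_l hb)) mulr_gt0//; exact: (gw_gt0 a0 hb (isT : (1 <= 4)%N)).
apply/cvgrPdist_le => e e0; near=> l; have hb : degree_bounds Hbar a b l by near: l.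
have [x0 l0 /andP[p1 p2] /andP[q1 q2]] := gwb hb.
(* The defect of the ratio is [2 q / p], which is at most [2 b x / a]. *)
have xe : l * psi l <= e * a / (2 * b).
  by near: l; apply: xle; rewrite divr_gt0 ?mulr_gt0.
have g1 := gw_gt0 a0 hb (isT : (1 <= 4)%N); have g2 := gw_gt0 a0 hb (isT : (2 <= 4)%N).
rewrite (VF l0) (V2 l0).
move: (l * psi l) (gw l 1) (gw l 2) x0 p1 p2 q1 q2 xe g1 g2 => x p q x0 p1 p2 q1 q2 xe g1 g2.
rewrite (_ : 1 - _ = - (2 * q / p)); last by field; rewrite gt_eqF.
rewrite normrN ger0_norm; last by rewrite divr_ge0//; lra.
rewrite ler_pdivrMr//; rewrite ler_pdivlMr ?mulr_gt0// in xe.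
have h1 := ler_wpM2l (mulr_ge0 (ltW l0) (ltW x0)) xe.
have h3 := ler_wpM2l (ltW e0) p1.
by move: h1 h3 q2; lra.
Unshelve. all: by end_near.
Qed.

Lemma sparse_variance : asymp (fun l : R => Var P (F2 l)) (fun l : R => l ^+ 2 * psi l).
Proof.
apply: (@asympI _ _ _ 1 (2 * b) (2 * a) 1); rewrite ?mulr_gt0//.
near=> l; have hb : degree_bounds Hbar a b l by near: l.
have [x0 l0 /andP[p1 p2] _] := gwb hb.
rewrite (V2 l0) (_ : l ^+ 2 * psi l = l * (l * psi l)); last by ring.
by split; lra.
Unshelve. all: by end_near.
Qed.

Lemma sparse_pinfty : (l ^+ 2 * psi l @[l --> +oo] --> +oo) <-> (Var P (F l) @[l --> +oo] --> +oo).
Proof.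
split=> /cvgryPge h; apply/cvgryPge => A; near=> l;
  have /andP[v1 v2] : 2 * a * (l ^+ 2 * psi l) <= Var P (F l) <= 6 * b * (l ^+ 2 * psi l) by near: l.
  have : A / (2 * a) <= l ^+ 2 * psi l by near: l; exact: h.
  by rewrite ler_pdivrMr ?mulr_gt0//; lra.
have : 6 * b * A <= Var P (F l) by near: l; exact: h.
by move=> h'; have := le_trans h' v2; rewrite ler_pM2l// mulr_gt0.
Unshelve. all: by end_near.
Qed.

Variables (dN : measure_display) (OmegaN : measurableType dN)
  (PN : probability OmegaN R) (N : {RV PN >-> R}).
Hypothesis hN : std_normal N.

Let sg l : R := Num.sqrt (4 * gw l 2 + 2 * gw l 1).
Let V l t : R := (sg l)^-1 * F1 l t + (sg l)^-1 * F2 l t.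
Let mV l : measurable_fun setT (V l).
Proof. by apply: measurable_funD; apply: measurable_funM => //; exact: measurable_funPT. Qed.

Let E_V (g : R -> R) : continuous g -> (exists M, forall x, `|g x| <= M) ->
  \forall l \near +oo, ('E_P[g \o Ftilde l] = (EX P (fun t => g (V l t)))%:E)%E.
Proof.
move=> cg [M gM]; near=> l; have hb : degree_bounds Hbar a b l by near: l.
have l0 := db_l hb; have mg := continuous_measurable_fun cg.
rewrite (EX_normalized l0 (hp l0) (mH l0) (Hsym l0) d_gt0 (H0n l0) (F1_def l0) (F2_def l0) mg).
apply: L1_E; apply: (L1_bounded _ _ (M := M)) => //.
exact: (measurableT_comp mg (mV l)).
Unshelve. all: by end_near.
Qed.

Let E_N (g : R -> R) : continuous g -> (exists M, forall x, `|g x| <= M) ->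
  ('E_PN[g \o N] = (EX (gaussian R) g)%:E)%E /\ EX PN (fun t => g (N t)) = EX (gaussian R) g.
Proof.
move=> cg [M gM]; have mg := continuous_measurable_fun cg.
have lg : L1 (gaussian R) g by apply: (L1_bounded _ _ (M := M)); [exact: mg|exact: gM].
have [lN eN] := std_normal_EX hN mg lg.
by split=> //; rewrite expectationE -eN; exact: L1_E.
Qed.

(** The Wasserstein-type bound controls Lipschitz tests only; bounded continuous tests are reached
    through [portmanteau], with the second coordinate frozen at 0. *)
Lemma sparse_clt : l ^+ 2 * psi l @[l --> +oo] --> +oo -> cvg_in_distribution P PN Ftilde N.
Proof.
move=> /cvgryPge hinf g cg bg; have [M gM] := bg.
have [-> eN] := E_N cg bg; rewrite -eN.
apply: (cvg_EFin_near (E_V cg bg)).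
pose phi (p : R * R) := g p.1.
have cphi : continuous phi.
  by move=> p; apply: (@continuous_comp _ _ _ (fun p : R * R => p.1) g); [exact: cvg_fst|exact: cg].
have [C C0 hC] := normal_approximation R.
apply: (@portmanteau _ _ _ P _ _ PN V (fun _ _ => 0) N (fun _ => 0) _ (std_normal_L2 hN) (L2_cst PN 0) _ phi M cphi).
- by near=> l; split.
- move=> A f f' h h' hf hh; pose Q := `|A| + 1; have Q0 : 0 < Q by rewrite /Q ltr_wpDl.
  have AQ : A <= Q by rewrite /Q (le_trans (ler_norm A))// lerDl.
  have fL x y : `|Q^-1 * f x - Q^-1 * f y| <= `|x - y|.
    rewrite -mulrBr normrM gtr0_norm ?invr_gt0// ler_pdivrMl//.
    by apply: (le_trans (C11_lip hf _ _)); rewrite ler_wpM2r.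
  have cf : continuous f := lipschitz_continuous (C11_lip hf).
  have bf : exists M, forall x, `|f x| <= M by exists A; exact: C11_bound hf.
  have [_ eNf] := E_N cf bf.
  have mf := continuous_measurable_fun cf.
  have lf : L1 (gaussian R) f := C11_lipschitz_gaussian hf.
  have lfV l : L1 P (fun t => f (V l t)).
    by apply: (L1_bounded _ _ (M := A)); [exact: (measurableT_comp mf (mV l))|move=> t; exact: C11_bound hf _].
  have e1 l : EX P (fun t => f (V l t) * h 0) = EX P (fun t => f (V l t)) * h 0.
    by rewrite mulrC -EX_Z//; apply: eq_EX => t; rewrite mulrC.
  have e2 : EX PN (fun t => f (N t) * h 0) = EX PN (fun t => f (N t)) * h 0.
    have [lN _] := std_normal_EX hN mf lf.
    by rewrite mulrC -EX_Z//; apply: eq_EX => t; rewrite mulrC.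
  rewrite e2 eNf; under eq_fun do rewrite e1.
  apply: cvgM; last exact: cvg_cst.
  apply/cvgrPdist_le => e e0; near=> l; have hb : degree_bounds Hbar a b l by near: l.
  have l0 := db_l hb; have p0 := db_psi hb; have g1 := gw_gt0 a0 hb (isT : (1 <= 4)%N); have g2 := gw_gt0 a0 hb (isT : (2 <= 4)%N).
  have x1 : l * psi l <= 1 by near: l; exact: xle.
  have := stein_bound l0 (hp l0) (mH l0) (Hsym l0) d_gt0 (H0n l0) (F1_def l0) (F2_def l0) g1 hC fL.
  have -> : EX P (fun t => Q^-1 * f (V l t)) = Q^-1 * EX P (fun t => f (V l t)) by exact: EX_Z.
  have -> : EX (gaussian R) (fun x => Q^-1 * f x) = Q^-1 * EX (gaussian R) f by exact: EX_Z.
  rewrite -/(sg l) -mulrBr normrM gtr0_norm ?invr_gt0// ler_pdivrMl// distrC => /le_trans; apply.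
  (* The rate is a constant over the square root of [l^2 psi], so this is where divergence of that
     quantity enters. *)
  have r := rate_sparse a0 b0 hb x1; rewrite -/(sg l) in r.
  rewrite -mulrA; apply: (@le_trans _ _ (Q * (C * (3 * b / ra ^+ 3 / (l * Num.sqrt (psi l)))))).
    by rewrite ler_wpM2l ?(ltW Q0)// ler_wpM2l// ltW.
  pose K := Q * (C * (3 * b / ra ^+ 3)).
  have lt0 : 0 < l * Num.sqrt (psi l) by rewrite mulr_gt0// sqrtr_gt0.
  rewrite [leLHS](_ : _ = K / (l * Num.sqrt (psi l))); last by rewrite /K !mulrA.
  rewrite ler_pdivrMr// mulrC -ler_pdivrMr//.
  have -> : l * Num.sqrt (psi l) = Num.sqrt (l ^+ 2 * psi l).
    by rewrite sqrtrM ?sqr_ge0// sqrtr_sqr gtr0_norm.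
  apply: (le_trans (ler_norm _)); rewrite -sqrtr_sqr; apply: ler_wsqrtr.
  by near: l; exact: hinf.
- by move=> p; exact: gM.
Unshelve. all: by end_near.
Qed.

(* The edge count is an integer, so that the normalized count lives in a lattice
   of mesh [(Var F)^(-1/2)], which must vanish if the limit is to charge two
   disjoint short intervals. *)
Lemma sparse_clt_inv : cvg_in_distribution P PN Ftilde N -> l ^+ 2 * psi l @[l --> +oo] --> +oo.
Proof.
(* Wherever [l^2 psi] is below [A], the variance is at most [B] and the mesh of the lattice at least
   [de]; both bumps can therefore be fixed independently of [l]. *)
move=> hcv; apply/cvgryPge => A; pose B := 6 * b * (`|A| + 1).
have B0 : 0 < B by rewrite /B !mulr_gt0// ltr_wpDl.
pose de := (Num.sqrt B)^-1; have de0 : 0 < de by rewrite invr_gt0 sqrtr_gt0.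
have a80 : 0 < 8 / de by rewrite divr_gt0.
pose Q := Num.max 1 (8 / de).
have Q1 : 1 <= Q by rewrite le_max lexx.
have aQ : `|8 / de| <= Q by rewrite gtr0_norm// le_max lexx orbT.
have lim q : EX P (fun w => sbump (8 / de) q (Ftilde l w)) @[l --> +oo] --> EX (gaussian R) (sbump (8 / de) q).
  have hb := C11_sbump q Q1 aQ.
  have cb : continuous (sbump (8 / de) q) := lipschitz_continuous (C11_lip hb).
  have bb : exists M, forall x, `|sbump (8 / de) q x| <= M by eexists; exact: C11_bound hb.
  have := hcv _ cb bb; rewrite (E_N cb bb).1 => /fine_cvg.
  by apply: cvg_trans; apply: near_eq_cvg; near=> l; rewrite /= expectationE.
(* The product of the two means tends to a positive Gaussian quantity, while [lattice_bumps] forces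
   it to be 0 wherever [l^2 psi < A]. *)
have lim2 := cvgM (lim 0) (lim (- 4)).
have pos : 0 < EX (gaussian R) (sbump (8 / de) 0) * EX (gaussian R) (sbump (8 / de) (- 4)).
  by rewrite mulr_gt0// EX_gaussian_sbump_gt0.
have hpos := cvgr_gt _ (lim2 _) _ pos.
near=> l; have hb : degree_bounds Hbar a b l by near: l.
have l0 := db_l hb; have g1 := gw_gt0 a0 hb (isT : (1 <= 4)%N); have g2 := gw_gt0 a0 hb (isT : (2 <= 4)%N).
have /andP[v1 v2] : 2 * a * (l ^+ 2 * psi l) <= Var P (F l) <= 6 * b * (l ^+ 2 * psi l) by near: l.
rewrite leNgt; apply/negP => lA.
have Vpos : 0 < Var P (F l) by rewrite (VF l0); lra.
have VB : Var P (F l) <= B.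
  apply: (le_trans v2); rewrite /B ler_wpM2l ?mulr_ge0 ?(ltW b0)//.
  by apply: (le_trans (ltW lA)); rewrite (le_trans (ler_norm A))// lerDl.
have sg0 : 0 < Num.sqrt (Var P (F l)) by rewrite sqrtr_gt0.
have sgde : de <= (Num.sqrt (Var P (F l)))^-1.
  by rewrite /de lef_pV2 ?posrE ?sqrtr_gt0// ler_wsqrtr.
have := lattice_bumps de0 sg0 sgde => e.
have : 0 < EX P (fun w => sbump (8 / de) 0 (Ftilde l w)) * EX P (fun w => sbump (8 / de) (- 4) (Ftilde l w)).
  by near: l; exact: hpos.
by rewrite e ltxx.
Unshelve. all: by end_near.
Qed.

End sparse.

End asymptotic_regimes.

Lemma asymp_one (R : realType) (f : R -> R) : asymp f (fun=> 1) ->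
  exists c D : R, [/\ 0 < c <= 1, 1 <= D & \forall l \near +oo, c <= f l <= D].
Proof.
move=> [C [C' [C0 C'0 h]]]; exists (Num.min 1 C'^-1), (Num.max 1 C^-1); split.
- by rewrite lt_min ltr01 invr_gt0 C'0 ge_min lexx.
- by rewrite le_max lexx.
- near=> l; have [h1 h2] : C * f l <= 1 /\ 1 <= C' * f l by near: l.
  rewrite ge_min le_max; apply/andP; split; apply/orP; right.
    by rewrite -div1r ler_pdivrMr// mulrC.
  by rewrite -div1r ler_pdivlMr// mulrC.
Unshelve. all: by end_near.
Qed.

Theorem theorem4p11 (R : realType) (d : nat) (d1_ge : (1 <= d)%N)
    (dO : measure_display) (Omega : measurableType dO)
    (P : probability Omega R)
    (Hbar : R -> set (Rvec R d))
    (Hbar_measurable : forall l : R, 0 < l -> measurable (Hbar l))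
    (Hbar_sym : forall l : R, 0 < l -> Hbar l = [set vopp x | x in Hbar l])
    (Hbar_0 : forall l : R, 0 < l -> ~ Hbar l (vzero R d))
    (Hbar_pos : forall l : R, 0 < l -> (0 < leb R d (Hbar l `&` cube 1))%E)
    (eta : R -> Omega -> {measure set (Rvec R d) -> \bar R})
    (eta_poisson : forall l : R, 0 < l ->
      is_poisson_measure P (intensity d l) (eta l))
    (F1 F2 : R -> {RV P >-> R})
    (F1_def : forall l : R, 0 < l ->
      is_multiple_integral (intensity d l) P (eta l) (f1 Hbar l) (F1 l))
    (F2_def : forall l : R, 0 < l ->
      is_multiple_integral (intensity d l) P (eta l) (f2 Hbar l) (F2 l))
    (psi_asymp : asymp (psi_check Hbar) (psi_hat Hbar))
    (dN : measure_display) (OmegaN : measurableType dN)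
    (PN : probability OmegaN R) (N : {RV PN >-> R}) (N_normal : std_normal N) :
  let psi := psi Hbar in
  let F := Fsum Hbar eta in
  let Ftilde (l : R) := normalized P (F l) in
  asymp (fun l : R => V1sq Hbar l / V2sq Hbar l) (fun l : R => l * psi l) /\
  asymp (fun l : R => (V1sq Hbar l)^-1 * Aq Hbar l) (fun l : R => l `^ (- 2^-1)) /\
  exists k K : R, 0 < k /\ k < K /\
    (\forall l \near +oo,
       k * Num.max (l `^ (- 2^-1))
             (Num.max ((l ^+ 2 * psi l) `^ (- 2^-1)) (l `^ 2^-1 * psi l))
         <= (V2sq Hbar l)^-1 *
            Num.max (Bq Hbar l)
              (Num.max (Cq Hbar l) (Num.max (Dq Hbar l) (Eq Hbar l)))
       /\
       (V2sq Hbar l)^-1 *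
         Num.max (Bq Hbar l)
           (Num.max (Cq Hbar l) (Num.max (Dq Hbar l) (Eq Hbar l)))
         <= K * Num.max (Num.sqrt (psi l))
                  (Num.max (l `^ (- 2^-1))
                    (Num.max ((l ^+ 2 * psi l) `^ (- 2^-1))
                       (l `^ 2^-1 * psi l)))) /\
    (l * psi l @[l --> +oo] --> +oo ->
       equivalent (fun l : R => Var P (F1 l)) (fun l : R => Var P (F l)) /\
       asymp (fun l : R => Var P (F l)) (fun l : R => l ^+ 3 * psi l ^+ 2) /\
       (l ^+ 3 * psi l ^+ 2 @[l --> +oo] --> +oo) /\
       \forall l \near +oo,
         (wasserstein P PN (Ftilde l) N <= (K * l `^ (- 2^-1))%:E)%E) /\
    (asymp (fun l : R => l * psi l) (fun=> 1) ->
       asymp (fun l : R => Var P (F l)) (fun l : R => Var P (F1 l)) /\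
       asymp (fun l : R => Var P (F1 l)) (fun l : R => Var P (F2 l)) /\
       asymp (fun l : R => Var P (F2 l)) (fun l : R => l) /\
       (\forall l \near +oo,
         (wasserstein P PN (Ftilde l) N <= (K * l `^ (- 2^-1))%:E)%E) /\
       forall (dM : measure_display) (M : measurableType dM)
           (PM : probability M R) (N1 N2 : {RV PM >-> R}),
         std_normal N1 -> std_normal N2 ->
         mutually_independent PM (fun b : bool => if b then N1 : M -> R else N2) ->
         cvg_in_distribution P PM
           (fun (l : R) w => (F1 l w / Num.sqrt (Var P (F1 l)),
                        F2 l w / Num.sqrt (Var P (F2 l))))
           (fun w => (N1 w, N2 w))) /\
    (l * psi l @[l --> +oo] --> (0 : R) ->
       equivalent (fun l : R => Var P (F l)) (fun l : R => Var P (F2 l)) /\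
       asymp (fun l : R => Var P (F2 l)) (fun l : R => l ^+ 2 * psi l) /\
       (\forall l \near +oo,
         (wasserstein P PN (Ftilde l) N <= (K / (l * Num.sqrt (psi l)))%:E)%E) /\
       (cvg_in_distribution P PN Ftilde N <->
          (l ^+ 2 * psi l @[l --> +oo] --> +oo)) /\
       ((l ^+ 2 * psi l @[l --> +oo] --> +oo) <->
          (Var P (F l) @[l --> +oo] --> +oo))).
Proof.
move=> psi F Ftilde.
have [a [b [a0 b0 hdb]]] := degree_bounds_near d1_ge Hbar_measurable Hbar_sym Hbar_pos psi_asymp.
have [C C0 hC] := normal_approximation R.
have sa0 : 0 < Num.sqrt a by rewrite sqrtr_gt0.
have sb0 : 0 < Num.sqrt b by rewrite sqrtr_gt0.
split.
  exists (a / (2 * b)), (b / (2 * a)); split; rewrite ?divr_gt0 ?mulr_gt0//.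
  near=> l; have hb : degree_bounds Hbar a b l by near: l.
  have /andP[h1 h2] := V_ratio_bounds Hbar_measurable a0 b0 hb.
  by split; [rewrite [leLHS]mulrC|rewrite [leRHS]mulrC].
split.
  exists (4 * a / Num.sqrt b), (4 * b / Num.sqrt a); split; rewrite ?divr_gt0 ?mulr_gt0//.
  near=> l; have hb : degree_bounds Hbar a b l by near: l.
  have /andP[h1 h2] := A_ratio_bounds Hbar_measurable a0 b0 hb.
  by split; [rewrite [leLHS]mulrC|rewrite [leRHS]mulrC].
(* In the balanced regime the constant depends on the lower bound for [l * psi l], which exists only
   under that hypothesis. As [K] must be chosen before the regimes are distinguished, this is
   decided by excluded middle. *)
have [K2 K20 hK2] : exists2 K2 : R, 0 <= K2 & asymp (fun l : R => l * psi l) (fun=> 1) ->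
    \forall l \near +oo, (wasserstein P PN (Ftilde l) N <= (K2 * l `^ (- 2^-1))%:E)%E.
  have [h|h] := pselect (asymp (fun l : R => l * psi l) (fun=> 1)); last by exists 0.
  have [c [D [c01 _ cD]]] := asymp_one h.
  have c0 : 0 < c by case/andP: c01.
  exists (C * (3 * b / (c ^+ 2 * Num.sqrt a ^+ 3))).
    by rewrite mulr_ge0 ?(ltW C0)// divr_ge0 ?mulr_ge0 ?exprn_ge0 ?(ltW b0) ?(ltW c0) ?(ltW sa0).
  move=> _; apply: (wasserstein_dense d1_ge Hbar_measurable Hbar_sym Hbar_0 eta_poisson
    F1_def F2_def a0 b0 hdb N_normal C0 hC c01).
  by apply: filterS cD => l /andP[].
pose k := Num.sqrt a / (2 * b); pose K1 := C * (3 * b / Num.sqrt a ^+ 3).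
pose K3 := Num.sqrt b / (2 * a).
have k0 : 0 < k by rewrite divr_gt0 ?mulr_gt0.
have K10 : 0 < K1 by rewrite mulr_gt0 ?divr_gt0 ?mulr_gt0 ?exprn_gt0.
have K30 : 0 < K3 by rewrite divr_gt0 ?mulr_gt0.
(* [K1] serves the dense and sparse regimes, [K2] the balanced one, [K3] the upper estimate of the
   maximum; adding [k] ensures [k < K]. *)
exists k, (k + K1 + K2 + K3); split=> //; split; first lra.
have weaken K' (r : R -> R) : K' <= k + K1 + K2 + K3 -> (\forall l \near +oo, 0 <= r l) ->
    (\forall l \near +oo, (wasserstein P PN (Ftilde l) N <= (K' * r l)%:E)%E) ->
    \forall l \near +oo, (wasserstein P PN (Ftilde l) N <= ((k + K1 + K2 + K3) * r l)%:E)%E.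
  move=> hK r0 h; near=> l; have hl : (wasserstein P PN (Ftilde l) N <= (K' * r l)%:E)%E by near: l.
  apply: (le_trans hl); rewrite lee_fin ler_wpM2r//; near: l; exact: r0.
have r0 : \forall l \near +oo, (0 : R) <= l `^ (- 2^-1) by near=> l; exact: powR_ge0.
split.
  near=> l; have hb : degree_bounds Hbar a b l by near: l.
  have [h1 h2] := max_ratio_bounds Hbar_measurable a0 b0 hb.
  split; first exact: h1.
  apply: (le_trans h2); rewrite ler_wpM2r//; last by rewrite -/K3; lra.
  by rewrite le_max sqrtr_ge0.
split.
  move=> hx; split.
    exact: (dense_equivalent d1_ge Hbar_measurable Hbar_sym Hbar_0 eta_poisson F1_def F2_def a0 hdb hx).
  split; first exact: (dense_variance d1_ge Hbar_measurable Hbar_sym Hbar_0 eta_poisson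
    F1_def F2_def a0 b0 hdb hx).
  split; first exact: (dense_variance_pinfty hdb hx).
  apply: (weaken K1 _ _ r0); first lra.
  have x1 : \forall l \near +oo, 1 <= l * psi l by move/cvgryPge : hx; apply.
  have := wasserstein_dense d1_ge Hbar_measurable Hbar_sym Hbar_0 eta_poisson
    F1_def F2_def a0 b0 hdb N_normal C0 hC (c := 1) _ x1.
  by rewrite expr1n mul1r; apply; rewrite ltr01 lexx.
split.
  move=> hx; have [c [D [c01 D1 cD]]] := asymp_one hx.
  have [v1 v2 v3] := balanced_variance d1_ge Hbar_measurable Hbar_sym Hbar_0 eta_poisson
    F1_def F2_def a0 b0 hdb c01 D1 cD.
  do 3![split=> //]; split; first by apply: (weaken K2 _ _ r0 (hK2 hx)); lra.
  move=> dM M PM N1 N2 hN1 hN2 hind.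
  exact: (balanced_pair d1_ge Hbar_measurable Hbar_sym Hbar_0 eta_poisson
    F1_def F2_def a0 b0 hdb c01 D1 cD hN1 hN2 hind).
move=> hx; split.
  exact: (sparse_equivalent d1_ge Hbar_measurable Hbar_sym Hbar_0 eta_poisson
    F1_def F2_def a0 b0 hdb hx).
split.
  exact: (sparse_variance Hbar_measurable Hbar_sym Hbar_0 eta_poisson F1_def F2_def a0 b0 hdb).
split.
  apply: (weaken K1 (fun l => (l * Num.sqrt (psi l))^-1)); first lra.
    near=> l; have l0 : 0 < l by near: l; exact: nbhs_pinfty_gt.
    by rewrite invr_ge0 mulr_ge0 ?sqrtr_ge0// ltW.
  apply: (wasserstein_sparse d1_ge Hbar_measurable Hbar_sym Hbar_0 eta_poisson
    F1_def F2_def a0 b0 hdb N_normal C0 hC).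
  by move/cvgrPdist_le : hx => /(_ _ ltr01); apply: filterS => l;
    rewrite sub0r normrN; apply: le_trans; exact: ler_norm.
split.
  split; first exact: (sparse_clt_inv d1_ge Hbar_measurable Hbar_sym Hbar_0 eta_poisson
    F1_def F2_def a0 b0 hdb hx N_normal).
  exact: (sparse_clt d1_ge Hbar_measurable Hbar_sym Hbar_0 eta_poisson
    F1_def F2_def a0 b0 hdb hx N_normal).
exact: (sparse_pinfty d1_ge Hbar_measurable Hbar_sym Hbar_0 eta_poisson F1_def F2_def a0 b0 hdb hx).
Unshelve. all: by end_near.
Qed.
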